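(* Let $m\ge1$ and let $a,b\in\mathbb{C}$, $c=(c_1,\dots,c_m)\in\mathbb{C}^m$ satisfy $a-\sum_{k=1}^m i_kc_k\notin\mathbb{Z}$ and $b-\sum_{k=1}^m i_kc_k\notin\mathbb{Z}$ for all $(i_1,\dots,i_m)\in\{0,1\}^m$. Then, even in cases where $c_k\in\mathbb{Z}$ for some or all $k$, the functions $\widetilde F_I(x)$, $I\in\{0,1\}^m$ (understood as limits from non-integral values of the $c_k$ when some $c_k\in\mathbb{Z}$), are well-defined and form a basis of the space $Sol_{\dot x}$ of local solutions to $E_C(a,b,c)$ around $\dot x$.
   Context: Write $\theta_k=x_k\,\partial/\partial x_k$, $\theta=\sum_{k=1}^m\theta_k$. $E_C(a,b,c)$ is the system $[\theta_k(\theta_k+c_k-1)-x_k(\theta+a)(\theta+b)]f(x)=0$, $k=1,\dots,m$, in $x=(x_1,\dots,x_m)\in\mathbb{C}^m$; it is holonomic of rank $2^m$. Put $\dot x=(\frac1{2m^2},\dots,\frac1{2m^2})$, which is not in the singular locus and lies in $D_C=\{x:\sum_k\sqrt{|x_k|}<1\}$. $Sol_{\dot x}$ is the $2^m$-dimensional $\mathbb{C}$-vector space of holomorphic solutions near $\dot x$. Put $(u,n)=\Gamma(u+n)/\Gamma(u)$ and, for $x\in D_C$, $$F_C(a,b,c;x)=\sum_{n_1,\dots,n_m\ge0}\frac{(a,n_1+\cdots+n_m)(b,n_1+\cdots+n_m)}{(c_1,n_1)\cdots(c_m,n_m)\,n_1!\cdots n_m!}x_1^{n_1}\cdots x_m^{n_m}.$$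 For $I=(i_1,\dots,i_m)\in\{0,1\}^m$ put $a^I=a+\sum_k i_k(1-c_k)$, $b^I=b+\sum_k i_k(1-c_k)$, $c^I=(c_1+2i_1(1-c_1),\dots,c_m+2i_m(1-c_m))$ and, when $c_1,\dots,c_m\notin\mathbb{Z}$, $$F_I(x)=\frac{\prod_{k=1}^m\Gamma((-1)^{i_k}(1-c_k))}{\Gamma(1-a^I)\Gamma(1-b^I)}\prod_{k=1}^m x_k^{i_k(1-c_k)}\,F_C(a^I,b^I,c^I;x)$$ near $\dot x$, with principal branches of the powers. Put $\gamma_k=\exp(2\pi\sqrt{-1}c_k)$. For $c_1,\dots,c_m\notin\mathbb{Z}$ define $$\widetilde F_I(x)=\prod_{k=1}^m(1-\gamma_k)^{1-i_k}\sum_{J\le I}F_J(x),$$ where $J\le I$ means $j_k\le i_k$ for all $k$. If some $c_k\in\mathbb{Z}$, $\widetilde F_I$ denotes the limit of the functions $\widetilde F_I$ with parameters $(a,b,c')$ as $c'\to c$ with $c'_1,\dots,c'_m\notin\mathbb{Z}$. *)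

(* Defs.v *)
From mathcomp Require Import all_boot all_order all_algebra complex.
From mathcomp Require Import all_classical all_reals all_analysis.
From mathcomp Require summability.

Set Implicit Arguments.
Unset Strict Implicit.
Unset Printing Implicit Defensive.
Import Order.TTheory GRing.Theory Num.Theory numFieldNormedType.Exports.
Local Open Scope classical_set_scope.
Local Open Scope complex_scope.
Local Open Scope ring_scope.

(* The complex numbers R[i], packaged as a numClosedFieldType so that Cpx R and
   'rV[Cpx R]_m inherit the generic MathComp-Analysis structure of normed
   spaces over Cpx R.  In particular [differentiable] and ['D_v f] below mean
   complex Frechet and complex directional derivatives. *)
Definition Cpx (R : realType) : numClosedFieldType := R[i].

Definition cplx (R : realType) (x y : R) : Cpx R := x +i* y.
Definition ReC (R : realType) (z : Cpx R) : R := complex.Re z.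
Definition ImC (R : realType) (z : Cpx R) : R := complex.Im z.

Definition is_integer (R : realType) (z : Cpx R) : Prop :=
  exists n : int, z = n%:~R.

Definition cexp (R : realType) (z : Cpx R) : Cpx R :=
  cplx (expR (ReC z) * cos (ImC z)) (expR (ReC z) * sin (ImC z)).

Definition cmod (R : realType) (z : Cpx R) : R :=
  Num.sqrt (ReC z ^+ 2 + ImC z ^+ 2).

(* Principal argument, with values in ]-pi, pi] (for z != 0). *)
Definition carg (R : realType) (z : Cpx R) : R :=
  if 0 <= ImC z then acos (ReC z / cmod z) else - acos (ReC z / cmod z).

Definition clog (R : realType) (z : Cpx R) : Cpx R :=
  cplx (ln (cmod z)) (carg z).

(* Principal branch of z ^ s; only meaningful for z != 0. *)
Definition cpow (R : realType) (z s : Cpx R) : Cpx R := cexp (s * clog z).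

(* Gauss's formula  Gamma(z) = lim_n n! n^z / (z (z+1) ... (z+n)).
   At the poles z = 0, -1, -2, ... the convention x / 0 = 0 gives the value 0
   (so that 1 / Gamma is right everywhere). *)
Definition Gamma (R : realType) (z : Cpx R) : Cpx R :=
  lim ((fun n : nat =>
     n`!%:R * cpow n%:R z / \prod_(j < n.+1) (z + j%:R)) @ \oo).

(* The symbol (u, n). *)
Definition poch (R : realType) (u : Cpx R) (n : nat) : Cpx R :=
  Gamma (u + n%:R) / Gamma u.

(* Multiple series are unordered sums: limits of the partial sums along the
   finite sets of multi-indices, ordered by inclusion. *)
Definition FC (R : realType) (m : nat) (a b : Cpx R) (c x : 'rV[Cpx R]_m) :
    Cpx R :=
  summability.sum (K := Cpx R) (R := Cpx R)
    (fun n : {ffun 'I_m -> nat} =>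
      poch a (\sum_k n k)%N * poch b (\sum_k n k)%N
      / ((\prod_k poch (c 0 k) (n k)) * \prod_k (n k)`!%:R)
      * \prod_k x 0 k ^+ n k).

(* I = (i_1, ..., i_m) in {0,1}^m; i_k is the boolean I k coerced to nat. *)
Definition cube (m : nat) := {ffun 'I_m -> bool}.

(* a^I (and b^I, with b in place of a). *)
Definition shiftI (R : realType) (m : nat) (a : Cpx R) (c : 'rV[Cpx R]_m)
    (I : cube m) : Cpx R :=
  a + \sum_k (I k)%:R * (1 - c 0 k).

(* c^I *)
Definition reflI (R : realType) (m : nat) (c : 'rV[Cpx R]_m) (I : cube m) :
    'rV[Cpx R]_m :=
  \row_k (c 0 k + 2 * (I k)%:R * (1 - c 0 k)).

Definition FI (R : realType) (m : nat) (a b : Cpx R) (c : 'rV[Cpx R]_m)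
    (I : cube m) (x : 'rV[Cpx R]_m) : Cpx R :=
  (\prod_k Gamma ((-1) ^+ I k * (1 - c 0 k)))
  / (Gamma (1 - shiftI a c I) * Gamma (1 - shiftI b c I))
  * (\prod_k cpow (x 0 k) ((I k)%:R * (1 - c 0 k)))
  * FC (shiftI a c I) (shiftI b c I) (reflI c I) x.

Definition gammak (R : realType) (m : nat) (c : 'rV[Cpx R]_m) (k : 'I_m) : Cpx R :=
  cexp (cplx 0 (2 * pi) * c 0 k).

(* The defining formula of tilde F_I, meaningful when no c_k is an integer. *)
Definition Ftilde_gen (R : realType) (m : nat) (a b : Cpx R)
    (c : 'rV[Cpx R]_m) (I : cube m) (x : 'rV[Cpx R]_m) : Cpx R :=
  (\prod_k (1 - gammak c k) ^+ (1 - I k)%N)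
  * \sum_(J : cube m | [forall k, (J k <= I k)%N]) FI a b c J x.

Definition non_integral (R : realType) (m : nat) : set 'rV[Cpx R]_m :=
  [set c | forall k, ~ is_integer (c 0 k)].

(* c' -> c through parameters none of whose components is an integer. *)
Definition to_param (R : realType) (m : nat) (c : 'rV[Cpx R]_m) :
    set_system 'rV[Cpx R]_m :=
  within (@non_integral R m) (nbhs c).

(* tilde F_I for arbitrary c.  The limit is taken pointwise; outside its domain of
   existence the value of [lim] is unspecified. *)
Definition Ftilde (R : realType) (m : nat) (a b : Cpx R) (c : 'rV[Cpx R]_m)
    (I : cube m) (x : 'rV[Cpx R]_m) : Cpx R :=
  if `[< non_integral c >] then Ftilde_gen a b c I x
  else lim ((fun c' => Ftilde_gen a b c' I x) @ to_param c).

Definition xdot (R : realType) (m : nat) : 'rV[Cpx R]_m :=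
  const_mx ((2 * m%:R ^+ 2)^-1).

(* theta_k + s and theta + s, as operators on functions. *)
Definition theta1 (R : realType) (m : nat) (k : 'I_m) (s : Cpx R)
    (f : 'rV[Cpx R]_m -> Cpx R) (x : 'rV[Cpx R]_m) : Cpx R :=
  x 0 k * 'D_(delta_mx 0 k : 'rV[Cpx R]_m) f x + s * f x.

Definition theta (R : realType) (m : nat) (s : Cpx R)
    (f : 'rV[Cpx R]_m -> Cpx R) (x : 'rV[Cpx R]_m) : Cpx R :=
  \sum_k theta1 k 0 f x + s * f x.

(* The k-th operator of E_C(a, b, c), applied to f. *)
Definition EC (R : realType) (m : nat) (a b : Cpx R) (c : 'rV[Cpx R]_m)
    (k : 'I_m) (f : 'rV[Cpx R]_m -> Cpx R) (x : 'rV[Cpx R]_m) : Cpx R :=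
  theta1 k 0 (theta1 k (c 0 k - 1) f) x - x 0 k * theta a (theta b f) x.

(* f represents an element of Sol_{xdot}.  Germs at xdot are represented by
   total functions, and two functions represent the same germ when they agree
   near xdot. *)
Definition Sol (R : realType) (m : nat) (a b : Cpx R) (c : 'rV[Cpx R]_m)
    (f : 'rV[Cpx R]_m -> Cpx R) : Prop :=
  \forall x \near xdot R m,
    differentiable f x /\ forall k : 'I_m, EC a b c k f x = 0.

(* The germs at x0 of the functions F i form a basis of the space of germs at
   x0 of functions satisfying S. *)
Definition is_germ_basis (R : realType) (m : nat) (x0 : 'rV[Cpx R]_m)
    (S : ('rV[Cpx R]_m -> Cpx R) -> Prop)
    (T : finType) (F : T -> 'rV[Cpx R]_m -> Cpx R) : Prop :=
  [/\ forall i, S (F i),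
      forall l : T -> Cpx R,
        (\forall x \near x0, \sum_i l i * F i x = 0) -> forall i, l i = 0
    & forall f, S f -> exists l : T -> Cpx R,
        \forall x \near x0, f x = \sum_i l i * F i x].

(* Main.v *)
From HB Require Import structures.
Require Import Defs.
From mathcomp Require Import all_boot all_order all_algebra complex.
From mathcomp Require Import all_classical all_reals all_analysis.
From mathcomp Require Import ring lra.
From mathcomp Require Import finmap.
From mathcomp Require summability.
Set Implicit Arguments.
Unset Strict Implicit.
Unset Printing Implicit Defensive.
Import Order.TTheory GRing.Theory Num.Theory numFieldNormedType.Exports.
Local Open Scope classical_set_scope.
Local Open Scope ring_scope.

(** The proof works in logarithmic coordinates x = e^t, where theta_k becomes
    d/dt_k and the base point becomes a real point t0.  For J in {0,1}^m put

      G_J(c; t) = sum over n in N^m of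
        prod_k [ rG(1 + s_k) rG(c_k + s_k) ] rG(1-a-|s|) rG(1-b-|s|) e^(t.s),

    where s_k = n_k + J_k (1 - c_k), |s| = s_1 + ... + s_m and rG = 1/Gamma is
    entire.  These series are holomorphic in t and entire in c, with no
    exceptional parameters, and by the reflection formula
    F_J = (-1)^|J| G_J / prod_k [ rG(c_k) rG(1 - c_k) ] (FI_formula).  The
    differential equations follow from the recurrence of the coefficients
    (coef_rec, G_ECt).

    Existence of the limits.  When c_k is an integer, replacing J_k by 1 - J_k
    only reindexes the series: G_J does not change (G_flip_int).  The
    alternating sum of the G_J over J <= I therefore vanishes on the hyperplane
    where the k-th parameter equals c_k, for every k with I_k = 1 and c_k
    integral (alt_sum_vanish).  It is thus divisible, uniformly in t, by the
    product of the corresponding coordinates (divide), and this product cancels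
    the poles of the prefactor, which are simple (pole_factor_regular).  So
    tilde F_I converges locally uniformly to a solution
    (Ftil_cvg_uniform, Flim_hol).

    Independence.  Let M_k be the analytic continuation t_k -> t_k + 2 pi i.  It
    multiplies G_J by exp(-2 pi i c_k) if J_k = 1 and fixes it otherwise.  The
    product of the M_k - 1 over the k with I0_k = 1 kills every tilde F_I with I
    not above I0, and maps tilde F_I0 to a nonzero multiple of G_I0, also in the
    limit (monod_Flim0, monod_Flim1).  Applied to a linear relation, with I0
    maximal among the indices of nonzero coefficients, it gives G_I0 = 0.  But
    G_I0 has a nonzero leading term along t - tau (1, ..., 1), tau -> +oo,
    because a and b are nonresonant (G_lead).

    Spanning.  At t0 the k-th equation expresses d_k^2 d_w f, up to derivatives
    of lower order, as 1/(2 m^2) times the sum of the m^2 terms d_i d_j d_w f.  If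
    all derivatives without repeated index vanish, induction on the order shows
    that the largest derivative of each order is at most half of itself
    (jets_zero).  A solution is thus determined by 2^m numbers; since the 2^m
    limits are independent, they span.

    The complex analysis behind this is developed from Goursat's lemma: Cauchy's
    formula on a square contour gives power series with explicit remainder
    (cauchy_series), and restriction to complex lines carries it over to several
    variables.  The result used throughout is that a bounded pointwise limit of
    holomorphic functions is holomorphic, with convergence of the partial
    derivatives (hol_lim). *)

(** * Modulus and limits of complex sequences *)

Section ComplexBasics.
Variable R : realType.
Local Notation C := (Cpx R).
Local Notation "x %:C" := (real_complex R x : C).
Implicit Types (x y z : C) (u v : nat -> C).

Definition clim u l := forall e : R, 0 < e ->
  exists N, forall n, (N <= n)%N -> cmod (u n - l) < e.

Lemma cmodE z : `|z| = (cmod z)%:C.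
Proof. exact: normc_def. Qed.

Lemma cmodP z1 z2 : `|z1| = `|z2| -> cmod z1 = cmod z2.
Proof. by rewrite !cmodE => -[]. Qed.

Lemma cmod_ge0 z : 0 <= cmod z. Proof. exact: sqrtr_ge0. Qed.

Lemma cmodM x y : cmod (x * y) = cmod x * cmod y.
Proof. by have := normrM x y; rewrite !cmodE -rmorphM /= => -[]. Qed.

Lemma cmodD x y : cmod (x + y) <= cmod x + cmod y.
Proof. by rewrite -lecR rmorphD /= -!cmodE ler_normD. Qed.

Lemma cmodN x : cmod (- x) = cmod x.
Proof. by apply: cmodP; rewrite normrN. Qed.

Lemma cmodBC x y : cmod (x - y) = cmod (y - x).
Proof. by rewrite -cmodN opprB. Qed.

Lemma cmodB x y : cmod (x - y) <= cmod x + cmod y.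
Proof. by rewrite (le_trans (cmodD _ _))// cmodN. Qed.

Lemma cmod_real (r : R) : cmod r%:C = `|r|.
Proof. by rewrite /cmod /ReC /ImC /= expr0n addr0 sqrtr_sqr. Qed.

Lemma cmod0 : cmod (0 : C) = 0.
Proof. by have := cmod_real 0; rewrite normr0. Qed.

Lemma cmod1 : cmod (1 : C) = 1.
Proof. by have := cmod_real 1; rewrite normr1. Qed.

Lemma natrC n : n%:R = (n%:R)%:C.
Proof. by rewrite rmorph_nat. Qed.

Lemma cmod_nat n : cmod (n%:R : C) = n%:R.
Proof. by rewrite natrC cmod_real normr_nat. Qed.

Lemma cmod_eq0 z : (cmod z == 0) = (z == 0).
Proof. by rewrite -(normr_eq0 z) cmodE eq_complex /= eqxx andbT. Qed.

Lemma cmod_gt0 z : (0 < cmod z) = (z != 0).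
Proof. by rewrite lt_def cmod_ge0 andbT cmod_eq0. Qed.

Lemma cmodV z : cmod z^-1 = (cmod z)^-1.
Proof.
have [->|z0] := eqVneq z 0; first by rewrite invr0 cmod0 invr0.
have c0 : cmod z != 0 by rewrite cmod_eq0.
by apply: (mulfI c0); rewrite mulfV// -cmodM mulfV// cmod1.
Qed.

Lemma cmodX z n : cmod (z ^+ n) = cmod z ^+ n.
Proof. by elim: n => [|n ih]; rewrite ?expr0 ?cmod1// !exprS cmodM ih. Qed.

Lemma cmod_sum I (r : seq I) (P : pred I) (F : I -> C) :
  cmod (\sum_(i <- r | P i) F i) <= \sum_(i <- r | P i) cmod (F i).
Proof.
elim/big_rec2 : _ => [|i a b _ h]; first by rewrite cmod0.
by rewrite (le_trans (cmodD _ _))// lerD2l.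
Qed.

Lemma cmod_prod I (r : seq I) (P : pred I) (F : I -> C) :
  cmod (\prod_(i <- r | P i) F i) = \prod_(i <- r | P i) cmod (F i).
Proof.
by elim/big_rec2 : _ => [|i a b _ h]; rewrite ?cmod1// cmodM h.
Qed.

Lemma cmodB_ge x y : cmod x - cmod y <= cmod (x - y).
Proof. by rewrite lerBlDr -{1}(subrK y x) cmodD. Qed.

Lemma cmodD_ge x y : cmod x - cmod y <= cmod (x + y).
Proof. by rewrite -(cmodN y) -{2}(opprK y) cmodB_ge. Qed.

Lemma cmod_tri x y z : cmod (x - z) <= cmod (x - y) + cmod (y - z).
Proof. by rewrite (le_trans _ (cmodD _ _))// addrA subrK. Qed.

Lemma Re_le_cmod z : `|ReC z| <= cmod z.
Proof. by rewrite -sqrtr_sqr ler_wsqrtr// lerDl sqr_ge0. Qed.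

Lemma Im_le_cmod z : `|ImC z| <= cmod z.
Proof. by rewrite -sqrtr_sqr ler_wsqrtr// lerDr sqr_ge0. Qed.

Lemma cmod_le_ReIm z : cmod z <= `|ReC z| + `|ImC z|.
Proof.
have -> : z = (ReC z)%:C + 'i%C * (ImC z)%:C by exact: complexE.
rewrite (le_trans (cmodD _ _))// cmodM !cmod_real.
have -> : cmod ('i%C : C) = 1.
  by rewrite /cmod /ReC /ImC /= expr0n expr1n add0r sqrtr1.
by rewrite mul1r /ReC /ImC /= !(mulr0,mul0r,mul1r,addr0,subr0,add0r).
Qed.

Lemma archi_ex (r : R) : exists n : nat, r < n%:R.
Proof.
exists (Num.bound r); have := archi_boundP (normr_ge0 r).
have := ler_norm r; have [r0 _|r0 _] := leP 0 r; first by rewrite ger0_norm.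
by move=> _; apply: lt_le_trans r0 _; rewrite ler0n.
Qed.

Lemma geo_lt (q A e : R) : 0 <= q -> q < 1 -> 0 < e ->
  exists N, forall n, (N <= n)%N -> A * q ^+ n < e.
Proof.
move=> q0 q1 e0; have [A0|A0] := leP A 0.
  by exists 0%N => n _; apply: le_lt_trans e0; rewrite mulr_le0_ge0// exprn_ge0.
have q1' : `|q| < 1 by rewrite ger0_norm.
have /cvgrPdist_lt/(_ _ (divr_gt0 e0 A0))[N _ h] := cvg_expr q1'.
exists N => n Nn; have := h n Nn; rewrite /= sub0r normrN ger0_norm ?exprn_ge0//.
by rewrite ltr_pdivlMr// mulrC.
Qed.

(** The explicit form of convergence used in all estimates below agrees with
    convergence for the norm of the complex numbers. *)
Lemma climP u l : clim u l <-> u @ \oo --> l.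
Proof.
split=> [h|/cvgrPdist_lt h].
  apply/cvgrPdist_lt => e e0.
  have [r -> r0] : exists2 r : R, e = r%:C & 0 < r.
    exists (ReC e); first by case: e e0 => a b; rewrite ltcE /= => /andP[/eqP-> _].
    by case: e e0 => a b; rewrite ltcE /= => /andP[_].
  have [N hN] := h _ r0; exists N => // n /= Nn.
  by rewrite cmodE ltcR cmodBC hN.
move=> e e0; have := h e%:C; rewrite ltcR => /(_ e0)[N _ hN].
by exists N => n /hN/=; rewrite cmodE ltcR cmodBC.
Qed.

Lemma clim_uniq u l l' : clim u l -> clim u l' -> l = l'.
Proof. by move=> /climP h /climP h'; apply: cvg_unique h h'. Qed.

Lemma clim_ext N u v l : (forall n, (N <= n)%N -> u n = v n) -> clim u l -> clim v l.
Proof.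
move=> h hu e /hu[N' hN]; exists (maxn N N') => n; rewrite geq_max => /andP[a b].
by rewrite -h// hN.
Qed.

Lemma clim_cst l : clim (fun=> l) l.
Proof. by apply/climP; exact: cvg_cst. Qed.

Lemma climD u v l l' : clim u l -> clim v l' -> clim (fun n => u n + v n) (l + l').
Proof.
move=> hu hv e e0; have e2 : 0 < e / 2 by rewrite divr_gt0.
have [N1 h1] := hu _ e2; have [N2 h2] := hv _ e2.
exists (maxn N1 N2) => n; rewrite geq_max => /andP[/h1 k1 /h2 k2].
rewrite opprD addrACA; apply: le_lt_trans (cmodD _ _) _.
by rewrite [ltRHS](splitr e) ltrD.
Qed.

Lemma clim_cb u l : clim u l -> exists N, forall n, (N <= n)%N -> cmod (u n) <= cmod l + 1.
Proof.
move=> /(_ 1 ltr01)[N hN]; exists N => n /hN h; rewrite addrC -lerBlDr ltW//.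
exact: le_lt_trans (cmodB_ge _ _) h.
Qed.

Lemma clim0M u v M N : clim u 0 -> (forall n, (N <= n)%N -> cmod (v n) <= M) ->
  clim (fun n => u n * v n) 0.
Proof.
move=> hu hv e e0; have M1 : 0 < M + 1.
  by rewrite ltr_wpDl// (le_trans (cmod_ge0 (v N)))// hv.
have [N' hN] := hu _ (divr_gt0 e0 M1); exists (maxn N N') => n.
rewrite geq_max => /andP[a /hN]; rewrite !subr0 cmodM => h.
have [v0|v0] := eqVneq (cmod (v n)) 0; first by rewrite v0 mulr0.
rewrite ltr_pdivlMr// in h; apply: le_lt_trans h.
by rewrite ler_wpM2l ?cmod_ge0// (le_trans (hv n a))// lerDl.
Qed.

Lemma clim0P u l : clim u l <-> clim (fun n => u n - l) 0.
Proof. by split=> h e /h[N hN]; exists N => n /hN; rewrite ?subr0. Qed.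

Lemma climN u l : clim u l -> clim (fun n => - u n) (- l).
Proof. by move=> /climP h; apply/climP; exact: cvgN. Qed.

Lemma climB u v l l' : clim u l -> clim v l' -> clim (fun n => u n - v n) (l - l').
Proof. by move=> h h'; apply: climD => //; exact: climN. Qed.

Lemma climM u v l l' : clim u l -> clim v l' -> clim (fun n => u n * v n) (l * l').
Proof.
move=> hu hv; have [N hN] := clim_cb hv.
have /clim0P h1 := hu; have /clim0P h2 := hv.
have h3 := clim0M (N := 0%N) h2 (fun n _ => lexx (cmod l)).
have := climD (clim0M h1 hN) h3; rewrite addr0 => h.
apply/clim0P; apply: (clim_ext (N := 0%N) _ h) => n _ /=; ring.
Qed.

Lemma climZ a u l : clim u l -> clim (fun n => a * u n) (a * l).
Proof. by move=> h; apply: climM => //; exact: clim_cst. Qed.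

Lemma climV u l : l != 0 -> clim u l -> clim (fun n => (u n)^-1) l^-1.
Proof. by move=> l0 /climP h; apply/climP; exact: cvgV. Qed.

Lemma clim_sum I (r : seq I) (P : pred I) (F : I -> nat -> C) (l : I -> C) :
  (forall i, P i -> clim (F i) (l i)) ->
  clim (fun n => \sum_(i <- r | P i) F i n) (\sum_(i <- r | P i) l i).
Proof.
move=> h; elim: r => [|i r ih].
  by move=> e e0; exists 0%N => n _; rewrite !big_nil subrr cmod0.
have [Pi|nPi] := boolP (P i); last first.
  by move=> e /ih[N hN]; exists N => n /hN; rewrite !big_cons (negbTE nPi).
by move=> e /(climD (h i Pi) ih)[N hN]; exists N => n /hN; rewrite !big_cons Pi.
Qed.

Lemma clim_prod I (r : seq I) (P : pred I) (F : I -> nat -> C) (l : I -> C) :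
  (forall i, P i -> clim (F i) (l i)) ->
  clim (fun n => \prod_(i <- r | P i) F i n) (\prod_(i <- r | P i) l i).
Proof.
move=> h; elim: r => [|i r ih].
  by move=> e e0; exists 0%N => n _; rewrite !big_nil subrr cmod0.
have [Pi|nPi] := boolP (P i); last first.
  by move=> e /ih[N hN]; exists N => n /hN; rewrite !big_cons (negbTE nPi).
by move=> e /(climM (h i Pi) ih)[N hN]; exists N => n /hN; rewrite !big_cons Pi.
Qed.

Lemma clim_sub u l (s : nat -> nat) : (forall n, (n <= s n)%N) -> clim u l ->
  clim (fun n => u (s n)) l.
Proof. by move=> h hu e /hu[N hN]; exists N => n nN; apply: hN; exact: leq_trans (h n). Qed.

Lemma clim_S u l : clim (fun n => u n.+1) l -> clim u l.
Proof. by move=> hu e /hu[N hN]; exists N.+1 => -[|n]//; rewrite ltnS => /hN. Qed.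

Lemma clim_le u l M N : (forall n, (N <= n)%N -> cmod (u n) <= M) -> clim u l -> cmod l <= M.
Proof.
move=> h hu; apply/ler_addgt0Pr => e /hu[N' hN].
have := hN (maxn N N') (leq_maxr _ _); have := h _ (leq_maxl N N').
set w := u _ => h1 h2; have := cmod_tri l w 0; rewrite !subr0 cmodBC => h3.
by rewrite (le_trans h3)// addrC lerD// ltW.
Qed.

Lemma clim_dom u l (A q : R) N : 0 <= q -> q < 1 ->
  (forall n, (N <= n)%N -> cmod (u n - l) <= A * q ^+ n) -> clim u l.
Proof.
move=> q0 q1 h e e0; have [N' hN] := geo_lt A q0 q1 e0.
exists (maxn N N') => n; rewrite geq_max => /andP[a b].
exact: le_lt_trans (h _ a) (hN _ b).
Qed.

Lemma clim_0inv : clim (fun n => n.+1%:R^-1) 0.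
Proof.
move=> e e0; have [N hN] := archi_ex e^-1; exists N => n Nn.
rewrite subr0 cmodV cmod_nat invf_plt ?posrE ?ltr0n//.
by rewrite (lt_le_trans hN)// ler_nat; exact: leq_trans Nn _.
Qed.

(** Identities between limits are mostly obtained in this form, by estimating a
    difference by an arbitrary positive real. *)
Lemma cmod_small z : (forall e : R, 0 < e -> cmod z <= e) -> z = 0.
Proof.
move=> h; apply/eqP; rewrite -cmod_eq0; apply/eqP/le_anti; rewrite cmod_ge0 andbT.
by apply/ler_addgt0Pr => e e0; rewrite add0r h.
Qed.

Definition ccauchy u := forall e : R, 0 < e ->
  exists N, forall n m, (N <= n)%N -> (N <= m)%N -> cmod (u n - u m) < e.

Lemma rcauchy (w : nat -> R) : (forall e : R, 0 < e ->
  exists N, forall n m, (N <= n)%N -> (N <= m)%N -> `|w n - w m| < e) ->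
  exists l : R, w @ \oo --> l.
Proof.
move=> h; have : cvg (w @ \oo).
  apply/cauchy_cvgP/cauchy_exP => e /h[N hN]; exists (w N), N => // n /= Nn.
  by rewrite /ball /= hN.
by move=> hw; exists (lim (w @ \oo)).
Qed.

Lemma complete_C u : ccauchy u -> exists l, clim u l.
Proof.
move=> h.
have hR : exists l : R, (fun n => ReC (u n)) @ \oo --> l.
  apply: rcauchy => e /h[N hN]; exists N => n m Nn Nm.
  apply: le_lt_trans (hN _ _ Nn Nm); have := Re_le_cmod (u n - u m).
  by case: (u n) (u m) => [? ?] [? ?].
have hI : exists l : R, (fun n => ImC (u n)) @ \oo --> l.
  apply: rcauchy => e /h[N hN]; exists N => n m Nn Nm.
  apply: le_lt_trans (hN _ _ Nn Nm); have := Im_le_cmod (u n - u m).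
  by case: (u n) (u m) => [? ?] [? ?].
have [a /cvgrPdist_lt ha] := hR; have [b /cvgrPdist_lt hb] := hI.
exists (cplx a b) => e e0; have e2 : 0 < e / 2 by rewrite divr_gt0.
have [N1 _ h1] := ha _ e2; have [N2 _ h2] := hb _ e2.
exists (maxn N1 N2) => n; rewrite geq_max => /andP[/h1/= k1 /h2/= k2].
apply: le_lt_trans (cmod_le_ReIm _) _; move: k1 k2.
rewrite distrC => k1; rewrite distrC => k2.
have -> : ReC (u n - cplx a b) = ReC (u n) - a by case: (u n).
have -> : ImC (u n - cplx a b) = ImC (u n) - b by case: (u n).
by rewrite [ltRHS](splitr e) ltrD.
Qed.

(** The increments are summable, so the sequence is Cauchy; the tail of the
    geometric series bounds the distance to the limit. *)
Lemma clim_geo u (A q : R) : 0 <= q -> q < 1 -> 0 <= A ->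
  (forall n, cmod (u n.+1 - u n) <= A * q ^+ n) ->
  exists2 l, clim u l & forall n, cmod (u n - l) <= A / (1 - q) * q ^+ n.
Proof.
move=> q0 q1 A0 h; have q1' : 0 < 1 - q by rewrite subr_gt0.
have hk n k : cmod (u (n + k)%N - u n) <= A / (1 - q) * q ^+ n * (1 - q ^+ k).
  elim: k => [|k ih]; first by rewrite addn0 subrr cmod0 expr0 subrr mulr0.
  rewrite addnS (le_trans (cmod_tri _ (u (n + k)%N) _))//.
  rewrite (le_trans (lerD (h _) ih))//.
  rewrite exprD exprS -subr_ge0 le_eqVlt; apply/orP; left; apply/eqP.
  by field; rewrite gt_eqF.
have hk' n k : cmod (u (n + k)%N - u n) <= A / (1 - q) * q ^+ n.
  rewrite (le_trans (hk _ _))// ler_piMr ?mulr_ge0 ?exprn_ge0 ?invr_ge0//.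
  - exact: ltW.
  - by rewrite gerBl exprn_ge0.
have : ccauchy u.
  move=> e e0; have [N hN] := geo_lt (2 * (A / (1 - q))) q0 q1 e0; exists N.
  move=> n m Nn Nm; have hn := hk' N (n - N)%N; have hm := hk' N (m - N)%N.
  rewrite subnKC// in hn; rewrite subnKC// in hm.
  apply: le_lt_trans (cmod_tri _ (u N) _) _; rewrite (cmodBC (u N)).
  apply: le_lt_trans (lerD hn hm) _; apply: le_lt_trans (hN N (leqnn N)).
  by rewrite -!mulrA mulrDl mul1r.
move=> /complete_C[l hl]; exists l => // n.
rewrite cmodBC; apply: (@clim_le (fun k => u (n + k)%N - u n) _ _ 0) => [k _|]//.
apply: climB; last exact: clim_cst.
by apply: (@clim_sub u l (fun k => n + k)%N) => // k; rewrite leq_addl.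
Qed.

End ComplexBasics.

(** * Continuity and complex derivatives in one variable *)

Section Continuity.
Variable R : realType.
Local Notation C := (Cpx R).
Local Notation "x %:C" := (real_complex R x : C).
Implicit Types (x y z w : C) (F G : C -> C).

Definition cont_at F z := forall e : R, 0 < e ->
  exists2 d : R, 0 < d & forall w, cmod (w - z) < d -> cmod (F w - F z) < e.

(** Sequential continuity turns the algebra of limits into the algebra of
    continuous functions. *)
Lemma cont_seqP F z : cont_at F z <-> forall u, clim u z -> clim (F \o u) (F z).
Proof.
split=> [h u hu e /h[d /hu[N hN] hd]|h e e0].
  by exists N => n /hN /hd.
apply: contrapT => hn.
have /choice[u hu] : forall n : nat, exists w, cmod (w - z) < n.+1%:R^-1 /\ ~ cmod (F w - F z) < e.
  move=> n; apply: contrapT => hw; apply: hn; exists n.+1%:R^-1.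
    by rewrite invr_gt0 ltr0n.
  by move=> w wn; apply: contrapT => hf; apply: hw; exists w.
have : clim u z.
  move=> r /(@clim_0inv R)[N hN]; exists N => n /hN.
  rewrite subr0 cmodV cmod_nat; apply: lt_trans; exact: (hu n).1.
by move=> /h /(_ e e0)[N /(_ N (leqnn N))]; apply: (hu N).2.
Qed.

Lemma cont_cst a z : cont_at (fun=> a) z.
Proof. by move=> e e0; exists 1 => // w _; rewrite subrr cmod0. Qed.

Lemma cont_id z : cont_at id z.
Proof. by move=> e e0; exists e. Qed.

Lemma contD F G z : cont_at F z -> cont_at G z -> cont_at (fun w => F w + G w) z.
Proof.
move=> /cont_seqP h /cont_seqP k; apply/cont_seqP => u hu.
exact: climD (h u hu) (k u hu).
Qed.

Lemma contN F z : cont_at F z -> cont_at (fun w => - F w) z.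
Proof. move=> /cont_seqP h; apply/cont_seqP => u hu; exact: climN (h u hu). Qed.

Lemma contB F G z : cont_at F z -> cont_at G z -> cont_at (fun w => F w - G w) z.
Proof. by move=> h k; apply: contD => //; exact: contN. Qed.

Lemma contM F G z : cont_at F z -> cont_at G z -> cont_at (fun w => F w * G w) z.
Proof.
move=> /cont_seqP h /cont_seqP k; apply/cont_seqP => u hu.
exact: climM (h u hu) (k u hu).
Qed.

Lemma contV F z : F z != 0 -> cont_at F z -> cont_at (fun w => (F w)^-1) z.
Proof. move=> z0 /cont_seqP h; apply/cont_seqP => u hu; exact: climV (h u hu). Qed.

Lemma contX F z n : cont_at F z -> cont_at (fun w => F w ^+ n) z.
Proof.
move=> h; elim: n => [|n ih]; first exact: cont_cst.
have -> : (fun w => F w ^+ n.+1) = (fun w => F w * F w ^+ n).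
  by apply/funext => w; rewrite exprS.
exact: contM.
Qed.

Lemma cont_comp F G z : cont_at F z -> cont_at G (F z) -> cont_at (G \o F) z.
Proof.
move=> /cont_seqP h /cont_seqP k; apply/cont_seqP => u hu.
exact: k _ (h u hu).
Qed.

(** Caratheodory's form of the derivative: the difference quotient extends to a
    function phi continuous at z. It makes the product and chain rules
    algebraic identities. *)
Definition cderiv G z d := exists phi,
  [/\ cont_at phi z, phi z = d & forall w, G w = G z + phi w * (w - z)].

Lemma cderivP G z d : cderiv G z d <-> forall e : R, 0 < e ->
  exists2 r : R, 0 < r & forall w, cmod (w - z) < r ->
    cmod (G w - G z - d * (w - z)) <= e * cmod (w - z).
Proof.
split=> [[phi [hc <- hG]] e /hc[r r0 hr]|h].
  exists r => // w wr.
  have -> : G w - G z - phi z * (w - z) = (phi w - phi z) * (w - z).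
    by rewrite [G w]hG; ring.
  rewrite cmodM; by rewrite ler_wpM2r ?cmod_ge0// ltW// hr.
exists (fun w => if w == z then d else (G w - G z) / (w - z)); split; last 2 first.
- by rewrite eqxx.
- move=> w; case: eqVneq => [->|wz]; first by rewrite subrr mulr0 addr0.
  by rewrite divfK ?subr_eq0// addrC subrK.
move=> e e0; have [r r0 hr] := h (e / 2) (divr_gt0 e0 (ltr0n _ 2)).
exists r => // w wr; rewrite eqxx; case: eqVneq => [_|wz]; first by rewrite subrr cmod0.
have wz0 : 0 < cmod (w - z) by rewrite cmod_gt0 subr_eq0.
have -> : (G w - G z) / (w - z) - d = (G w - G z - d * (w - z)) / (w - z).
  by field; rewrite subr_eq0.
rewrite cmodM cmodV ltr_pdivrMr//; apply: le_lt_trans (hr w wr) _.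
by rewrite ltr_pM2r// ltr_pdivrMr// ltr_pMr// ltr1n.
Qed.

Lemma cderiv_cont G z d : cderiv G z d -> cont_at G z.
Proof.
move=> [phi [hc hd hG]].
have -> : G = fun w => G z + phi w * (w - z) by apply/funext.
by apply: contD (cont_cst _ _) (contM hc (contB (@cont_id _) (cont_cst _ _))).
Qed.

Lemma cderiv_cst a z : cderiv (fun=> a) z 0.
Proof.
by exists (fun=> 0); split=> //; [exact: cont_cst|move=> w; rewrite mul0r addr0].
Qed.

Lemma cderiv_id z : cderiv id z 1.
Proof.
exists (fun=> 1); split=> //; [exact: cont_cst|move=> w].
by rewrite mul1r addrC subrK.
Qed.

Lemma cderivD F G z d d' : cderiv F z d -> cderiv G z d' ->
  cderiv (fun w => F w + G w) z (d + d').
Proof.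
move=> [f [fc <- hF]] [g [gc <- hG]]; exists (fun w => f w + g w); split=> //.
  exact: contD.
by move=> w; rewrite (hF w) (hG w); ring.
Qed.

Lemma cderivM F G z d d' : cderiv F z d -> cderiv G z d' ->
  cderiv (fun w => F w * G w) z (d * G z + F z * d').
Proof.
move=> hf hg; have gcont := cderiv_cont hg; move: hf hg.
move=> [f [fc <- hF]] [g [gc <- hG]].
exists (fun w => f w * G w + F z * g w); split=> //.
  by apply: contD; [exact: contM|apply: contM => //; exact: cont_cst].
by move=> w; rewrite [F w]hF [G w]hG; ring.
Qed.

Lemma cderivZ a G z d : cderiv G z d -> cderiv (fun w => a * G w) z (a * d).
Proof. by move=> h; have := cderivM (cderiv_cst a z) h; rewrite mul0r add0r. Qed.

Lemma cderivN G z d : cderiv G z d -> cderiv (fun w => - G w) z (- d).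
Proof.
move=> /(cderivZ (-1)); rewrite mulN1r.
by under [fun w => _ * _]eq_fun do rewrite mulN1r.
Qed.

Lemma cderivB F G z d d' : cderiv F z d -> cderiv G z d' ->
  cderiv (fun w => F w - G w) z (d - d').
Proof. by move=> h k; apply: cderivD => //; exact: cderivN. Qed.

Lemma cderivV G z d : G z != 0 -> cderiv G z d ->
  cderiv (fun w => (G w)^-1) z (- d / G z ^+ 2).
Proof.
move=> z0 hg; have gcont := cderiv_cont hg.
apply/cderivP => e e0; case: hg => g [gc <- hG].
have h1 : cont_at (fun w => - g w / (G w * G z)) z.
  apply: contM; first exact: contN.
  by apply: contV; [rewrite mulf_neq0|apply: contM => //; exact: cont_cst].
have [r r0 hr] := h1 e e0.
have g0 : 0 < cmod (G z) by rewrite cmod_gt0.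
have [r' r0' hr'] := gcont _ g0.
exists (Num.min r r'); first by rewrite lt_min r0.
move=> w; rewrite lt_min => /andP[wr wr'].
have Gw0 : G w != 0.
  by apply/negP => /eqP Gw; have := hr' w wr'; rewrite Gw sub0r cmodN ltxx.
rewrite expr2.
have -> : (G w)^-1 - (G z)^-1 - - g z / (G z * G z) * (w - z) =
   (- g w / (G w * G z) - - g z / (G z * G z)) * (w - z).
  have e1 : (G w)^-1 - (G z)^-1 = - g w / (G w * G z) * (w - z).
    have e2 : g w * (w - z) = G w - G z by rewrite [G w]hG; ring.
    have e3 : - g w * (w - z) = G z - G w by rewrite mulNr e2 opprB.
    by rewrite mulrAC e3; field; rewrite z0 Gw0.
  by rewrite e1 -mulrBl.
by rewrite cmodM ler_wpM2r ?cmod_ge0// ltW// hr.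
Qed.

Lemma cderiv_comp F G z d d' : cderiv F z d -> cderiv G (F z) d' ->
  cderiv (G \o F) z (d' * d).
Proof.
move=> hf hg; have fcont := cderiv_cont hf; move: hf hg.
move=> [f [fc <- hF]] [g [gc <- hG]].
exists (fun w => g (F w) * f w); split=> //.
  by apply: contM => //; exact: (cont_comp (G := g)).
by move=> w /=; rewrite (hG (F w)) [in F w - F z]hF; ring.
Qed.

Lemma cderivX z n : cderiv (fun w => w ^+ n) z (n%:R * z ^+ n.-1).
Proof.
elim: n => [|n ih]; first by rewrite mul0r; exact: cderiv_cst.
have -> : (fun w => w ^+ n.+1) = (fun w => w * w ^+ n).
  by apply/funext => w; rewrite exprS.
have := cderivM (@cderiv_id z) ih; congr (cderiv _ _ _) => /=.
by case: n {ih} => [|n] /=; rewrite ?expr0 ?exprS -natr1; ring.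
Qed.

Lemma cderiv_ext F G z d (r : R) : 0 < r -> (forall w, cmod (w - z) < r -> F w = G w) ->
  cderiv F z d -> cderiv G z d.
Proof.
move=> r0 h /cderivP hF; apply/cderivP => e /hF[s s0 hs].
exists (Num.min s r); first by rewrite lt_min s0.
move=> w; rewrite lt_min => /andP[ws wr].
by rewrite -!h ?subrr ?cmod0//; exact: hs.
Qed.

Lemma cderiv_uniq G z d d' : cderiv G z d -> cderiv G z d' -> d = d'.
Proof.
move=> /cderivP h /cderivP h'; apply/eqP; rewrite -subr_eq0; apply/eqP.
apply: cmod_small => e e0; have e2 : 0 < e / 2 by rewrite divr_gt0.
have [r r0 hr] := h _ e2; have [r' r0' hr'] := h' _ e2.
pose t : R := Num.min r r' / 2; have t0 : 0 < t by rewrite divr_gt0// lt_min r0.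
have tm : t < Num.min r r' by rewrite ltr_pdivrMr// ltr_pMr ?lt_min ?r0// ltr1n.
have e1 : z + t%:C - z = t%:C by rewrite addrC addKr.
have ct : cmod (z + t%:C - z) = t by rewrite e1 cmod_real gtr0_norm.
move: tm; rewrite lt_min => /andP[tr tr'].
have := hr (z + t%:C); have := hr' (z + t%:C); rewrite ct => /(_ tr') k' /(_ tr) k.
have := le_trans (cmodB _ _) (lerD k' k); rewrite e1.
set A := _ - _; have -> : A = (d - d') * t%:C by rewrite /A; ring.
by rewrite cmodM cmod_real gtr0_norm// -mulrDl -splitr ler_pM2r.
Qed.
End Continuity.

(** * Averages of continuous functions on [0, 1] *)

Section Average.
Variable R : realType.
Local Notation C := (Cpx R).
Local Notation "x %:C" := (real_complex R x : C).
Implicit Types (h k : R -> C).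

(** Bisection: if P failed on [0, 1], it would fail on nested dyadic intervals
    that shrink to a point s, contradicting the local hypothesis at s. This
    replaces compactness of [0, 1] in the proofs below. *)
Lemma cousin (P : R -> R -> Prop) :
  (forall a b : R, 0 <= a -> a < b -> b <= 1 -> P a ((a + b) / 2) -> P ((a + b) / 2) b -> P a b) ->
  (forall s : R, 0 <= s -> s <= 1 -> exists2 d : R, 0 < d & forall a b : R,
     0 <= a -> a <= s -> s <= b -> b <= 1 -> a < b -> b - a < d -> P a b) ->
  P 0 1.
Proof.
move=> glue loc; apply: contrapT => nP.
(* [a n, a n + w n] is the nested dyadic interval; the right half is chosen
   exactly when P holds on the left half *)
pose w n : R := 2^-1 ^+ n.
pose step (a : R) n : R := if `[< P a (a + w n.+1) >] then a + w n.+1 else a.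
pose a := fix a n := if n is n'.+1 then step (a n') n' else 0.
have w0 n : 0 < w n by rewrite exprn_gt0// invr_gt0.
have wS n : w n = w n.+1 + w n.+1 by rewrite /w exprS; lra.
have aS n : a n.+1 = step (a n) n by [].
have astep n : a n <= a n.+1 /\ a n.+1 + w n.+1 <= a n + w n.
  rewrite aS /step (wS n); case: ifP => _; have := w0 n.+1; lra.
have ab n : 0 <= a n /\ a n + w n <= 1.
  elim: n => [|n [h1 h2]]; first by rewrite /w expr0 /=; lra.
  by have [h3 h4] := astep n; split; lra.
have mon n (k : nat) : a n <= a (n + k)%N /\ a (n + k)%N + w (n + k)%N <= a n + w n.
  elim: k => [|k [h1 h2]]; first by rewrite addn0.
  by have [h3 h4] := astep (n + k)%N; rewrite addnS; split; lra.
have bad n : ~ P (a n) (a n + w n).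
  elim: n => [|n ih]; first by rewrite /= /w expr0 add0r.
  have [h1 h2] := ab n.
  have em : (a n + (a n + w n)) / 2 = a n + w n.+1 by rewrite (wS n); lra.
  rewrite aS /step; case: ifPn => [/asboolP hp|/asboolP hp] // hq.
  apply: ih; apply: glue => //; first by have := w0 n; lra.
    by rewrite em.
  by rewrite em; move: hq; rewrite -addrA -wS.
pose s := sup (range a).
have cross n m : a m <= a n + w n.
  case/orP: (leq_total n m) => [/subnKC<-|/subnKC<-].
    by have [h1 h2] := mon n (m - n)%N; have := w0 (n + (m - n))%N; lra.
  by have [h1 h2] := mon m (n - m)%N; have := w0 (m + (n - m))%N; lra.
have hsup : has_sup (range a).
  by split; [exists (a 0%N), 0%N|exists (a 0%N + w 0%N) => _ [m _ <-]; exact: cross].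
have as_ n : a n <= s by apply: sup_upper_bound => //; exists n.
have sb n : s <= a n + w n.
  by apply: ge_sup; [exists (a 0%N), 0%N|move=> _ [m _ <-]; exact: cross].
have s0 : 0 <= s by exact: (as_ 0%N).
have s1 : s <= 1 by have := sb 0%N; rewrite /w expr0 /=; lra.
have [d d0 hd] := loc s s0 s1.
have [N hN] := geo_lt 1 (q := 2^-1 : R) (e := d) ltac:(lra) ltac:(lra) d0.
apply: (bad N); apply: hd => //; [by case: (ab N)|by case: (ab N)| |].
  by rewrite ltrDl.
by have := hN N (leqnn N); rewrite mul1r addrC addKr.
Qed.

Definition cont01 h := forall s : R, 0 <= s -> s <= 1 -> forall e : R, 0 < e ->
  exists2 d : R, 0 < d &
    forall t, 0 <= t -> t <= 1 -> `|t - s| < d -> cmod (h t - h s) < e.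

Lemma heine h : cont01 h -> forall e : R, 0 < e -> exists2 d : R, 0 < d &
  forall s t, 0 <= s -> s <= 1 -> 0 <= t -> t <= 1 -> `|t - s| < d -> cmod (h t - h s) < e.
Proof.
move=> hc e e0.
pose P (a b : R) := exists2 d : R, 0 < d & forall s t, a <= s -> s <= b ->
  0 <= t -> t <= 1 -> `|t - s| < d -> cmod (h t - h s) < e.
suff [d d0 hd] : P 0 1 by exists d => // s t s0 s1 t0 t1; exact: hd.
apply: cousin => [a b a0 ab b1 [d d0 hd] [d' d0' hd']|s s0 s1].
  exists (Num.min d d'); first by rewrite lt_min d0.
  move=> s t sa sb t0 t1; rewrite lt_min => /andP[td td'].
  have [sm|/ltW sm] := leP s ((a + b) / 2); first exact: hd.
  exact: hd'.
have [d d0 hd] := hc s s0 s1 (e / 2) ltac:(lra).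
exists (d / 2); first by rewrite divr_gt0.
move=> a b a0 as_ sb b1 ab bad; exists (d / 2); first by rewrite divr_gt0.
move=> x t ax xb t0 t1 tx.
have k1 : cmod (h t - h s) < e / 2.
  apply: hd => //; move: tx; rewrite !ltr_norml => /andP[? ?]; apply/andP; split; lra.
have k2 : cmod (h x - h s) < e / 2.
  by apply: hd; rewrite ?ltr_norml; lra.
apply: le_lt_trans (cmod_tri _ (h s) _) _; rewrite (cmodBC (h s)); lra.
Qed.

(** Left Riemann sum over the dyadic subdivision of step 2^-n. *)
Definition dsum n h : C := (2 ^+ n)^-1 * \sum_(k < (2 ^ n)%N) h (k%:R / 2 ^+ n).

(** The integral of h over [0, 1]. As a limit of dyadic sums it is compatible
    by construction with halving the interval, the only subdivision needed
    below. *)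
Definition av h : C := lim ((fun n => dsum n h) @ \oo).

Lemma dsum_half n h : dsum n.+1 h =
  2^-1 * (dsum n (fun s => h (s / 2)) + dsum n (fun s => h (2^-1 + s / 2))).
Proof.
rewrite /dsum exprS invfM -mulrA -mulrDr; congr (_ * (_ * _)).
rewrite expnS mul2n -addnn big_split_ord /=; congr (_ + _); apply: eq_bigr => k _.
  by congr h; rewrite exprS invfM mulrA mulrAC.
congr h; rewrite natrD natrX exprS; field.
by rewrite expf_neq0.
Qed.

(** Refining the subdivision: each term of the coarse sum is replaced by a fine
    sum over its own dyadic interval. *)
Lemma dsum_comp n j h : dsum (n + j) h =
  (2 ^+ n)^-1 * \sum_(k < (2 ^ n)%N) dsum j (fun s => h (k%:R / 2 ^+ n + s / 2 ^+ n)).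
Proof.
elim: n h => [|n ih] h.
  rewrite add0n expr0 invr1 mul1r big_ord1 mul0r; congr dsum.
  by apply/funext => s; rewrite add0r divr1.
rewrite addSn dsum_half !ih exprS invfM -mulrA -mulrDr; congr (_ * (_ * _)).
rewrite expnS mul2n -addnn big_split_ord /=; congr (_ + _); apply: eq_bigr => k _;
  congr dsum; apply/funext => s; congr h; rewrite ?natrD ?natrX exprS; field;
  by rewrite expf_neq0.
Qed.

Lemma dsum_le n h M : (forall s, 0 <= s -> s <= 1 -> cmod (h s) <= M) -> cmod (dsum n h) <= M.
Proof.
move=> hM; have e2 : (0 : R) < 2 ^+ n by rewrite exprn_gt0.
rewrite /dsum cmodM cmodV cmodX cmod_nat ler_pdivrMl//.
apply: le_trans (cmod_sum _ _ _) _.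
have -> : 2 ^+ n * M = \sum_(k < (2 ^ n)%N) M.
  by rewrite sumr_const card_ord -natrX mulr_natl.
apply: ler_sum => k _; apply: hM; first by rewrite divr_ge0// ltW.
by rewrite ler_pdivrMr// mul1r -natrX ler_nat ltnW.
Qed.

Lemma dsumD n h k : dsum n (fun s => h s + k s) = dsum n h + dsum n k.
Proof. by rewrite /dsum big_split mulrDr. Qed.

Lemma dsumZ n a h : dsum n (fun s => a * h s) = a * dsum n h.
Proof. by rewrite /dsum -mulr_sumr mulrCA. Qed.

Lemma dsum_cst n a : dsum n (fun=> a) = a.
Proof.
rewrite /dsum sumr_const card_ord -[a *+ _]mulr_natl natrX mulrA mulVf ?mul1r//.
Qed.

(** By uniform continuity the fine sums stay within e/4 of the coarse one. *)
Lemma avP h : cont01 h -> clim (fun n => dsum n h) (av h).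
Proof.
move=> hc; suff [l hl] : exists l, clim (fun n => dsum n h) l.
  by rewrite /av; move/climP: (hl) => /cvg_lim -> //.
apply: complete_C => e e0; have e4 : 0 < e / 4 by rewrite divr_gt0.
have [d d0 hd] := heine hc e4.
have [N hN] := geo_lt 1 (q := 2^-1 : R) (e := d) ltac:(lra) ltac:(lra) d0.
have key j : cmod (dsum (N + j) h - dsum N h) <= e / 4.
  rewrite dsum_comp [in X in _ - X]/dsum -mulrBr -sumrB.
  have e2 : (0 : R) < 2 ^+ N by rewrite exprn_gt0.
  rewrite cmodM cmodV cmodX cmod_nat ler_pdivrMl//.
  apply: le_trans (cmod_sum _ _ _) _.
  have -> : 2 ^+ N * (e / 4) = \sum_(k < (2 ^ N)%N) (e / 4).
    by rewrite sumr_const card_ord -natrX mulr_natl.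
  apply: ler_sum => k _; rewrite -[h _]/((fun=> h (k%:R / 2 ^+ N)) (0 : R)).
  rewrite -(dsum_cst j (h (k%:R / 2 ^+ N))) -mulN1r -dsumZ -dsumD.
  apply: dsum_le => s s0 s1; rewrite mulN1r ltW//.
  have k1 : k%:R + 1 <= 2 ^+ N :> R by rewrite -natrX natr1 ler_nat.
  have k0 : 0 <= k%:R :> R by rewrite ler0n.
  have i0 : 0 < (2 ^+ N)^-1 :> R by rewrite invr_gt0.
  apply: hd.
  - by rewrite divr_ge0// ltW.
  - by rewrite ler_pdivrMr//; lra.
  - by rewrite addr_ge0// divr_ge0// ltW.
  - by rewrite -mulrDl ler_pdivrMr//; lra.
  - rewrite addrC addKr ger0_norm ?divr_ge0 ?(ltW e2)//.
    have := hN N (leqnn N); rewrite mul1r exprVn; apply: le_lt_trans.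
    by rewrite ler_piMl// ltW.
exists N => n m Nn Nm; rewrite -(subnKC Nn) -(subnKC Nm).
apply: le_lt_trans (cmod_tri _ (dsum N h) _) _; rewrite (cmodBC (dsum N h)).
have := key (n - N)%N; have := key (m - N)%N; lra.
Qed.

Lemma cont01_comp h (a b : R) : cont01 h -> 0 <= a -> 0 <= a + b -> a <= 1 -> a + b <= 1 ->
  cont01 (fun s => h (a + b * s)).
Proof.
move=> hc a0 ab0 a1 ab1 s s0 s1 e e0.
have rg t : 0 <= t -> t <= 1 -> 0 <= a + b * t <= 1.
  by move=> t0 t1; apply/andP; split; nra.
have /andP[u0 u1] := rg s s0 s1.
have [d d0 hd] := hc _ u0 u1 e e0.
have b1 : 0 < `|b| + 1 by rewrite ltr_wpDl.
exists (d / (`|b| + 1)); first by rewrite divr_gt0.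
move=> t t0 t1 ts; have /andP[v0 v1] := rg t t0 t1; apply: hd => //.
have -> : a + b * t - (a + b * s) = b * (t - s) by ring.
rewrite normrM; apply: le_lt_trans (_ : (`|b| + 1) * `|t - s| < d).
  by rewrite ler_wpM2r// lerDl.
by rewrite -ltr_pdivlMl// mulrC.
Qed.

Lemma cont01D h k : cont01 h -> cont01 k -> cont01 (fun s => h s + k s).
Proof.
move=> hh hk s s0 s1 e e0; have e2 : 0 < e / 2 by rewrite divr_gt0.
have [d d0 hd] := hh s s0 s1 _ e2; have [d' d0' hd'] := hk s s0 s1 _ e2.
exists (Num.min d d'); first by rewrite lt_min d0.
move=> t t0 t1; rewrite lt_min => /andP[/(hd t t0 t1) h1 /(hd' t t0 t1) h2].
rewrite opprD addrACA (splitr e); apply: le_lt_trans (cmodD _ _) _; exact: ltrD.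
Qed.

Lemma cont01Z a h : cont01 h -> cont01 (fun s => a * h s).
Proof.
move=> hh s s0 s1 e e0; have a1 : 0 < cmod a + 1 by rewrite ltr_wpDl// cmod_ge0.
have [d d0 hd] := hh s s0 s1 _ (divr_gt0 e0 a1); exists d => // t t0 t1 /(hd t t0 t1).
rewrite ltr_pdivlMr// => h1; rewrite -mulrBr cmodM; apply: le_lt_trans h1.
by rewrite mulrC ler_wpM2l ?cmod_ge0// lerDl.
Qed.

Lemma av_uniq h l : cont01 h -> clim (fun n => dsum n h) l -> av h = l.
Proof. by move=> /avP h1 h2; exact: clim_uniq h1 h2. Qed.

Lemma av_ext h k : (forall s, 0 <= s -> s <= 1 -> h s = k s) -> av h = av k.
Proof.
move=> e; rewrite /av; congr (lim (_ @ \oo)); apply/funext => n.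
congr (_ * _); apply: eq_bigr => i _; apply: e.
  by rewrite divr_ge0// exprn_ge0.
by rewrite ler_pdivrMr ?exprn_gt0// mul1r -natrX ler_nat ltnW.
Qed.

Lemma av_half h : cont01 h ->
  av h = 2^-1 * (av (fun s => h (s / 2)) + av (fun s => h (2^-1 + s / 2))).
Proof.
move=> hc.
have h1 : cont01 (fun s => h (s / 2)).
  have -> : (fun s => h (s / 2)) = (fun s => h (0 + 2^-1 * s)).
    by apply/funext => s; rewrite add0r mulrC.
  by apply: cont01_comp => //; lra.
have h2 : cont01 (fun s => h (2^-1 + s / 2)).
  have -> : (fun s => h (2^-1 + s / 2)) = (fun s => h (2^-1 + 2^-1 * s)).
    by apply/funext => s; rewrite (mulrC s).
  by apply: cont01_comp => //; lra.
apply: av_uniq => //; apply: clim_S.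
apply: (clim_ext (N := 0%N) (u := fun n => 2^-1 * (dsum n (fun s => h (s / 2)) +
  dsum n (fun s => h (2^-1 + s / 2))))); first by move=> n _; rewrite dsum_half.
by apply: climZ; apply: climD; exact: avP.
Qed.

Lemma avD h k : cont01 h -> cont01 k -> av (fun s => h s + k s) = av h + av k.
Proof.
move=> hh hk; apply: av_uniq; first exact: cont01D.
apply: (clim_ext (N := 0%N) _ (climD (avP hh) (avP hk))) => n _.
by rewrite dsumD.
Qed.

Lemma avZ a h : cont01 h -> av (fun s => a * h s) = a * av h.
Proof.
move=> hh; apply: av_uniq; first exact: cont01Z.
by apply: (clim_ext (N := 0%N) _ (climZ a (avP hh))) => n _; rewrite dsumZ.
Qed.

Lemma av_cst a : av (fun=> a) = a.
Proof.
apply: av_uniq; first by move=> s _ _ e e0; exists 1 => // t _ _ _; rewrite subrr cmod0.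
by apply: (clim_ext (N := 0%N) _ (clim_cst a)) => n _; rewrite dsum_cst.
Qed.

Lemma av_le h M : cont01 h -> (forall s, 0 <= s -> s <= 1 -> cmod (h s) <= M) ->
  cmod (av h) <= M.
Proof. move=> hh hM; apply: (clim_le (N := 0%N) _ (avP hh)) => n _; exact: dsum_le. Qed.

(** Reversal exchanges left and right endpoint sums, whose difference
    telescopes to (h 1 - h 0) / 2^n. *)
Lemma av_rev h : cont01 h -> av (fun s => h (1 - s)) = av h.
Proof.
move=> hc; apply: av_uniq.
  have -> : (fun s => h (1 - s)) = (fun s => h (1 + (-1) * s)).
    by apply/funext => s; rewrite mulN1r.
  by apply: cont01_comp => //; lra.
have hb : clim (fun n => (h 1 - h 0) * (2 ^+ n)^-1) 0.
  apply: (clim_dom (A := cmod (h 1 - h 0)) (q := 2^-1) (N := 0%N)); try lra.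
  by move=> n _; rewrite subr0 cmodM cmodV cmodX cmod_nat exprVn.
have := climD (avP hc) hb; rewrite addr0; apply: (clim_ext (N := 0%N)) => n _.
have n0 : (2 ^+ n : R) != 0 by rewrite expf_neq0.
rewrite /dsum [X in _ = _ * X](reindex_inj rev_ord_inj) /= [_ * (_)^-1]mulrC -mulrDr.
congr (_ * _); rewrite addrC; apply/esym.
have e1 : \sum_(k < (2 ^ n)%N) h (1 - ((2 ^ n - k.+1)%N%:R / 2 ^+ n)) =
   \sum_(k < (2 ^ n)%N) h (k.+1%:R / 2 ^+ n).
  apply: eq_bigr => k _; congr h; rewrite natrB//  natrX mulrBl divff//; ring.
rewrite {}e1 -(big_mkord xpredT (fun i : nat => h (i.+1%:R / 2 ^+ n))).
rewrite -(big_mkord xpredT (fun i : nat => h (i%:R / 2 ^+ n))).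
apply/eqP; rewrite -subr_eq -sumrB.
rewrite (telescope_sumr (fun i : nat => h (i%:R / 2 ^+ n)))//.
by rewrite mul0r natrX divff.
Qed.

Lemma av_Re_ge h (c : R) : cont01 h -> (forall s, 0 <= s -> s <= 1 -> c <= ReC (h s)) ->
  c <= ReC (av h).
Proof.
move=> hh hM; apply/ler_addgt0Pr => e /(avP hh)[N /(_ N (leqnn N)) hN].
have k1 : c <= ReC (dsum N h).
  have e2 : (0 : R) < 2 ^+ N by rewrite exprn_gt0.
  have -> : dsum N h = (2 ^+ N)^-1%:C * \sum_(k < (2 ^ N)%N) h (k%:R / 2 ^+ N).
    by rewrite /dsum fmorphV rmorphXn /= natrC.
  have -> : forall (r : R) (z : C), ReC (r%:C * z) = r * ReC z.
    by move=> r [a b]; rewrite /ReC /= mul0r subr0.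
  have -> : ReC (\sum_(k < (2 ^ N)%N) h (k%:R / 2 ^+ N)) =
            \sum_(k < (2 ^ N)%N) ReC (h (k%:R / 2 ^+ N)).
    by elim/big_rec2 : _ => // i a b _ <-; case: (h _) => ? ?; case: b.
  rewrite ler_pdivlMl//.
  have -> : 2 ^+ N * c = \sum_(k < (2 ^ N)%N) c.
    by rewrite sumr_const card_ord -natrX mulr_natl.
  apply: ler_sum => k _; apply: hM; first by rewrite divr_ge0// ltW.
  by rewrite ler_pdivrMr// mul1r -natrX ler_nat ltnW.
have := le_lt_trans (Re_le_cmod _) hN.
have -> : ReC (dsum N h - av h) = ReC (dsum N h) - ReC (av h).
  by case: (dsum N h) (av h) => [? ?] [? ?].
by rewrite ltr_norml => /andP[_ ?]; lra.
Qed.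
End Average.

(** * Integrals along segments and Goursat's lemma *)

(* conversion must not unfold the analytic constants *)
Opaque av.
Section Segments.
Variable R : realType.
Local Notation C := (Cpx R).
Local Notation "x %:C" := (real_complex R x : C).
Implicit Types (p q x y z w : C) (F G : C -> C).

Definition seg p q (s : R) : C := p + s%:C * (q - p).
Definition scont F p q := forall s : R, 0 <= s -> s <= 1 -> cont_at F (seg p q s).

(** The contour integral of F along the segment from p to q. *)
Definition edge F p q : C := (q - p) * av (fun s => F (seg p q s)).

Lemma seg_lip p q (s t : R) : cmod (seg p q t - seg p q s) = `|t - s| * cmod (q - p).
Proof.
rewrite /seg; have -> : p + t%:C * (q - p) - (p + s%:C * (q - p)) = (t - s)%:C * (q - p).
  by rewrite rmorphB /=; ring.
by rewrite cmodM cmod_real.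
Qed.

Lemma scont01 F p q : scont F p q -> cont01 (fun s => F (seg p q s)).
Proof.
move=> h s s0 s1 e e0; have [d d0 hd] := h s s0 s1 e e0.
have c1 : 0 < cmod (q - p) + 1 by rewrite ltr_wpDl// cmod_ge0.
exists (d / (cmod (q - p) + 1)); first by rewrite divr_gt0.
move=> t _ _ ts; apply: hd; rewrite seg_lip; rewrite ltr_pdivlMr// in ts.
by apply: le_lt_trans ts; rewrite ler_wpM2l// lerDl.
Qed.

Lemma edge_ext F G p q : (forall s : R, 0 <= s -> s <= 1 -> F (seg p q s) = G (seg p q s)) ->
  edge F p q = edge G p q.
Proof. by move=> h; rewrite /edge (av_ext h). Qed.

Lemma edgeD F G p q : scont F p q -> scont G p q ->
  edge (fun w => F w + G w) p q = edge F p q + edge G p q.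
Proof. by move=> /scont01 hF /scont01 hG; rewrite /edge (avD hF hG) mulrDr. Qed.

Lemma edgeZ a F p q : scont F p q -> edge (fun w => a * F w) p q = a * edge F p q.
Proof. by move=> /scont01 hF; rewrite /edge (avZ a hF) mulrCA. Qed.

Lemma edge_cst a p q : edge (fun=> a) p q = a * (q - p).
Proof. by rewrite /edge av_cst mulrC. Qed.

Lemma edge_le F p q M : scont F p q ->
  (forall s : R, 0 <= s -> s <= 1 -> cmod (F (seg p q s)) <= M) ->
  cmod (edge F p q) <= cmod (q - p) * M.
Proof.
by move=> /scont01 hF h; rewrite /edge cmodM ler_wpM2l ?cmod_ge0//; exact: av_le.
Qed.

Lemma seg0 p q : seg p q 0 = p.
Proof. by rewrite /seg rmorph0 mul0r addr0. Qed.

Lemma seg1 p q : seg p q 1 = q.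
Proof. by rewrite /seg rmorph1 mul1r addrC subrK. Qed.

Lemma seg_rev p q s : seg q p s = seg p q (1 - s).
Proof. by rewrite /seg rmorphB /= rmorph1; ring. Qed.

Lemma edge_rev F p q : scont F p q -> edge F q p = - edge F p q.
Proof.
move=> /scont01 h; rewrite /edge -mulNr opprB; congr (_ * _).
rewrite -[RHS](av_rev h); congr av; apply/funext => s; by rewrite seg_rev.
Qed.

Lemma half_seg p q s : seg p ((p + q) / 2) s = seg p q (s / 2).
Proof. by rewrite /seg rmorphM fmorphV /= -natrC; field. Qed.

Lemma half_seg2 p q s : seg ((p + q) / 2) q s = seg p q (2^-1 + s / 2).
Proof. by rewrite /seg rmorphD rmorphM fmorphV /= -natrC; field. Qed.

Lemma edge_half F p q : scont F p q ->
  edge F p q = edge F p ((p + q) / 2) + edge F ((p + q) / 2) q.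
Proof.
move=> /scont01 h; rewrite /edge (av_half h).
under [in RHS]av_ext do rewrite half_seg.
under [X in _ = _ + _ * X]av_ext do rewrite half_seg2.
set A := av _; set B := av _; by field.
Qed.

(** The error G(q) - G(p) minus the integral is additive under bisection, and
    locally at most e times the length, since F is the derivative of G and is
    continuous; Cousin's lemma bounds it by e globally. *)
Lemma edge_ftc F G p q : scont F p q ->
  (forall s : R, 0 <= s -> s <= 1 -> cderiv G (seg p q s) (F (seg p q s))) ->
  edge F p q = G q - G p.
Proof.
move=> hF hG.
have seg2 (a b s : R) : seg (seg p q a) (seg p q b) s = seg p q (a + s * (b - a)).
  by rewrite /seg rmorphD rmorphM rmorphB /=; ring.
have sc (a b : R) : 0 <= a -> a < b -> b <= 1 -> scont F (seg p q a) (seg p q b).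
  by move=> a0 ab b1 s s0 s1; rewrite seg2; apply: hF; nra.
have mid (a b : R) : (seg p q a + seg p q b) / 2 = seg p q ((a + b) / 2).
  by rewrite /seg rmorphM rmorphD fmorphV /= -natrC; field.
have main (e : R) : 0 < e -> cmod (G q - G p - edge F p q) <= e.
  move=> e0.
  pose P (a b : R) : Prop := cmod (G (seg p q b) - G (seg p q a) -
     edge F (seg p q a) (seg p q b)) <= e * (b - a).
  suff : P 0 1.
    by rewrite /P seg0 seg1 subr0 mulr1.
  apply: cousin => [a b a0 ab b1|s s0 s1].
    rewrite /P => h1 h2; have hc := sc a b a0 ab b1.
    rewrite (edge_half hc) mid.
    set X := edge _ _ _ in h1 *; set Y := edge _ _ _ in h2 *.
    set Gm := G _ in h1 h2.
    have -> : G (seg p q b) - G (seg p q a) - (X + Y) =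
      (Gm - G (seg p q a) - X) + (G (seg p q b) - Gm - Y) by ring.
    apply: le_trans (cmodD _ _) _; apply: le_trans (lerD h1 h2) _.
    by rewrite -mulrDr; have -> : (a + b) / 2 - a + (b - (a + b) / 2) = b - a by ring.
  (* both the increment of G and the integral of F are compared with their
     values for the constant F (seg p q s), each with error e' times the
     length *)
  have c1 : 0 < 2 * (cmod (q - p) + 1) by have := cmod_ge0 (q - p); lra.
  pose e' := e / (2 * (cmod (q - p) + 1)); have e'0 : 0 < e' by rewrite divr_gt0.
  have /cderivP hd := hG s s0 s1.
  have [r1 r10 hr1] := hd _ e'0; have [r2 r20 hr2] := hF s s0 s1 _ e'0.
  have r0 : 0 < Num.min r1 r2 by rewrite lt_min r10.
  exists (Num.min r1 r2 / (cmod (q - p) + 1)).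
    by rewrite divr_gt0//; lra.
  move=> a b a0 as_ sb b1 ab; rewrite ltr_pdivlMr; last by lra.
  move=> bad; rewrite /P.
  have near t : a <= t -> t <= b -> cmod (seg p q t - seg p q s) <= (b - a) * cmod (q - p) /\
      cmod (seg p q t - seg p q s) < r1 /\ cmod (seg p q t - seg p q s) < r2.
    move=> ta tb; rewrite seg_lip.
    have : `|t - s| <= b - a by rewrite ler_norml; apply/andP; lra.
    move=> h; have c0 := cmod_ge0 (q - p).
    have h2 : `|t - s| * cmod (q - p) <= (b - a) * cmod (q - p) by rewrite ler_wpM2r.
    split => //; apply/andP; rewrite -lt_min; apply: le_lt_trans h2 _.
    by apply: le_lt_trans bad; rewrite ler_wpM2l// ?lerDl//; lra.
  have [la [ra1 ra2]] := near a (lexx a) (ltW ab).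
  have [lb [rb1 rb2]] := near b (ltW ab) (lexx b).
  have ka := hr1 _ ra1; have kb := hr1 _ rb1.
  set D := F (seg p q s) in ka kb.
  have hc := sc a b a0 ab b1.
  have hc' : scont (fun w => F w + - D) (seg p q a) (seg p q b).
    by move=> t t0 t1; apply: contD; [exact: hc|exact: cont_cst].
  have kE : cmod (edge F (seg p q a) (seg p q b) - D * (seg p q b - seg p q a)) <=
      cmod (seg p q b - seg p q a) * e'.
    rewrite -edge_cst -mulN1r -edgeZ; last by move=> *; exact: cont_cst.
    rewrite -edgeD//; last by move=> *; apply: contM; exact: cont_cst.
    rewrite mulN1r; apply: edge_le => // t t0 t1; rewrite seg2 ltW// hr2//.
    by apply: (near _ _ _).2.2; nra.
  rewrite seg_lip ger0_norm in kE; last by lra.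
  set X := edge _ _ _ in kE *; set ga := G _ in ka *; set gb := G (seg p q b) in kb *.
  have -> : gb - ga - X = (gb - G (seg p q s) - D * (seg p q b - seg p q s))
     - (ga - G (seg p q s) - D * (seg p q a - seg p q s))
     - (X - D * (seg p q b - seg p q a)) by ring.
  apply: le_trans (cmodB _ _) _.
  apply: le_trans (lerD (cmodB _ _) kE) _.
  apply: le_trans (lerD (lerD kb ka) (lexx _)) _.
  move: la lb; rewrite !seg_lip => _ _.
  have ea : `|a - s| = s - a by rewrite ler0_norm; lra.
  have eb : `|b - s| = b - s by rewrite ger0_norm; lra.
  rewrite ea eb; have -> : e' * ((b - s) * cmod (q - p)) + e' * ((s - a) * cmod (q - p)) +
     (b - a) * cmod (q - p) * e' = (b - a) * (2 * cmod (q - p) * e') by ring.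
  rewrite [leRHS]mulrC ler_wpM2l//; first by lra.
  rewrite /e' mulrA ler_pdivrMr// mulrC ler_wpM2l ?(ltW e0)//; lra.
by apply/esym/eqP; rewrite -subr_eq0; apply/eqP/cmod_small.
Qed.

Definition triangle F a b c := edge F a b + edge F b c + edge F c a.

(** Affine coordinates on the triangle with vertices p, p + u, p + v. *)
Definition pt p u v (s t : R) : C := p + s%:C * u + t%:C * v.

(** The integral of F over the boundary of the triangle with corner (s, t) and
    sides h u, h v. A negative h describes the inverted triangle in the middle
    of a subdivision. *)
Definition tri F p u v (s t h : R) :=
  triangle F (pt p u v s t) (pt p u v (s + h) t) (pt p u v s (t + h)).
Definition simplex (s t : R) := [/\ 0 <= s, 0 <= t & s + t <= 1].
Definition insimplex (s t h : R) :=
  [/\ simplex s t, simplex (s + h) t & simplex s (t + h)].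

Lemma insimplex_sub (a b k : R) : insimplex a b k ->
  [/\ insimplex a b (k / 2), insimplex (a + k / 2) b (k / 2),
   insimplex a (b + k / 2) (k / 2) & insimplex (a + k / 2) (b + k / 2) (- (k / 2))].
Proof. by move=> [[? ? ?] [? ? ?] [? ? ?]]; split; split; split; lra. Qed.

Lemma seg_pt p u v (s t s' t' r : R) :
  seg (pt p u v s t) (pt p u v s' t') r =
  pt p u v (s + r * (s' - s)) (t + r * (t' - t)).
Proof. by rewrite /seg /pt !rmorphD !rmorphM !rmorphB /=; ring. Qed.

Lemma simplex_seg (s t s' t' r : R) : simplex s t -> simplex s' t' ->
  0 <= r -> r <= 1 -> simplex (s + r * (s' - s)) (t + r * (t' - t)).
Proof. by move=> [a b c] [a' b' c'] r0 r1; split; nra. Qed.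

Lemma mid_pt p u v (s t s' t' : R) :
  (pt p u v s t + pt p u v s' t') / 2 = pt p u v ((s + s') / 2) ((t + t') / 2).
Proof. by rewrite /pt !rmorphM !rmorphD fmorphV /= -natrC; field. Qed.

(** Joining the midpoints of the sides cuts a triangle into four; the integrals
    over the inner edges cancel. *)
Lemma tri_split F p u v (s t h : R) :
  (forall s t, simplex s t -> cont_at F (pt p u v s t)) -> insimplex s t h ->
  tri F p u v s t h = tri F p u v s t (h / 2) + tri F p u v (s + h / 2) t (h / 2)
    + tri F p u v s (t + h / 2) (h / 2) + tri F p u v (s + h / 2) (t + h / 2) (- (h / 2)).
Proof.
move=> hF [i1 i2 i3].
have sc s1 t1 s2 t2 : simplex s1 t1 -> simplex s2 t2 ->
    scont F (pt p u v s1 t1) (pt p u v s2 t2).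
  move=> j1 j2 r r0 r1; rewrite seg_pt; apply: hF; exact: simplex_seg.
rewrite /tri /triangle.
rewrite (edge_half (sc _ _ _ _ i1 i2)) (edge_half (sc _ _ _ _ i2 i3)).
rewrite (edge_half (sc _ _ _ _ i3 i1)) !mid_pt.
have -> : (s + (s + h)) / 2 = s + h / 2 by field.
have -> : (s + h + s) / 2 = s + h / 2 by field.
have -> : (t + (t + h)) / 2 = t + h / 2 by field.
have -> : (t + h + t) / 2 = t + h / 2 by field.
have -> : (t + t) / 2 = t by field.
have -> : (s + s) / 2 = s by field.
have -> : s + h / 2 + h / 2 = s + h by field.
have -> : t + h / 2 + h / 2 = t + h by field.
have -> : s + h / 2 - h / 2 = s by ring.
have -> : t + h / 2 - h / 2 = t by ring.
have [a b c] := i1; have [a' b' c'] := i2; have [a'' b'' c''] := i3.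
rewrite (@edge_rev F (pt p u v (s + h / 2) t) (pt p u v s (t + h / 2))); last first.
  by apply: sc; split; lra.
rewrite (@edge_rev F (pt p u v s (t + h / 2)) (pt p u v (s + h / 2) (t + h / 2))); last first.
  by apply: sc; split; lra.
rewrite (@edge_rev F (pt p u v (s + h / 2) (t + h / 2)) (pt p u v (s + h / 2) t)); last first.
  by apply: sc; split; lra.
repeat match goal with |- context [edge F ?x ?y] =>
  let e := fresh "e" in generalize (edge F x y); intro e end.
ring.
Qed.

Lemma triangle_le F a b c M d : scont F a b -> scont F b c -> scont F c a ->
  (forall s : R, 0 <= s -> s <= 1 -> cmod (F (seg a b s)) <= M) ->
  (forall s : R, 0 <= s -> s <= 1 -> cmod (F (seg b c s)) <= M) ->
  (forall s : R, 0 <= s -> s <= 1 -> cmod (F (seg c a s)) <= M) ->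
  cmod (b - a) <= d -> cmod (c - b) <= d -> cmod (a - c) <= d ->
  cmod (triangle F a b c) <= 3 * d * M.
Proof.
move=> s1 s2 s3 h1 h2 h3 d1 d2 d3.
have M0 : 0 <= M by apply: le_trans (cmod_ge0 _) (h1 0 _ _).
apply: le_trans (cmodD _ _) _; apply: le_trans (lerD (cmodD _ _) (lexx _)) _.
have := edge_le s1 h1; have := edge_le s2 h2; have := edge_le s3 h3.
have := ler_wpM2r M0 d1; have := ler_wpM2r M0 d2; have := ler_wpM2r M0 d3; lra.
Qed.

Lemma pt_diff p u v (s t s' t' : R) :
  cmod (pt p u v s' t' - pt p u v s t) <= `|s' - s| * cmod u + `|t' - t| * cmod v.
Proof.
have -> : pt p u v s' t' - pt p u v s t = (s' - s)%:C * u + (t' - t)%:C * v.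
  by rewrite /pt !rmorphB /=; ring.
by apply: le_trans (cmodD _ _) _; rewrite !cmodM !cmod_real.
Qed.

Lemma le0_geo (x A : R) : (forall n, x <= A * 2^-1 ^+ n) -> x <= 0.
Proof.
move=> h; apply/ler_addgt0Pr => e e0; rewrite add0r.
have [N hN] := geo_lt A (q := 2^-1 : R) (e := e) ltac:(lra) ltac:(lra) e0.
by rewrite ltW// (le_lt_trans (h N))// hN.
Qed.

Lemma pigeon4 (E x1 x2 x3 x4 : R) : E < x1 + x2 + x3 + x4 ->
  x1 <= E / 4 -> x2 <= E / 4 -> x3 <= E / 4 -> E / 4 < x4.
Proof. by move=> *; lra. Qed.

Lemma convex_abs (a x y k r : R) : `|x - a| <= k -> `|y - a| <= k -> 0 <= r -> r <= 1 ->
  `|x + r * (y - x) - a| <= k.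
Proof.
move=> hx hy r0 r1; have -> : x + r * (y - x) - a = (1 - r) * (x - a) + r * (y - a) by ring.
apply: le_trans (ler_normD _ _) _; rewrite !normrM (ger0_norm r0) (ger0_norm (_ : 0 <= 1 - r)); last by lra.
have h1 := ler_wpM2l r0 hy; have h2 : (1 - r) * `|x - a| <= (1 - r) * k by rewrite ler_wpM2l//; lra.
by apply: le_trans (lerD h2 h1) _; rewrite -mulrDl subrK mul1r.
Qed.

Lemma scale_bound (x y P g u v : R) : x <= P * g -> y <= P * g -> 0 <= u -> 0 <= v -> 0 <= g ->
  x * u + y * v <= (P * (u + v) + 1) * g.
Proof.
move=> hx hy u0 v0 g0; have := ler_wpM2r u0 hx; have := ler_wpM2r v0 hy => h1 h2.
apply: le_trans (lerD h2 h1) _; rewrite mulrDl mul1r -subr_ge0.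
by have -> : P * (u + v) * g + g - (P * g * u + P * g * v) = g by ring.
Qed.

(** If the integral were nonzero, repeated subdivision would produce triangles
    converging to a point l whose integrals are at least eta times the square
    of their scale. At l the function equals an affine function, which has a
    primitive, up to an error e times the distance, so the integrals are at
    most a constant times e times the squared scale: a contradiction for small
    e. *)
Lemma goursat F p u v (s t h : R) :
  (forall s t, simplex s t -> exists d, cderiv F (pt p u v s t) d) ->
  insimplex s t h -> tri F p u v s t h = 0.
Proof.
move=> hD hin; have hF s' t' : simplex s' t' -> cont_at F (pt p u v s' t').
  by move=> /hD[d /cderiv_cont].
apply: contrapT => T0.
have h0 : 0 < `|h|.
  rewrite normr_gt0; apply/eqP => h0; apply: T0.
  by rewrite /tri /triangle h0 !addr0 /edge !subrr !mul0r !addr0.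
(* a triple (corner, scale) whose triangle has a large integral; one of its
   four parts is again such a triple *)
pose bad eta (x : R * R * R) := insimplex x.1.1 x.1.2 x.2 /\
  eta * x.2 ^+ 2 < cmod (tri F p u v x.1.1 x.1.2 x.2).
pose eta := cmod (tri F p u v s t h) / `|h| ^+ 2 / 2.
have T0' : 0 < cmod (tri F p u v s t h) by rewrite cmod_gt0; apply/eqP.
have eta0 : 0 < eta by rewrite divr_gt0// divr_gt0// exprn_gt0.
pose close (x y : R * R * R) := [/\ `|y.1.1 - x.1.1| <= `|x.2|, `|y.1.2 - x.1.2| <= `|x.2|
  & `|y.2| = `|x.2| / 2].
have step (x : R * R * R) : exists y : R * R * R, bad eta x -> bad eta y /\ close x y.
  have [hb|] := pselect (bad eta x); last by exists x.
  case: x hb => -[a b] k [/= hi hb].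
  have [i1 i2 i3] := hi; have [? ? ?] := i1; have [? ? ?] := i2; have [? ? ?] := i3.
  rewrite (tri_split hF hi) in hb.
  have [j1 j2 j3 j4] := insimplex_sub hi.
  set A1 := tri _ _ _ _ a b _ in hb; set A2 := tri _ _ _ _ _ b _ in hb.
  set A3 := tri _ _ _ _ a _ _ in hb; set A4 := tri _ _ _ _ _ _ _ in hb.
  have k2 : (k / 2) ^+ 2 = k ^+ 2 / 4 by field.
  have kn : (- (k / 2)) ^+ 2 = k ^+ 2 / 4 by field.
  have n2 : `|k / 2| = `|k| / 2 by rewrite normrM normfV (ger0_norm (ler0n R 2)).
  have n3 : `|- (k / 2)| = `|k| / 2 by rewrite normrN n2.
  have k0 : 0 <= `|k| by [].
  have n1 : `|a + k / 2 - a| <= `|k| by rewrite addrC addKr n2; lra.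
  have n4 : `|b + k / 2 - b| <= `|k| by rewrite addrC addKr n2; lra.
  have n5 : `|a - a| <= `|k| by rewrite subrr normr0.
  have n6 : `|b - b| <= `|k| by rewrite subrr normr0.
  have hb' : eta * k ^+ 2 < cmod A1 + cmod A2 + cmod A3 + cmod A4.
    apply: lt_le_trans hb _; apply: le_trans (cmodD _ _) _; rewrite lerD2r.
    apply: le_trans (cmodD _ _) _; rewrite lerD2r; exact: cmodD.
  have [c1|c1] := ltP (eta * (k / 2) ^+ 2) (cmod A1).
    exists (a, b, k / 2) => _; split; first by split; [exact: j1|exact: c1].
    by split; [exact: n5|exact: n6|exact: n2].
  have [c2|c2] := ltP (eta * (k / 2) ^+ 2) (cmod A2).
    exists (a + k / 2, b, k / 2) => _; split; first by split; [exact: j2|exact: c2].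
    by split; [exact: n1|exact: n6|exact: n2].
  have [c3|c3] := ltP (eta * (k / 2) ^+ 2) (cmod A3).
    exists (a, b + k / 2, k / 2) => _; split; first by split; [exact: j3|exact: c3].
    by split; [exact: n5|exact: n4|exact: n2].
  exists (a + k / 2, b + k / 2, - (k / 2)) => _; split; last first.
    by split; [exact: n1|exact: n4|exact: n3].
  split; first exact: j4.
  rewrite /= kn mulrA; rewrite k2 mulrA in c1 c2 c3.
  exact: pigeon4 hb' c1 c2 c3.
have [f hf] := choice step.
pose X n := iter n f (s, t, h).
have XS n : X n.+1 = f (X n) by [].
have badX n : bad eta (X n).
  elim: n => [|n /hf[]//]; split=> //=.
  rewrite /eta -[h ^+ 2]ger0_norm ?sqr_ge0// normrX.
  have h2 : 0 < `|h| ^+ 2 by rewrite exprn_gt0.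
  by rewrite mulrAC divfK ?gt_eqF// ltr_pdivrMr// ltr_pMr// ltr1n.
have hX n : `|(X n).2| = `|h| * 2^-1 ^+ n.
  elim: n => [|n ih]; first by rewrite expr0 mulr1.
  by have [_ [_ _ ->]] := hf _ (badX n); rewrite ih exprS; field.
(* the corners, as complex numbers, form a Cauchy sequence with geometric
   increments *)
pose Z n : C := (X n).1.1%:C + 'i%C * (X n).1.2%:C.
have ReZ n : ReC (Z n) = (X n).1.1 by rewrite /Z /ReC /=; ring.
have ImZ n : ImC (Z n) = (X n).1.2 by rewrite /Z /ImC /=; ring.
have Zd n m : ReC (Z n - m) = (X n).1.1 - ReC m /\ ImC (Z n - m) = (X n).1.2 - ImC m.
  by rewrite -ReZ -ImZ; case: (Z n) m => [? ?] [? ?].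
have Zc n : cmod (Z n.+1 - Z n) <= 2 * `|h| * 2^-1 ^+ n.
  have [_ [c1 c2 _]] := hf _ (badX n); rewrite -XS in c1 c2.
  apply: le_trans (cmod_le_ReIm _) _; have [-> ->] := Zd n.+1 (Z n); rewrite ReZ ImZ.
  by rewrite hX in c1 c2; lra.
have [l hl hl'] : exists2 l, clim Z l & forall n,
    cmod (Z n - l) <= 2 * `|h| / (1 - 2^-1) * 2^-1 ^+ n.
  by apply: clim_geo => //; lra.
pose K := 4 * `|h|.
have K0 : 0 < K by rewrite mulr_gt0.
have {}hl' n : cmod (Z n - l) <= K * 2^-1 ^+ n.
  by have := hl' n; have -> : 2 * `|h| / (1 - 2^-1) = K by rewrite /K; field.
have Zl n : `|(X n).1.1 - ReC l| <= K * 2^-1 ^+ n /\ `|(X n).1.2 - ImC l| <= K * 2^-1 ^+ n.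
  have [<- <-] := Zd n l; split.
    apply: le_trans (Re_le_cmod _) _; exact: hl'.
  apply: le_trans (Im_le_cmod _) _; exact: hl'.
have sl : simplex (ReC l) (ImC l).
  have hx n : simplex (X n).1.1 (X n).1.2 by case: (badX n) => -[].
  split; rewrite -subr_le0.
  - apply: (@le0_geo _ K) => n; have [a b c] := hx n; have [] := Zl n.
    rewrite !ler_norml => /andP[? ?] _; lra.
  - apply: (@le0_geo _ K) => n; have [a b c] := hx n; have [] := Zl n.
    rewrite !ler_norml => _ /andP[? ?]; lra.
  - apply: (@le0_geo _ (2 * K)) => n; have [a b c] := hx n; have [] := Zl n.
    rewrite !ler_norml => /andP[? ?] /andP[? ?]; lra.
have [d /cderivP hd] := hD _ _ sl.
set q := pt p u v (ReC l) (ImC l) in hd.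
pose B := (K + `|h|) * (cmod u + cmod v) + 1.
have B0 : 0 < B by rewrite ltr_wpDl// mulr_ge0 ?addr_ge0 ?cmod_ge0// ltW.
pose e := eta * `|h| ^+ 2 / (3 * (2 * B) * B).
have e0 : 0 < e.
  apply: divr_gt0; first by apply: mulr_gt0 => //; exact: exprn_gt0.
  by rewrite !mulr_gt0.
have [r r0 hr] := hd e e0.
have [N hN] := geo_lt B (q := 2^-1 : R) (e := r) ltac:(lra) ltac:(lra) r0.
have := hN N (leqnn N); set g := 2^-1 ^+ N => Bg.
have g0 : 0 < g by rewrite exprn_gt0// invr_gt0.
have [[i1 i2 i3] hT] := badX N.
have hXN := hX N; have [zl1 zl2] := Zl N; rewrite -/g in hXN zl1 zl2.
set a := (X N).1.1 in i1 i2 i3 hT zl1; set b := (X N).1.2 in i1 i2 i3 hT zl2.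
set k := (X N).2 in i1 i2 i3 hT hXN.
have nearq s' t' : `|s' - a| <= `|k| -> `|t' - b| <= `|k| ->
    cmod (pt p u v s' t' - q) <= B * g.
  move=> ha hb; apply: le_trans (pt_diff _ _ _ _ _ _ _) _.
  have l1 : `|s' - ReC l| <= (K + `|h|) * g.
    by rewrite mulrDl [leRHS]addrC -hXN; apply: le_trans (ler_distD a _ _) _; rewrite lerD.
  have l2 : `|t' - ImC l| <= (K + `|h|) * g.
    by rewrite mulrDl [leRHS]addrC -hXN; apply: le_trans (ler_distD b _ _) _; rewrite lerD.
  by apply: scale_bound => //; rewrite ?cmod_ge0// ltW.
(* rho is the error of the affine approximation at the limit point q *)
pose rho w := F w + - (F q + d * (w - q)).
have cont_aff w : cont_at (fun w => F q + d * (w - q)) w.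
  apply: contD; first exact: cont_cst.
  apply: contM; first exact: cont_cst.
  by apply: contB; [exact: cont_id|exact: cont_cst].
have sc s1 t1 s2 t2 G : (forall s t, simplex s t -> cont_at G (pt p u v s t)) ->
    simplex s1 t1 -> simplex s2 t2 -> scont G (pt p u v s1 t1) (pt p u v s2 t2).
  by move=> hG x1 x2 x x0 x1'; rewrite seg_pt; apply: hG; exact: simplex_seg.
have hrho s' t' : simplex s' t' -> cont_at rho (pt p u v s' t').
  by move=> /hF hc; apply: contB.
have eqT : tri F p u v a b k = tri rho p u v a b k.
  have aux s1 t1 s2 t2 : simplex s1 t1 -> simplex s2 t2 ->
      edge F (pt p u v s1 t1) (pt p u v s2 t2) =
      edge rho (pt p u v s1 t1) (pt p u v s2 t2) +
      ((F q * pt p u v s2 t2 + d * (pt p u v s2 t2 - q) ^+ 2 / 2) -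
       (F q * pt p u v s1 t1 + d * (pt p u v s1 t1 - q) ^+ 2 / 2)).
    move=> x1 x2.
    rewrite -(@edge_ftc (fun w => F q + d * (w - q)) (fun w => F q * w + d * (w - q) ^+ 2 / 2)).
    - rewrite -edgeD; [|exact: sc|by move=> *; exact: cont_aff].
      by apply: edge_ext => x _ _; rewrite /rho subrK.
    - by move=> *; exact: cont_aff.
    - move=> x _ _; set y := seg _ _ _.
      have hh := cderivD (cderivZ (F q) (@cderiv_id _ y)) (cderivZ (d / 2)
        (cderivM (cderivB (@cderiv_id _ y) (cderiv_cst q y)) (cderivB (@cderiv_id _ y) (cderiv_cst q y)))).
      have -> : F q + d * (y - q) = F q * 1 + d / 2 * ((1 - 0) * (y - q) + (y - q) * (1 - 0)) by field.
      have -> : (fun w => F q * w + d * (w - q) ^+ 2 / 2) =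
        (fun w => F q * w + d / 2 * ((w - q) * (w - q))) by apply/funext => w; field.
      exact: hh.
  rewrite /tri /triangle !aux//.
  repeat match goal with |- context [edge rho ?x ?y] =>
    let e := fresh "e" in generalize (edge rho x y); intro e end.
  ring.
have kB : cmod (tri rho p u v a b k) <= 3 * (2 * B * g) * (e * (B * g)).
  rewrite /tri.
  have nk : `|k| <= `|k| by [].
  have na : `|a - a| <= `|k| by rewrite subrr normr0.
  have nb : `|b - b| <= `|k| by rewrite subrr normr0.
  have nak : `|a + k - a| <= `|k| by rewrite addrC addKr.
  have nbk : `|b + k - b| <= `|k| by rewrite addrC addKr.
  have dist s1 t1 s2 t2 : `|s1 - a| <= `|k| -> `|t1 - b| <= `|k| ->
      `|s2 - a| <= `|k| -> `|t2 - b| <= `|k| ->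
      cmod (pt p u v s2 t2 - pt p u v s1 t1) <= 2 * B * g.
    move=> x1 x2 x3 x4; apply: le_trans (cmod_tri _ q _) _; rewrite (cmodBC q).
    apply: le_trans (lerD (nearq _ _ x3 x4) (nearq _ _ x1 x2)) _.
    by have -> : B * g + B * g = 2 * B * g by ring.
  have bnd s1 t1 s2 t2 : `|s1 - a| <= `|k| -> `|t1 - b| <= `|k| ->
      `|s2 - a| <= `|k| -> `|t2 - b| <= `|k| ->
      forall x : R, 0 <= x -> x <= 1 ->
      cmod (rho (seg (pt p u v s1 t1) (pt p u v s2 t2) x)) <= e * (B * g).
    move=> x1 x2 x3 x4 x x0 x1'; rewrite seg_pt.
    set s' := _ + _; set t' := t1 + _.
    have y1 : `|s' - a| <= `|k|.
      exact: convex_abs.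
    have y2 : `|t' - b| <= `|k|.
      exact: convex_abs.
    have nq := nearq _ _ y1 y2; rewrite /rho opprD addrA.
    apply: le_trans (hr _ (le_lt_trans nq Bg)) _.
    by rewrite ler_wpM2l// ltW.
  apply: triangle_le; [exact: sc|exact: sc|exact: sc|exact: bnd|exact: bnd|exact: bnd|
    exact: dist|exact: dist|exact: dist].
rewrite eqT in hT.
have := lt_le_trans hT kB.
rewrite -[k ^+ 2]ger0_norm ?sqr_ge0// normrX hXN.
have -> : 3 * (2 * B * g) * (e * (B * g)) = eta * (`|h| * g) ^+ 2.
  by rewrite /e; field; rewrite gt_eqF.
by rewrite ltxx.
Qed.

(** The difference quotient in Cauchy's formula is differentiable except at the
    centre, which is a vertex of the triangles used there. Away from this
    vertex Goursat's lemma applies, so the integral equals the one over an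
    arbitrarily small triangle at the vertex, where F is bounded. *)
Lemma goursat_vertex F p u v M :
  (forall s t, simplex s t -> cont_at F (pt p u v s t)) ->
  (forall s t, simplex s t -> cmod (F (pt p u v s t)) <= M) ->
  (forall s t, simplex s t -> 0 < s + t -> exists d, cderiv F (pt p u v s t) d) ->
  tri F p u v 0 0 1 = 0.
Proof.
move=> hF hM hD.
have sub (s t h s' t' : R) :
    pt (pt p u v s t) (h%:C * u) (h%:C * v) s' t' = pt p u v (s + s' * h) (t + t' * h).
  by rewrite /pt !rmorphD !rmorphM /=; ring.
have key (s t h : R) : insimplex s t h -> 0 < s + t -> 0 < s + t + h -> tri F p u v s t h = 0.
  move=> hi st sth.
  have e : tri F p u v s t h = tri F (pt p u v s t) (h%:C * u) (h%:C * v) 0 0 1.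
    by rewrite /tri !sub !add0r !mul0r !mul1r !addr0.
  rewrite e; apply: goursat; last by split; split; lra.
  move=> s' t' hs'; rewrite sub; case: hs' => ? ? ?.
  have [[? ? ?] [? ? ?] [? ? ?]] := hi.
  apply: hD; first by split; nra.
  by nra.
have rec n : tri F p u v 0 0 1 = tri F p u v 0 0 (2^-1 ^+ n).
  elim: n => [|n ->]; first by rewrite expr0.
  have g0 : 0 < 2^-1 ^+ n :> R by rewrite exprn_gt0// invr_gt0.
  have g1 : 2^-1 ^+ n <= 1 :> R by rewrite exprn_ile1//; lra.
  rewrite exprS mulrC; set g := 2^-1 ^+ n in g0 g1 *.
  rewrite (tri_split hF); last by split; split; lra.
  rewrite !add0r (key (g / 2)); [|by split; split; lra|lra|lra].
  rewrite (key 0 (g / 2)); [|by split; split; lra|lra|lra].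
  by rewrite (key (g / 2) (g / 2)) ?addr0//; [by split; split; lra|lra|lra].
apply: cmod_small => e e0.
pose d := 2 * (cmod u + cmod v).
have [N hN] := geo_lt (3 * d * M) (q := 2^-1 : R) (e := e) ltac:(lra) ltac:(lra) e0.
rewrite (rec N); apply/ltW; apply: le_lt_trans (hN N (leqnn N)).
have g0 : 0 < 2^-1 ^+ N :> R by rewrite exprn_gt0// invr_gt0.
have g1 : 2^-1 ^+ N <= 1 :> R by rewrite exprn_ile1//; lra.
set g := 2^-1 ^+ N in g0 g1 *.
have -> : 3 * d * M * g = 3 * (d * g) * M by ring.
have u0 := cmod_ge0 u; have v0 := cmod_ge0 v.
have sc s1 t1 s2 t2 : simplex s1 t1 -> simplex s2 t2 ->
    scont F (pt p u v s1 t1) (pt p u v s2 t2).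
  by move=> x1 x2 x x0 x1'; rewrite seg_pt; apply: hF; exact: simplex_seg.
have bn s1 t1 s2 t2 : simplex s1 t1 -> simplex s2 t2 -> forall x : R, 0 <= x -> x <= 1 ->
    cmod (F (seg (pt p u v s1 t1) (pt p u v s2 t2) x)) <= M.
  by move=> x1 x2 x x0 x1'; rewrite seg_pt; apply: hM; exact: simplex_seg.
have s00 : simplex 0 0 by split; lra.
have s10 : simplex g 0 by split; lra.
have s01 : simplex 0 g by split; lra.
have ds s1 t1 s2 t2 : `|s2 - s1| <= g -> `|t2 - t1| <= g ->
    cmod (pt p u v s2 t2 - pt p u v s1 t1) <= d * g.
  move=> x1 x2; apply: le_trans (pt_diff _ _ _ _ _ _ _) _.
  have := ler_wpM2r u0 x1; have := ler_wpM2r v0 x2; rewrite /d; nra.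
have n0 : `|0 - 0 : R| <= g by rewrite subrr normr0 ltW.
have n1 : `|g - 0 : R| <= g by rewrite subr0 gtr0_norm.
have n2 : `|0 - g : R| <= g by rewrite sub0r normrN gtr0_norm.
rewrite /tri !add0r; apply: triangle_le; [exact: sc|exact: sc|exact: sc|exact: bn|exact: bn|exact: bn|
    exact: ds|exact: ds|exact: ds].
Qed.
End Segments.

(** * Cauchy's formula on a square, and power series *)

Opaque av edge.
Section CauchySquare.
Variable R : realType.
Local Notation C := (Cpx R).
Local Notation "x %:C" := (real_complex R x : C).
Local Notation I := ('i%C : C).
Implicit Types (p q x y z w : C) (F G g : C -> C).

Lemma addKl x y : x + y - x = y.
Proof. ring. Qed.

Lemma cmod2 z : cmod z ^+ 2 = ReC z ^+ 2 + ImC z ^+ 2.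
Proof. by rewrite sqr_sqrtr// addr_ge0// sqr_ge0. Qed.

Lemma cmod_I : cmod I = 1.
Proof. by rewrite /cmod /ReC /ImC /= expr0n expr1n add0r sqrtr1. Qed.

Lemma sqrI : I * I = -1.
Proof. by rewrite -expr2 sqr_i. Qed.

(** The corners 1 - i, 1 + i, -1 + i, -1 - i of a square which lies between the
    circles of radii 1 and 2; multiplication by i permutes its edges. *)
Definition vtx (j : nat) : C := I ^+ j * (1 - I).
Lemma vtxS j : vtx j.+1 - vtx j = I ^+ j * (2 * I).
Proof.
rewrite /vtx exprSr.
have -> : I ^+ j * I * (1 - I) - I ^+ j * (1 - I) = I ^+ j * (I + I - 1 - I * I) by ring.
by rewrite sqrI opprK subrK -mulr2n mulr_natl.
Qed.

Lemma vtx4 : vtx 4 = vtx 0.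
Proof.
by rewrite /vtx (_ : I ^+ 4 = 1) ?expr0// -[4%N]/(2 * 2)%N exprM sqr_i sqrrN expr1n.
Qed.

Lemma seg_vtx j (s : R) : seg (vtx j) (vtx j.+1) s = I ^+ j * (1 + (2 * s - 1)%:C * I).
Proof. by rewrite /seg vtxS /vtx rmorphB rmorphM /= -natrC rmorph1; ring. Qed.

Lemma cmod_vtx j (s : R) : 0 <= s -> s <= 1 ->
  1 <= cmod (seg (vtx j) (vtx j.+1) s) /\ cmod (seg (vtx j) (vtx j.+1) s) < 2.
Proof.
move=> s0 s1; rewrite seg_vtx cmodM cmodX cmod_I expr1n mul1r.
set w := _ + _; have rw : ReC w = 1 by rewrite /w /ReC /=; ring.
have iw : ImC w = 2 * s - 1 by rewrite /w /ImC /=; ring.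
have := Re_le_cmod w; rewrite rw normr1 => h1; split=> //.
have h2 := cmod2 w; rewrite rw iw in h2; rewrite ltNge; apply/negP => h3; nra.
Qed.

Definition contour F : C := \sum_(j < 4) edge F (vtx j) (vtx j.+1).
Definition ccont F := forall j (s : R), 0 <= s -> s <= 1 ->
   cont_at F (seg (vtx j) (vtx j.+1) s).

Lemma contourD F G : ccont F -> ccont G ->
  contour (fun w => F w + G w) = contour F + contour G.
Proof. by move=> hF hG; rewrite /contour -big_split; apply: eq_bigr => j _;
  rewrite /= edgeD; [by []|exact: hF|exact: hG]. Qed.

Lemma contourZ a F : ccont F -> contour (fun w => a * F w) = a * contour F.
Proof. by move=> hF; rewrite /contour big_distrr; apply: eq_bigr => j _;
  rewrite /= edgeZ; [by []|exact: hF]. Qed.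

Lemma contour_ext F G : (forall w, 1 <= cmod w -> cmod w < 2 -> F w = G w) ->
  contour F = contour G.
Proof.
move=> h; apply: eq_bigr => j _; apply: edge_ext => s s0 s1.
by have [h1 h2] := cmod_vtx j s0 s1; exact: h.
Qed.

Lemma contour_le F M : ccont F -> (forall w, 1 <= cmod w -> cmod w < 2 -> cmod (F w) <= M) ->
  cmod (contour F) <= 8 * M.
Proof.
move=> hF h; apply: le_trans (cmod_sum _ _ _) _.
have -> : 8 * M = \sum_(j < 4) 2 * M by rewrite sumr_const card_ord -mulr_natl; lra.
apply: ler_sum => j _; apply: le_trans (edge_le (M := M) _ _) _.
- exact: hF.
- by move=> s s0 s1; have [h1 h2] := cmod_vtx j s0 s1; exact: h.
- by rewrite vtxS !cmodM cmodX cmod_I expr1n mul1r mulr1 cmod_nat.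
Qed.

Lemma contour_primitive F G : ccont F ->
  (forall w, 1 <= cmod w -> cmod w < 2 -> cderiv G w (F w)) -> contour F = 0.
Proof.
move=> hF hG; have e j : edge F (vtx j) (vtx j.+1) = G (vtx j.+1) - G (vtx j).
  by apply: edge_ftc => [|s s0 s1]; [exact: hF|have [? ?] := cmod_vtx j s0 s1; exact: hG].
rewrite /contour !big_ord_recl big_ord0 /= !e /bump /= !add1n vtx4; ring.
Qed.

Lemma ccont_annulus F : (forall w, 1 <= cmod w -> cmod w < 2 -> cont_at F w) -> ccont F.
Proof. by move=> h j s s0 s1; have [h1 h2] := cmod_vtx j s0 s1; exact: h. Qed.

Lemma convex_lt2 (a b c s t : R) : a < 2 -> b < 2 -> c < 2 -> 0 <= s -> 0 <= t ->
  0 <= 1 - s - t -> (1 - s - t) * a + s * b + t * c < 2.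
Proof.
move=> a2 b2 c2 s0 t0 r0.
have h1 := ler_wpM2l s0 (ltW b2); have h2 := ler_wpM2l t0 (ltW c2).
have h3 := ler_wpM2l r0 (ltW a2).
have [s'|s'] := leP s 0; last first.
  by have : s * b < s * 2; [rewrite ltr_pM2l|lra].
have [t'|t'] := leP t 0; last first.
  by have : t * c < t * 2; [rewrite ltr_pM2l|lra].
have -> : s = 0 by lra.
have -> : t = 0 by lra.
lra.
Qed.

(** The quotient (g(w) - g(z)) / (w - z), completed by the derivative of g at
    z, is continuous, and differentiable off z. Goursat's lemma on the four
    triangles from z to the edges shows that its integral over the square
    vanishes. *)
Lemma cauchy_square g z M : cmod z < 1 ->
  (forall w, cmod w < 2 -> exists d, cderiv g w d) ->
  (forall w, cmod w < 2 -> cmod (g w) <= M) ->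
  contour (fun w => g w / (w - z)) = g z * contour (fun w => (w - z)^-1).
Proof.
move=> z1 hg hM; have z2 : cmod z < 2 by apply: lt_trans z1 _; rewrite ltr1n.
have [d hd] := hg z z2; have [phi [phic phid hphi]] := hd.
pose F w := if w == z then d else (g w - g z) / (w - z).
have Fphi w : F w = phi w.
  rewrite /F; case: eqVneq => [->//|wz].
  by rewrite [g w]hphi addrC addKr mulfK// subr_eq0.
have Fd w : cmod w < 2 -> w != z -> exists d, cderiv F w d.
  move=> w2 wz; have [d' hd'] := hg w w2.
  have wz0 : w - z != 0 by rewrite subr_eq0.
  have h := cderivM (cderivB hd' (cderiv_cst (g z) w))
    (@cderivV _ (fun w => w - z) w _ wz0 (cderivB (@cderiv_id _ w) (cderiv_cst z w))).
  eexists; apply: (cderiv_ext (r := cmod (w - z))) h; first by rewrite cmod_gt0.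
  move=> y yw; rewrite /F; case: eqVneq => // yz.
  by move: yw; rewrite yz cmodBC ltxx.
have Fc w : cmod w < 2 -> cont_at F w.
  move=> w2; have [->|/(Fd _ w2)[d' /cderiv_cont]//] := eqVneq w z.
  by have -> : F = phi by apply/funext.
have [r r0 hr] := Fc z z2 1 ltr01.
have M0 : 0 <= M by apply: le_trans (cmod_ge0 _) (hM z z2).
have FM w : cmod w < 2 -> cmod (F w) <= cmod d + 1 + 2 * M / r.
  move=> w2; have Mr : 0 <= 2 * M / r by rewrite divr_ge0 ?mulr_ge0// ltW.
  have [wr|wr] := ltP (cmod (w - z)) r.
    have := hr w wr; rewrite {2}/F eqxx => h.
    have := cmod_tri (F w) d 0; rewrite !subr0; lra.
  have wz : w != z by apply/negP => /eqP wz; move: wr; rewrite wz subrr cmod0; lra.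
  rewrite /F (negbTE wz) cmodM cmodV; apply: (@le_trans _ _ (2 * M / r)).
    apply: ler_pM; rewrite ?cmod_ge0 ?invr_ge0 ?cmod_ge0//.
      by apply: le_trans (cmodB _ _) _; have := hM w w2; have := hM z z2; lra.
    by rewrite lef_pV2 ?posrE ?cmod_gt0 ?subr_eq0.
  by have := cmod_ge0 d; lra.
have vb j : cmod (vtx j) < 2.
  have := (@cmod_vtx j 0 (lexx _) ler01).2; by rewrite seg0.
have tr0 j : tri F z (vtx j - z) (vtx j.+1 - z) 0 0 1 = 0.
  have ptE (s t : R) : pt z (vtx j - z) (vtx j.+1 - z) s t =
      (1 - s - t)%:C * z + s%:C * vtx j + t%:C * vtx j.+1.
    by rewrite /pt !rmorphB rmorph1 /=; ring.
  have pt2 s t : simplex s t -> cmod (pt z (vtx j - z) (vtx j.+1 - z) s t) < 2.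
    move=> [s0 t0 st]; rewrite ptE.
    apply: le_lt_trans (cmodD _ _) _; apply: le_lt_trans (lerD (cmodD _ _) (lexx _)) _.
    have r0' : 0 <= 1 - s - t by lra.
    rewrite (cmodM (1 - s - t)%:C) (cmodM s%:C) (cmodM t%:C) !cmod_real !ger0_norm//.
    exact: convex_lt2.
  apply: (goursat_vertex (M := cmod d + 1 + 2 * M / r)).
  - by move=> s t /pt2/Fc.
  - by move=> s t /pt2/FM.
  move=> s t st pos; apply: Fd; first exact: pt2.
  apply/negP => /eqP; rewrite /pt -addrA => /(congr1 (fun y => y - z)).
  rewrite subrr addKl => e0; have [s0 t0 _] := st.
  (* a point of the triangle other than the vertex z differs from z: otherwise
     (s + t) z would have modulus at least s + t *)
  have e1 : (s + t)%:C * z = I ^+ j * (s%:C * (1 - I) + t%:C * (1 + I)).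
    have e2 : vtx j.+1 = I ^+ j * (1 + I).
      by rewrite /vtx exprSr -mulrA mulrBr mulr1 sqrI opprK addrC.
    have -> : (s + t)%:C * z = (s%:C * vtx j + t%:C * vtx j.+1) -
       (s%:C * (vtx j - z) + t%:C * (vtx j.+1 - z)) by rewrite rmorphD /=; ring.
    by rewrite e0 subr0 e2 /vtx; ring.
  have := congr1 (@cmod R) e1; rewrite !cmodM cmodX cmod_I expr1n mul1r cmod_real.
  rewrite gtr0_norm// => e2; have := Re_le_cmod (s%:C * (1 - I) + t%:C * (1 + I)).
  have -> : ReC (s%:C * (1 - I) + t%:C * (1 + I)) = s + t by rewrite /ReC /=; ring.
  rewrite -e2 gtr0_norm// => h; move: (ltr_pM2l pos (cmod z) 1); rewrite z1; lra.
have scz j : scont F z (vtx j).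
  move=> s s0 s1; apply: Fc; rewrite /seg.
  have -> : z + s%:C * (vtx j - z) = (1 - s)%:C * z + s%:C * vtx j.
    by rewrite rmorphB rmorph1 /=; ring.
  apply: le_lt_trans (cmodD _ _) _.
  rewrite (cmodM (1 - s)%:C) (cmodM s%:C) !cmod_real !ger0_norm ?subr_ge0//.
  have := @convex_lt2 (cmod z) (cmod (vtx j)) 0 s 0; rewrite !subr0 mul0r addr0; apply => //.
  by rewrite subr_ge0.
have e3 j : edge F (vtx j) (vtx j.+1) = edge F z (vtx j.+1) - edge F z (vtx j).
  have zk v : z + (v - z) = v by ring.
  have := tr0 j; rewrite /tri /pt /triangle !add0r rmorph0 rmorph1 !mul0r !mul1r !addr0 !zk.
  by rewrite (@edge_rev _ F z (vtx j.+1))// => /eqP; rewrite subr_eq0 => /eqP <-; rewrite addKl.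
have cF0 : contour F = 0.
  rewrite /contour !big_ord_recl big_ord0 /= !e3 /bump /= !add1n vtx4; ring.
have wz0 w : 1 <= cmod w -> w - z != 0.
  by move=> w1; rewrite subr_eq0; apply/negP => /eqP wz; move: w1; rewrite wz; lra.
have hi w : 1 <= cmod w -> cont_at (fun w => (w - z)^-1) w.
  move=> w1; apply: contV; first exact: wz0.
  by apply: contB; [exact: cont_id|exact: cont_cst].
have hgc w : cmod w < 2 -> cont_at g w by move=> /hg[d' /cderiv_cont].
have : contour (fun w => g w / (w - z)) = contour (fun w => F w + g z * (w - z)^-1).
  apply: contour_ext => w w1 w2; rewrite /F.
  have wz := wz0 w w1; have wz' : w != z by rewrite -subr_eq0.
  by rewrite (negbTE wz') -mulrDl subrK.
rewrite contourD ?cF0 ?add0r ?contourZ//.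
- by apply: ccont_annulus => w w1 _; exact: hi.
- by apply: ccont_annulus => w _ w2; exact: Fc.
- by apply: ccont_annulus => w w1 _; apply: contM; [exact: cont_cst|exact: hi].
Qed.

(** The winding integral of the square, 2 pi i. Cauchy's formula only involves
    ratios of contour integrals, so a lower bound of its modulus suffices. *)
Definition kappa : C := contour (fun w => w^-1).

(** The remainder after N steps of the expansion 1/(w - z) = 1/w + z/w^2 + ...
    + z^(N-1)/w^N + z^N / (w^N (w - z)). *)
Definition cauchy_rem g z N : C := contour (fun w => g w * ((w ^+ N)^-1 * (w - z)^-1)).
Definition cauchy_coef g n : C := contour (fun w => g w * (w ^+ n.+1)^-1).

Lemma cauchy_rem_cont g z N : cmod z < 1 -> (forall w, 1 <= cmod w -> cmod w < 2 -> cont_at g w) ->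
  ccont (fun w => g w * ((w ^+ N)^-1 * (w - z)^-1)).
Proof.
move=> z1 hg; apply: ccont_annulus => w w1 w2; apply: contM; first exact: hg.
apply: contM; apply: contV.
- by rewrite expf_neq0// -cmod_gt0; lra.
- by apply: contX; exact: cont_id.
- by rewrite subr_eq0; apply/negP => /eqP wz; move: w1; rewrite wz; lra.
- by apply: contB; [exact: cont_id|exact: cont_cst].
Qed.

Lemma cauchy_coef_cont g n : (forall w, 1 <= cmod w -> cmod w < 2 -> cont_at g w) ->
  ccont (fun w => g w * (w ^+ n.+1)^-1).
Proof.
move=> hg; apply: ccont_annulus => w w1 w2; apply: contM; first exact: hg.
apply: contV; first by rewrite expf_neq0// -cmod_gt0; lra.
by apply: contX; exact: cont_id.
Qed.

Lemma cauchy_remS g z N : cmod z < 1 -> (forall w, 1 <= cmod w -> cmod w < 2 -> cont_at g w) ->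
  cauchy_rem g z N = cauchy_coef g N + z * cauchy_rem g z N.+1.
Proof.
move=> z1 hg; rewrite /cauchy_coef /cauchy_rem -contourZ; last exact: cauchy_rem_cont.
rewrite -contourD; [|exact: cauchy_coef_cont|].
  apply: contour_ext => w w1 w2.
  have w0 : w != 0 by rewrite -cmod_gt0; lra.
  have wz : w - z != 0.
    by rewrite subr_eq0; apply/negP => /eqP wz; move: w1; rewrite wz; lra.
  by rewrite exprS; field; rewrite w0 wz expf_neq0.
move=> j s s0 s1; apply: contM; first exact: cont_cst.
exact: cauchy_rem_cont.
Qed.

Lemma cauchy_rem_sum g z N : cmod z < 1 -> (forall w, 1 <= cmod w -> cmod w < 2 -> cont_at g w) ->
  cauchy_rem g z 0 = \sum_(n < N) z ^+ n * cauchy_coef g n + z ^+ N * cauchy_rem g z N.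
Proof.
move=> z1 hg; elim: N => [|N ih]; first by rewrite big_ord0 expr0 mul1r add0r.
by rewrite ih big_ord_recr /= (cauchy_remS N z1 hg) exprSr; ring.
Qed.

Lemma cauchy_rem_le g z N M : cmod z < 1 -> (forall w, 1 <= cmod w -> cmod w < 2 -> cont_at g w) ->
  (forall w, 1 <= cmod w -> cmod w < 2 -> cmod (g w) <= M) ->
  cmod (cauchy_rem g z N) <= 8 * (M / (1 - cmod z)).
Proof.
move=> z1 hg hM; apply: contour_le; first exact: cauchy_rem_cont.
move=> w w1 w2; rewrite !cmodM !cmodV cmodX.
have h1 : 0 < cmod (w - z) by apply: lt_le_trans (cmodB_ge _ _); lra.
apply: ler_pM; rewrite ?cmod_ge0//; [|exact: hM|].
  by rewrite mulr_ge0 ?invr_ge0 ?exprn_ge0 ?cmod_ge0.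
apply: (@le_trans _ _ (1 * (cmod (w - z))^-1)).
  rewrite ler_wpM2r ?invr_ge0 ?cmod_ge0// invf_le1 ?exprn_ege1// exprn_gt0//; lra.
rewrite mul1r lef_pV2 ?posrE// ?subr_gt0//.
by apply: le_trans (cmodB_ge _ _); lra.
Qed.

Lemma cauchy_coef_le g n M : (forall w, 1 <= cmod w -> cmod w < 2 -> cont_at g w) ->
  (forall w, 1 <= cmod w -> cmod w < 2 -> cmod (g w) <= M) ->
  cmod (cauchy_coef g n) <= 8 * M.
Proof.
move=> hg hM; apply: contour_le; first exact: cauchy_coef_cont.
move=> w w1 w2; rewrite !cmodM !cmodV cmodX -[leRHS]mulr1.
apply: ler_pM; rewrite ?cmod_ge0//; [|exact: hM|].
  by rewrite invr_ge0 exprn_ge0 ?cmod_ge0.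
rewrite invf_le1 ?exprn_ege1// exprn_gt0//; lra.
Qed.

(** By symmetry the four edges contribute equally, and the real part of 1/(1 +
    i y) is at least 1/2 for -1 <= y <= 1. *)
Lemma kappa_ge : 4 <= cmod kappa.
Proof.
have c01 : cont01 (fun s : R => (1 + (2 * s - 1)%:C * I)^-1).
  have : scont (fun w => w^-1) (vtx 0) (vtx 1).
    move=> s s0 s1; have [w1 _] := cmod_vtx 0 s0 s1.
    by apply: contV; [rewrite -cmod_gt0; lra|exact: cont_id].
  move=> /scont01; congr cont01; apply/funext => s.
  by rewrite seg_vtx expr0 mul1r.
have e j : edge (fun w => w^-1) (vtx j) (vtx j.+1) =
   2 * I * av (fun s : R => (1 + (2 * s - 1)%:C * I)^-1).
  Transparent edge. rewrite /edge vtxS. Opaque edge.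
  under av_ext do rewrite seg_vtx invfM.
  rewrite (avZ _ c01) mulrA; congr (_ * _); rewrite mulrC mulKf//.
  by rewrite expf_neq0// -cmod_gt0 cmod_I.
have -> : kappa = 8 * I * av (fun s : R => (1 + (2 * s - 1)%:C * I)^-1).
  rewrite /kappa /contour (eq_bigr _ (fun (j : 'I_4) _ => e j)) sumr_const card_ord.
  by rewrite -mulr_natl; ring.
rewrite !cmodM cmod_I cmod_nat mulr1.
have := @av_Re_ge _ _ (2^-1) c01 _; set A := av _ => h.
have : 2^-1 <= ReC A.
  apply: h => s s0 s1; set t := 2 * s - 1.
  have -> : ReC (1 + t%:C * I)^-1 = (1 + t ^+ 2)^-1.
    have -> : 1 + t%:C * I = cplx 1 t.
      by apply/eqP; rewrite eq_complex /=; apply/andP; split; apply/eqP; ring.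
    by rewrite /ReC /= expr1n div1r.
  by rewrite lef_pV2 ?posrE//; rewrite /t; nra.
by have := Re_le_cmod A; rewrite ler_norml => /andP[_]; lra.
Qed.

Lemma cauchy_rem1 z : cmod z < 1 -> cauchy_rem (fun=> 1) z 0 = kappa.
Proof.
move=> z1; have c1 w : 1 <= cmod w -> cmod w < 2 -> cont_at (fun=> 1 : C) w.
  by move=> _ _; exact: cont_cst.
have A0 : cauchy_coef (fun=> 1) 0 = kappa.
  by apply: contour_ext => w _ _; rewrite mul1r expr1.
have AS n : cauchy_coef (fun=> 1) n.+1 = 0.
  (* a primitive of w^-(n+2) *)
  pose G w : C := - (n.+1%:R)^-1 * (w ^+ n.+1)^-1.
  apply: (contour_primitive (G := G)); first exact: cauchy_coef_cont.
  move=> w w1 w2; have w0 : w != 0 by rewrite -cmod_gt0; lra.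
  have := cderivZ (- (n.+1%:R)^-1) (@cderivV _ (fun w => w ^+ n.+1) w _
    (expf_neq0 n.+1 w0) (cderivX w n.+1)).
  congr cderiv; rewrite /= !exprS; field.
  by rewrite expf_neq0// w0 /= nat1r pnatr_eq0.
apply/eqP; rewrite -subr_eq0; apply/eqP; apply: cmod_small => e e0.
have [N hN] := geo_lt (8 * (1 / (1 - cmod z))) (cmod_ge0 z) z1 e0.
have := hN N.+1 (leqnSn N); rewrite (cauchy_rem_sum N.+1 z1 c1) big_ord_recl /= A0 expr0 (mul1r kappa).
rewrite big1 ?addr0; last by move=> i _; rewrite AS mulr0.
rewrite addKl cmodM cmodX [leLHS]mulrC => h; apply/ltW; apply: le_lt_trans h.
rewrite ler_wpM2r ?exprn_ge0 ?cmod_ge0//.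
by apply: cauchy_rem_le => // w _ _; rewrite cmod1.
Qed.

(** Cauchy's formula with the kernel expanded geometrically under the integral.
    The explicit remainder is what survives limits and restriction to lines. *)
Theorem cauchy_series g M : (forall w, cmod w < 2 -> exists d, cderiv g w d) ->
  (forall w, cmod w < 2 -> cmod (g w) <= M) ->
  exists2 a : nat -> C, (forall n, cmod (a n) <= 2 * M) &
    forall z N, cmod z < 1 ->
      cmod (g z - \sum_(n < N) a n * z ^+ n) <= 2 * M / (1 - cmod z) * cmod z ^+ N.
Proof.
move=> hg hM; have k4 := kappa_ge; have k0 : kappa != 0 by rewrite -cmod_gt0; lra.
have gc w : 1 <= cmod w -> cmod w < 2 -> cont_at g w by move=> _ /hg[d /cderiv_cont].
have gM w : 1 <= cmod w -> cmod w < 2 -> cmod (g w) <= M by move=> _ /hM.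
have M0 : 0 <= M by apply: le_trans (cmod_ge0 _) (hM 0 _); rewrite cmod0.
have kV : (cmod kappa)^-1 <= 4^-1 by rewrite lef_pV2 ?posrE//; lra.
have kV0 : 0 <= (cmod kappa)^-1 by rewrite invr_ge0 cmod_ge0.
exists (fun n => kappa^-1 * cauchy_coef g n) => [n|z N z1].
  rewrite cmodM cmodV; apply: le_trans (ler_pM _ _ kV (cauchy_coef_le n gc gM)) _;
    rewrite ?cmod_ge0//; lra.
have := cauchy_square z1 hg hM.
have -> : contour (fun w => g w / (w - z)) = cauchy_rem g z 0.
  by apply: contour_ext => w _ _; rewrite expr0 invr1 mul1r.
have -> : contour (fun w => (w - z)^-1) = cauchy_rem (fun=> 1) z 0.
  by apply: contour_ext => w _ _; rewrite expr0 invr1 !mul1r.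
rewrite cauchy_rem1// (cauchy_rem_sum N z1 gc) => e.
have -> : g z - \sum_(n < N) kappa^-1 * cauchy_coef g n * z ^+ n = kappa^-1 * (z ^+ N * cauchy_rem g z N).
  have -> : \sum_(n < N) kappa^-1 * cauchy_coef g n * z ^+ n = kappa^-1 * \sum_(n < N) z ^+ n * cauchy_coef g n.
    by rewrite big_distrr; apply: eq_bigr => n _ /=; ring.
  set S := \sum_(_ < N) _ in e *; set T := z ^+ N * _ in e *.
  have -> : T = g z * kappa - S by rewrite -e; ring.
  by field.
rewrite !cmodM cmodV cmodX mulrCA mulrC.
rewrite ler_wpM2r ?exprn_ge0 ?cmod_ge0//.
have h := cauchy_rem_le N z1 gc gM.
apply: le_trans (ler_pM _ _ kV h) _; rewrite ?cmod_ge0//.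
have -> : 4^-1 * (8 * (M / (1 - cmod z))) = 2 * M / (1 - cmod z).
  by field; rewrite subr_eq0 gt_eqF.
exact: lexx.
Qed.
End CauchySquare.

(** * The complex exponential and logarithm *)

Section CExp.
Variable R : realType.
Local Notation C := (Cpx R).
Local Notation "x %:C" := (real_complex R x : C).
Local Notation I := ('i%C : C).
Implicit Types (z w : C).

Lemma ReCD z w : ReC (z + w) = ReC z + ReC w. Proof. by case: z w => [? ?] [? ?]. Qed.

Lemma ImCD z w : ImC (z + w) = ImC z + ImC w. Proof. by case: z w => [? ?] [? ?]. Qed.

Lemma ReCB z w : ReC (z - w) = ReC z - ReC w. Proof. by case: z w => [? ?] [? ?]. Qed.

Lemma ImCB z w : ImC (z - w) = ImC z - ImC w. Proof. by case: z w => [? ?] [? ?]. Qed.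

Lemma ReCZ (r : R) z : ReC (r%:C * z) = r * ReC z.
Proof. by case: z => a b; rewrite /ReC /= mul0r subr0. Qed.

Lemma C_eta z : z = cplx (ReC z) (ImC z). Proof. by case: z. Qed.

Lemma C_eqP z w : ReC z = ReC w -> ImC z = ImC w -> z = w.
Proof. by move=> h1 h2; rewrite (C_eta z) (C_eta w) h1 h2. Qed.

Lemma cexpD z w : cexp (z + w) = cexp z * cexp w.
Proof.
rewrite /cexp ReCD ImCD expRD cosD sinD.
by apply: C_eqP; rewrite /ReC /ImC /=; ring.
Qed.

Lemma cexp0 : cexp (0 : C) = 1.
Proof. by rewrite /cexp /ReC /ImC /= expR0 cos0 sin0 mulr1 mulr0. Qed.

Lemma cmod_cexp z : cmod (cexp z) = expR (ReC z).
Proof.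
rewrite /cmod /cexp {1}/ReC {2}/ImC /= !exprMn -mulrDr cos2Dsin2 mulr1 sqrtr_sqr.
by rewrite ger0_norm// expR_ge0.
Qed.

Lemma cexp_neq0 z : cexp z != 0.
Proof. by rewrite -cmod_eq0 cmod_cexp expR_eq0. Qed.

Lemma cexpN z : cexp (- z) = (cexp z)^-1.
Proof.
apply: (mulfI (cexp_neq0 z)); rewrite mulfV ?cexp_neq0//.
by rewrite -cexpD subrr cexp0.
Qed.

Lemma cexpB z w : cexp (z - w) = cexp z / cexp w.
Proof. by rewrite cexpD cexpN. Qed.

Lemma cexp_sum (J : Type) (r : seq J) (P : pred J) (F : J -> C) :
  cexp (\sum_(i <- r | P i) F i) = \prod_(i <- r | P i) cexp (F i).
Proof. by elim/big_rec2 : _ => [|i a b _ <-]; rewrite ?cexp0 ?cexpD. Qed.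

Lemma cexp_nat n z : cexp (n%:R * z) = cexp z ^+ n.
Proof.
elim: n => [|n ih]; first by rewrite mul0r cexp0 expr0.
by rewrite -natr1 mulrDl mul1r cexpD ih exprSr.
Qed.

Lemma cexp_2pi : cexp (cplx 0 (2 * pi)) = 1 :> C.
Proof.
rewrite /cexp /ReC /ImC /= expR0 !mul1r mulr_natl cos2pi sin2pi.
by apply: C_eqP.
Qed.

Lemma cexp_real (r : R) : cexp r%:C = (expR r)%:C.
Proof. by rewrite /cexp /ReC /ImC /= cos0 sin0 mulr1 mulr0. Qed.

Lemma sin_mvt (y : R) : 0 <= y -> exists2 c : R, 0 <= c <= y & sin y = cos c * y.
Proof.
move=> y0; have [|c] := @MVT_segment R sin cos 0 y y0.
  by apply: continuous_subspaceT => x; exact: continuous_sin.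
by rewrite sin0 !subr0 in_itv /= => h e; exists c.
Qed.

Lemma sin_le (y : R) : `|sin y| <= `|y|.
Proof.
wlog y0 : y / 0 <= y => [H|].
  have [/H//|/ltW y0] := leP 0 y; rewrite -normrN -sinN -(normrN y).
  by apply: H; rewrite oppr_ge0.
by have [c _ ->] := sin_mvt y0; rewrite normrM ler_piMl// cos_max.
Qed.

Lemma half_sq_aux (s u : R) : s ^+ 2 <= u ^+ 2 -> 1 - ((1 - s ^+ 2) *+ 2 - 1) <= (u *+ 2) ^+ 2 / 2.
Proof.
move=> h; have -> : (u *+ 2) ^+ 2 / 2 = 2 * u ^+ 2 by rewrite -mulr_natl; field.
by rewrite -mulr_natl; lra.
Qed.

Lemma cos_ge_quad (y : R) : 1 - cos y <= y ^+ 2 / 2 /\ 0 <= 1 - cos y.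
Proof.
split; last by rewrite subr_ge0 cos_le1.
have -> : y = (y / 2) *+ 2 by rewrite -mulr_natl; field.
rewrite cos_mulr2n cos2sin2; have := sin_le (y / 2).
move=> /(lerXn2r 2 (normr_ge0 _) (normr_ge0 _)); rewrite !real_normK ?num_real//.
exact: half_sq_aux.
Qed.

Lemma sin_sub_le (y : R) : `|y| <= 1 -> `|sin y - y| <= y ^+ 2.
Proof.
wlog y0 : y / 0 <= y => [H|].
  have [/H//|/ltW y0 y1] := leP 0 y.
  have := H (- y); rewrite oppr_ge0 normrN sqrrN sinN opprK => /(_ y0 y1).
  by rewrite -normrN opprD !opprK.
rewrite ger0_norm// => y1; have [c /andP[c0 cy] ->] := sin_mvt y0.
have -> : cos c * y - y = - ((1 - cos c) * y) by ring.
have [h1 h2] := cos_ge_quad c.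
rewrite normrN ger0_norm ?mulr_ge0// expr2 ler_wpM2r//.
apply: le_trans h1 _; nra.
Qed.

Lemma expR_quad (a : R) : `|a| <= 2^-1 -> `|expR a - 1 - a| <= 2 * a ^+ 2 /\ expR a <= 2
  /\ `|expR a - 1| <= 2 * `|a|.
Proof.
rewrite ler_norml => /andP[a1 a2].
have h1 := expR_ge1Dx a; have h2 := expR_ge1Dx (- a).
have e0 := expR_gt0 a; have e1 := expRxMexpNx_1 a.
have h3 : expR a * (1 - a) <= 1.
  by have := ler_wpM2l (ltW e0) h2; rewrite e1.
have h4 : expR a <= 1 + a + 2 * a ^+ 2.
  have d : 0 < 1 - a by lra.
  rewrite -(ler_pM2r d); apply: le_trans h3 _; nra.
split; first by rewrite ger0_norm; lra.
split; first nra.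
have [a0|a0] := leP 0 a.
  by rewrite (ger0_norm a0) ger0_norm; nra.
by rewrite (ltr0_norm a0) ler_norml; apply/andP; split; nra.
Qed.

(** The first order expansion at 0, with a quadratic remainder, obtained from
    the real expansions of exp, cos and sin. *)
Lemma cexp_quad z : cmod z <= 2^-1 -> cmod (cexp z - 1 - z) <= 6 * cmod z ^+ 2.
Proof.
move=> z1; have ha := Re_le_cmod z; have hb := Im_le_cmod z.
set a := ReC z in ha *; set b := ImC z in hb *.
have [e1 [e2 e3]] := expR_quad (le_trans ha z1).
have [c1 c2] := cos_ge_quad b.
have b1 : `|b| <= 1 by apply: le_trans hb _; lra.
have s1 := sin_sub_le b1; have s2 := sin_le b.
apply: le_trans (cmod_le_ReIm _) _.
have -> : ReC (cexp z - 1 - z) = (expR a - 1 - a) - expR a * (1 - cos b).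
  by rewrite !ReCB /cexp /ReC /=; rewrite -/a -/b; ring.
have -> : ImC (cexp z - 1 - z) = (expR a - 1) * sin b + (sin b - b).
  by rewrite !ImCB /cexp /ImC /=; rewrite -/a -/b; ring.
have c0 := cmod_ge0 z; set q := cmod z in c0 ha hb z1 *.
have aq : a ^+ 2 <= q ^+ 2.
  by rewrite -(real_normK (num_real a)) lerXn2r.
have bq : b ^+ 2 <= q ^+ 2.
  by rewrite -(real_normK (num_real b)) lerXn2r.
have r1 : `|(expR a - 1 - a) - expR a * (1 - cos b)| <= 2 * q ^+ 2 + q ^+ 2.
  apply: le_trans (ler_normB _ _) _; rewrite normrM (ger0_norm (ltW (expR_gt0 a))) (ger0_norm c2).
  apply: lerD; first by apply: le_trans e1 _; rewrite ler_pM2l.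
  apply: le_trans (_ : 2 * (b ^+ 2 / 2) <= _).
    by apply: ler_pM => //; exact: expR_ge0.
  by rewrite mulrC divfK.
have r2 : `|(expR a - 1) * sin b + (sin b - b)| <= 2 * q ^+ 2 + q ^+ 2.
  apply: le_trans (ler_normD _ _) _; rewrite normrM; apply: lerD; last exact: le_trans s1 _.
  apply: le_trans (_ : (2 * q) * q <= _); last by rewrite -mulrA expr2.
  apply: ler_pM => //; first by apply: le_trans e3 _; rewrite ler_pM2l.
  exact: le_trans s2 _.
apply: le_trans (lerD r1 r2) _; move: (q ^+ 2); clear; move=> ?; lra.
Qed.

Lemma quad_aux (A q B e : R) : q * (6 * A + 1) <= e -> 0 <= A -> 0 <= q ->
  B <= 6 * q ^+ 2 -> A * B <= e * q.
Proof.
move=> w2 A0 q0 hB; apply: le_trans (ler_wpM2l A0 hB) _; rewrite expr2.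
have : 6 * A * q <= e by lra.
by move=> /(ler_wpM2r q0); lra.
Qed.

Lemma cderiv_cexp z : cderiv (@cexp R) z (cexp z).
Proof.
apply/cderivP => e e0; have d0 : 0 < 6 * cmod (cexp z) + 1.
  by have := cmod_ge0 (cexp z); clear; lra.
exists (Num.min 2^-1 (e / (6 * cmod (cexp z) + 1))).
  by rewrite lt_min invr_gt0 ltr0n divr_gt0.
move=> w; rewrite lt_min => /andP[w1 w2].
have -> : cexp w - cexp z - cexp z * (w - z) = cexp z * (cexp (w - z) - 1 - (w - z)).
  rewrite cexpB; field; exact: cexp_neq0.
rewrite cmodM; rewrite ltr_pdivlMr// in w2.
exact: quad_aux (ltW w2) (cmod_ge0 _) (cmod_ge0 _) (cexp_quad (ltW w1)).
Qed.

Lemma div_cmod z : z != 0 -> -1 <= ReC z / cmod z <= 1 /\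
  (ReC z / cmod z) ^+ 2 + (ImC z / cmod z) ^+ 2 = 1.
Proof.
move=> z0; have c0 : 0 < cmod z by rewrite cmod_gt0.
split.
  rewrite ler_pdivlMr// ler_pdivrMr// mulN1r mul1r -ler_norml; exact: Re_le_cmod.
rewrite !expr_div_n -mulrDl -cmod2 divff// expf_neq0// gt_eqF//.
Qed.

Lemma carg_cs z : z != 0 -> cos (carg z) = ReC z / cmod z /\ sin (carg z) = ImC z / cmod z.
Proof.
move=> z0; have [h1 h2] := div_cmod z0; have c0 : 0 < cmod z by rewrite cmod_gt0.
have hin : ReC z / cmod z \in `[-1, 1] by rewrite in_itv.
have hs : sin (acos (ReC z / cmod z)) = `|ImC z / cmod z|.
  rewrite sin_acos//; have -> : 1 - (ReC z / cmod z) ^+ 2 = (ImC z / cmod z) ^+ 2.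
    by rewrite -h2 addrC addrA addNr add0r.
  by rewrite sqrtr_sqr.
rewrite /carg; case: ifP => i0; rewrite ?cosN ?sinN acosK// hs.
  by split=> //; rewrite ger0_norm// divr_ge0// ltW.
split=> //; rewrite ltr0_norm ?opprK// pmulr_llt0 ?invr_gt0//.
by rewrite ltNge i0.
Qed.

Lemma clogK z : z != 0 -> cexp (clog z) = z.
Proof.
move=> z0; have [h1 h2] := carg_cs z0; have c0 : 0 < cmod z by rewrite cmod_gt0.
rewrite /cexp /clog /ReC /ImC /= lnK ?posrE// h1 h2 !(mulrC (cmod z)) !divfK ?gt_eqF//.
by case: (z).
Qed.

Lemma cexpK z : `|ImC z| < pi -> clog (cexp z) = z.
Proof.
move=> zp; apply: C_eqP; rewrite /clog /ReC /ImC /=.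
  by rewrite cmod_cexp expRK.
rewrite /carg cmod_cexp {1}/ImC {1 2}/ReC /cexp /= !(mulrC (expR _)) !mulfK ?expR_eq0//.
rewrite pmulr_lge0 ?expR_gt0//.
move: zp; rewrite ltr_norml => /andP[z1 z2].
have [z0|z0] := leP 0 (ImC z).
  rewrite sin_ge0_pi ?z0 ?(ltW z2)// cosK// in_itv /= z0 ltW//.
rewrite leNgt -oppr_gt0 -sinN sin_gt0_pi ?oppr_gt0 ?z0/=; last by rewrite ltrNl.
by rewrite cosKN ?opprK// (ltW z1) ltW.
Qed.

Lemma clog_real (r : R) : 0 < r -> clog r%:C = (ln r)%:C.
Proof.
move=> r0; rewrite -{1}(lnK r0) -cexp_real cexpK//.
by rewrite /ImC /= normr0 pi_gt0.
Qed.

Lemma carg_pihalf z : 0 < ReC z -> `|carg z| < pi / 2.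
Proof.
move=> z0; have zn0 : z != 0.
  by apply/eqP => e; move: z0; rewrite e /ReC /= ltxx.
have c0 : 0 < cmod z by rewrite cmod_gt0.
have [h _] := div_cmod zn0.
have -> : `|carg z| = acos (ReC z / cmod z).
  by rewrite /carg; case: ifP => _; rewrite ?normrN ger0_norm// acos_ge0.
rewrite ltNge; apply/negP => bad.
have := acos_lepi h => le1.
have p0 : 0 <= pi / 2 :> R by rewrite divr_ge0// pi_ge0.
have p1 : pi / 2 <= pi :> R by have := @pi_gt0 R; clear; lra.
have i1 : pi / 2 \in `[0, pi :> R] by rewrite in_itv /= p0 p1.
have i2 : acos (ReC z / cmod z) \in `[0, pi :> R] by rewrite in_itv /= le1 (le_trans p0 bad).
have : 0 < cos (acos (ReC z / cmod z)) by rewrite acosK ?divr_gt0// in_itv.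
move=> hc; have : cos (pi / 2) < cos (acos (ReC z / cmod z)) by rewrite cos_pihalf.
rewrite (ltr_cos i2 i1) => h3; by move: (lt_le_trans h3 bad); rewrite ltxx.
Qed.

(** A quantitative inverse of exp near 1; it turns the expansion of exp at 0
    into the derivative of the logarithm. *)
Lemma cexp_near1 z : `|ImC z| < pi -> cmod (cexp z - 1) <= 4^-1 ->
  cmod z <= 5 * cmod (cexp z - 1).
Proof.
move=> zp; set d := cmod (_ - _) => d4; have d0 : 0 <= d by exact: cmod_ge0.
set a := ReC z; set b := ImC z.
have e0 := expR_gt0 a.
have ed : `|expR a - 1| <= d.
  rewrite -(cmod_cexp z) -{1}(cmod1 R) ler_norml; apply/andP; split.
    by have := cmodB_ge 1 (cexp z); rewrite (cmodBC 1) -/d; clear; lra.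
  exact: cmodB_ge.
move: ed; rewrite ler_norml => /andP[ed1 ed2].
have h1 := expR_ge1Dx a; have h2 := expR_ge1Dx (- a).
have e1 := expRxMexpNx_1 a.
have h3 : expR a * (1 - a) <= 1.
  by have := ler_wpM2l (ltW e0) h2; rewrite e1.
have ha : `|a| <= 2 * d.
  rewrite ler_norml; apply/andP; split; last lra.
  have : 1 - a <= 1 + 2 * d.
    rewrite -(ler_pM2l e0); apply: le_trans h3 _; nra.
  lra.
have hc : 3 / 5 <= cos b.
  have := Re_le_cmod (cexp z - 1); rewrite ReCB -/d.
  have -> : ReC (cexp z) = expR a * cos b by [].
  have -> : ReC (1 : C) = 1 by [].
  rewrite ler_norml => /andP[k1 _].
  have : 3 / 4 <= expR a * cos b by lra.
  move=> k2; have c0 : 0 <= cos b by rewrite -(pmulr_rge0 _ e0); lra.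
  nra.
have hs : `|sin b| <= 4 / 3 * d.
  have := Im_le_cmod (cexp z - 1); rewrite ImCB -/d.
  have -> : ImC (cexp z) = expR a * sin b by [].
  have -> : ImC (1 : C) = 0 by [].
  rewrite subr0 normrM (gtr0_norm e0); have := normr_ge0 (sin b); nra.
have hb : `|b| <= 5 / 3 * `|sin b|.
  have -> : `|sin b| = `|sin `|b| |.
    have [b0|b0] := leP 0 b; first by rewrite (ger0_norm b0).
    by rewrite (ltr0_norm b0) sinN normrN.
  have [c /andP[c0 cb] ->] := sin_mvt (normr_ge0 b).
  have hc' : 3 / 5 <= cos c.
    apply: le_trans hc _; rewrite -cos_norm.
    have [->//|cb'] := eqVneq c `|b|.
    have i1 : c \in `[0, pi :> R] by rewrite in_itv /= c0 (le_trans cb (ltW zp)).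
    have i2 : `|b| \in `[0, pi :> R] by rewrite in_itv /= normr_ge0 (ltW zp).
    by apply: ltW; rewrite (ltr_cos i1 i2) lt_neqAle cb' cb.
  rewrite normrM normr_id; have c1 : 0 <= cos c by lra.
  rewrite (ger0_norm c1); have := normr_ge0 b; nra.
apply: le_trans (cmod_le_ReIm z) _; rewrite -/a -/b.
by move: ha hb hs d0; clear; lra.
Qed.

(** For w close to z, u = log w - log z is the small logarithm of w/z, so exp u
    - 1 - u is quadratically small in u, hence in w - z. *)
Lemma cderiv_clog z : 0 < ReC z -> cderiv (@clog R) z z^-1.
Proof.
move=> z0; have zn0 : z != 0.
  by apply/eqP => e; move: z0; rewrite e /ReC /= ltxx.
have c0 : 0 < cmod z by rewrite cmod_gt0.
have za := carg_pihalf z0.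
apply/cderivP => e e0.
pose r := Num.min (ReC z / 2) (Num.min (cmod z / 10) (e * cmod z ^+ 2 / 150)).
exists r; first by rewrite !lt_min !divr_gt0// mulr_gt0// exprn_gt0.
move=> w; rewrite !lt_min => /andP[w1 /andP[w2 w3]].
have wz0 : 0 < ReC w.
  have := le_lt_trans (Re_le_cmod _) w1; rewrite ReCB ltr_norml => /andP[h _]; lra.
have wn0 : w != 0.
  by apply/eqP => e'; move: wz0; rewrite e' /ReC /= ltxx.
have wa := carg_pihalf wz0.
pose u := clog w - clog z.
have eu : cexp u = w / z by rewrite /u cexpB !clogK.
have iu : `|ImC u| < pi.
  rewrite /u ImCB; have -> : ImC (clog w) = carg w by [].
  have -> : ImC (clog z) = carg z by [].
  apply: le_lt_trans (ler_normB _ _) _; move: wa za; clear; lra.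
have eu1 : cexp u - 1 = (w - z) / z by rewrite eu mulrBl divff.
have cu : cmod (cexp u - 1) = cmod (w - z) / cmod z by rewrite eu1 cmodM cmodV.
have cu10 : cmod (cexp u - 1) <= 10^-1.
  rewrite cu ler_pdivrMr//; move: w2; clear; lra.
have u5 := cexp_near1 iu (le_trans cu10 _).
have {}u5 : cmod u <= 5 * cmod (cexp u - 1) by apply: u5; lra.
have u2 : cmod u <= 2^-1 by move: u5 cu10; clear; lra.
have q := cexp_quad u2.
have -> : clog w - clog z - z^-1 * (w - z) = - (cexp u - 1 - u).
  by rewrite eu1 /u mulrC; ring.
rewrite cmodN; apply: le_trans q _.
have c2 : 0 < cmod z ^+ 2 by rewrite exprn_gt0.
have h0 := cmod_ge0 (w - z).
apply: le_trans (_ : 6 * (5 * (cmod (w - z) / cmod z)) ^+ 2 <= _).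
  by rewrite ler_pM2l// lerXn2r ?nnegrE ?cmod_ge0// -?cu// mulr_ge0// cmod_ge0.
rewrite exprMn expr_div_n mulrA mulrA ler_pdivrMr//.
move: w3 h0 c2; move: (cmod (w - z)) (cmod z ^+ 2) => h q2; clear => w3 h0 c2.
have : 150 * h <= e * q2 by lra.
by move=> /(ler_wpM2r h0); lra.
Qed.

(** The modulus gives that z is real, and then cos (2 pi x) = 1 for the
    fractional part x of z forces sin (pi x) = 0. *)
Lemma cexp_eq1 z : cexp (cplx 0 (2 * pi) * z) = 1 -> is_integer z.
Proof.
have e1 : ReC (cplx 0 (2 * pi) * z) = - (2 * pi * ImC z).
  by clear; case: z => a b; rewrite /ReC /ImC /=; ring.
have e2 : ImC (cplx 0 (2 * pi) * z) = 2 * pi * ReC z.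
  by clear; case: z => a b; rewrite /ReC /ImC /=; ring.
have p0 := @pi_gt0 R.
move=> h; have := congr1 (@cmod R) h; rewrite cmod_cexp cmod1 e1.
move=> /(congr1 (@ln R)); rewrite expRK ln1 => /eqP.
rewrite oppr_eq0 mulf_eq0 mulf_eq0 pnatr_eq0 (gt_eqF p0) /= => /eqP im0.
have hc : cos (2 * pi * ReC z) = 1.
  have := congr1 (@ReC R) h; rewrite /cexp e1 e2 im0 mulr0 oppr0 expR0 /ReC /= mul1r//.
set n := Num.floor (ReC z); pose x := ReC z - n%:~R.
have x0 : 0 <= x by rewrite subr_ge0 floor_le.
have x1 : x < 1 by rewrite ltrBlDl; have := floorD1_gt (ReC z); rewrite intrD addrC.
have periodic_int (k : int) y : cos (y + 2 * pi * k%:~R) = cos y :> R.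
  have pn (j : nat) y' : cos (y' + 2 * pi * j%:R) = cos y' :> R.
    have -> : y' + 2 * pi * j%:R = y' + (pi *+ 2) *+ j.
      by rewrite mulr_natl mulr_natr.
    by rewrite periodicn//; exact: cosD2pi.
  case: k => j; first exact: pn.
  by rewrite NegzE intrN -[LHS](pn j.+1) mulrN -addrA addNr addr0.
have hx : cos (2 * pi * x) = 1.
  by rewrite -(periodic_int n) -[RHS]hc -mulrDr /x subrK.
have sx : sin (pi * x) = 0.
  have := hx; have -> : 2 * pi * x = (pi * x) *+ 2 by rewrite -(mulr_natl (pi * x)) mulrA.
  rewrite cos_mulr2n cos2sin2 => h2; apply/eqP; rewrite -sqrf_eq0; apply/eqP.
  move: h2; rewrite -(mulr_natl (1 - _)); move: (sin _ ^+ 2); clear; move=> ? ?; lra.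
have xz : x = 0.
  apply/eqP; rewrite eq_le x0 andbT leNgt; apply/negP => xp.
  have : 0 < sin (pi * x).
    by apply: sin_gt0_pi; rewrite mulr_gt0//= gtr_pMr.
  by rewrite sx ltxx.
exists n; apply: C_eqP.
  have -> : ReC z = n%:~R by move: xz; rewrite /x; lra.
  by rewrite -(rmorph_int (real_complex R)).
by rewrite im0 -(rmorph_int (real_complex R)).
Qed.
End CExp.

(** * Complex differentials in several variables *)

Opaque av edge.
Section Several.
Variables (R : realType) (N : nat).
Local Notation C := (Cpx R).
Local Notation V := 'rV[C]_N.
Local Notation "x %:C" := (real_complex R x : C).
Implicit Types (x y h : V) (f g : V -> C).

(** The l1 norm, with real values. *)
Definition vn x : R := \sum_k cmod (x 0 k).
Lemma vn_ge0 x : 0 <= vn x.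
Proof. by apply: sumr_ge0 => k _; exact: cmod_ge0. Qed.

Lemma vn0 : vn 0 = 0.
Proof. by apply: big1 => k _; rewrite mxE cmod0. Qed.

Lemma vnD x y : vn (x + y) <= vn x + vn y.
Proof. by rewrite /vn -big_split; apply: ler_sum => k _; rewrite mxE cmodD. Qed.

Lemma vnZ (a : C) x : vn (a *: x) = cmod a * vn x.
Proof. by rewrite /vn mulr_sumr; apply: eq_bigr => k _; rewrite mxE cmodM. Qed.

Lemma vnN x : vn (- x) = vn x.
Proof. by apply: eq_bigr => k _; rewrite mxE cmodN. Qed.

Lemma vnBC x y : vn (x - y) = vn (y - x).
Proof. by rewrite -vnN opprB. Qed.

Lemma vn_tri x y z : vn (x - z) <= vn (x - y) + vn (y - z).
Proof. by rewrite (le_trans _ (vnD _ _))// addrA subrK. Qed.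

Lemma cmod_le_vn x k : cmod (x 0 k) <= vn x.
Proof.
by rewrite /vn (bigD1 k)//= lerDl; apply: sumr_ge0 => j _; exact: cmod_ge0.
Qed.

Lemma vn_delta k : vn (delta_mx 0 k : V) = 1.
Proof.
rewrite /vn (bigD1 k)//= big1 ?addr0 ?mxE ?eqxx ?cmod1//.
by move=> j jk; rewrite mxE eqxx (negbTE jk) cmod0.
Qed.

Lemma vn_eq0 x : vn x = 0 -> x = 0.
Proof.
move=> h; apply/rowP => k; rewrite mxE; apply/eqP; rewrite -cmod_eq0.
by apply/eqP/le_anti; rewrite cmod_ge0 -h cmod_le_vn.
Qed.

Definition vlim (u : nat -> V) x := forall k, clim (fun n => u n 0 k) (x 0 k).
Lemma vlimP u x : vlim u x <-> forall e : R, 0 < e ->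
  exists n0, forall n, (n0 <= n)%N -> vn (u n - x) < e.
Proof.
split=> [h e e0|h k e /h[n0 hn]]; last first.
  by exists n0 => n /hn; apply: le_lt_trans; have := cmod_le_vn (u n - x) k; rewrite !mxE.
have h2 : clim (fun n => \sum_k (cmod (u n 0 k - x 0 k))%:C) (\sum_(k < N) (0 : C)).
  apply: clim_sum => k _ r /(h k)[n0 hn]; exists n0 => n /hn.
  by rewrite subr0 cmod_real ger0_norm ?cmod_ge0.
rewrite [X in clim _ X]big1 // in h2.
have [n0 hn] := h2 e e0; exists n0 => n /hn; rewrite subr0 -rmorph_sum cmod_real.
rewrite ger0_norm; last by apply: sumr_ge0 => k _; exact: cmod_ge0.
by congr (_ < _); apply: eq_bigr => k _; rewrite !mxE.
Qed.

Definition vcont f x := forall u, vlim u x -> clim (fun n => f (u n)) (f x).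
Lemma vcontP f x : vcont f x <-> forall e : R, 0 < e -> exists2 d : R, 0 < d &
  forall y, vn (y - x) < d -> cmod (f y - f x) < e.
Proof.
split=> [h e e0|h u /vlimP hu e /h[d /hu[n0 hn] hd]]; last first.
  by exists n0 => n /hn /hd.
apply: contrapT => hn.
have /choice[u hu] : forall n : nat, exists w, vn (w - x) < n.+1%:R^-1 /\ ~ cmod (f w - f x) < e.
  move=> n; apply: contrapT => hw; apply: hn; exists n.+1%:R^-1.
    by rewrite invr_gt0 ltr0n.
  by move=> w wn; apply: contrapT => hf; apply: hw; exists w.
have : vlim u x.
  apply/vlimP => r /(@clim_0inv R)[n0 h0]; exists n0 => n /h0.
  rewrite subr0 cmodV cmod_nat; apply: lt_trans; exact: (hu n).1.
by move=> /h /(_ e e0)[n0 /(_ n0 (leqnn n0))]; apply: (hu n0).2.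
Qed.

Lemma vcont_cst a x : vcont (fun=> a) x.
Proof. by move=> u _; exact: clim_cst. Qed.

Lemma vcont_coord k x : vcont (fun y => y 0 k) x.
Proof. by move=> u; exact. Qed.

Lemma vcontD f g x : vcont f x -> vcont g x -> vcont (fun y => f y + g y) x.
Proof. by move=> hf hg u hu; exact: climD (hf u hu) (hg u hu). Qed.

Lemma vcontM f g x : vcont f x -> vcont g x -> vcont (fun y => f y * g y) x.
Proof. by move=> hf hg u hu; exact: climM (hf u hu) (hg u hu). Qed.

Lemma vcont_sum (I : Type) (r : seq I) (P : pred I) (F : I -> V -> C) x :
  (forall i, P i -> vcont (F i) x) -> vcont (fun y => \sum_(i <- r | P i) F i y) x.
Proof. by move=> hf u hu; apply: clim_sum => i Pi; exact: hf. Qed.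

(** Complex differentiability in several variables, again in Caratheodory's
    form; L is the row of partial derivatives. *)
Definition hdiff f x (L : V) := exists phi : V -> V,
  [/\ forall k, vcont (fun y => phi y 0 k) x, phi x = L &
      forall y, f y = f x + \sum_k phi y 0 k * (y 0 k - x 0 k)].

Lemma hdiffP f x L : hdiff f x L <-> forall e : R, 0 < e -> exists2 d : R, 0 < d &
  forall h, vn h < d -> cmod (f (x + h) - f x - \sum_k L 0 k * h 0 k) <= e * vn h.
Proof.
split=> [[phi [pc <- hf]] e e0|H].
  have hc : vcont (fun y => \sum_k (cmod (phi y 0 k - phi x 0 k))%:C) x.
    apply: vcont_sum => k _ u hu r /(pc k u hu)[n0 hn]; exists n0 => n /hn.
    by rewrite subrr cmod0 subr0 cmod_real ger0_norm ?cmod_ge0.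
  have [d d0 hd] := (vcontP _ _).1 hc e e0; exists d => // h hh.
  have := hd (x + h); have e1 : x + h - x = h by rewrite addrC addKr.
  rewrite e1 => /(_ hh); rewrite [X in _ - X]big1; last first.
    by move=> k _; rewrite subrr cmod0.
  rewrite subr0 -rmorph_sum cmod_real ger0_norm; last first.
    by apply: sumr_ge0 => k _; exact: cmod_ge0.
  move=> /ltW hs; rewrite (hf (x + h)) addKl -sumrB.
  apply: le_trans (cmod_sum _ _ _) _; rewrite /vn mulr_sumr; apply: ler_sum => k _.
  rewrite !mxE (addrC (x 0 k)) addrK -mulrBl cmodM ler_wpM2r ?cmod_ge0//.
  apply: le_trans hs; rewrite (bigD1 k)//= lerDl.
  by apply: sumr_ge0 => j _; exact: cmod_ge0.
pose rho y := f y - f x - \sum_k L 0 k * (y 0 k - x 0 k).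
pose cj (z : C) : C := conjc z / (cmod z)%:C.
have cjM z : cj z * z = (cmod z)%:C.
  have [->|z0] := eqVneq z 0; first by rewrite mulr0 cmod0.
  rewrite /cj mulrAC (mulrC _ z) -sqr_normc cmodE expr2 mulfK//.
  by rewrite -cmod_eq0 cmod_real normr_eq0 cmod_eq0.
have cjn z : cmod (cj z) <= 1.
  have [->|z0] := eqVneq z 0; first by rewrite /cj cmod0 invr0 mulr0 cmod0.
  have c0 : 0 < cmod z by rewrite cmod_gt0.
  have := congr1 (@cmod R) (cjM z); rewrite cmodM cmod_real ger0_norm ?cmod_ge0//.
  by move/eqP; rewrite -subr_eq0 -{2}[cmod z]mul1r -mulrBl mulf_eq0 (gt_eqF c0) orbF subr_eq0 => /eqP ->.
pose phi y : V := \row_k (L 0 k + rho y / (vn (y - x))%:C * cj (y 0 k - x 0 k)).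
exists phi; split.
- move=> k; apply/vcontP => e e0; have [d d0 hd] := H (e / 2) ltac:(lra).
  exists d => // y yd; rewrite !mxE [rho x]/rho subrr sub0r.
  rewrite [\sum_k _]big1; last by move=> j _; rewrite subrr mulr0.
  rewrite oppr0 !mul0r addr0 addKl cmodM; apply: le_lt_trans (ler_piMr (cmod_ge0 _) (cjn _)) _.
  rewrite cmodM cmodV cmod_real ger0_norm ?vn_ge0//.
  have [y0|y0] := eqVneq (vn (y - x)) 0; first by rewrite y0 invr0 mulr0.
  have hy0 : 0 < vn (y - x) by rewrite lt_def y0 vn_ge0.
  have := hd _ yd; have -> : x + (y - x) = y by rewrite addrC subrK.
  have -> : \sum_k0 L 0 k0 * (y - x) 0 k0 = \sum_k0 L 0 k0 * (y 0 k0 - x 0 k0).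
    by apply: eq_bigr => j _; rewrite !mxE.
  rewrite -/(rho y) => h1; apply: (@le_lt_trans _ _ (e / 2)); last by lra.
  by rewrite ler_pdivrMr.
- apply/rowP => k; rewrite mxE subrr vn0 invr0 mulr0 mul0r addr0 //.
- move=> y; under eq_bigr => k _ do rewrite mxE mulrDl -mulrA cjM.
  rewrite big_split /= -mulr_sumr.
  have -> : \sum_k (cmod (y 0 k - x 0 k))%:C = (vn (y - x))%:C.
    by rewrite -rmorph_sum; congr (_%:C); apply: eq_bigr => k _; rewrite !mxE.
  have [y0|y0] := eqVneq (vn (y - x)) 0.
    have yx : y = x by apply/eqP; rewrite -subr_eq0; apply/eqP/vn_eq0.
    rewrite yx big1 ?add0r; last by move=> k _; rewrite subrr mulr0.
    by rewrite subrr vn0 mulr0 addr0.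
  rewrite divfK; last by rewrite -cmod_eq0 cmod_real normr_eq0.
  by rewrite /rho; ring.
Qed.

Lemma hdiff_cont f x L : hdiff f x L -> vcont f x.
Proof.
move=> [phi [pc _ hf]].
have -> : f = fun y => f x + \sum_k phi y 0 k * (y 0 k - x 0 k) by apply/funext.
apply: vcontD; first exact: vcont_cst.
apply: vcont_sum => k _; apply: vcontM; first exact: pc.
by apply: vcontD; [exact: vcont_coord|exact: vcont_cst].
Qed.

Lemma hdiff_cst a x : hdiff (fun=> a) x 0.
Proof.
exists (fun=> 0); split=> // [k u _|y].
  by rewrite mxE; exact: clim_cst.
by rewrite big1 ?addr0// => k _; rewrite mxE mul0r.
Qed.

Lemma hdiff_coord k x : hdiff (fun y => y 0 k) x (delta_mx 0 k).
Proof.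
exists (fun=> delta_mx 0 k); split=> // [j u _|y]; first exact: clim_cst.
rewrite (bigD1 k)//= mxE !eqxx mul1r big1 ?addr0; first by rewrite addrC subrK.
by move=> j jk; rewrite mxE eqxx (negbTE jk) mul0r.
Qed.

Lemma hdiffD f g x L K : hdiff f x L -> hdiff g x K -> hdiff (fun y => f y + g y) x (L + K).
Proof.
move=> [p [pc <- hf]] [q [qc <- hg]]; exists (fun y => p y + q y); split=> //.
  by move=> k u hu; rewrite mxE; have := climD (pc k u hu) (qc k u hu);
    apply: (clim_ext (N := 0%N)) => n _; rewrite mxE.
move=> y; rewrite (hf y) (hg y) addrACA -big_split; congr (_ + _).
by apply: eq_bigr => k _; rewrite mxE mulrDl.
Qed.

Lemma hdiffM f g x L K : hdiff f x L -> hdiff g x K ->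
  hdiff (fun y => f y * g y) x (g x *: L + f x *: K).
Proof.
move=> hf hg; have gc := hdiff_cont hg; move: hf hg.
move=> [p [pc <- hf]] [q [qc <- hg]]; exists (fun y => g y *: p y + f x *: q y); split=> //.
  move=> k u hu; rewrite !mxE.
  have := climD (climM (gc u hu) (pc k u hu)) (climZ (f x) (qc k u hu)).
  by apply: (clim_ext (N := 0%N)) => n _; rewrite !mxE.
move=> y.
have -> : \sum_k (g y *: p y + f x *: q y) 0 k * (y 0 k - x 0 k) =
   g y * (f y - f x) + f x * (g y - g x).
  rewrite (hf y) (hg y) !addKl -(hg y) !mulr_sumr -big_split.
  by apply: eq_bigr => k _; rewrite !mxE /=; ring.
ring.
Qed.

Lemma hdiffZ a f x L : hdiff f x L -> hdiff (fun y => a * f y) x (a *: L).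
Proof. by move=> h; have := hdiffM (hdiff_cst a x) h; rewrite scaler0 add0r. Qed.

Lemma hdiff_sum (I : Type) (r : seq I) (P : pred I) (F : I -> V -> C) (L : I -> V) x :
  (forall i, P i -> hdiff (F i) x (L i)) ->
  hdiff (fun y => \sum_(i <- r | P i) F i y) x (\sum_(i <- r | P i) L i).
Proof.
move=> h; elim: r => [|i r ih].
  rewrite big_nil (_ : (fun y => _) = fun=> 0); first exact: hdiff_cst.
  by apply/funext => y; rewrite big_nil.
rewrite big_cons; case: ifP => Pi; last first.
  by rewrite (_ : (fun y => _) = (fun y => \sum_(i <- r | P i) F i y))//;
   apply/funext => y; rewrite big_cons Pi.
rewrite (_ : (fun y => _) = (fun y => F i y + \sum_(i <- r | P i) F i y)).
  by apply: hdiffD => //; exact: h.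
by apply/funext => y; rewrite big_cons Pi.
Qed.

Lemma hdiff_ext f g x L (r : R) : 0 < r -> (forall y, vn (y - x) < r -> f y = g y) ->
  hdiff f x L -> hdiff g x L.
Proof.
move=> r0 e /hdiffP hf; apply/hdiffP => e' /hf[d d0 hd].
exists (Num.min d r); first by rewrite lt_min d0.
move=> h; rewrite lt_min => /andP[hd' hr]; rewrite -!e ?subrr ?vn0//; first exact: hd.
by rewrite addrC addKr.
Qed.

Lemma hdiff_cderiv f (G : C -> C) x L d : hdiff f x L -> cderiv G (f x) d ->
  hdiff (G \o f) x (d *: L).
Proof.
move=> hf; have fc := hdiff_cont hf; case: hf => p [pc <- hf] [phi [phic <- hG]].
exists (fun y => phi (f y) *: p y); split=> //.
  move=> k u hu; rewrite mxE.
  have hh : clim (fun n => phi (f (u n))) (phi (f x)).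
    by move/cont_seqP: phic; apply; exact: fc.
  have := climM hh (pc k u hu).
  by apply: (clim_ext (N := 0%N)) => n _; rewrite !mxE.
move=> y; rewrite /= (hG (f y)) (_ : f y - f x = \sum_k p y 0 k * (y 0 k - x 0 k)).
  by rewrite mulr_sumr; congr (_ + _); apply: eq_bigr => k _; rewrite mxE mulrA.
by rewrite (hf y) addKl.
Qed.

(** Restriction to complex lines reduces several variables to one. *)
Lemma line_cderiv f x h (w : C) L : hdiff f (x + w *: h) L ->
  cderiv (fun z => f (x + z *: h)) w (\sum_k L 0 k * h 0 k).
Proof.
move=> [p [pc <- hf]]; exists (fun z => \sum_k p (x + z *: h) 0 k * h 0 k); split=> //.
  apply/cont_seqP => u hu; apply: clim_sum => k _; apply: climM; last exact: clim_cst.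
  apply: (pc k (fun n => x + u n *: h)) => j; rewrite mxE [in X in clim _ X]mxE.
  have := climD (clim_cst (x 0 j)) (climM hu (clim_cst (h 0 j))).
  by apply: (clim_ext (N := 0%N)) => n _; rewrite !mxE.
move=> z; rewrite (hf (x + z *: h)); congr (_ + _); rewrite mulr_suml.
by apply: eq_bigr => k _; rewrite !mxE; ring.
Qed.
End Several.

Section Chain.
Variables (R : realType) (N M : nat).
Local Notation C := (Cpx R).
Lemma hdiff_comp (phi : 'rV[C]_N -> 'rV[C]_M) (f : 'rV[C]_M -> C) x (A : 'I_M -> 'rV[C]_N) L :
  (forall k, hdiff (fun y => phi y 0 k) x (A k)) -> hdiff f (phi x) L ->
  hdiff (f \o phi) x (\sum_k L 0 k *: A k).
Proof.
move=> hphi [p [pc <- hf]].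
have /choice[B hB] := hphi.
have pv u : vlim u x -> vlim (fun n => phi (u n)) (phi x).
  by move=> hu k; exact: (hdiff_cont (hphi k)).
exists (fun y => \sum_k p (phi y) 0 k *: B k y); split.
- move=> j u hu; rewrite summxE.
  have : clim (fun n => \sum_k p (phi (u n)) 0 k * B k (u n) 0 j)
     (\sum_k p (phi x) 0 k * B k x 0 j).
    apply: clim_sum => k _; apply: climM; first exact: (pc k _ (pv u hu)).
    by have [hc _ _] := hB k; exact: hc.
  have -> : \sum_k (p (phi x) 0 k *: B k x) 0 j = \sum_k p (phi x) 0 k * B k x 0 j.
    by apply: eq_bigr => k _; rewrite mxE.
  apply: (clim_ext (N := 0%N)) => n _; rewrite summxE.
  by apply: eq_bigr => k _; rewrite mxE.
- by apply: eq_bigr => k _; have [_ -> _] := hB k.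
- move=> y; rewrite /= (hf (phi y)); congr (_ + _).
  under [RHS]eq_bigr do rewrite summxE mulr_suml.
  rewrite exchange_big; apply: eq_bigr => k _ /=.
  have [_ _ /(_ y) ->] := hB k; rewrite addKl mulr_sumr; apply: eq_bigr => j _.
  by rewrite mxE mulrA.
Qed.
End Chain.

Section Bridge.
Variables (R : realType) (N : nat).
Local Notation C := (Cpx R).
Local Notation V := 'rV[C]_N.
Local Notation "x %:C" := (real_complex R x : C).
Implicit Types (x y h : V) (f g : V -> C).

Lemma pos_real (e : C) : 0 < e -> exists2 r : R, e = r%:C & 0 < r.
Proof.
move=> e0; exists (ReC e); first by case: e e0 => a b; rewrite ltcE /= => /andP[/eqP-> _].
by case: e e0 => a b; rewrite ltcE /= => /andP[_].
Qed.

(** Lets the qualifier near be replaced by balls with a real radius. *)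
Lemma nbhs_vnP x (P : set V) : nbhs x P <->
  exists2 r : R, 0 < r & forall y, vn (y - x) < r -> P y.
Proof.
split=> [/nbhs_ballP[e /= e0 he]|[r r0 hr]].
  have [r er r0] := pos_real e0; exists r => // y yr; apply: he; rewrite /ball /= /mx_ball.
  split => // i j; rewrite (ord1 i) /ball /= er cmodE ltcR cmodBC.
  by apply: le_lt_trans yr; have := cmod_le_vn (y - x) j; rewrite !mxE.
have N0 : 0 < (N.+1)%:R :> R by rewrite ltr0n.
apply/nbhs_ballP; exists (r / N.+1%:R)%:C; first by rewrite /= ltcR divr_gt0.
move=> y [_ hy]; apply: hr.
have : vn (y - x) <= \sum_(k < N) (r / N.+1%:R).
  apply: ler_sum => k _; have := hy 0 k.
  by rewrite /ball /= cmodE ltcR !mxE cmodBC => /ltW.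
move=> /le_lt_trans; apply; rewrite sumr_const card_ord -[X in X < _]mulr_natr mulrAC.
by rewrite ltr_pdivrMr// ltr_pM2l// ltr_nat.
Qed.

Lemma vn_norm x : `|x| <= (vn x)%:C /\ (vn x)%:C <= N%:R * `|x|.
Proof.
split.
  have [x0|/mx_norm_neq0[[i j]]] := eqVneq (mx_norm x) 0.
    by have -> : `|x| = 0 := x0; rewrite lecR vn_ge0.
  move=> e; have -> : `|x| = `|x 0 j| by move: e; rewrite /= (ord1 i).
  by rewrite cmodE lecR cmod_le_vn.
rewrite /vn rmorph_sum /=.
have -> : N%:R * `|x| = \sum_(k < N) `|x| by rewrite sumr_const card_ord mulr_natl.
apply: ler_sum => k _; rewrite -cmodE.
rewrite [leRHS]mx_normE -[leLHS]nngE num_le; exact: (le_bigmax _ _ (0, k)).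
Qed.

Definition lform (L : V) (h : V) : C := \sum_k L 0 k * h 0 k.
Fact lform_linear L : linear (lform L).
Proof.
move=> a u v; rewrite /lform scaler_sumr -big_split; apply: eq_bigr => k _ /=.
by rewrite !mxE mulrDr; congr (_ + _); rewrite mulrCA.
Qed.

HB.instance Definition _ L := GRing.isLinear.Build C V C _ (lform L) (lform_linear L).

Lemma lform_le (L h : V) : cmod (lform L h) <= vn L * vn h.
Proof.
apply: le_trans (cmod_sum _ _ _) _; rewrite /vn mulr_suml; apply: ler_sum => k _.
by rewrite cmodM ler_wpM2l ?cmod_ge0// cmod_le_vn.
Qed.

Definition pd (k : 'I_N) f x : C := 'D_(delta_mx 0 k : V) f x.
Definition grad f x : V := \row_k pd k f x.
Definition hol f x := hdiff f x (grad f x).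

Lemma hdiff_lib f x L : hdiff f x L -> differentiable f x /\ grad f x = L.
Proof.
move=> /hdiffP H.
have lc : continuous (lform L).
  move=> y; have FF : Filter (nbhs y) by exact: nbhs_filter.
  apply/(@cvgrPdist_lt _ _ _ (nbhs y) FF (lform L)) => e e0; have [r er r0] := pos_real e0.
  have L0 : 0 < vn L + 1 by rewrite ltr_wpDl// vn_ge0.
  apply/nbhs_vnP; exists (r / (vn L + 1)); first by rewrite divr_gt0.
  move=> z zr; rewrite er cmodE ltcR -linearB /=.
  rewrite ltr_pdivlMr// in zr; apply: le_lt_trans zr; apply: le_trans (lform_le _ _) _.
  by rewrite mulrC vnBC ler_wpM2l ?vn_ge0// lerDl.
have oE : f \o shift x = cst (f x) + lform L +o_ (nbhs (0 : V)) id.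
  apply/eqaddoP => e e0; have [r er r0] := pos_real e0.
  have N0 : 0 < N.+1%:R :> R by rewrite ltr0n.
  have rN : 0 < r / N.+1%:R by rewrite divr_gt0.
  have [d d0 hd] := H _ rN; apply/nbhs_vnP; exists d => // h; rewrite subr0 => hh.
  have := hd h hh; rewrite (addrC x h) -/(lform L h) => h1.
  have -> : (f \o shift x - (cst (f x) + lform L)) h = f (h + x) - f x - lform L h.
    by rewrite opprD addrA.
  rewrite er cmodE; apply: (@le_trans _ _ ((r / N.+1%:R)%:C * (vn h)%:C)).
    by rewrite -rmorphM lecR.
  have [_ h2] := vn_norm h; apply: (@le_trans _ _ ((r / N.+1%:R)%:C * (N%:R * `|h|))).
    by rewrite ler_wpM2l// lecR ltW.
  rewrite mulrA ler_wpM2r// natrC -rmorphM lecR mulrAC ler_pdivrMr// ler_pM2l//.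
  by rewrite ler_nat.
have dl : 'd f x = lform L :> (V -> C) by apply: diff_unique.
have df : differentiable f x by apply/diff_locallyP; rewrite dl.
split=> //; apply/rowP => k; rewrite mxE /pd deriveE// dl /lform (bigD1 k)//= big1 ?addr0.
  by rewrite mxE !eqxx mulr1.
by move=> j jk; rewrite mxE eqxx (negbTE jk) mulr0.
Qed.

Lemma lib_hdiff f x : differentiable f x -> hol f x.
Proof.
move=> df; apply/hdiffP => e e0.
have /diff_locallyP[_ /eqaddoP H] := df.
have ec : 0 < e%:C by rewrite ltcR.
have /nbhs_vnP[r r0 hr] := H _ ec; exists r => // h hh.
have := hr h; rewrite subr0 => /(_ hh).
have -> : (f \o shift x - (cst (f x) + 'd f x)) h = f (h + x) - f x - 'd f x h.
  by rewrite opprD addrA.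
have -> : 'd f x h = \sum_k grad f x 0 k * h 0 k.
  rewrite {1}(row_sum_delta h) linear_sum; apply: eq_bigr => k _.
  by rewrite linearZ /= mxE /pd deriveE// mulrC.
rewrite (addrC x h) cmodE => h1.
have := le_trans h1 (ler_wpM2l (ltW ec) (vn_norm h).1).
by rewrite -rmorphM lecR.
Qed.

Lemma hdiff_hol f x L : hdiff f x L -> hol f x.
Proof. by move=> h; have [_ e] := hdiff_lib h; rewrite /hol e. Qed.

Lemma hdiff_pd f x L k : hdiff f x L -> pd k f x = L 0 k.
Proof. by move=> /hdiff_lib[_ <-]; rewrite mxE. Qed.

Lemma holP f x : hol f x <-> differentiable f x.
Proof. by split=> [/hdiff_lib[]|/lib_hdiff]. Qed.
End Bridge.

(** * Holomorphic functions of several variables *)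

Opaque av edge pd cmod vn.
Section Holomorphic.
Variables (R : realType) (N : nat).
Local Notation C := (Cpx R).
Local Notation V := 'rV[C]_N.
Local Notation "x %:C" := (real_complex R x : C).
Local Notation delta k := (delta_mx 0 k : V).
Implicit Types (x y h : V) (f g : V -> C) (M r : R).

Lemma gradE f x k : grad f x 0 k = pd k f x.
Proof. by rewrite mxE. Qed.

Lemma addrowE (u v : V) k : (u + v) 0 k = u 0 k + v 0 k.
Proof. by rewrite mxE. Qed.

Lemma diff_ident (p q D a b : C) : (p - q) * D = (a - b) - (a - p * D) + (b - q * D).
Proof. ring. Qed.

Definition hol_on f x r M := forall y, vn (y - x) < r -> hol f y /\ cmod (f y) <= M.

Lemma hol_on_sub f x r M y r' : hol_on f x r M -> vn (y - x) + r' <= r -> hol_on f y r' M.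
Proof.
move=> h yr z zy; apply: h; apply: le_lt_trans (vn_tri z y x) _.
by apply: lt_le_trans yr; rewrite addrC ltrD2l.
Qed.

Lemma hol_onM0 f x r M : 0 < r -> hol_on f x r M -> 0 <= M.
Proof. by move=> r0 h; apply: le_trans (cmod_ge0 _) (h x _).2; rewrite subrr vn0. Qed.

Lemma vnl (x h : V) (a : C) : vn (x + a *: h - x) = cmod a * vn h.
Proof. by rewrite (addrC x) addrK vnZ. Qed.

(** Cauchy's series for the restriction of f to the line through x in direction
    h; the factor 2 is the radius of the disc in the one-variable theorem. *)
Lemma line_series f x r M h : 0 < r -> hol_on f x r M -> 2 * vn h <= r ->
  exists2 a : nat -> C, (forall n, cmod (a n) <= 2 * M) &
    forall z n, cmod z < 1 ->
      cmod (f (x + z *: h) - \sum_(i < n) a i * z ^+ i) <= 2 * M / (1 - cmod z) * cmod z ^+ n.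
Proof.
move=> r0 hf hr.
have inb (w : C) : cmod w < 2 -> vn (x + w *: h - x) < r.
  move=> w2; rewrite vnl; have [h0|h0] := eqVneq (vn h) 0; first by rewrite h0 mulr0.
  by apply: lt_le_trans hr; rewrite ltr_pM2r// lt_def h0 vn_ge0.
have := @cauchy_series _ (fun w => f (x + w *: h)) M; apply.
  move=> w /inb/hf[hw _]; eexists; exact: line_cderiv hw.
by move=> w /inb/hf[].
Qed.

(** The coefficient of z in the series along the line, evaluated at the largest
    multiple of h allowed, bounds the differential and the second order
    error. *)
Lemma taylor1 f x r M : 0 < r -> hol_on f x r M ->
  forall h, 4 * vn h <= r ->
   cmod (f (x + h) - f x - \sum_k pd k f x * h 0 k) <= 16 * M * (vn h / r) ^+ 2 /\
   cmod (\sum_k pd k f x * h 0 k) <= 4 * M * (vn h / r).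
Proof.
move=> r0 hf h hr; have [h0|h0] := eqVneq (vn h) 0.
  rewrite (vn_eq0 h0) addr0 subrr vn0 mul0r expr0n !mulr0.
  by rewrite big1 ?subr0 ?cmod0// => k _; rewrite mxE mulr0.
have h0' : 0 < vn h by rewrite lt_def h0 vn_ge0.
have M0 := hol_onM0 r0 hf.
(* the largest multiple s h of h to which the series along the line applies *)
pose s : R := r / (2 * vn h); have s0 : 0 < s by rewrite divr_gt0// mulr_gt0.
have sc : cmod s%:C = s by rewrite cmod_real gtr0_norm.
have hs : 2 * vn (s%:C *: h) <= r.
  rewrite vnZ sc /s; have -> : 2 * (r / (2 * vn h) * vn h) = r by field.
  exact: lexx.
have [a aM ha] := line_series r0 hf hs.
have e0 : f x = a 0%N.
  have := ha 0 1%N ltac:(by rewrite cmod0).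
  rewrite scale0r addr0 big_ord1 expr0 mulr1 cmod0 subr0 expr1 mulr0 => h1.
  by apply/eqP; rewrite -subr_eq0 -cmod_eq0; apply/eqP/le_anti; rewrite h1 cmod_ge0.
have est z : cmod z <= 2^-1 ->
    cmod (f (x + z *: (s%:C *: h)) - f x - a 1%N * z) <= 4 * M * cmod z ^+ 2.
  move=> z2; have z1 : cmod z < 1 by lra.
  have := ha z 2%N z1; rewrite big_ord_recl big_ord1 expr0 mulr1 -e0 expr1 opprD addrA.
  move=> h1; apply: le_trans h1 _; rewrite ler_wpM2r ?exprn_ge0 ?cmod_ge0//.
  by rewrite ler_pdivrMr; [nra|lra].
have d1 : cderiv (fun z => f (x + z *: (s%:C *: h))) 0 (a 1%N).
  apply/cderivP => e ep; have M1 : 0 < 4 * M + 1 by lra.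
  exists (Num.min (2^-1) (e / (4 * M + 1))).
    by rewrite lt_min invr_gt0 ltr0n divr_gt0.
  move=> w; rewrite subr0 lt_min => /andP[w1 w2]; rewrite scale0r addr0.
  apply: le_trans (est w (ltW w1)) _; rewrite expr2 mulrA ler_wpM2r ?cmod_ge0//.
  rewrite ltr_pdivlMr// in w2; have := cmod_ge0 w; nra.
have d2 : cderiv (fun z => f (x + z *: (s%:C *: h))) 0 (\sum_k pd k f x * (s%:C *: h) 0 k).
  have [hx _] := hf x ltac:(by rewrite subrr vn0).
  have := @line_cderiv _ _ f x (s%:C *: h) 0 (grad f x).
  rewrite scale0r addr0 => /(_ hx).
  by under [X in cderiv _ _ X]eq_bigr do rewrite mxE.
have e1 := cderiv_uniq d1 d2.
have sV : s%:C^-1 * s%:C = 1 :> C.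
  by rewrite mulVf// -cmod_eq0 sc gt_eqF.
have eS : \sum_k pd k f x * h 0 k = a 1%N * s%:C^-1.
  rewrite e1 mulr_suml; apply: eq_bigr => k _; rewrite mxE.
  by rewrite -!mulrA (mulrC (h 0 k)) mulrA mulrA -(mulrA (pd k f x)) (mulrC s%:C) sV mulr1.
have cz : cmod s%:C^-1 = 2 * (vn h / r).
  by rewrite cmodV sc /s; field; rewrite h0 gt_eqF.
have cz2 : cmod s%:C^-1 <= 2^-1.
  by rewrite cz mulrA ler_pdivrMr//; lra.
split.
  have := est _ cz2; rewrite scalerA sV scale1r -eS => h1; apply: le_trans h1 _.
  by rewrite cz; have -> : 4 * M * (2 * (vn h / r)) ^+ 2 = 16 * M * (vn h / r) ^+ 2 by ring.
rewrite eS cmodM cz; apply: le_trans (ler_wpM2r _ (aM 1%N)) _.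
  by rewrite mulr_ge0// divr_ge0 ?vn_ge0// ltW.
by have -> : 2 * M * (2 * (vn h / r)) = 4 * M * (vn h / r) by ring.
Qed.

Lemma pd_sum_delta f x (k : 'I_N) (a : C) :
  \sum_j pd j f x * (a *: delta k) 0 j = pd k f x * a.
Proof.
rewrite (bigD1 k)//= big1 ?addr0; first by rewrite !mxE !eqxx mulr1.
by move=> j jk; rewrite !mxE eqxx (negbTE jk) !mulr0.
Qed.

Lemma taylor_num1 M (e s d : R) : 0 <= M -> 0 < s -> 0 < d ->
  d * (64 * M + 1) <= e * s ^+ 2 / 2 -> 32 * M * (d / s) ^+ 2 <= e * d / 4.
Proof.
move=> M0 s0 d0 dM; have s2 : 0 < s ^+ 2 by rewrite exprn_gt0.
rewrite expr_div_n mulrA ler_pdivrMr//.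
have : 64 * M * d <= e * s ^+ 2 / 2 by lra.
by move=> /(ler_wpM2r (ltW d0)); rewrite (expr2 d); lra.
Qed.

Lemma taylor_num2 M (e s v : R) : 0 <= v -> 0 < s ->
  v * (16 * M + 1) < e * s ^+ 2 -> 16 * M * (v / s) ^+ 2 <= e * v.
Proof.
move=> v0 s0 h; have s2 : 0 < s ^+ 2 by rewrite exprn_gt0.
rewrite expr_div_n mulrA ler_pdivrMr//.
have h3 : 16 * M * v <= e * s ^+ 2 by lra.
by have := ler_wpM2r v0 h3; rewrite (expr2 v); lra.
Qed.

(** By the uniform second order estimate taylor1, the partial derivatives of u
    n differ from difference quotients of u n by O(d), uniformly in n. As the
    difference quotients converge for fixed d, the derivatives form Cauchy
    sequences, and the estimate passes to the limit. *)
Lemma hol_lim (u : nat -> V -> C) f x r M : 0 < r ->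
  (forall n, hol_on (u n) x r M) ->
  (forall y, vn (y - x) < r -> clim (fun n => u n y) (f y)) ->
  hol_on f x r M /\
  forall y k, vn (y - x) < r -> clim (fun n => pd k (u n) y) (pd k f y).
Proof.
move=> r0 hu hl.
have M0 := hol_onM0 r0 (hu 0%N).
have main y : vn (y - x) < r -> exists2 L : V,
    (forall k, clim (fun n => pd k (u n) y) (L 0 k)) & hdiff f y L.
  move=> yr; pose s := r - vn (y - x); have s0 : 0 < s by rewrite subr_gt0.
  have hus n : hol_on (u n) y s M.
    by apply: hol_on_sub (hu n) _; rewrite /s addrC subrK.
  have hls h : vn h < s -> clim (fun n => u n (y + h)) (f (y + h)).
    move=> hh; apply: hl; apply: le_lt_trans (vn_tri _ y _) _.
    by rewrite (addrC y) addrK; rewrite /s in hh; lra.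
  have ca k : ccauchy (fun n => pd k (u n) y).
    move=> e e0.
    (* step of the difference quotients: the two Taylor errors 16 M (d/s)^2 add
       up to at most e d / 4 *)
    pose d := Num.min (s / 4) (e * s ^+ 2 / (64 * M + 1) / 2).
    have M1 : 0 < 64 * M + 1 by lra.
    have s2 : 0 < s ^+ 2 by rewrite exprn_gt0.
    have d0 : 0 < d.
      by rewrite lt_min divr_gt0//= divr_gt0// divr_gt0// mulr_gt0.
    have d4 : d <= s / 4 by rewrite ge_min lexx.
    have dM : d * (64 * M + 1) <= e * s ^+ 2 / 2.
      by rewrite -ler_pdivlMr// mulrAC; rewrite ge_min lexx orbT.
    have vd : vn (d%:C *: delta k) = d by rewrite vnZ vn_delta mulr1 cmod_real gtr0_norm.
    have ds : vn (d%:C *: delta k) < s by rewrite vd; lra.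
    have h4 : 4 * vn (d%:C *: delta k) <= s by rewrite vd; lra.
    have ed : 0 < e * d / 4 by rewrite divr_gt0// mulr_gt0.
    pose w n := u n (y + d%:C *: delta k) - u n y.
    have : clim w (f (y + d%:C *: delta k) - f y).
      apply: climB; first exact: hls.
      exact: hl.
    move=> /(_ (e * d / 8)) []; first by rewrite divr_gt0// mulr_gt0.
    move=> n0 hn; exists n0 => n m nn nm.
    have t0 i : cmod (w i - pd k (u i) y * d%:C) <= 16 * M * (d / s) ^+ 2.
      by have := (taylor1 s0 (hus i) h4).1; rewrite pd_sum_delta vd.
    have t1 := t0 n; have t2 := t0 m.
    have wnm : cmod (w n - w m) <= e * d / 4.
      apply: le_trans (cmod_tri _ (f (y + d%:C *: delta k) - f y) _) _.
      rewrite (cmodBC _ (w m)); apply: le_trans (lerD (ltW (hn n nn)) (ltW (hn m nm))) _.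
      by clear; lra.
    have key : cmod ((pd k (u n) y - pd k (u m) y) * d%:C) <=
        e * d / 4 + 32 * M * (d / s) ^+ 2.
      rewrite (diff_ident _ _ _ (w n) (w m)).
      apply: le_trans (cmodD _ _) _; apply: le_trans (lerD (cmodB _ _) t2) _.
      apply: le_trans (lerD (lerD wnm t1) (lexx _)) _.
      have -> : e * d / 4 + 16 * M * (d / s) ^+ 2 + 16 * M * (d / s) ^+ 2 =
        e * d / 4 + 32 * M * (d / s) ^+ 2 by ring.
      exact: lexx.
    rewrite cmodM cmod_real gtr0_norm// in key.
    have q := taylor_num1 M0 s0 d0 dM.
    rewrite -(ltr_pM2r d0); apply: le_lt_trans key _.
    apply: le_lt_trans (lerD (lexx _) q) _.
    have : 0 < e * d by rewrite mulr_gt0.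
    by clear; lra.
  have /choice[L hL] : forall k, exists l, clim (fun n => pd k (u n) y) l.
    by move=> k; exact: complete_C.
  pose Lv : V := \row_k L k.
  have hL' k : clim (fun n => pd k (u n) y) (Lv 0 k) by rewrite mxE.
  exists Lv => //.
  have bnd h : 4 * vn h <= s ->
     cmod (f (y + h) - f y - \sum_k Lv 0 k * h 0 k) <= 16 * M * (vn h / s) ^+ 2.
    move=> hs; have hs' : vn h < s by have := vn_ge0 h; lra.
    apply: (@clim_le _ (fun n => u n (y + h) - u n y - \sum_k pd k (u n) y * h 0 k) _ _ 0%N).
      by move=> n _; exact: (taylor1 s0 (hus n) hs).1.
    apply: climB; first by apply: climB; [exact: hls|exact: hl].
    by apply: clim_sum => k _; apply: climM; [exact: hL'|exact: clim_cst].
  apply/hdiffP => e e0; have s2 : 0 < s ^+ 2 by rewrite exprn_gt0.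
  have M1 : 0 < 16 * M + 1 by lra.
  exists (Num.min (s / 4) (e * s ^+ 2 / (16 * M + 1))).
    by rewrite lt_min divr_gt0//= divr_gt0// mulr_gt0.
  move=> h; rewrite lt_min => /andP[h1 h2].
  apply: le_trans (bnd h _) _; first by lra.
  rewrite ltr_pdivlMr// in h2; exact: taylor_num2 (vn_ge0 h) s0 h2.
split=> [y yr|y k yr].
  have [L _ hL] := main y yr; split; first exact: hdiff_hol hL.
  by apply: (clim_le (N := 0%N) _ (hl y yr)) => n _; have [_] := hu n y yr.
by have [L hk hL] := main y yr; rewrite (hdiff_pd k hL).
Qed.

Lemma hol_translate f x h : hol f (x + h) -> hol (fun y => f (y + h)) x /\
  forall k, pd k (fun y => f (y + h)) x = pd k f (x + h).
Proof.
move=> hf.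
have : hdiff (fun y => f (y + h)) x (grad f (x + h)).
  have := @hdiff_comp _ N N (fun y => y + h) f x (fun k => delta k + 0) _ _ hf.
  have -> : \sum_k grad f (x + h) 0 k *: (delta k + 0) = grad f (x + h).
    rewrite [RHS]row_sum_delta; apply: eq_bigr => k _; by rewrite addr0.
  apply=> k; rewrite (_ : (fun y => _) = (fun y : V => y 0 k + h 0 k)).
    by apply: hdiffD; [exact: hdiff_coord|exact: hdiff_cst].
  by apply/funext => y; rewrite mxE.
move=> hd; split=> [|k]; first exact: hdiff_hol hd.
by rewrite (hdiff_pd k hd) mxE.
Qed.

Lemma holZ_pd a f x : hol f x -> hol (fun y => a * f y) x /\
  forall k, pd k (fun y => a * f y) x = a * pd k f x.
Proof.
move=> /(hdiffZ a) hf; split; first exact: hdiff_hol hf.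
by move=> k; rewrite (hdiff_pd k hf) mxE gradE.
Qed.

Lemma holD_pd f g x : hol f x -> hol g x -> hol (fun y => f y + g y) x /\
  forall k, pd k (fun y => f y + g y) x = pd k f x + pd k g x.
Proof.
move=> hf hg; have h := hdiffD hf hg; split; first exact: hdiff_hol h.
move=> k; exact: etrans (hdiff_pd k h) (etrans (addrowE _ _ _)
  (congr2 +%R (gradE f x k) (gradE g x k))).
Qed.

(** A partial derivative is a bounded limit of difference quotients, which are
    holomorphic, so hol_lim applies; the convergence of the derivatives in
    hol_lim is the interchange of partial derivatives. *)
Lemma hol_pd f x r M : 0 < r -> hol_on f x r M -> forall k,
  hol_on (pd k f) x (r / 2) (16 * M / r) /\
  forall j y, vn (y - x) < r / 2 -> pd j (pd k f) y = pd k (pd j f) y.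
Proof.
move=> r0 hf.
have M0 := hol_onM0 r0 hf; have r2 : 0 < r / 2 by lra.
(* steps of difference quotients, small enough for the translates to stay in
   the ball *)
pose d n : R := r / 8 / n.+1%:R.
have d0 n : 0 < d n by rewrite divr_gt0 ?ltr0n//; lra.
have d8 n : d n <= r / 8.
  by rewrite ler_pdivrMr ?ltr0n// ler_peMr ?ler1n//; lra.
have dlim : clim (fun n => (d n)%:C) 0.
  have -> : (fun n => (d n)%:C) = fun n => (r / 8)%:C * (n.+1%:R : C)^-1.
    by apply/funext => n; rewrite rmorphM fmorphV natrC.
  by have := climZ (r / 8)%:C (@clim_0inv R); rewrite mulr0.
have vd n k : vn ((d n)%:C *: delta k) = d n.
  by rewrite vnZ vn_delta mulr1 cmod_real gtr0_norm.
pose u k n y : C := (d n)%:C^-1 * (f (y + (d n)%:C *: delta k) + (-1) * f y).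
have quot g y k (hg : hol g y) :
    clim (fun n => (d n)%:C^-1 * (g (y + (d n)%:C *: delta k) + (-1) * g y)) (pd k g y).
  move=> e e0; move/hdiffP: hg => /(_ (e / 2) ltac:(lra))[s s0 hs].
  have [n0 hn] := dlim s s0; exists n0 => n nn; have := hn n nn.
  rewrite subr0 cmod_real gtr0_norm// => ds.
  have := hs ((d n)%:C *: delta k); rewrite vd => /(_ ds).
  have -> : \sum_j grad g y 0 j * ((d n)%:C *: delta k) 0 j = pd k g y * (d n)%:C.
    by under eq_bigr do rewrite mxE; exact: pd_sum_delta.
  have dn0 : (d n)%:C != 0 by rewrite -cmod_eq0 cmod_real gtr0_norm// gt_eqF.
  have -> : (d n)%:C^-1 * (g (y + (d n)%:C *: delta k) + -1 * g y) - pd k g y =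
     (d n)%:C^-1 * (g (y + (d n)%:C *: delta k) - g y - pd k g y * (d n)%:C) by field.
  rewrite cmodM cmodV cmod_real gtr0_norm// => h; rewrite mulrC ltr_pdivrMr//.
  apply: le_lt_trans h _; rewrite ltr_pM2r//; lra.
have sub y : vn (y - x) < r / 2 -> hol_on f y (r / 2) M.
  move=> yr; apply: hol_on_sub hf _; lra.
have hu k n : hol_on (u k n) x (r / 2) (16 * M / r).
  move=> y yr; have hy := sub y yr.
  have [hfy _] := hy y ltac:(by rewrite subrr vn0).
  have [hfd _] : hol f (y + (d n)%:C *: delta k) /\ cmod (f (y + (d n)%:C *: delta k)) <= M.
    by apply: hy; rewrite (addrC y) addrK vd; have := d8 n; lra.
  have [h1 _] := hol_translate hfd; have [h2 _] := holZ_pd (-1) hfy.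
  have [h3 _] := holD_pd h1 h2; have [h4 _] := holZ_pd (d n)%:C^-1 h3.
  split=> //; rewrite /u cmodM cmodV cmod_real gtr0_norm// mulrC ler_pdivrMr//.
  have [|t1 t2] := taylor1 r2 hy (h := (d n)%:C *: delta k).
    by rewrite vd; have := d8 n; lra.
  rewrite vd in t1 t2; rewrite mulN1r.
  apply: le_trans (_ : 16 * M * (d n / (r / 2)) ^+ 2 + 4 * M * (d n / (r / 2)) <= _).
    set S := \sum_j _ in t1 t2.
    rewrite -(subrK S (f _ - f y)); apply: le_trans (cmodD _ _) _; exact: lerD.
  have -> : d n / (r / 2) = 2 * (d n / r) by field; rewrite gt_eqF.
  have -> : 16 * M / r * d n = 16 * M * (d n / r) by field; rewrite gt_eqF.
  have q0 : 0 <= d n / r by rewrite divr_ge0// ltW.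
  have q8 : d n / r <= 1 / 8 by rewrite ler_pdivrMr//; have := d8 n; lra.
  have : M * (d n / r) * (d n / r) <= M * (d n / r) * (1 / 8).
    by rewrite ler_wpM2l// mulr_ge0.
  rewrite expr2; lra.
have hfy y : vn (y - x) < r / 2 -> hol f y.
  by move=> yr; apply: (hf y _).1; lra.
have hl k y : vn (y - x) < r / 2 -> clim (fun n => u k n y) (pd k f y).
  by move=> yr; apply: quot; exact: hfy.
have H k := hol_lim r2 (hu k) (hl k).
move=> k; split=> [|j y yr]; first exact: (H k).1.
have c1 := (H k).2 y j yr.
have c2 := quot (pd j f) y k ((H j).1 y yr).1.
apply: clim_uniq c1 _; apply: (clim_ext (N := 0%N)) c2 => n _.
have [hfd _] : hol f (y + (d n)%:C *: delta k) /\ cmod (f (y + (d n)%:C *: delta k)) <= M.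
  by apply: (sub y yr); rewrite (addrC y) addrK vd; have := d8 n; lra.
have [h1 e1] := hol_translate hfd; have [h2 e2] := holZ_pd (-1) (hfy y yr).
have [h3 e3] := holD_pd h1 h2; have [h4 e4] := holZ_pd (d n)%:C^-1 h3.
by rewrite /u e4 e3 e1 e2.
Qed.

(** Divide by the first nonzero power of z and let z tend to 0. *)
Lemma series_small_zero (a : nat -> C) (g : C -> C) (B : R) :
  (forall z n, cmod z < 1 -> cmod (g z - \sum_(i < n) a i * z ^+ i) <= B / (1 - cmod z) * cmod z ^+ n) ->
  (forall n, exists A e : R, 0 < e /\ forall z, cmod z < e -> cmod (g z) <= A * cmod z ^+ n) ->
  forall n, a n = 0.
Proof.
move=> hs hgn; elim/ltn_ind => n ih; apply: cmod_small => t t0.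
have [A [e [e0 hg]]] := hgn n.+1.
have B0 : 0 <= B.
  have := hs 0 0%N; rewrite cmod0 subr0 divr1 expr0 mulr1 => h; apply: le_trans (h ltr01).
  exact: cmod_ge0.
pose K := Num.max A 0 + 2 * B + 1.
have A0 : 0 <= Num.max A 0 by rewrite le_max lexx orbT.
have AM : A <= Num.max A 0 by rewrite le_max lexx.
have K0 : 0 < K by rewrite /K; lra.
(* evaluation at the small real point s, where the remainder is below t times
   s^n *)
pose s := Num.min (Num.min e 1 / 2) (t / K).
have s0 : 0 < s by rewrite lt_min !divr_gt0// lt_min e0 ltr01.
have s12 : s <= Num.min e 1 / 2 by rewrite ge_min lexx.
have st : s * K <= t by rewrite -ler_pdivlMr// ge_min lexx orbT.
have se : s < e.
  apply: le_lt_trans s12 _; have : Num.min e 1 <= e by rewrite ge_min lexx.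
  by lra.
have s2 : s <= 2^-1.
  apply: le_trans s12 _; have : Num.min e 1 <= 1 by rewrite ge_min lexx orbT.
  by lra.
have cs : cmod s%:C = s by rewrite cmod_real gtr0_norm.
have h1 := hs s%:C n.+1 ltac:(rewrite cs; lra).
have h2 := hg s%:C ltac:(by rewrite cs).
rewrite cs in h1 h2; rewrite big_ord_recr /= big1 ?add0r in h1; last first.
  by move=> i _; rewrite ih// mul0r.
have h3 : cmod (a n * s%:C ^+ n) <= A * s ^+ n.+1 + B / (1 - s) * s ^+ n.+1.
  have -> : a n * s%:C ^+ n = g s%:C - (g s%:C - a n * s%:C ^+ n) by ring.
  by apply: le_trans (cmodB _ _) _; exact: lerD.
rewrite cmodM cmodX cs in h3.
have sn : 0 < s ^+ n by rewrite exprn_gt0.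
rewrite -(ler_pM2r sn); apply: le_trans h3 _; rewrite exprS.
have B2 : B / (1 - s) <= 2 * B.
  rewrite ler_pdivrMr; last by lra.
  nra.
have -> : A * (s * s ^+ n) + B / (1 - s) * (s * s ^+ n) =
   ((A + B / (1 - s)) * s) * s ^+ n by ring.
rewrite ler_wpM2r ?(ltW sn)//; apply: le_trans st; rewrite mulrC ler_wpM2l ?(ltW s0)//.
rewrite /K; lra.
Qed.

(** On each line through x all power series coefficients vanish. *)
Lemma hol_vanish f x r M : 0 < r -> hol_on f x r M ->
  (forall h n, 2 * vn h <= r -> exists A e : R, 0 < e /\
     forall z : C, cmod z < e -> cmod (f (x + z *: h)) <= A * cmod z ^+ n) ->
  forall y, vn (y - x) <= r / 4 -> f y = 0.
Proof.
move=> r0 hf hA y yr; pose h := (2 : C) *: (y - x).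
have hh : 2 * vn h <= r by rewrite /h vnZ cmod_nat; lra.
have [a _ ha] := line_series r0 hf hh.
have a0 := series_small_zero ha (fun n => hA h n hh).
have cz : cmod (2^-1 : C) = 2^-1 by rewrite cmodV cmod_nat.
apply: cmod_small => t t0.
have [n hn] := geo_lt (2 * M / (1 - 2^-1)) (q := 2^-1 : R) (e := t) ltac:(lra) ltac:(lra) t0.
apply/ltW; apply: le_lt_trans (hn n (leqnn n)).
have := ha 2^-1 n ltac:(rewrite cz; lra); rewrite cz big1; last by move=> i _; rewrite a0 mul0r.
rewrite subr0 /h scalerA mulVf ?pnatr_eq0// scale1r addrC subrK//.
Qed.

Lemma identity_step f x r M e : 0 < r -> 0 < e -> hol_on f x r M ->
  (forall y, vn (y - x) < e -> f y = 0) -> forall y, vn (y - x) <= r / 4 -> f y = 0.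
Proof.
move=> r0 e0 hf hz.
apply: (hol_vanish r0 hf) => h n hr; exists 0, (e / r); split; first by rewrite divr_gt0.
move=> z ze; rewrite mul0r hz ?cmod0//.
rewrite vnl; apply: (@le_lt_trans _ _ (cmod z * r)).
  by rewrite ler_wpM2l ?cmod_ge0//; have := vn_ge0 h; lra.
by rewrite -ltr_pdivlMr.
Qed.

(** Vanishing near a point propagates to a ball of fixed radius r/4, and
    finitely many steps of length at most r/8 reach the end of the segment. *)
Lemma identity_segment f x y r M e : 0 < r -> 0 < e ->
  (forall s : R, 0 <= s -> s <= 1 -> hol_on f (x + s%:C *: (y - x)) r M) ->
  (forall z, vn (z - x) < e -> f z = 0) -> forall z, vn (z - y) <= r / 4 -> f z = 0.
Proof.
move=> r0 e0 hf hz.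
have [n hn] := archi_ex (vn (y - x) / (r / 8)).
have n0 : 0 < n%:R :> R by apply: le_lt_trans hn; rewrite divr_ge0 ?vn_ge0//; lra.
pose p j := x + (j%:R / n%:R)%:C *: (y - x).
have rg j : (j <= n)%N -> 0 <= j%:R / n%:R :> R /\ j%:R / n%:R <= 1 :> R.
  move=> jn; split; first by rewrite divr_ge0// ?ler0n// ltW.
  by rewrite ler_pdivrMr// mul1r ler_nat.
have stp j : vn (p j.+1 - p j) <= r / 8.
  have -> : p j.+1 - p j = (n%:R^-1)%:C *: (y - x).
    rewrite /p opprD addrACA subrr add0r -scalerBl -rmorphB; congr (_%:C *: _).
    by rewrite -natr1; field; rewrite gt_eqF.
  rewrite vnZ cmod_real gtr0_norm ?invr_gt0// mulrC ler_pdivrMr//.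
  by rewrite ltr_pdivrMr in hn; [lra|lra].
have main j : (j <= n)%N -> forall z, vn (z - p j) <= r / 4 -> f z = 0.
  elim: j => [_|j ih jn].
    have [a b] := rg 0%N (leq0n _).
    apply: (identity_step r0 e0 (hf _ a b)) => z; rewrite mul0r rmorph0 scale0r addr0.
    exact: hz.
  have [a b] := rg _ jn; have r8 : 0 < r / 8 by lra.
  apply: (identity_step r0 r8 (hf _ a b)) => z zr; apply: (ih (ltnW jn)).
  apply: le_trans (vn_tri _ (p j.+1) _) _.
  have zr' : vn (z - p j.+1) <= r / 8 by exact: ltW.
  by apply: le_trans (lerD zr' (stp j)) _; lra.
have := main n (leqnn n).
by have -> : p n = y by rewrite /p divff ?gt_eqF// rmorph1 scale1r addrC subrK.
Qed.
End Holomorphic.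

(** * Jets, and division by coordinates *)

Opaque av edge pd cmod vn.
Section Jets.
Variables (R : realType) (N : nat).
Local Notation C := (Cpx R).
Local Notation V := 'rV[C]_N.
Local Notation "x %:C" := (real_complex R x : C).
Local Notation delta k := (delta_mx 0 k : V).
Implicit Types (x y h : V) (f g : V -> C) (M r : R).

Definition hol_near f x := exists r M, 0 < r /\ hol_on f x r M.
Definition pds (w : seq 'I_N) f : V -> C := foldr (@pd R N) f w.

Lemma hol_near_pd f x k : hol_near f x -> hol_near (pd k f) x.
Proof.
move=> [r [M [r0 hf]]]; exists (r / 2), (16 * M / r); split; first by rewrite divr_gt0.
by have [] := hol_pd r0 hf k.
Qed.

Lemma hol_near_pds f x w : hol_near f x -> hol_near (pds w f) x.
Proof. by move=> hf; elim: w => //= k w; exact: hol_near_pd. Qed.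

Lemma near_hol f x : (\forall y \near x, differentiable f y) -> hol_near f x.
Proof.
move=> /nbhs_vnP[r r0 hr].
have hx : hol f x by apply/holP; apply: hr; rewrite subrr vn0.
have [d d0 hd] := (vcontP _ _).1 (hdiff_cont hx) 1 ltr01.
exists (Num.min r d), (cmod (f x) + 1); split; first by rewrite lt_min r0.
move=> y; rewrite lt_min => /andP[yr yd]; split; first by apply/holP; exact: hr.
have := hd y yd; have := cmod_tri (f y) (f x) 0; rewrite !subr0; clear; lra.
Qed.

Lemma pd_ext f g x r k : 0 < r -> (forall y, vn (y - x) < r -> f y = g y) ->
  hol f x -> pd k f x = pd k g x.
Proof.
by move=> r0 e hf; rewrite (hdiff_pd k (hdiff_ext r0 e hf)) gradE.
Qed.

Lemma hol_ext f g x r : 0 < r -> (forall y, vn (y - x) < r -> f y = g y) ->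
  hol f x -> hol g x.
Proof. by move=> r0 e hf; exact: hdiff_hol (hdiff_ext r0 e hf). Qed.

(** Induction on n: the bound for the partial derivatives is integrated along
    the segment from x to x + h. *)
Lemma jet_bound n f x : hol_near f x ->
  (forall w, (size w <= n)%N -> pds w f x = 0) ->
  exists A e : R, [/\ 0 < e, 0 <= A & forall h, vn h < e -> cmod (f (x + h)) <= A * vn h ^+ n.+1].
Proof.
elim: n f => [|n ih] f hf hw.
  have fx : f x = 0 by exact: (hw [::]).
  have [r [M [r0 hr]]] := hf; have M0 := hol_onM0 r0 hr.
  exists (8 * M / r), (r / 4); split; [by rewrite divr_gt0|by rewrite divr_ge0 ?mulr_ge0// ltW|].
  move=> h hh; have [|t1 t2] := taylor1 r0 hr (h := h); first by move: hh; clear; lra.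
  set S := \sum_k _ in t1 t2.
  rewrite fx subr0 in t1; rewrite -(subrK S (f _)) expr1.
  apply: le_trans (cmodD _ _) _; apply: le_trans (lerD t1 t2) _.
  have q0 : 0 <= vn h / r by rewrite divr_ge0 ?vn_ge0// ltW.
  have q4 : vn h / r <= 1 / 4.
    by rewrite ler_pdivrMr//; move: hh; clear; lra.
  have -> : 8 * M / r * vn h = 8 * M * (vn h / r) by rewrite mulrAC mulrA.
  move: (vn h / r) q0 q4 => q q0 q4; rewrite expr2.
  have : M * q * q <= M * q * (1 / 4) by rewrite ler_wpM2l// mulr_ge0.
  by move: M0; clear; lra.
have /choice[A hA] : forall k : 'I_N, exists A : R, exists e : R,
    [/\ 0 < e, 0 <= A & forall h, vn h < e -> cmod (pd k f (x + h)) <= A * vn h ^+ n.+1].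
  move=> k; have [|w ws|A [e h]] := ih (pd k f); last by exists A, e.
    exact: hol_near_pd.
  have := hw (rcons w k); rewrite /pds foldr_rcons size_rcons ltnS => -> //.
have /choice[e he] := hA.
have [r [M [r0 hr]]] := hf.
pose B := \sum_k A k.
have B0 : 0 <= B by apply: sumr_ge0 => k _; have [] := he k.
have r2 : 0 < r / 2 by rewrite divr_gt0.
(* a common radius for all partial derivatives *)
pose d := \big[Num.min/(r / 2)]_k e k.
have d0 : 0 < d.
  rewrite /d; elim/big_ind : _ => //; first by move=> a b a0 b0; rewrite lt_min a0.
  by move=> k _; have [] := he k.
have dr : d <= r / 2 by exact: bigmin_le_id.
have dk k : d <= e k by exact: bigmin_le_cond.
exists B, d; split=> // h hd.
have hs (z : C) : cmod z <= 1 -> vn (z *: h) < d.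
  move=> z1; apply: le_lt_trans hd; rewrite vnZ ler_piMl// vn_ge0//.
have inr (z : C) : cmod z <= 1 -> vn (x + z *: h - x) < r / 2.
  by move=> z1; rewrite (addrC x) addrK; apply: lt_le_trans dr; exact: hs.
have rr : r / 2 <= r by move: r0; clear; lra.
have fx : f x = 0 by exact: (hw [::]).
(* f along the segment, and its derivative there *)
pose G (z : C) := f (x + z *: h).
pose F (z : C) := \sum_k pd k f (x + z *: h) * h 0 k.
have seg01 (s : R) : 0 <= s -> s <= 1 -> seg (0 : C) 1 s = s%:C /\ cmod (s%:C) = s.
  by move=> s0 s1; rewrite /seg add0r subr0 mulr1 cmod_real ger0_norm.
have Gd (s : R) : 0 <= s -> s <= 1 -> cderiv G (seg 0 1 s) (F (seg 0 1 s)).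
  move=> s0 s1; have [-> zs] := seg01 s s0 s1.
  have z1 : cmod (s%:C) <= 1 by rewrite zs.
  have := line_cderiv (hr _ (lt_le_trans (inr _ z1) rr)).1.
  by under [X in cderiv _ _ X]eq_bigr do rewrite gradE.
have Fc : scont F 0 1.
  move=> s s0 s1; have [-> zs] := seg01 s s0 s1.
  have z1 : cmod (s%:C) <= 1 by rewrite zs.
  apply/cont_seqP => u hu; apply: clim_sum => k _; apply: climM; last exact: clim_cst.
  have hk := (hol_pd r0 hr k).1.
  by have /cont_seqP := cderiv_cont (line_cderiv (hk _ (inr _ z1)).1); apply.
have := edge_le (M := B * vn h ^+ n.+2) Fc; rewrite (edge_ftc Fc Gd).
rewrite subr0 cmod1 mul1r /G scale1r scale0r addr0 fx subr0; apply.
move=> s s0 s1; have [-> zs] := seg01 s s0 s1.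
apply: le_trans (cmod_sum _ _ _) _.
rewrite /B mulr_suml; apply: ler_sum => k _.
have [_ A0 hk] := he k.
rewrite cmodM exprSr mulrA; apply: ler_pM; rewrite ?cmod_ge0 ?cmod_le_vn//.
have vs : vn (s%:C *: h) <= vn h by rewrite vnZ zs ler_piMl ?vn_ge0.
apply: le_trans (hk _ _) _; first by apply: le_lt_trans vs (lt_le_trans hd (dk k)).
by rewrite ler_wpM2l// lerXn2r// ?nnegrE ?vn_ge0.
Qed.

(** All derivatives at x vanish, so f is O(|h|^n) for every n, and its power
    series on lines are zero. *)
Lemma jets_vanish f x : hol_near f x -> (forall w, pds w f x = 0) ->
  exists2 r : R, 0 < r & forall y, vn (y - x) < r -> f y = 0.
Proof.
move=> hf hw; have [r [M [r0 hr]]] := hf.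
exists (r / 4); first by rewrite divr_gt0.
move=> y yr; apply: (hol_vanish r0 hr) (ltW yr) => h n hh.
have [A [e [e0 A0 he]]] := jet_bound (n := n) hf (fun w _ => hw w).
have v1 : 0 < vn h + 1 by have := vn_ge0 h; clear; lra.
exists (A * vn h ^+ n.+1), (Num.min (e / (vn h + 1)) 1); split.
  by rewrite lt_min ltr01 andbT divr_gt0.
move=> z; rewrite lt_min => /andP[ze z1].
have zh : vn (z *: h) < e.
  rewrite vnZ; rewrite ltr_pdivlMr// in ze; apply: le_lt_trans ze.
  by rewrite ler_wpM2l ?cmod_ge0// lerDl.
apply: le_trans (he _ zh) _; rewrite vnZ exprMn mulrCA mulrC ler_wpM2l//.
  by rewrite mulr_ge0// exprn_ge0// vn_ge0.
by rewrite exprS ler_piMl ?exprn_ge0 ?cmod_ge0// ltW.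
Qed.

(** The point whose k-th coordinate is moved to x_k + s (y_k - x_k). *)
Definition toward (k : 'I_N) x (s : R) y : V := y + ((1 - s)%:C * (x 0 k - y 0 k)) *: delta k.

(** Hadamard's quotient: by the fundamental theorem of calculus in the k-th
    coordinate, this is the difference quotient of f in the direction k,
    extended holomorphically across the hyperplane y_k = x_k. *)
Definition quotk (k : 'I_N) x f y : C := av (fun s : R => pd k f (toward k x s y)).

Lemma towardE k x s y j : toward k x s y 0 j =
  if j == k then x 0 k + s%:C * (y 0 k - x 0 k) else y 0 j.
Proof.
rewrite !mxE eqxx /=; case: eqVneq => [->|_]; last by rewrite mulr0 addr0.
by rewrite rmorphB rmorph1 mulr1; ring.
Qed.

Lemma rowBE (u v : V) j : (u - v) 0 j = u 0 j - v 0 j.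
Proof. by rewrite !mxE. Qed.

Lemma vn_toward k x s y : 0 <= s -> s <= 1 -> vn (toward k x s y - x) <= vn (y - x).
Proof.
Transparent vn.
move=> s0 s1; apply: ler_sum => j _; rewrite !rowBE towardE.
have [->|//] := eqVneq j k.
by rewrite addKl cmodM cmod_real ger0_norm// ler_piMl ?cmod_ge0.
Opaque vn.
Qed.

Lemma hol_toward k x s y f : hol f (toward k x s y) -> hol (f \o toward k x s) y.
Proof.
move=> hf.
have hc j : exists A : V, hdiff (fun y => toward k x s y 0 j) y A.
  have [->|jk] := eqVneq j k.
    rewrite (_ : (fun y => _) = fun y : V => x 0 k + s%:C * (y 0 k + - x 0 k)).
      eexists; apply: hdiffD; first exact: hdiff_cst.
      by apply: hdiffZ; apply: hdiffD; [exact: hdiff_coord|exact: hdiff_cst].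
    by apply/funext => z; rewrite towardE eqxx.
  rewrite (_ : (fun y => _) = fun y : V => y 0 j).
    by eexists; exact: hdiff_coord.
  by apply/funext => z; rewrite towardE (negbTE jk).
have /choice[A hA] := hc.
exact: hdiff_hol (hdiff_comp hA hf).
Qed.

Lemma hol_dsum n (F : R -> V -> C) x r M : 0 <= M ->
  (forall s : R, 0 <= s -> s <= 1 -> hol_on (F s) x r M) ->
  hol_on (fun y => dsum n (fun s => F s y)) x r M.
Proof.
move=> M0 hF y yr; split; last first.
  by apply: dsum_le => s s0 s1; have [] := hF s s0 s1 y yr.
have rg (k : 'I_(2 ^ n)) : 0 <= (k%:R / 2 ^+ n : R) /\ (k%:R / 2 ^+ n : R) <= 1.
  split; first by rewrite divr_ge0 ?exprn_ge0.
  by rewrite ler_pdivrMr ?exprn_gt0// mul1r -natrX ler_nat ltnW.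
apply: (@hdiff_hol _ _ _ _ ((2 ^+ n)^-1 *: \sum_(k < 2 ^ n) grad (F (k%:R / 2 ^+ n)) y)).
apply: hdiffZ; apply: (@hdiff_sum _ _ _ _ _ (fun (k : 'I_(2 ^ n)) y => F (k%:R / 2 ^+ n) y)).
by move=> k _; have [a b] := rg k; have [] := hF _ a b y yr.
Qed.

Lemma quotkP k x f r M : 0 < r -> hol_on f x r M ->
  hol_on (quotk k x f) x (r / 2) (16 * M / r) /\
  forall y, vn (y - x) < r / 2 ->
    f y = f (toward k x 0 y) + (y 0 k - x 0 k) * quotk k x f y.
Proof.
move=> r0 hf; have M0 := hol_onM0 r0 hf; have r2 : 0 < r / 2 by rewrite divr_gt0.
have rr : r / 2 <= r by move: r0; clear; lra.
have M1 : 0 <= 16 * M / r by rewrite divr_ge0 ?mulr_ge0// ltW.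
have hk := (hol_pd r0 hf k).1.
have hin s y : 0 <= s -> s <= 1 -> vn (y - x) < r / 2 -> vn (toward k x s y - x) < r / 2.
  by move=> s0 s1; apply: le_lt_trans; exact: vn_toward.
pose Fy y (z : C) := pd k f (toward k x 0 y + z *: ((y 0 k - x 0 k) *: delta k)).
have tw y (s : R) : toward k x 0 y + s%:C *: ((y 0 k - x 0 k) *: delta k) = toward k x s y.
  rewrite /toward -addrA scalerA -scalerDl; congr (_ + _ *: _).
  by rewrite !rmorphB rmorph1 rmorph0; ring.
have seg01 (s : R) : seg (0 : C) 1 s = s%:C by rewrite /seg add0r subr0 mulr1.
have sc y : vn (y - x) < r / 2 -> scont (Fy y) 0 1.
  move=> yr s s0 s1; rewrite seg01.
  apply: cderiv_cont; apply: line_cderiv; rewrite tw.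
  by apply: (hk _ _).1; exact: hin.
have eF y : (fun s => Fy y (seg 0 1 s)) = (fun s => pd k f (toward k x s y)).
  by apply/funext => s; rewrite seg01 /Fy tw.
have c01 y : vn (y - x) < r / 2 -> cont01 (fun s => pd k f (toward k x s y)).
  move=> yr; exact: (eq_ind _ (fun F => cont01 F) (scont01 (sc y yr)) _ (eF y)).
have hd n : hol_on (fun y => dsum n (fun s => pd k f (toward k x s y))) x (r / 2) (16 * M / r).
  apply: (hol_dsum n (F := fun s => pd k f \o toward k x s) M1) => s s0 s1 y yr.
  have [h1 h2] := hk _ (hin s y s0 s1 yr).
  by split; [exact: hol_toward|exact: h2].
have [H _] := hol_lim r2 hd (fun y yr => avP (c01 y yr)).
split=> // y yr.
pose G (z : C) := f (toward k x 0 y + z *: ((y 0 k - x 0 k) *: delta k)).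
have sc' : scont (fun z => (y 0 k - x 0 k) * Fy y z) 0 1.
  by move=> s s0 s1; apply: contM; [exact: cont_cst|exact: sc].
have Gd (s : R) : 0 <= s -> s <= 1 -> cderiv G (seg 0 1 s) ((y 0 k - x 0 k) * Fy y (seg 0 1 s)).
  move=> s0 s1; rewrite seg01.
  have := @line_cderiv _ _ f (toward k x 0 y) ((y 0 k - x 0 k) *: delta k) s%:C.
  rewrite tw => /(_ _ (hf _ (lt_le_trans (hin s y s0 s1 yr) rr)).1).
  rewrite (_ : \sum_j _ = pd k f (toward k x s y) * (y 0 k - x 0 k)).
    by rewrite mulrC /Fy tw.
  by under eq_bigr do rewrite gradE; exact: pd_sum_delta.
have e3 : edge (Fy y) 0 1 = quotk k x f y.
  Transparent edge. rewrite /edge subr0 mul1r. Opaque edge.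
  exact: (congr1 (@av R) (eF y)).
have := edge_ftc sc' Gd; rewrite edgeZ; last exact: sc.
rewrite e3 => ->; rewrite /G scale0r addr0.
rewrite -[1 : C]/(1%:C) tw addrC subrK; congr f.
apply/rowP => j; rewrite towardE; case: eqVneq => // ->.
by rewrite rmorph1 mul1r addrC subrK.
Qed.

Lemma pd_zero_line f y k e : 0 < e -> hol f y ->
  (forall z : C, cmod z < e -> f (y + z *: delta k) = 0) -> pd k f y = 0.
Proof.
move=> e0 hf hz.
have d1 := @line_cderiv _ _ f y (delta k) 0 (grad f y).
rewrite scale0r addr0 in d1; have {}d1 := d1 hf.
have d2 : cderiv (fun z => f (y + z *: delta k)) 0 0.
  apply: (cderiv_ext (F := fun=> 0) e0) (cderiv_cst 0 0) => w; rewrite subr0 => we.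
  by rewrite hz.
rewrite -(cderiv_uniq d1 d2) (bigD1 k)//= big1 ?addr0 ?gradE ?mxE ?eqxx ?mulr1//.
by move=> j jk; rewrite [X in _ * X]mxE eqxx (negbTE jk) mulr0.
Qed.

(** The radius and the bound of the quotient depend only on those of f: applied
    to a family of functions of c indexed by t, the quotients are bounded
    uniformly in t. *)
Lemma divide (L : seq 'I_N) : uniq L -> forall r M, 0 < r -> exists r' B, 0 < r' /\
  forall f x, hol_on f x r M ->
  (forall k y, k \in L -> vn (y - x) < r -> y 0 k = x 0 k -> f y = 0) ->
  exists2 g, hol_on g x r' B &
    forall y, vn (y - x) < r' -> f y = (\prod_(k <- L) (y 0 k - x 0 k)) * g y.
Proof.
elim: L => [|k L ih] /=.
  move=> _ r M r0; exists r, M; split=> // f x hf _; exists f => // y _.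
  by rewrite big_nil mul1r.
move=> /andP[kL uL] r M r0; have r2 : 0 < r / 2 by rewrite divr_gt0.
have [r' [B [r0' H]]] := ih uL (r / 2) (16 * M / r) r2.
exists (Num.min r' (r / 2)), B; split; first by rewrite lt_min r0'.
move=> f x hf hz; have [hq eq] := quotkP k r0 hf.
have rr : r / 2 <= r by move: r0; clear; lra.
have [|g hg eg] := H _ x hq.
  move=> j y jL yr yj; have jk : j != k by apply: contraNneq kL => <-.
  rewrite /quotk (av_ext (k := fun=> 0)) ?av_cst// => s s0 s1.
  have vt : vn (toward k x s y - x) < r / 2 by apply: le_lt_trans yr; exact: vn_toward.
  apply: (@pd_zero_line _ _ _ (r / 2)) => //.
    by apply: (hf _ _).1; exact: lt_le_trans rr.
  move=> z zr; apply: (hz j); first by rewrite inE jL orbT.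
    rewrite addrAC; apply: le_lt_trans (vnD _ _) _.
    rewrite vnZ vn_delta mulr1; move: vt zr; clear; lra.
  by rewrite mxE towardE (negbTE jk) !mxE eqxx (negbTE jk) mulr0 addr0.
exists g; first by move=> y; rewrite lt_min => /andP[yr _]; exact: hg.
move=> y; rewrite lt_min => /andP[yr yr2].
rewrite big_cons (eq y yr2) (eg y yr) mulrA (hz k) ?add0r// ?inE ?eqxx//.
  by apply: lt_le_trans rr; apply: le_lt_trans yr2; exact: vn_toward.
by rewrite towardE eqxx rmorph0 mul0r addr0.
Qed.
End Jets.

(** * The reciprocal of the Gamma function *)

Opaque av edge pd cmod vn cexp clog.
Section RGamma.
Variable R : realType.
Local Notation C := (Cpx R).
Local Notation "x %:C" := (real_complex R x : C).
Implicit Types (z w v : C).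

Lemma inv_diff (n : nat) : (0 < n)%N -> n%:R^-1 - n.+1%:R^-1 = (n%:R * n.+1%:R)^-1 :> R.
Proof.
move=> n0; rewrite -natr1; field.
by rewrite natr1 !pnatr_eq0 /= -lt0n n0.
Qed.

(** The increments are at most a constant times 1/(n (n+1)), which telescopes
    to 1/m - 1/n; N >= 2 K keeps |u n| <= 2 |u N| along the way. *)
Lemma ratio_step (u : nat -> C) (K : R) (N m n : nat) : (0 < N)%N -> 0 <= K -> 2 * K <= N%:R ->
  (forall n, (N <= n)%N -> cmod (u n.+1 - u n) <= cmod (u n) * (K / (n%:R * n.+1%:R))) ->
  (N <= m)%N -> (m <= n)%N ->
  cmod (u n) <= 2 * cmod (u N) /\ cmod (u n - u m) <= 2 * cmod (u N) * K * (m%:R^-1 - n%:R^-1).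
Proof.
move=> N0 K0 NK hu.
have main k : cmod (u (N + k)%N - u N) <= 2 * cmod (u N) * K * (N%:R^-1 - (N + k)%:R^-1)
    /\ cmod (u (N + k)%N) <= 2 * cmod (u N).
  elim: k => [|k [ih1 ih2]]; first by rewrite addn0 !subrr cmod0 mulr0; have := cmod_ge0 (u N); split => //; lra.
  have c0 := cmod_ge0 (u N).
  have st : cmod (u (N + k.+1)%N - u N) <= 2 * cmod (u N) * K * (N%:R^-1 - (N + k.+1)%:R^-1).
    apply: le_trans (cmod_tri _ (u (N + k)%N) _) _.
    have h := hu (N + k)%N (leq_addr _ _).
    have e := @inv_diff (N + k) (leq_trans N0 (leq_addr _ _)).
    have -> : N%:R^-1 - (N + k.+1)%:R^-1 = (N%:R^-1 - (N + k)%:R^-1) + ((N + k)%:R * (N + k).+1%:R)^-1 :> R.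
      by rewrite -e addrA subrK addnS.
    rewrite addnS addrC [leRHS]mulrDr; apply: lerD => //.
    apply: le_trans h _; rewrite mulrA ler_wpM2r//.
    by rewrite ler_wpM2r.
  split=> //.
  have : 2 * cmod (u N) * K * (N%:R^-1 - (N + k.+1)%:R^-1) <= cmod (u N).
    apply: le_trans (_ : 2 * cmod (u N) * K * N%:R^-1 <= _).
      by rewrite ler_wpM2l ?mulr_ge0// lerBlDr lerDl invr_ge0.
    rewrite ler_pdivrMr ?ltr0n//; have := ler_wpM2l c0 NK; clear; lra.
  have := le_trans (cmodB_ge _ _) st; clear; lra.
move=> Nm mn; split; first by have [_] := main (n - N)%N; rewrite subnKC// (leq_trans Nm).
elim: n mn => [|n ih].
  by rewrite leqn0 => /eqP->; rewrite !subrr cmod0 mulr0.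
rewrite leq_eqVlt => /orP[/eqP->|]; first by rewrite !subrr cmod0 mulr0.
rewrite ltnS => mn; have {}ih := ih mn.
have Nn : (N <= n)%N := leq_trans Nm mn.
apply: le_trans (cmod_tri _ (u n) _) _.
have -> : m%:R^-1 - n.+1%:R^-1 = (m%:R^-1 - n%:R^-1) + (n%:R * n.+1%:R)^-1 :> R.
  by rewrite -(inv_diff (leq_trans N0 Nn)) addrA subrK.
rewrite addrC [leRHS]mulrDr; apply: lerD => //.
apply: le_trans (hu n Nn) _; rewrite mulrA ler_wpM2r//.
rewrite ler_wpM2r//; have [_] := main (n - N)%N; rewrite subnKC//.
Qed.

(** An infinite product with factors 1 + O(1/n^2): it converges, and the bound
    of ratio_step keeps the limit within |u N| / 2 of u N, so it vanishes only
    with u N. *)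
Lemma ratio_lim (u : nat -> C) (K : R) (N : nat) : (0 < N)%N -> 0 <= K -> 4 * K <= N%:R ->
  (forall n, (N <= n)%N -> cmod (u n.+1 - u n) <= cmod (u n) * (K / (n%:R * n.+1%:R))) ->
  exists l, [/\ clim u l, cmod l <= 2 * cmod (u N), (l == 0) = (u N == 0) &
    forall n, (N <= n)%N -> cmod (u n) <= 2 * cmod (u N)].
Proof.
move=> N0 K0 NK hu.
have NK2 : 2 * K <= N%:R by lra.
have hs m n Nm mn := ratio_step N0 K0 NK2 hu Nm mn (m := m) (n := n).
have c0 := cmod_ge0 (u N).
have hm m n : (N <= m)%N -> (m <= n)%N -> cmod (u n - u m) <= 2 * cmod (u N) * K / m%:R.
  move=> Nm mn; have [_ h] := hs m n Nm mn; apply: le_trans h _.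
  by rewrite ler_wpM2l ?mulr_ge0// lerBlDr lerDl invr_ge0.
have cu : ccauchy u.
  move=> e e0; have [M hM] := archi_ex (2 * (2 * cmod (u N) * K) / e).
  exists (maxn N M) => n m; wlog nm : n m / (m <= n)%N => [H h1 h2|].
    have [le|/ltnW le] := leqP m n; first exact: H.
    by rewrite cmodBC; exact: H.
  rewrite !geq_max => /andP[_ _] /andP[Nm Mm].
  apply: le_lt_trans (hm _ _ Nm nm) _.
  have m0 : 0 < m%:R :> R by rewrite ltr0n (leq_trans N0).
  have M1 : M%:R <= m%:R :> R by rewrite ler_nat.
  rewrite ltr_pdivrMr//; rewrite ltr_pdivrMr// in hM.
  have := ler_wpM2l (ltW e0) M1; have : 0 <= 2 * cmod (u N) * K by rewrite !mulr_ge0.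
  move: hM; clear; lra.
have hb n : (N <= n)%N -> cmod (u n) <= 2 * cmod (u N) by move=> Nn; have [] := hs N n (leqnn _) Nn.
have [l hl] := complete_C cu; exists l; split => //.
  exact: (clim_le (N := N)) hl.
have hd : cmod (l - u N) <= cmod (u N) / 2.
  apply: (clim_le (u := fun n => u n - u N) (N := N)); last first.
    by apply: climB => //; exact: clim_cst.
  move=> n Nn; apply: le_trans (hm _ _ (leqnn _) Nn) _.
  rewrite ler_pdivrMr ?ltr0n//; have := ler_wpM2l c0 NK; clear; lra.
rewrite -!cmod_eq0; apply/eqP/eqP => h.
  have := cmodB_ge (u N) l; rewrite cmodBC h subr0; move: hd c0; clear; lra.
have := cmodB_ge l (u N); move: hd; rewrite h; have := cmod_ge0 l; clear; lra.
Qed.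

(** The reciprocal of the n-th term of Gauss's formula. Unlike that term it is
    an entire function of z. *)
Definition gauss_prod (n : nat) z : C :=
  (\prod_(j < n.+1) (z + j%:R)) / (n`!%:R * cexp (z * (ln (n%:R : R))%:C)).

Lemma gauss_prod_eq0 n z : (gauss_prod n z == 0) = [exists j : 'I_n.+1, z + (j : nat)%:R == 0].
Proof.
rewrite mulf_eq0 invr_eq0 mulf_eq0 pnatr_eq0 (gtn_eqF (fact_gt0 n)) (negbTE (cexp_neq0 _)) !orbF.
apply/prodf_eq0/existsP => [[j _ h]|[j h]]; exists j => //.
Qed.

Lemma gauss_prodS n z : (0 < n)%N -> gauss_prod n.+1 z =
  gauss_prod n z * ((1 + z / n.+1%:R) * cexp (- (z * (ln n.+1%:R - ln n%:R)%:C))).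
Proof.
move=> n0; rewrite /gauss_prod big_ord_recr/= factS natrM.
have -> : cexp (z * (ln n.+1%:R)%:C) = cexp (z * (ln n%:R)%:C) * cexp (z * (ln n.+1%:R - ln n%:R)%:C).
  by rewrite -cexpD -mulrDr -rmorphD /= subrKC.
rewrite cexpN.
have h1 := cexp_neq0 (z * (ln n%:R)%:C); have h2 := cexp_neq0 (z * (ln n.+1%:R - ln n%:R)%:C).
have h3 : (n`!%:R : C) != 0 by rewrite pnatr_eq0 -lt0n fact_gt0.
have h4 : (n.+1%:R : C) != 0 by rewrite pnatr_eq0.
move: h1 h2 h3 h4; move: (cexp _) (cexp _) (n`!%:R : C) (n.+1%:R : C) (\prod_(_ < _) _) => A B F' S P.
by clear => h1 h2 h3 h4; field; rewrite h1 h2 h3 h4.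
Qed.

Lemma ln_step (n : nat) : (0 < n)%N ->
  n.+1%:R^-1 <= ln n.+1%:R - ln n%:R :> R /\ ln n.+1%:R - ln n%:R <= n%:R^-1 :> R.
Proof.
move=> n0; have np : 0 < n%:R :> R by rewrite ltr0n.
have Sp : 0 < n.+1%:R :> R by rewrite ltr0n.
have h1 := expR_ge1Dx (ln n.+1%:R - ln n%:R : R).
have h2 := expR_ge1Dx (- (ln n.+1%:R - ln n%:R) : R).
move: h1 h2; rewrite opprB !expRD !expRN !lnK ?posrE// => h1 h2; split.
  have e : n%:R / n.+1%:R = 1 - n.+1%:R^-1 :> R by rewrite -natr1; field; rewrite natr1 gt_eqF.
  by move: h2; rewrite e; move: (ln _) (ln _) (_^-1); clear; move=> *; lra.
have e : n.+1%:R / n%:R = 1 + n%:R^-1 :> R by rewrite -natr1; field; rewrite gt_eqF.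
by move: h1; rewrite e; move: (ln _) (ln _) (_^-1); clear; move=> *; lra.
Qed.

(** 1 + z/(n+1) and n^-z (n+1)^z = exp(z (log(n+1) - log n)) agree up to
    O(1/n^2), uniformly for bounded z. *)
Lemma gauss_ratio_le (B : R) (n : nat) z : cmod z <= B -> (0 < n)%N -> 2 * B <= n%:R ->
  cmod ((1 + z / n.+1%:R) * cexp (- (z * (ln n.+1%:R - ln n%:R)%:C)) - 1) <=
  (B + 25 * B ^+ 2) / (n%:R * n.+1%:R).
Proof.
move=> zB n0 nB; have [l1 l2] := ln_step n0; set l := ln _ - ln _ in l1 l2 *.
have np : 0 < n%:R :> R by rewrite ltr0n.
have Sp : 0 < n.+1%:R :> R by rewrite ltr0n.
have B0 : 0 <= B := le_trans (cmod_ge0 z) zB.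
set w := z / _; set v := z * _; pose E := cexp (- v) - 1 - - v.
have -> : (1 + w) * cexp (- v) - 1 = (w - v) - w * v + (1 + w) * E by rewrite /E; ring.
have l0 : 0 <= l by apply: le_trans l1; rewrite invr_ge0 ltW.
have vB : cmod v <= B / n%:R.
  by rewrite cmodM cmod_real (ger0_norm l0) ler_pM ?cmod_ge0.
have wB : cmod w <= B / n.+1%:R.
  by rewrite cmodM cmodV cmod_nat ler_wpM2r// invr_ge0 ltW.
have v2 : cmod v <= 2^-1 by apply: le_trans vB _; rewrite ler_pdivrMr//; lra.
have w1 : cmod w <= 1.
  apply: le_trans wB _; rewrite ler_pdivrMr// mul1r -natr1; move: nB; clear -B0; lra.
have hE : cmod E <= 6 * cmod v ^+ 2 by rewrite /E -(cmodN v); apply: cexp_quad; rewrite cmodN.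
have e1 : cmod (w - v) <= B / (n%:R * n.+1%:R).
  have -> : w - v = z * (n.+1%:R^-1 - l)%:C.
    by rewrite /w /v (natrC R n.+1) -fmorphV -mulrBr -rmorphB.
  rewrite cmodM cmod_real ler_pM ?cmod_ge0 ?normr_ge0// -inv_diff// ler0_norm; move: l1 l2; move: (_^-1) (_^-1); clear; move=> *; lra.
have e2 : cmod (w * v) <= B ^+ 2 / (n%:R * n.+1%:R).
  rewrite cmodM; apply: le_trans (ler_pM (cmod_ge0 _) (cmod_ge0 _) wB vB) _.
  by rewrite expr2 invfM mulrACA (mulrC n.+1%:R^-1).
have e3 : cmod ((1 + w) * E) <= 24 * B ^+ 2 / (n%:R * n.+1%:R).
  have w2 : cmod (1 + w) <= 2 by apply: le_trans (cmodD _ _) _; rewrite cmod1; move: w1; clear; lra.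
  rewrite cmodM; apply: le_trans (ler_pM (cmod_ge0 _) (cmod_ge0 _) w2 hE) _.
  apply: le_trans (_ : 2 * (6 * (B / n%:R) ^+ 2) <= _).
    by rewrite !ler_pM2l// lerXn2r ?nnegrE ?cmod_ge0// divr_ge0// ltW.
  rewrite expr_div_n ler_pdivlMr ?mulr_gt0//.
  have -> : 2 * (6 * (B ^+ 2 / n%:R ^+ 2)) * (n%:R * n.+1%:R) = 12 * B ^+ 2 * (n.+1%:R / n%:R).
    by field; rewrite gt_eqF.
  have : n.+1%:R / n%:R <= 2 :> R by rewrite ler_pdivrMr// mulr_natl mulr2n -natrD ler_nat -addn1 leq_add2l.
  have := sqr_ge0 B; move: (B ^+ 2) (_ / _) => Q q Q0 q2; clear -Q0 q2; nra.
have -> : (B + 25 * B ^+ 2) / (n%:R * n.+1%:R) =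
  B / (n%:R * n.+1%:R) + B ^+ 2 / (n%:R * n.+1%:R) + 24 * B ^+ 2 / (n%:R * n.+1%:R).
  by rewrite -!mulrDl; congr (_ * _); ring.
apply: le_trans (cmodD _ _) _; apply: lerD => //.
by apply: le_trans (cmodB _ _) _; apply: lerD.
Qed.

(** The reciprocal of Gamma, an entire function. The convention 1/0 = 0 makes
    the formula correct at the poles of Gamma too. *)
Definition rG z : C := (Gamma z)^-1.

(** The index N from which the products are controlled depends only on the
    bound B; this uniformity gives local boundedness and holomorphy of the
    limit. *)
Lemma gauss_prod_cvg (B : R) : 0 <= B -> exists N : nat, (0 < N)%N /\ forall z, cmod z <= B ->
  exists l, [/\ clim (gauss_prod ^~ z) l, cmod l <= 2 * cmod (gauss_prod N z), (l == 0) = (gauss_prod N z == 0) &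
      forall n, (N <= n)%N -> cmod (gauss_prod n z) <= 2 * cmod (gauss_prod N z)].
Proof.
move=> B0; pose K := B + 25 * B ^+ 2.
have K0 : 0 <= K by rewrite addr_ge0// mulr_ge0// sqr_ge0.
have [N hN] := archi_ex (4 * K + 2 * B); exists N.+1; split=> // z zB.
apply: (@ratio_lim _ K) => //.
  by rewrite -natr1; lra.
move=> n Nn; have n0 : (0 < n)%N by exact: leq_trans Nn.
rewrite gauss_prodS//; set q := _ * cexp _.
have -> : gauss_prod n z * q - gauss_prod n z = gauss_prod n z * (q - 1) by rewrite mulrBr mulr1.
rewrite cmodM; apply: ler_wpM2l; first exact: cmod_ge0.
apply: gauss_ratio_le => //.
have : N%:R <= n%:R :> R by rewrite ler_nat ltnW.
lra.
Qed.

Lemma clim_gauss_prod z : clim (gauss_prod ^~ z) (rG z) /\ (rG z = 0 <-> exists j : nat, z + j%:R = 0).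
Proof.
have [N [N0 H]] := gauss_prod_cvg (cmod_ge0 z); have [l [hl _ l0 _]] := H z (lexx _).
have eG (n : nat) : (0 < n)%N -> n`!%:R * cpow n%:R z / \prod_(j < n.+1) (z + j%:R) = (gauss_prod n z)^-1.
  move=> n0; rewrite invf_div; congr (_ * _ / _).
  by rewrite /cpow natrC clog_real ?ltr0n.
have hG g : clim (fun n => (gauss_prod n z)^-1) g -> Gamma z = g.
  move=> hg; apply/cvg_lim => //; apply/climP.
  by apply: (clim_ext (N := 1%N)) hg => n n0; rewrite eG.
have zero : (l == 0) = `[< exists j : nat, z + j%:R = 0 >].
  rewrite l0 gauss_prod_eq0; apply/existsP/asboolP => [[j /eqP h]|[j h]]; first by exists j.
  have [jN|Nj] := ltnP j N.+1; first by exists (Ordinal jN); rewrite h.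
  exfalso; have lj : l = 0.
    apply: (clim_uniq hl); apply: (clim_ext (u := fun=> 0) (N := j)) (clim_cst _) => n jn.
    apply/esym/eqP; rewrite gauss_prod_eq0; apply/existsP.
    have jn' : (j < n.+1)%N by [].
    by exists (Ordinal jn'); rewrite /= h.
  have /eqP := lj; rewrite l0 gauss_prod_eq0 => /existsP[i /eqP hi].
  have /eqP : j%:R = (i : nat)%:R :> C by apply: (addrI z); rewrite h hi.
  by rewrite eqr_nat => /eqP e; move: Nj; rewrite e leqNgt ltn_ord.
have e : rG z = l.
  have [/eqP l00|ln0] := boolP (l == 0).
    rewrite /rG (hG 0) ?invr0 ?l00//.
    move: zero; rewrite l00 eqxx => /esym/asboolP[j hj].
    apply: (clim_ext (u := fun=> 0) (N := j)) (clim_cst _) => n jn.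
    apply/esym/eqP; rewrite invr_eq0 gauss_prod_eq0; apply/existsP.
    have jn' : (j < n.+1)%N by [].
    by exists (Ordinal jn'); rewrite /= hj.
  by rewrite /rG (hG l^-1) ?invrK//; exact: climV.
rewrite e; split=> //; split=> [h|h].
  by apply/asboolP; rewrite -zero h.
by apply/eqP; rewrite zero; apply/asboolP.
Qed.

Lemma gauss_prod_bound (B : R) n : 0 <= B -> exists A, forall z, cmod z <= B -> cmod (gauss_prod n z) <= A.
Proof.
move=> B0; exists ((\prod_(j < n.+1) (B + j%:R)) / (n`!%:R * expR (- (B * `|ln (n%:R : R)|)))) => z zB.
rewrite /gauss_prod cmodM cmodV cmod_prod cmodM cmod_nat cmod_cexp.
have f0 : 0 < (n`!)%:R :> R by rewrite ltr0n fact_gt0.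
apply: ler_pM; rewrite ?invr_ge0 ?mulr_ge0 ?expR_ge0 ?prodr_ge0//; first by move=> *; exact: cmod_ge0.
  apply: ler_prod => j _; rewrite cmod_ge0/=; apply: le_trans (cmodD _ _) _.
  by rewrite cmod_nat lerD2r.
rewrite lef_pV2 ?posrE ?mulr_gt0 ?expR_gt0// ler_pM2l// ler_expR lerNl.
rewrite mulrC ReCZ; apply: le_trans (ler_norm _) _; rewrite normrN normrM mulrC.
by apply: ler_wpM2r => //; exact: le_trans (Re_le_cmod _) zB.
Qed.

Lemma rG_bound (B : R) : 0 <= B -> exists A, 0 <= A /\ forall z, cmod z <= B -> cmod (rG z) <= A.
Proof.
move=> B0; have [N [_ H]] := gauss_prod_cvg B0; have [A hA] := gauss_prod_bound N B0.
exists (2 * A); split.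
  have := hA 0; rewrite cmod0 => /(_ B0); have := cmod_ge0 (gauss_prod N 0); lra.
move=> z zB; have [l [hl lb _ _]] := H z zB.
rewrite -(clim_uniq hl (clim_gauss_prod z).1); apply: le_trans lb _.
by rewrite ler_pM2l// hA.
Qed.

Lemma rG_eq0 z : rG z = 0 <-> exists j : nat, z + j%:R = 0.
Proof. by have [] := clim_gauss_prod z. Qed.

Lemma clim_ratio a : clim (fun n : nat => (a + n.+1%:R) / n%:R : C) 1.
Proof.
apply: clim_S; have h : clim (fun n => 1 + (a + 1) * n.+1%:R^-1) (1 + (a + 1) * 0 : C).
  have h1 := climZ (a + 1) (@clim_0inv R); exact: climD (clim_cst 1) h1.
move: h; rewrite mulr0 addr0; apply: (clim_ext (N := 0%N)) => n _.
have h4 : (n.+1%:R : C) != 0 by rewrite pnatr_eq0.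
by rewrite -(natr1 n.+1); move: (n.+1%:R : C) h4 => S h4; field.
Qed.

Lemma rG_rec z : rG z = z * rG (z + 1).
Proof.
have h1 := climZ z (clim_gauss_prod (z + 1)).1; apply: (clim_uniq _ h1).
have h2 := climM (clim_gauss_prod z).1 (clim_ratio z); rewrite mulr1 in h2.
apply: (clim_ext (N := 1%N)) h2 => n n0; rewrite /gauss_prod.
have -> : \prod_(j < n.+1) (z + j%:R) = z * \prod_(i < n) (z + 1 + i%:R).
  rewrite big_ord_recl/= mulr0n addr0; congr (_ * _); apply: eq_bigr => i _.
  by rewrite /bump/= add1n -addrA; congr (_ + _); rewrite addrC natr1.
rewrite [in RHS]big_ord_recr/= [in RHS]mulrDl [in RHS]mul1r cexpD.
have -> : cexp (ln (n%:R : R))%:C = n%:R by rewrite cexp_real lnK ?posrE ?ltr0n// natrC.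
have h3 : (n`!%:R : C) != 0 by rewrite pnatr_eq0 -lt0n fact_gt0.
have h4 : (n%:R : C) != 0 by rewrite pnatr_eq0 -lt0n.
have h1' := cexp_neq0 (z * (ln n%:R)%:C); rewrite -(natr1 n).
move: h1' h3 h4; move: (cexp _) (n`!%:R : C) (n%:R : C) (\prod_(_ < _) _) => A F' S P.
by clear => h1 h3 h4; field; rewrite h1 h3 h4.
Qed.

Lemma rG1 : rG 1 = 1.
Proof.
apply: (clim_uniq (clim_gauss_prod 1).1); apply: (clim_ext (N := 1%N)) (clim_ratio 0) => n n0.
rewrite add0r /gauss_prod mul1r cexp_real lnK ?posrE ?ltr0n//.
have -> : \prod_(j < n.+1) (1 + j%:R) = (n.+1)`!%:R :> C.
  rewrite fact_prod natr_prod big_add1/= big_mkord; apply: eq_bigr => j _.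
  by rewrite addrC natr1.
have h3 : (n`!%:R : C) != 0 by rewrite pnatr_eq0 -lt0n fact_gt0.
have h4 : (n%:R : C) != 0 by rewrite pnatr_eq0 -lt0n.
by rewrite factS natrM -natrC; field; rewrite h3 h4.
Qed.
End RGamma.

(** * Growth of 1/Gamma under integer translations *)

Opaque av edge pd cmod vn cexp clog.
Section Growth.
Variable R : realType.
Local Notation C := (Cpx R).
Local Notation "x %:C" := (real_complex R x : C).

Section HolClosure.
Variable N : nat.
Local Notation V := 'rV[C]_N.
Implicit Types (x y : V) (f g : V -> C).
Lemma hol_cst a x : hol (fun=> a) x. Proof. exact: hdiff_hol (hdiff_cst a x). Qed.

Lemma hol_coord k x : hol (fun y => y 0 k) x. Proof. exact: hdiff_hol (hdiff_coord k x). Qed.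

Lemma holD f g x : hol f x -> hol g x -> hol (fun y => f y + g y) x.
Proof. by move=> h1 h2; exact: hdiff_hol (hdiffD h1 h2). Qed.

Lemma holM f g x : hol f x -> hol g x -> hol (fun y => f y * g y) x.
Proof. by move=> h1 h2; exact: hdiff_hol (hdiffM h1 h2). Qed.

Lemma hol_sum (J : Type) (r : seq J) (P : pred J) (F : J -> V -> C) x :
  (forall i, P i -> hol (F i) x) -> hol (fun y => \sum_(i <- r | P i) F i y) x.
Proof. by move=> h; apply: hdiff_hol (hdiff_sum _ h). Qed.

Lemma hol_prod (J : Type) (r : seq J) (P : pred J) (F : J -> V -> C) x :
  (forall i, P i -> hol (F i) x) -> hol (fun y => \prod_(i <- r | P i) F i y) x.
Proof.
move=> h; elim: r => [|i r ih].
  have -> : (fun y => \prod_(i <- [::] | P i) F i y) = fun=> 1 by apply/funext => y; rewrite big_nil.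
  exact: hol_cst.
have -> : (fun y => \prod_(j <- i :: r | P j) F j y) =
  fun y => (if P i then F i y else 1) * \prod_(j <- r | P j) F j y.
  by apply/funext => y; rewrite big_cons; case: ifP => // _; rewrite mul1r.
by apply: holM => //; case Pi : (P i); [exact: h|exact: hol_cst].
Qed.

Lemma hol_comp1 f (G : C -> C) x d : hol f x -> cderiv G (f x) d -> hol (fun y => G (f y)) x.
Proof. by move=> h1 h2; exact: hdiff_hol (hdiff_cderiv h1 h2). Qed.

Lemma hol_cexp f x : hol f x -> hol (fun y => cexp (f y)) x.
Proof. by move=> h; exact: hol_comp1 h (cderiv_cexp _). Qed.
End HolClosure.

(** rG is a locally bounded limit of the entire functions gauss_prod n; the
    several-variable theorem hol_lim is applied with one variable. *)
Lemma rG_cderiv (z : C) : exists d, cderiv (@rG R) z d.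
Proof.
pose B := cmod z + 1; have B0 : 0 <= B by rewrite addr_ge0 ?cmod_ge0.
have [N [N0 H]] := gauss_prod_cvg B0; have [A hA] := gauss_prod_bound N B0.
pose x : 'rV[C]_1 := const_mx z.
have hB (y : 'rV[C]_1) : vn (y - x) < 1 -> cmod (y 0 0) <= B.
  move=> yx; have := cmod_le_vn (y - x) 0; rewrite !mxE => h1.
  by have := cmodB_ge (y 0 0) z; move: h1 yx; rewrite /B; clear; lra.
have hu n : hol_on (fun y : 'rV[C]_1 => gauss_prod (n + N) (y 0 0)) x 1 (2 * A).
  move=> y /hB yB; split; last first.
    have [l [_ _ _ h]] := H _ yB; apply: le_trans (h _ (leq_addl _ _)) _.
    by rewrite ler_pM2l// hA.
  have -> : (fun y : 'rV[C]_1 => gauss_prod (n + N) (y 0 0)) = fun y =>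
     (\prod_(j < (n + N).+1) (y 0 0 + j%:R)) *
     ((n + N)`!%:R^-1 * cexp ((- (ln ((n + N)%:R : R))%:C) * y 0 0)).
    apply/funext => w; rewrite /gauss_prod; congr (_ * _).
    by rewrite invfM -cexpN mulNr mulrC [RHS]mulrC (mulrC (w 0 0)).
  apply: holM; first by apply: hol_prod => j _; apply: holD (hol_coord _ _) (hol_cst _ _).
  apply: holM (hol_cst _ _) _; apply: hol_cexp; apply: holM (hol_cst _ _) (hol_coord _ _).
have hl (y : 'rV[C]_1) : vn (y - x) < 1 -> clim (fun n => gauss_prod (n + N) (y 0 0)) (rG (y 0 0)).
  move=> _; apply: (clim_sub (s := fun n => (n + N)%N)) (clim_gauss_prod _).1 => n; exact: leq_addr.
have [h _] := hol_lim ltr01 hu hl.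
have [hx _] : hol (fun y : 'rV[C]_1 => rG (y 0 0)) x /\ cmod (rG (x 0 0)) <= 2 * A.
  by apply: h; rewrite subrr vn0.
exists (\sum_k (grad (fun y : 'rV[C]_1 => rG (y 0 0)) x) 0 k * (const_mx 1 : 'rV[C]_1) 0 k).
have e : x = 0 + z *: const_mx 1 by apply/matrixP => i j; rewrite !mxE mulr1 add0r.
have hx' : hdiff (fun y : 'rV[C]_1 => rG (y 0 0)) (0 + z *: const_mx 1)
  (grad (fun y : 'rV[C]_1 => rG (y 0 0)) x) by rewrite -e.
have := line_cderiv hx'.
apply: (cderiv_ext ltr01) => w _; congr rG.
by rewrite !mxE add0r mulr1.
Qed.

Lemma hol_rG N (f : 'rV[C]_N -> C) x : hol f x -> hol (fun y => rG (f y)) x.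
Proof. by move=> h; have [d hd] := rG_cderiv (f x); exact: hol_comp1 h hd. Qed.

Lemma geo_growth (a : nat -> R) (q A : R) (M : nat) : 1 <= q -> 0 <= A ->
  (forall n, (n <= M)%N -> a n <= A) -> (forall n, (M <= n)%N -> a n.+1 <= q * a n) ->
  forall n, a n <= A * q ^+ n.
Proof.
move=> q1 A0 hA hq; elim=> [|n ih]; first by rewrite mulr1 hA.
have [nM|Mn] := leqP n.+1 M.
  by apply: le_trans (hA _ nM) _; rewrite ler_peMr// exprn_ege1.
apply: le_trans (hq n Mn) _; rewrite exprS mulrCA ler_wpM2l//.
by apply: le_trans q1.
Qed.

(** 1/Gamma(z + n) is 1/n! up to subexponential factors: by the functional
    equation the ratio of consecutive terms tends to 1. *)
Lemma rG_up (B q : R) : 0 <= B -> 1 < q -> exists2 A, 0 <= A &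
  forall (z : C) n, cmod z <= B -> cmod (rG (z + n%:R)) * n`!%:R <= A * q ^+ n.
Proof.
move=> B0 q1; have [M hM] := archi_ex ((1 + q * B) / (q - 1)).
have q10 : 0 < q - 1 by rewrite subr_gt0.
rewrite ltr_pdivrMr// in hM.
have [A [A0 hA]] := rG_bound (addr_ge0 B0 (ler0n R M)).
exists (A * M`!%:R); first by rewrite mulr_ge0.
move=> z n zB; move: n; apply: (@geo_growth _ q _ M); rewrite ?mulr_ge0 ?(ltW q1)//.
  move=> n nM; apply: ler_pM; rewrite ?cmod_ge0//; last by rewrite ler_nat leq_fact.
  apply: hA; apply: le_trans (cmodD _ _) _; rewrite cmod_nat; apply: lerD => //.
  by rewrite ler_nat.
move=> n Mn; rewrite -natr1 addrA (rG_rec (z + n%:R)) cmodM factS natrM.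
have -> : q * (cmod (z + n%:R) * cmod (rG (z + n%:R + 1)) * n`!%:R) =
  (q * cmod (z + n%:R)) * (cmod (rG (z + n%:R + 1)) * n`!%:R) by ring.
rewrite mulrCA; apply: ler_wpM2r; first by rewrite mulr_ge0 ?cmod_ge0.
have h1 : n%:R - B <= cmod (z + n%:R).
  by rewrite (addrC z); apply: le_trans (cmodD_ge _ _); rewrite cmod_nat lerB.
have Mn' : M%:R <= n%:R :> R by rewrite ler_nat.
have h2 := ler_wpM2r (ltW q10) Mn'.
have h3 := ler_wpM2l (le_trans ler01 (ltW q1)) h1.
by apply: le_trans h3; rewrite -natr1; move: h2 hM; move: (n%:R : R) (M%:R : R); clear; move=> ? ? ? ?; lra.
Qed.

(** 1/Gamma(z - n) is at most n! up to subexponential factors, for the same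
    reason. *)
Lemma rG_down (B q : R) : 0 <= B -> 1 < q -> exists2 A, 0 <= A &
  forall (z : C) n, cmod z <= B -> cmod (rG (z - n%:R)) <= A * q ^+ n * n`!%:R.
Proof.
move=> B0 q1; have [M hM] := archi_ex (B / (q - 1)).
have q10 : 0 < q - 1 by rewrite subr_gt0.
rewrite ltr_pdivrMr// in hM.
have [A [A0 hA]] := rG_bound (addr_ge0 B0 (ler0n R M)).
have f0 n : 0 < (n`!)%:R :> R by rewrite ltr0n fact_gt0.
exists A => // z n zB; rewrite -ler_pdivrMr//; move: n.
apply: (@geo_growth _ q _ M); rewrite ?mulr_ge0 ?(ltW q1)//.
  move=> n nM; rewrite ler_pdivrMr//; apply: le_trans (_ : A <= _).
    apply: hA; apply: le_trans (cmodB _ _) _; rewrite cmod_nat; apply: lerD => //.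
    by rewrite ler_nat.
  by rewrite ler_peMr// ler1n fact_gt0.
move=> n Mn; rewrite (rG_rec (z - n.+1%:R)).
have -> : z - n.+1%:R + 1 = z - n%:R by rewrite -natr1; ring.
rewrite cmodM factS natrM ler_pdivrMr ?mulr_gt0 ?ltr0n ?fact_gt0//.
have -> : q * (cmod (rG (z - n%:R)) / n`!%:R) * (n.+1%:R * n`!%:R) = q * n.+1%:R * cmod (rG (z - n%:R)).
  by field; rewrite gt_eqF.
apply: ler_wpM2r; first exact: cmod_ge0.
apply: le_trans (cmodB _ _) _; rewrite cmod_nat.
have Mn' : M%:R <= n.+1%:R :> R by rewrite ler_nat ltnW.
have h2 := ler_wpM2r (ltW q10) Mn'.
by move: zB h2 hM; move: (n.+1%:R : R) (M%:R : R) (cmod z); clear; move=> ? ? ? ? ?; lra.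
Qed.
End Growth.

(** * Multi-indices and unordered sums *)

Section Multi.
Variable m : nat.
Local Notation I := {ffun 'I_m -> nat}.
Implicit Types (n : I).
Definition mdeg n : nat := \sum_k n k.
Definition up (k : 'I_m) (p : nat) n : I := [ffun j => n j + (if j == k then p else 0)]%N.
Definition down (k : 'I_m) (p : nat) n : I := [ffun j => n j - (if j == k then p else 0)]%N.
Lemma upK k p : cancel (up k p) (down k p).
Proof. by move=> n; apply/ffunP => j; rewrite !ffunE addnK. Qed.

Lemma downK k p n : (p <= n k)%N -> up k p (down k p n) = n.
Proof. by move=> h; apply/ffunP => j; rewrite !ffunE subnK//; case: eqVneq => [->|]. Qed.

Lemma mdeg_up k p n : mdeg (up k p n) = (mdeg n + p)%N.
Proof.
rewrite /mdeg (eq_bigr (fun j => n j + (if j == k then p else 0))%N); last by move=> j _; rewrite ffunE.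
by rewrite big_split/= -big_mkcond/= big_pred1_eq.
Qed.

Lemma leq_mdeg n k : (n k <= mdeg n)%N.
Proof. by rewrite /mdeg (bigD1 k)//= leq_addr. Qed.

(** The multinomial coefficient is at most m^|n|; by induction, |n| (|n| - 1)!
    is split over the m indices. *)
Lemma fact_mdeg n : ((mdeg n)`! <= m ^ mdeg n * \prod_k (n k)`!)%N.
Proof.
move e : (mdeg n) => N; elim: N n e => [|N ih] n e.
  by rewrite fact0 expn0 mul1n prodn_gt0// => i; exact: fact_gt0.
rewrite factS -{1}e big_distrl/=.
have -> : (m ^ N.+1 = \sum_(k < m) m ^ N)%N by rewrite sum_nat_const card_ord expnS.
rewrite big_distrl/=; apply: leq_sum => k _.
case nk : (n k) => [|p]; first by rewrite mul0n.
have e' : mdeg (down k 1 n) = N.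
  by apply/eqP; rewrite -(eqn_add2r 1) -(mdeg_up k 1) downK ?nk// e addn1.
apply: leq_trans (leq_mul (leqnn _) (ih _ e')) _.
rewrite mulnCA leq_mul2l; apply/orP; right.
rewrite (bigD1 k)//= [X in (_ <= X)%N](bigD1 k)//= ffunE eqxx nk subn1/= factS -mulnA.
rewrite leq_mul2l/= leq_mul2l; apply/orP; right; apply: eq_leq; apply: eq_bigr => j jk.
by rewrite ffunE (negbTE jk) subn0.
Qed.
End Multi.

Opaque av edge pd cmod vn cexp clog.
Section Sums.
Variables (R : realType) (m : nat).
Local Notation C := (Cpx R).
Local Notation "x %:C" := (real_complex R x : C).
Local Notation I := {ffun 'I_m -> nat}.
Implicit Types (n : I) (f : I -> C) (A B : seq I).

(** Unordered summation along the finite sets of indices, represented by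
    duplicate-free sequences. *)
Definition usum f (l : C) := forall e : R, 0 < e -> exists A, forall B, uniq B ->
  {subset A <= B} -> cmod (\sum_(n <- B) f n - l) < e.
Definition box (N : nat) : seq I :=
  [seq [ffun k => (g k : nat)] | g : {ffun 'I_m -> 'I_N} <- enum {: {ffun 'I_m -> 'I_N}}].
Definition bsum N f := \sum_(n <- box N) f n.

Lemma box_uniq N : uniq (box N).
Proof.
rewrite map_inj_uniq ?enum_uniq// => g h /ffunP e; apply/ffunP => k; apply/val_inj.
by have := e k; rewrite !ffunE.
Qed.

Lemma mem_box N n : reflect (forall k, (n k < N)%N) (n \in box N).
Proof.
apply: (iffP mapP) => [[g _ ->] k|h]; first by rewrite ffunE ltn_ord.
exists [ffun k => Ordinal (h k)]; first by rewrite mem_enum.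
by apply/ffunP => k; rewrite !ffunE.
Qed.

Lemma sub_box A : exists N, {subset A <= box N}.
Proof.
exists (\max_(n <- A) mdeg n).+1 => n nA; apply/mem_box => k; rewrite ltnS.
by apply: leq_trans (leq_mdeg n k) _; exact: leq_bigmax_seq.
Qed.

Lemma box_sub N M : (N <= M)%N -> {subset box N <= box M}.
Proof. by move=> NM n /mem_box h; apply/mem_box => k; exact: leq_trans (h k) NM. Qed.

Lemma geo_sum_le (r : R) N : 0 <= r -> r < 1 -> \sum_(j < N) r ^+ j <= (1 - r)^-1.
Proof.
move=> r0 r1; have d : 0 < 1 - r by rewrite subr_gt0.
rewrite -(ler_pM2l d) mulfV ?gt_eqF//.
have := subrX1 r N => e; have : (1 - r) * (\sum_(j < N) r ^+ j) = 1 - r ^+ N.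
  by rewrite -opprB mulNr -e opprB.
by move=> ->; rewrite lerBlDr lerDl exprn_ge0.
Qed.

Lemma box_geo (r : R) N : 0 <= r -> r < 1 ->
  \sum_(n <- box N) r ^+ mdeg n <= (1 - r)^-1 ^+ m.
Proof.
move=> r0 r1; rewrite big_map big_enum/=.
have -> : \sum_(g : {ffun 'I_m -> 'I_N}) r ^+ mdeg [ffun k => (g k : nat)] =
   \sum_(g : {ffun 'I_m -> 'I_N}) \prod_(k < m) r ^+ g k.
  apply: eq_bigr => g _; rewrite prodrXr /mdeg; congr (_ ^+ _).
  by apply: eq_bigr => k _; rewrite ffunE.
rewrite -(bigA_distr_bigA (fun (k : 'I_m) (j : 'I_N) => r ^+ j)) /= prodr_const card_ord.
by apply: lerXn2r; rewrite ?nnegrE ?sumr_ge0 ?invr_ge0 ?subr_ge0 ?(ltW r1) ?geo_sum_le// => *; exact: exprn_ge0.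
Qed.

Lemma sum_geo (r : R) A : 0 <= r -> r < 1 -> uniq A ->
  \sum_(n <- A) r ^+ mdeg n <= (1 - r)^-1 ^+ m.
Proof.
move=> r0 r1 uA; have [N hN] := sub_box A; apply: le_trans (box_geo N r0 r1).
rewrite [leRHS](perm_big (A ++ [seq n <- box N | n \notin A])).
  by rewrite big_cat/= lerDl sumr_ge0// => n _; rewrite exprn_ge0.
apply: uniq_perm; first exact: box_uniq.
  rewrite cat_uniq uA filter_uniq ?box_uniq// andbT/=; apply/hasPn => n.
  by rewrite mem_filter => /andP[].
move=> n; rewrite mem_cat mem_filter; case nA : (n \in A) => //=.
exact: hN.
Qed.

Definition dombd f (A r : R) := forall n, cmod (f n) <= A * r ^+ mdeg n.

(** Geometric domination by the degree, which implies absolute convergence and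
    is stable under multiplication by polynomials in the index. *)
Definition dom f := exists A r : R, [/\ 0 <= A, 0 <= r, r < 1 & dombd f A r].

Lemma dom_sum_le f (A r : R) B : 0 <= A -> 0 <= r -> r < 1 -> dombd f A r -> uniq B ->
  cmod (\sum_(n <- B) f n) <= A * (1 - r)^-1 ^+ m.
Proof.
move=> A0 r0 r1 h uB; apply: le_trans (cmod_sum _ _ _) _.
apply: le_trans (_ : \sum_(n <- B) A * r ^+ mdeg n <= _); first by apply: ler_sum => n _.
by rewrite -mulr_sumr ler_wpM2l// sum_geo.
Qed.

(** Outside the box of side N the degree is at least N, so half of the
    geometric decay is left to bound the tail by q^N with q = sqrt r. *)
Lemma dom_tail f : dom f -> exists K q : R, [/\ 0 <= q, q < 1 &
  forall N B, uniq B -> (forall n, n \in B -> n \notin box N) ->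
    cmod (\sum_(n <- B) f n) <= K * q ^+ N].
Proof.
move=> [A [r [A0 r0 r1 h]]]; pose q := Num.sqrt r.
have q0 : 0 <= q by rewrite sqrtr_ge0.
have qq : q ^+ 2 = r by rewrite sqr_sqrtr.
have q1 : q < 1 by rewrite -(@ltr_pXn2r _ 2)// ?nnegrE// qq expr1n.
exists (A * (1 - q)^-1 ^+ m), q; split=> // N B uB hB.
apply: le_trans (cmod_sum _ _ _) _.
apply: le_trans (_ : \sum_(n <- B) (A * q ^+ N) * q ^+ mdeg n <= _); last first.
  rewrite -mulr_sumr [leRHS]mulrAC; apply: ler_wpM2l; first by rewrite mulr_ge0 ?exprn_ge0.
  exact: sum_geo.
rewrite !big_seq; apply: ler_sum => n nB; apply: le_trans (h n) _.
rewrite -mulrA ler_wpM2l// -qq -exprM mul2n -addnn exprD ler_wpM2r ?exprn_ge0//.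
apply: ler_wiXn2l => //; first exact: ltW.
have /mem_box hn := hB n nB; rewrite leqNgt; apply/negP => lt; apply: hn => k.
exact: leq_ltn_trans (leq_mdeg n k) lt.
Qed.

Lemma box_split f N B : uniq B -> {subset box N <= B} ->
  \sum_(n <- B) f n = bsum N f + \sum_(n <- [seq n <- B | n \notin box N]) f n.
Proof.
move=> uB sB; rewrite /bsum -big_cat; apply: perm_big; apply: uniq_perm => //.
  rewrite cat_uniq box_uniq filter_uniq// andbT/=; apply/hasPn => n.
  by rewrite mem_filter => /andP[].
move=> n; rewrite mem_cat mem_filter; case nA : (n \in box N) => //=.
exact: sB.
Qed.

Lemma usum_box f : dom f -> exists2 l, usum f l & clim (fun N => bsum N f) l.
Proof.
move=> /dom_tail[K [q [q0 q1 hK]]].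
have hd N B : uniq B -> {subset box N <= B} -> cmod (\sum_(n <- B) f n - bsum N f) <= K * q ^+ N.
  move=> uB sB; rewrite (box_split f uB sB) addrC addrA addNr add0r.
  by apply: hK; rewrite ?filter_uniq// => n; rewrite mem_filter => /andP[].
have [l hl] : exists l, clim (fun N => bsum N f) l.
  apply: complete_C => e e0; have [N hN] := geo_lt K q0 q1 e0.
  exists N => n p; wlog np : n p / (p <= n)%N => [H h1 h2|].
    have [le|/ltnW le] := leqP p n; first exact: H.
    by rewrite cmodBC; exact: H.
  move=> Nn Np; apply: le_lt_trans (hN _ Np).
  by apply: hd; [exact: box_uniq|exact: box_sub].
exists l => // e e0; have e2 : 0 < e / 2 by rewrite divr_gt0.
have [N hN] := geo_lt K q0 q1 e2; have [M hM] := hl _ e2.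
exists (box (maxn N M)) => B uB sB.
apply: le_lt_trans (cmod_tri _ (bsum (maxn N M) f) _) _; rewrite (splitr e).
apply: ltrD; last by apply: hM; rewrite leq_maxr.
by apply: le_lt_trans (hd _ _ uB sB) _; apply: hN; rewrite leq_maxl.
Qed.

Lemma usum_clim f l : usum f l -> clim (fun N => bsum N f) l.
Proof.
move=> h e e0; have [A hA] := h e e0; have [N hN] := sub_box A.
exists N => n Nn; apply: hA; first exact: box_uniq.
by move=> i iA; apply: (box_sub Nn); exact: hN.
Qed.

Lemma usum_uniq f l l' : usum f l -> usum f l' -> l = l'.
Proof. by move=> /usum_clim h1 /usum_clim h2; exact: clim_uniq h1 h2. Qed.

Lemma usumZ a f l : usum f l -> usum (fun n => a * f n) (a * l).
Proof.
move=> h e e0; have d : 0 < cmod a + 1 by rewrite ltr_wpDl ?cmod_ge0.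
have [A hA] := h _ (divr_gt0 e0 d); exists A => B uB sB.
rewrite -mulr_sumr -mulrBr cmodM; have := hA B uB sB; rewrite ltr_pdivlMr// mulrC.
have := cmod_ge0 (\sum_(n <- B) f n - l); move: (cmod (_ - _)) (cmod a); clear.
move=> x y; lra.
Qed.

Lemma usum_ext f g l : f =1 g -> usum f l -> usum g l.
Proof. by move=> /funext ->. Qed.

(** Terms with n_k < p vanish, so the sum may be taken over the image of n -> n
    + p e_k. This reindexing gives the differential equations and the
    coincidences at integral parameters. *)
Lemma usum_shift k p f l : (forall n, (n k < p)%N -> f n = 0) -> usum f l ->
  usum (fun n => f (up k p n)) l.
Proof.
move=> hf h e e0; have [A hA] := h e e0; exists (map (down k p) A) => B uB sB.
pose E := [seq n <- undup A | n \notin map (up k p) B].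
have := hA (map (up k p) B ++ E); rewrite big_cat/= big_map.
have -> : \sum_(n <- E) f n = 0.
  rewrite big_seq big1// => n; rewrite mem_filter mem_undup => /andP[nB nA].
  apply: hf; rewrite ltnNge; apply/negP => pn; move: nB => /negP; apply.
  by rewrite -(downK pn) map_f// sB// map_f.
rewrite addr0; apply.
  rewrite cat_uniq map_inj_uniq ?uB; last exact: can_inj (upK k p).
  rewrite filter_uniq ?undup_uniq// andbT/=; apply/hasPn => n.
  by rewrite mem_filter => /andP[].
move=> n nA; rewrite mem_cat mem_filter mem_undup nA andbT.
by case: (n \in _).
Qed.

(** Agreement with the limit along the filter of finite sets, which defines
    F_C. *)
Lemma usum_sum f l : usum f l -> summability.sum (K := C) (R := C) f = l.
Proof.
move=> h; have FF := @summability.totally_filter I.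
apply/cvg_lim => //; apply/(@cvgrPdist_lt _ _ _ summability.totally _ (summability.partial_sum f)) => e e0; have [r er r0] := pos_real e0.
have [A hA] := h r r0; exists [fset n | n in A]%fset => // B /= /fsubsetP sB.
rewrite /summability.partial_sum er cmodE ltcR cmodBC.
rewrite -(big_seq_fsetE _ B xpredT f).
by apply: hA; [exact: fset_uniq|move=> n nA; apply: sB; rewrite in_fset].
Qed.

(** n q^n <= 1 + q + ... + q^(n-1) for 0 <= q <= 1, with q = sqrt r. *)
Lemma linear_geo (a r : R) : 0 <= a -> 0 <= r -> r < 1 -> exists B q : R,
  [/\ 0 <= B, 0 <= q, q < 1 & forall N : nat, (N%:R + a) * r ^+ N <= B * q ^+ N].
Proof.
move=> a0 r0 r1; pose q := Num.sqrt r.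
have q0 : 0 <= q by rewrite sqrtr_ge0.
have qq : q ^+ 2 = r by rewrite sqr_sqrtr.
have q1 : q < 1 by rewrite -(@ltr_pXn2r _ 2)// ?nnegrE// qq expr1n.
have d : 0 < 1 - q by rewrite subr_gt0.
exists ((1 - q)^-1 + a), q; split=> //; first by rewrite addr_ge0// invr_ge0 ltW.
move=> N; rewrite -qq -exprM mul2n -addnn exprD mulrA; apply: ler_wpM2r; first exact: exprn_ge0.
have h1 : q ^+ N <= 1 by rewrite exprn_ile1// ltW.
rewrite mulrDl; apply: lerD; last by rewrite ler_piMr.
apply: le_trans (geo_sum_le N q0 q1).
have -> : N%:R * q ^+ N = \sum_(j < N) q ^+ N by rewrite sumr_const card_ord mulr_natl.
by apply: ler_sum => j _; apply: ler_wiXn2l => //; [exact: ltW|exact: ltnW].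
Qed.

Lemma dom_lin f (b : I -> C) (a : R) : 0 <= a ->
  (forall n, cmod (b n) <= (mdeg n)%:R + a) -> dom f -> dom (fun n => b n * f n).
Proof.
move=> a0 hb [A [r [A0 r0 r1 h]]]; have [B [q [B0 q0 q1 hq]]] := linear_geo a0 r0 r1.
exists (A * B), q; split=> //; first by rewrite mulr_ge0.
move=> n; rewrite cmodM -mulrA; apply: le_trans (_ : ((mdeg n)%:R + a) * (A * r ^+ mdeg n) <= _).
  by apply: ler_pM; rewrite ?cmod_ge0.
by rewrite mulrCA ler_wpM2l.
Qed.
End Sums.

(** * The operators of the system in logarithmic coordinates *)

Opaque av edge pd cmod vn cexp clog rG.
Section Operators.
Variables (R : realType) (m : nat).
Local Notation C := (Cpx R).
Local Notation V := 'rV[C]_m.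
Local Notation "x %:C" := (real_complex R x : C).
Implicit Types (f g : V -> C) (t x : V) (k : 'I_m) (a b s : C) (c : V).

(** theta_k + s in the coordinates t = log x, where theta_k is d/dt_k. *)
Definition tth1 k s f t : C := pd k f t + s * f t.

(** theta + s in the coordinates t = log x. *)
Definition tth s f t : C := \sum_k pd k f t + s * f t.
Definition ECt a b c k f t : C :=
  tth1 k 0 (tth1 k (c 0 k - 1) f) t - cexp (t 0 k) * tth a (tth b f) t.

Lemma near_nearW t (P : V -> Prop) : (\forall y \near t, P y) ->
  \forall y \near t, \forall z \near y, P z.
Proof.
move=> /nbhs_vnP[r r0 h]; apply/nbhs_vnP; exists (r / 2); first by rewrite divr_gt0.
move=> y yr; apply/nbhs_vnP; exists (r / 2); first by rewrite divr_gt0.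
move=> z zr; apply: h; apply: le_lt_trans (vn_tri _ y _) _; rewrite (splitr r).
exact: ltrD.
Qed.

Lemma hol_near_near f t : hol_near f t -> \forall y \near t, hol_near f y.
Proof.
move=> [r [M [r0 h]]]; apply/nbhs_vnP; exists (r / 2); first by rewrite divr_gt0.
move=> y yr; exists (r / 2), M; split; first by rewrite divr_gt0.
by apply: hol_on_sub h _; rewrite [leRHS](splitr r) lerD2r ltW.
Qed.

Lemma hol_near_hol f t : hol_near f t -> hol f t.
Proof. by move=> [r [M [r0 h]]]; have [] := h t; rewrite ?subrr ?vn0. Qed.

Lemma hol_nearP f t : hol_near f t <-> \forall y \near t, hol f y.
Proof.
split=> [/hol_near_near|h]; first by apply: filterS => y; exact: hol_near_hol.
by apply: near_hol; apply: filterS h => y /holP.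
Qed.

Lemma pd_near f g t k : (\forall y \near t, f y = g y) -> hol f t -> pd k f t = pd k g t.
Proof. by move=> /nbhs_vnP[r r0 h] hf; exact: pd_ext r0 h hf. Qed.

Lemma hol_near_ext f g t : (\forall y \near t, f y = g y) -> hol_near f t -> hol_near g t.
Proof.
move=> e /hol_nearP h; apply/hol_nearP.
have e' := near_nearW e.
apply: filterS2 e' h => y /nbhs_vnP[r r0 h1] h2; exact: hol_ext r0 h1 h2.
Qed.

Lemma hol_nearD f g t : hol_near f t -> hol_near g t -> hol_near (fun y => f y + g y) t.
Proof.
move=> /hol_nearP h1 /hol_nearP h2; apply/hol_nearP.
by apply: filterS2 h1 h2 => y; exact: holD.
Qed.

Lemma hol_nearM f g t : hol_near f t -> hol_near g t -> hol_near (fun y => f y * g y) t.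
Proof.
move=> /hol_nearP h1 /hol_nearP h2; apply/hol_nearP.
by apply: filterS2 h1 h2 => y; exact: holM.
Qed.

Lemma hol_near_cst s t : hol_near (fun=> s) t.
Proof. by apply/hol_nearP; near=> y; exact: hol_cst. Unshelve. all: by end_near. Qed.

Lemma hol_near_sum (J : Type) (r : seq J) (P : pred J) (F : J -> V -> C) x :
  (forall i, P i -> hol_near (F i) x) -> hol_near (fun y => \sum_(i <- r | P i) F i y) x.
Proof.
move=> h; elim: r => [|i r ih].
  have -> : (fun y => \sum_(i <- [::] | P i) F i y) = fun=> 0 by apply/funext => y; rewrite big_nil.
  exact: hol_near_cst.
case Pi : (P i).
  have -> : (fun y => \sum_(j <- i :: r | P j) F j y) =
    fun y => F i y + \sum_(j <- r | P j) F j y by apply/funext => y; rewrite big_cons Pi.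
  by apply: hol_nearD ih; exact: h.
have -> // : (fun y => \sum_(j <- i :: r | P j) F j y) =
    fun y => \sum_(j <- r | P j) F j y by apply/funext => y; rewrite big_cons Pi.
Qed.

Lemma pd_sum (J : Type) (r : seq J) (P : pred J) (F : J -> V -> C) x k :
  (forall i, P i -> hol (F i) x) -> pd k (fun y => \sum_(i <- r | P i) F i y) x =
  \sum_(i <- r | P i) pd k (F i) x.
Proof.
move=> h; rewrite (hdiff_pd k (hdiff_sum r h)).
have -> : (\sum_(i <- r | P i) grad (F i) x) 0 k = \sum_(i <- r | P i) grad (F i) x 0 k.
  by rewrite summxE.
by apply: eq_bigr => i _; rewrite gradE.
Qed.

Lemma pdD f g x k : hol f x -> hol g x -> pd k (fun y => f y + g y) x = pd k f x + pd k g x.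
Proof. by move=> h1 h2; have [_] := holD_pd h1 h2. Qed.

Lemma pdZ s f x k : hol f x -> pd k (fun y => s * f y) x = s * pd k f x.
Proof. by move=> h1; have [_] := holZ_pd s h1. Qed.

Lemma scalerowE s (u : V) k : (s *: u) 0 k = s * u 0 k. Proof. by rewrite mxE. Qed.

Lemma sum_lin (A B : 'I_m -> C) s : \sum_i (A i + s * B i) = \sum_i A i + s * \sum_i B i.
Proof. by rewrite big_split/= -mulr_sumr. Qed.

Lemma pdM f g x k : hol f x -> hol g x ->
  pd k (fun y => f y * g y) x = pd k f x * g x + f x * pd k g x.
Proof.
move=> h1 h2; apply: etrans (hdiff_pd k (hdiffM h1 h2)) _.
apply: etrans (addrowE _ _ _) _; apply: congr2.
  exact: etrans (scalerowE (g x) _ _) (etrans (mulrC _ _) (congr1 (fun z => z * g x) (gradE f x k))).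
exact: etrans (scalerowE (f x) _ _) (congr1 (fun z => f x * z) (gradE g x k)).
Qed.

(** The square of theta, applied to f. *)
Definition hess_sum f t : C := \sum_i \sum_j pd i (pd j f) t.

(** Expanding the products of first order operators; the second derivatives
    only enter through d_k^2 f and (theta)^2 f. *)
Lemma ECtE a b c k f t : hol_near f t -> ECt a b c k f t =
  pd k (pd k f) t + (c 0 k - 1) * pd k f t
  - cexp (t 0 k) * (hess_sum f t + (a + b) * (\sum_j pd j f t) + a * b * f t).
Proof.
move=> h; have hf := hol_near_hol h; have hp j := hol_near_hol (hol_near_pd j h).
have hz s : hol (fun y => s * f y) t by exact: holM (hol_cst _ _) hf.
have e1 j i s : pd i (tth1 j s f) t = pd i (pd j f) t + s * pd i f t.
  by rewrite /tth1 pdD// pdZ.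
have e2 i s : pd i (tth s f) t = \sum_j pd i (pd j f) t + s * pd i f t.
  by rewrite /tth pdD ?pdZ ?pd_sum//; apply: hol_sum => j _.
rewrite /ECt {1}/tth1 e1 mul0r addr0 {1}/tth; congr (_ - _ * _).
have E : \sum_i pd i (tth b f) t = hess_sum f t + b * \sum_i pd i f t.
  apply: etrans (sum_lin (fun i => \sum_j pd i (pd j f) t) (fun i => pd i f t) b).
  by apply: eq_bigr => i _; exact: e2.
apply: etrans (congr1 (fun z => z + a * tth b f t) E) _.
rewrite /tth; generalize (hess_sum f t); generalize (\sum_i pd i f t); generalize (f t).
by clear; move=> A B D; ring.
Qed.

Lemma ECt_val_ext (z w1 w2 w3 p p' q q' l l' s s' v v' : C) :
  p = p' -> q = q' -> l = l' -> s = s' -> v = v' ->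
  p + z * q - w1 * (l + w2 * s + w3 * v) = p' + z * q' - w1 * (l' + w2 * s' + w3 * v').
Proof. by move=> -> -> -> -> ->. Qed.

Lemma ECt_ext a b c k f g t : hol_near f t -> (\forall y \near t, f y = g y) ->
  ECt a b c k f t = ECt a b c k g t.
Proof.
move=> h e; have hg := hol_near_ext e h; rewrite !ECtE//.
have e' : \forall y \near t, forall j, pd j f y = pd j g y.
  have h' := (hol_nearP _ _).1 h; apply: filterS2 (near_nearW e) h' => y e1 h1 j.
  exact: pd_near e1 h1.
have e2 i j : pd i (pd j f) t = pd i (pd j g) t.
  apply: pd_near; last exact: hol_near_hol (hol_near_pd j h).
  by apply: filterS e' => y.
have e1 j : pd j f t = pd j g t := nbhs_singleton e' j.
have e0 := nbhs_singleton e.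
have lf : hess_sum f t = hess_sum g t by apply: eq_bigr => i _; apply: eq_bigr => j _.
have sf : \sum_j pd j f t = \sum_j pd j g t by apply: eq_bigr => j _.
exact: ECt_val_ext (e2 k k) (e1 k) lf sf e0.
Qed.

(** First and second partial derivatives converge by hol_lim, applied twice, so
    a limit of solutions is a solution for the limit parameters. *)
Lemma ECt_lim a b (cn : nat -> V) c k (u : nat -> V -> C) f t (r M : R) : 0 < r ->
  (forall n, hol_on (u n) t r M) ->
  (forall y, vn (y - t) < r -> clim (fun n => u n y) (f y)) ->
  clim (fun n => cn n 0 k) (c 0 k) ->
  clim (fun n => ECt a b (cn n) k (u n) t) (ECt a b c k f t).
Proof.
move=> r0 hu hl hc; have [hf hp] := hol_lim r0 hu hl.
have r2 : 0 < r / 2 by rewrite divr_gt0.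
have tt : vn (t - t) = 0 by rewrite subrr vn0.
have d1 j : clim (fun n => pd j (u n) t) (pd j f t) by apply: hp; rewrite tt.
have d2 i j : clim (fun n => pd i (pd j (u n)) t) (pd i (pd j f) t).
  have h1 n : hol_on (pd j (u n)) t (r / 2) (16 * M / r) by have [] := hol_pd r0 (hu n) j.
  have h2 y : vn (y - t) < r / 2 -> clim (fun n => pd j (u n) y) (pd j f y).
    by move=> yr; apply: hp; apply: lt_le_trans yr _; rewrite ler_pdivrMr// ler_peMr// ltW// ltr1n.
  by have [_ h3] := hol_lim r2 h1 h2; apply: h3; rewrite tt.
have d0 : clim (fun n => u n t) (f t) by apply: hl; rewrite tt.
have en n : ECt a b (cn n) k (u n) t = pd k (pd k (u n)) t + (cn n 0 k - 1) * pd k (u n) t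
  - cexp (t 0 k) * (hess_sum (u n) t + (a + b) * (\sum_j pd j (u n) t) + a * b * u n t).
  by apply: ECtE; exists r, M.
rewrite ECtE; last by exists r, M.
apply: (clim_ext (N := 0%N)) (fun n _ => esym (en n)) _.
apply: climB; first apply: climD => //.
  by apply: climM => //; apply: climB hc (clim_cst _).
apply: climZ; apply: climD; last exact: climZ.
apply: climD; first by apply: clim_sum => i _; apply: clim_sum => j _.
by apply: climZ; apply: clim_sum => j _.
Qed.

(** The monomial x^s in the coordinates t; it is a joint eigenfunction of the
    d/dt_k. *)
Definition expfun (s : 'I_m -> C) t : C := cexp (\sum_k t 0 k * s k).
Lemma expfun_pd (s : 'I_m -> C) t : hol (expfun s) t /\ forall k, pd k (expfun s) t = s k * expfun s t.
Proof.
have h j : hdiff (fun y : V => y 0 j * s j) t (s j *: delta_mx 0 j).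
  have := hdiffZ (s j) (hdiff_coord j t).
  by have -> : (fun y : V => s j * y 0 j) = (fun y : V => y 0 j * s j) by apply/funext => y; rewrite mulrC.
have h2 := hdiff_sum (index_enum _) (P := xpredT) (fun j _ => h j).
have h3 := hdiff_cderiv h2 (cderiv_cexp _).
split; first exact: hdiff_hol h3.
move=> k; rewrite (hdiff_pd k h3) mxE mulrC summxE; congr (_ * _).
rewrite (bigD1 k)//= big1 ?addr0; first by rewrite !mxE !eqxx mulr1.
by move=> j jk; rewrite !mxE eqxx /= eq_sym (negbTE jk) mulr0.
Qed.

Section ExpSum.
Variables (T : Type) (S : seq T) (al : T -> C) (s : T -> 'I_m -> C).
Local Notation esum al := (fun t => \sum_(n <- S) al n * expfun (s n) t).
Lemma esum_hol (be : T -> C) t : hol (esum be) t.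
Proof. by apply: hol_sum => n _; apply: holM (hol_cst _ _) _; have [] := expfun_pd (s n) t. Qed.

Lemma esum_pd (be : T -> C) k : pd k (esum be) = esum (fun n => s n k * be n).
Proof.
apply/funext => t; rewrite pd_sum; last first.
  by move=> n _; apply: holM (hol_cst _ _) _; have [] := expfun_pd (s n) t.
apply: eq_bigr => n _; have [h1 h2] := expfun_pd (s n) t.
by rewrite pdZ// h2; ring.
Qed.

Lemma esum_tth1 (be : T -> C) k z : tth1 k z (esum be) = esum (fun n => (s n k + z) * be n).
Proof.
apply/funext => t; rewrite /tth1 esum_pd mulr_sumr -big_split; apply: eq_bigr => n _ /=.
by ring.
Qed.

Lemma esum_tth (be : T -> C) z : tth z (esum be) = esum (fun n => (\sum_k s n k + z) * be n).
Proof.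
apply/funext => t; rewrite /tth (eq_bigr _ (fun k _ => congr1 (@^~ t) (esum_pd be k))) exchange_big/=.
rewrite mulr_sumr -big_split; apply: eq_bigr => n _ /=.
by rewrite -mulr_suml -mulr_suml; ring.
Qed.

Lemma esum_ECt a b c k t : ECt a b c k (esum al) t =
  \sum_(n <- S) s n k * (s n k + c 0 k - 1) * (al n * expfun (s n) t) -
  \sum_(n <- S) cexp (t 0 k) * ((\sum_k s n k + a) * (\sum_k s n k + b)) * (al n * expfun (s n) t).
Proof.
rewrite /ECt !esum_tth !esum_tth1 mulr_sumr; congr (_ - _); apply: eq_bigr => n _; ring.
Qed.
End ExpSum.
End Operators.

(** * The series G_J and their convergence *)

Opaque av edge pd cmod vn cexp clog rG.
Section Series.
Variables (R : realType) (m : nat).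
Local Notation C := (Cpx R).
Local Notation V := 'rV[C]_m.
Local Notation "x %:C" := (real_complex R x : C).
Local Notation I := {ffun 'I_m -> nat}.
Variables (a b : C).
Implicit Types (c t : V) (J : cube m) (n : I) (k : 'I_m) (s : 'I_m -> C).

(** The difference a^J - a = b^J - b. *)
Definition shift_sum c J : C := \sum_k (J k)%:R * (1 - c 0 k).

(** The exponents of the J-th local solution. *)
Definition expo c J n k : C := (n k)%:R + (J k)%:R * (1 - c 0 k).

(** The coefficient depends on J and n only through the exponent s, which makes
    its recurrence, and the coincidence of two series with the same exponents,
    visible. *)
Definition coef c s : C := (\prod_k (rG (1 + s k) * rG (c 0 k + s k))) *
  (rG (1 - a - \sum_k s k) * rG (1 - b - \sum_k s k)).
Definition expterm c t s : C := coef c s * expfun s t.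
Definition term J c t n : C := expterm c t (expo c J n).
Definition Gser J c t : C := lim ((fun N => bsum N (term J c t)) @ \oo).

Lemma expo_sum c J n : \sum_k expo c J n k = (mdeg n)%:R + shift_sum c J.
Proof. by rewrite big_split/= /mdeg natr_sum. Qed.

Lemma cmod_bool (d : bool) (z : C) : cmod (d%:R * z) <= cmod z.
Proof. by case: d; rewrite ?mul1r// mul0r cmod0 cmod_ge0. Qed.

Lemma cmod1B c k : cmod (1 - c 0 k) <= 1 + cmod (c 0 k).
Proof. by apply: le_trans (cmodB _ _) _; rewrite cmod1. Qed.

Lemma shift_sum_le c J : cmod (shift_sum c J) <= m%:R + vn c.
Proof.
Transparent vn.
apply: le_trans (cmod_sum _ _ _) _.
apply: le_trans (_ : \sum_k (1 + cmod (c 0 k)) <= _).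
  by apply: ler_sum => k _; apply: le_trans (cmod_bool _ _) (cmod1B _ _).
by rewrite big_split/= sumr_const card_ord.
Opaque vn.
Qed.

(** Room for the four subexponential factors. *)
Lemma q_choice (y : R) : 0 <= y -> y < 1 -> exists2 q : R, 1 < q & q ^+ 4 * y < 1.
Proof.
move=> y0 y1; pose d := (1 - y) / 16; exists (1 + d); first by rewrite /d; lra.
have d0 : 0 < d by rewrite /d; lra.
have d1 : d <= 1 by rewrite /d; lra.
have e : (1 + d) ^+ 2 <= 1 + 3 * d by rewrite expr2; nra.
have e0 : 0 <= (1 + d) ^+ 2 by rewrite exprn_ge0//; lra.
have e2 : ((1 + d) ^+ 2) ^+ 2 <= 1 + 15 * d.
  apply: le_trans (_ : (1 + 3 * d) ^+ 2 <= _); first by rewrite lerXn2r// nnegrE; lra.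
  by rewrite expr2; nra.
rewrite (exprM _ 2 2); apply: le_lt_trans (ler_wpM2r y0 e2) _.
by rewrite /d; nra.
Qed.

Lemma expfun_expo c J n t : expfun (expo c J n) t =
  \prod_k cexp (t 0 k) ^+ n k * cexp (\sum_k t 0 k * ((J k)%:R * (1 - c 0 k))).
Proof.
rewrite /expfun; have -> : \sum_k t 0 k * expo c J n k =
  \sum_k (n k)%:R * t 0 k + \sum_k t 0 k * ((J k)%:R * (1 - c 0 k)).
  by rewrite -big_split/=; apply: eq_bigr => k _; rewrite /expo mulrDr (mulrC (t 0 k)).
by rewrite cexpD cexp_sum; congr (_ * _); apply: eq_bigr => k _; rewrite cexp_nat.
Qed.

(** On the half space Re t_k <= T the monomial e^(t.s) is at most e^(T |n|), up
    to a factor which depends on bounds of c and t. *)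
Lemma expfun_expo_le c J n t (B T : R) : vn c <= B -> vn t <= B -> (forall k, ReC (t 0 k) <= T) ->
  cmod (expfun (expo c J n) t) <= expR T ^+ mdeg n * expR (B * (1 + B)).
Proof.
move=> cB tB tT; rewrite expfun_expo cmodM; have B0 : 0 <= B := le_trans (vn_ge0 c) cB.
apply: ler_pM; rewrite ?cmod_ge0//.
  rewrite cmod_prod /mdeg -prodrXr; apply: ler_prod => k _; rewrite cmod_ge0/= cmodX cmod_cexp.
  by rewrite lerXn2r ?nnegrE ?expR_ge0// ler_expR.
rewrite cmod_cexp ler_expR; apply: le_trans (ler_norm _) _.
apply: le_trans (Re_le_cmod _) _; apply: le_trans (cmod_sum _ _ _) _.
apply: le_trans (_ : vn t * (1 + B) <= _); last by rewrite ler_wpM2r// addr_ge0.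
Transparent vn.
rewrite /vn mulr_suml; apply: ler_sum => k _; rewrite cmodM; apply: ler_wpM2l; first exact: cmod_ge0.
apply: le_trans (cmod_bool _ _) _; apply: le_trans (cmod1B _ _) _; rewrite lerD2l.
exact: le_trans (cmod_le_vn _ _) cB.
Opaque vn.
Qed.

(** Collects the bounds of rG, with F = prod_k n_k! and f = |n|!: two factors
    1/F, two factors f, and f <= M^N F with M = m. *)
Lemma term_bd_num (N : nat) (A1 A2 q X F f E M : R) : 0 < F -> 0 <= f -> f <= M ^+ N * F ->
  0 <= A1 -> 0 <= A2 -> 0 <= q -> 0 <= X -> 0 <= E ->
  (A1 * q ^+ N / F) ^+ 2 * (A2 * q ^+ N * f) ^+ 2 * (X ^+ N * E) <=
  (A1 ^+ 2 * A2 ^+ 2 * E) * (q ^+ 4 * (M ^+ 2 * X)) ^+ N.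
Proof.
move=> F0 f0 h A10 A20 q0 X0 E0.
have -> : (A1 * q ^+ N / F) ^+ 2 * (A2 * q ^+ N * f) ^+ 2 * (X ^+ N * E) =
  (A1 ^+ 2 * A2 ^+ 2 * E) * ((q ^+ N) ^+ 4 * X ^+ N) * (f / F) ^+ 2.
  by field; rewrite gt_eqF.
have -> : (q ^+ 4 * (M ^+ 2 * X)) ^+ N = ((q ^+ N) ^+ 4 * X ^+ N) * (M ^+ N) ^+ 2.
  by rewrite (exprMn N (q ^+ 4)) (exprMn N (M ^+ 2)) (exprAC q 4 N) (exprAC M 2 N) -mulrA (mulrC (X ^+ N)).
rewrite -(mulrA (A1 ^+ 2 * A2 ^+ 2 * E)); do 2 (apply: ler_wpM2l; first by rewrite !mulr_ge0 ?exprn_ge0).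
have h' : f / F <= M ^+ N by rewrite ler_pdivrMr.
have h0 : 0 <= f / F by rewrite divr_ge0// ltW.
by rewrite lerXn2r ?nnegrE// (le_trans h0).
Qed.

(** For x = e^t the series is dominated by sum of (m^2 max |x_k|)^|n|, up to
    subexponential factors q^(4 |n|), uniformly for bounded c and t. *)
Lemma term_bd (B T : R) : 0 <= B -> m%:R ^+ 2 * expR T < 1 -> exists A r : R,
  [/\ 0 <= A, 0 <= r, r < 1 & forall J c t, vn c <= B -> vn t <= B ->
     (forall k, ReC (t 0 k) <= T) -> dombd (term J c t) A r].
Proof.
move=> B0 hT; have y0 : 0 <= m%:R ^+ 2 * expR T by rewrite mulr_ge0 ?exprn_ge0 ?expR_ge0.
have [q q1 qy] := q_choice y0 hT; have q0 : 0 <= q by apply: le_trans ler01 (ltW q1).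
have B10 : 0 <= 2 + 2 * B by lra.
have [A1 A10 h1] := @rG_up R _ _ B10 q1.
pose B2 := 1 + cmod a + cmod b + m%:R + B.
have ca := cmod_ge0 a; have cb := cmod_ge0 b; have m0 := ler0n R m.
have B20 : 0 <= B2 by rewrite /B2; lra.
have [A2 A20 h2] := @rG_down R _ _ B20 q1.
exists ((A1 ^+ m) ^+ 2 * A2 ^+ 2 * expR (B * (1 + B))), (q ^+ 4 * (m%:R ^+ 2 * expR T)).
split=> //; first by rewrite !mulr_ge0 ?exprn_ge0 ?expR_ge0.
  by rewrite mulr_ge0 ?exprn_ge0.
move=> J c t cB tB tT n; rewrite /term /expterm cmodM.
pose F : R := (\prod_k (n k)`!)%N%:R.
have F0 : 0 < F by rewrite ltr0n prodn_gt0// => k; exact: fact_gt0.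
have hf : (mdeg n)`!%:R <= m%:R ^+ mdeg n * F by rewrite -natrX -natrM ler_nat fact_mdeg.
apply: le_trans (term_bd_num F0 (ler0n _ _) hf (exprn_ge0 m A10) A20 q0 (expR_ge0 T) (expR_ge0 _)).
apply: ler_pM; rewrite ?cmod_ge0//; last exact: expfun_expo_le.
rewrite /coef cmodM; apply: ler_pM; rewrite ?cmod_ge0//.
  have -> : (A1 ^+ m * q ^+ mdeg n / F) ^+ 2 = \prod_k ((A1 * q ^+ n k / (n k)`!%:R) ^+ 2).
    rewrite prodrXl /F natr_prod; congr (_ ^+ 2).
    rewrite !big_split/= prodr_const card_ord prodrXr -prodfV//.
  rewrite cmod_prod; apply: ler_prod => k _; rewrite cmod_ge0/= cmodM expr2.
  have f0 : 0 < ((n k)`!)%:R :> R by rewrite ltr0n fact_gt0.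
  have ck : cmod (c 0 k) <= B := le_trans (cmod_le_vn _ _) cB.
  have kB : cmod ((J k)%:R * (1 - c 0 k)) <= 1 + B.
    apply: le_trans (cmod_bool _ _) _; apply: le_trans (cmod1B _ _) _.
    by rewrite lerD2l.
  apply: ler_pM; rewrite ?cmod_ge0// ler_pdivlMr// /expo.
    have -> : 1 + ((n k)%:R + (J k)%:R * (1 - c 0 k)) = (1 + (J k)%:R * (1 - c 0 k)) + (n k)%:R.
      by rewrite -addrA; congr (_ + _); rewrite addrC.
    by apply: h1; apply: le_trans (cmodD _ _) _; rewrite cmod1; move: kB B0; clear; lra.
  have -> : c 0 k + ((n k)%:R + (J k)%:R * (1 - c 0 k)) = (c 0 k + (J k)%:R * (1 - c 0 k)) + (n k)%:R.
    by rewrite -addrA; congr (_ + _); rewrite addrC.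
  by apply: h1; apply: le_trans (cmodD _ _) _; move: kB B0 ck; clear; lra.
have hk := shift_sum_le c J.
have hd (z : C) : cmod z <= cmod a + cmod b ->
    cmod (rG (1 - z - \sum_k expo c J n k)) <= A2 * q ^+ mdeg n * (mdeg n)`!%:R.
  move=> zab; rewrite expo_sum.
  have -> : 1 - z - ((mdeg n)%:R + shift_sum c J) = (1 - z - shift_sum c J) - (mdeg n)%:R.
    by rewrite opprD addrA addrAC.
  apply: h2; apply: le_trans (cmodB _ _) _.
  have := cmodB 1 z; rewrite cmod1 /B2; move: hk cB zab; clear; lra.
rewrite cmodM expr2; apply: ler_pM; rewrite ?cmod_ge0//; apply: hd.
  by rewrite lerDl.
by rewrite lerDr.
Qed.
End Series.

(** * Differential equations, monodromy and coincidences of the G_J *)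

Opaque av edge pd cmod vn cexp clog rG.
Section SeriesProperties.
Variables (R : realType) (m : nat).
Local Notation C := (Cpx R).
Local Notation V := 'rV[C]_m.
Local Notation "x %:C" := (real_complex R x : C).
Local Notation I := {ffun 'I_m -> nat}.
Variables (a b : C) (T : R).
Hypothesis hT : m%:R ^+ 2 * expR T < 1.
Implicit Types (c t : V) (J : cube m) (n : I) (k : 'I_m) (s : 'I_m -> C).
Local Notation term_ab := (term a b).
Local Notation Gser := (Gser a b).
Local Notation expterm_ab := (expterm a b).
Local Notation coef_ab := (coef a b).

(** A half space, invariant under t_k -> t_k + 2 pi i, on which all the series
    converge. *)
Definition good t := forall k, ReC (t 0 k) <= T.

Lemma term_dom J c t : good t -> dom (term_ab J c t).
Proof.
move=> tT; have B0 : 0 <= vn c + vn t by rewrite addr_ge0 ?vn_ge0.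
have [A [r [A0 r0 r1 h]]] := @term_bd R m a b _ _ B0 hT; exists A, r; split=> //.
by apply: h => //; rewrite ?lerDl ?lerDr vn_ge0.
Qed.

Lemma G_usum J c t : good t -> usum (term_ab J c t) (Gser J c t) /\
  clim (fun N => bsum N (term_ab J c t)) (Gser J c t).
Proof.
move=> /(term_dom J c)/usum_box[l h1 h2].
have -> : Gser J c t = l by apply/cvg_lim => //; apply/climP.
by split.
Qed.

Lemma G_le (B : R) : 0 <= B -> exists M, forall J c t N, vn c <= B -> vn t <= B -> good t ->
  cmod (bsum N (term_ab J c t)) <= M /\ cmod (Gser J c t) <= M.
Proof.
move=> B0; have [A [r [A0 r0 r1 h]]] := @term_bd R m a b _ _ B0 hT.
exists (A * (1 - r)^-1 ^+ m) => J c t N cB tB tT.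
have hb N' : cmod (bsum N' (term_ab J c t)) <= A * (1 - r)^-1 ^+ m.
  by apply: dom_sum_le (box_uniq m N') => //; exact: h.
by split=> //; apply: (clim_le (N := 0%N)) (G_usum J c tT).2 => p _.
Qed.

Lemma bsum_expfun J c N : (fun t => bsum N (term_ab J c t)) =
  fun t => \sum_(n <- box m N) coef_ab c (expo c J n) * expfun (expo c J n) t.
Proof. by []. Qed.

Lemma vn_near_le (x y : V) (r B : R) : vn (y - x) < r -> vn x + r <= B -> vn y <= B.
Proof.
move=> yr xB; have := vn_tri y x 0; rewrite !subr0 => h.
apply: le_trans h _; apply: le_trans xB; rewrite addrC lerD2l; exact: ltW.
Qed.

(** The bound M only depends on bounds of c and t. *)
Lemma G_hol_t (B : R) : 0 <= B -> exists M, forall J c t (r : R), 0 < r -> vn c <= B -> vn t + r <= B ->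
  (forall y, vn (y - t) < r -> good y) ->
  hol_on (Gser J c) t r M /\ forall N, hol_on (fun y => bsum N (term_ab J c y)) t r M.
Proof.
move=> B0; have [M hM] := G_le B0; exists M => J c t r r0 cB tB hg.
have h N : hol_on (fun y => bsum N (term_ab J c y)) t r M.
  move=> y yr; rewrite bsum_expfun; split; first exact: esum_hol.
  by have [] := hM J c y N cB (vn_near_le yr tB) (hg y yr).
split=> //; have [] := hol_lim r0 h (f := Gser J c); last by [].
by move=> y yr; have [] := G_usum J c (hg y yr).
Qed.

Lemma expo_hol J n k c : hol (fun c => expo c J n k) c.
Proof.
apply: holD (hol_cst _ _) (holM (hol_cst _ _) _).
have -> : (fun y : V => 1 - y 0 k) = fun y => 1 + (-1) * y 0 k by apply/funext => y; rewrite mulN1r.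
exact: holD (hol_cst _ _) (holM (hol_cst _ _) (hol_coord _ _)).
Qed.

Lemma term_hol_c J t n c : hol (fun c => term_ab J c t n) c.
Proof.
have hs k := expo_hol J n k c.
have hS : hol (fun c => \sum_k expo c J n k) c by apply: hol_sum => k _.
have hN (z : C) : hol (fun c => z - \sum_k expo c J n k) c.
  have -> : (fun y : V => z - \sum_k expo y J n k) = fun y => z + (-1) * \sum_k expo y J n k.
    by apply/funext => y; rewrite mulN1r.
  exact: holD (hol_cst _ _) (holM (hol_cst _ _) hS).
apply: holM.
  apply: holM; last by apply: holM; apply: hol_rG.
  apply: hol_prod => k _; apply: holM; apply: hol_rG; apply: holD => //; first exact: hol_cst.
  exact: hol_coord.
by apply: hol_cexp; apply: hol_sum => k _; apply: holM (hol_cst _ _) (hs k).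
Qed.

(** Holomorphy in the parameters, also at integral values, is what makes the
    limits computable. *)
Lemma G_hol_c (B : R) : 0 <= B -> exists M, forall J c t (r : R), 0 < r -> vn c + r <= B ->
  vn t <= B -> good t -> hol_on (fun c' => Gser J c' t) c r M.
Proof.
move=> B0; have [M hM] := G_le B0; exists M => J c t r r0 cB tB hg.
have h N : hol_on (fun c' => bsum N (term_ab J c' t)) c r M.
  move=> y yr; split; first by apply: hol_sum => n _; exact: term_hol_c.
  by have [] := hM J y t N (vn_near_le yr cB) tB hg.
have [] := hol_lim r0 h (f := fun c' => Gser J c' t); last by [].
by move=> y yr; have [] := G_usum J y hg.
Qed.

Lemma expo_up J c k n p : expo c J (up k p n) = fun j => expo c J n j + (if j == k then p else 0)%N%:R.
Proof. by apply/funext => j; rewrite /expo ffunE natrD addrAC. Qed.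

Lemma rec_alg (z w S r1 r2 P r3 r4 : C) :
  (z + 1) * (z + 1 + w - 1) * (r1 * r2 * P * (- (S + a) * r3 * (- (S + b) * r4))) =
  (S + a) * (S + b) * ((z + 1) * r1 * ((z + 1 + w - 1) * r2) * P * (r3 * r4)).
Proof. ring. Qed.

(** The functional equation of rG for the four factors that change when s_k is
    increased by 1; the two signs cancel. *)
Lemma coef_rec c k s :
  (s k + 1) * (s k + 1 + c 0 k - 1) * coef_ab c (fun j => s j + (if j == k then 1 else 0)%N%:R) =
  (\sum_j s j + a) * (\sum_j s j + b) * coef_ab c s.
Proof.
have hsum : \sum_j (s j + (if j == k then 1 else 0)%N%:R) = \sum_j s j + 1.
  rewrite big_split/=; congr (_ + _); rewrite (bigD1 k)//= eqxx big1 ?addr0// => j.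
  by case: (j == k).
rewrite /coef_ab hsum (bigD1 k)//= [X in _ = _ * (X * _)](bigD1 k)//= eqxx mulr1n.
rewrite (eq_bigr (fun j => rG (1 + s j) * rG (c 0 j + s j))); last first.
  by move=> j jk; rewrite (negbTE jk) mulr0n addr0.
have e1 : rG (1 + s k) = (s k + 1) * rG (1 + (s k + 1)) by rewrite rG_rec -addrA (addrC 1 (s k)).
have e2 : rG (c 0 k + s k) = (s k + 1 + c 0 k - 1) * rG (c 0 k + (s k + 1)).
  by rewrite rG_rec addrA; congr (_ * _); ring.
have e3 (z : C) : rG (1 - z - (\sum_j s j + 1)) = - (\sum_j s j + z) * rG (1 - z - \sum_j s j).
  by rewrite rG_rec; congr (_ * rG _); ring.
rewrite e1 e2 !e3.
exact: rec_alg.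
Qed.

Lemma expfun_up k t s : expfun (fun j => s j + (if j == k then 1 else 0)%N%:R) t = cexp (t 0 k) * expfun s t.
Proof.
rewrite /expfun -cexpD; congr cexp; rewrite (bigD1 k)//= [X in _ = _ + X](bigD1 k)//= eqxx mulrDr mulr1.
rewrite (addrC _ (t 0 k)) -addrA; congr (_ + (_ + _)); apply: eq_bigr => j jk.
by rewrite (negbTE jk) mulr0n addr0.
Qed.

(** The operator multiplies the monomial of exponent s by s_k (s_k + c_k - 1) -
    e^(t_k) (|s| + a) (|s| + b). Increasing n_k by 1 turns the first sum T1
    into the second sum T2, by the recurrence of the coefficients; the terms of
    T1 with n_k = 0 vanish since then s_k is 0 or 1 - c_k. *)
Lemma G_ECt J c k t : (\forall y \near t, good y) -> ECt a b c k (Gser J c) t = 0.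
Proof.
move=> /nbhs_vnP[r r0 hg].
have B0 : 0 <= vn c + vn t + r by rewrite !addr_ge0 ?vn_ge0 ?(ltW r0).
have [M hM] := G_hol_t B0.
have [hG hb] : hol_on (Gser J c) t r M /\ forall N, hol_on (fun y => bsum N (term_ab J c y)) t r M.
  by apply: hM => //; rewrite -?addrA ?lerDl ?lerDr ?addr_ge0 ?vn_ge0// ltW.
have tg : good t by apply: hg; rewrite subrr vn0.
have h1 := @ECt_lim _ _ a b (fun=> c) c k _ (Gser J c) t r M r0 hb
  (fun y yr => (G_usum J c (hg y yr)).2) (clim_cst _).
apply: (clim_uniq h1).
(* the two parts of the operator applied to the series *)
pose T1 n := expo c J n k * (expo c J n k + c 0 k - 1) * term_ab J c t n.
pose T2 n := cexp (t 0 k) * ((\sum_k expo c J n k + a) * (\sum_k expo c J n k + b)) * term_ab J c t n.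
have e0 N : ECt a b c k (fun y => bsum N (term_ab J c y)) t = bsum N T1 - bsum N T2.
  by rewrite bsum_expfun esum_ECt.
apply: (clim_ext (N := 0%N)) (fun N _ => esym (e0 N)) _.
have dt := term_dom J c tg.
have svk (z : C) n : cmod (expo c J n k + z) <= (mdeg n)%:R + (1 + cmod (c 0 k) + cmod z).
  rewrite /expo; apply: le_trans (cmodD _ _) _; rewrite addrA lerD2r.
  apply: le_trans (cmodD _ _) _; rewrite cmod_nat; apply: lerD; first by rewrite ler_nat leq_mdeg.
  by apply: le_trans (cmod_bool _ _) (cmod1B _ _).
have svs (z : C) n : cmod (\sum_k expo c J n k + z) <= (mdeg n)%:R + (m%:R + vn c + cmod z).
  rewrite expo_sum; apply: le_trans (cmodD _ _) _; rewrite addrA lerD2r.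
  by apply: le_trans (cmodD _ _) _; rewrite cmod_nat lerD2l shift_sum_le.
have p0 (z : C) : 0 <= 1 + cmod (c 0 k) + cmod z by rewrite !addr_ge0 ?cmod_ge0.
have p1 (z : C) : 0 <= m%:R + vn c + cmod z by rewrite !addr_ge0 ?cmod_ge0 ?vn_ge0.
have d1 : dom T1.
  have := dom_lin (p0 0) (svk 0) (dom_lin (p0 (c 0 k - 1)) (svk _) dt).
  by congr dom; apply/funext => n; rewrite /T1 addr0 !mulrA addrA.
have d2 : dom (fun n => ((\sum_k expo c J n k + a) * (\sum_k expo c J n k + b)) * term_ab J c t n).
  have := dom_lin (p1 a) (svs a) (dom_lin (p1 b) (svs b) dt).
  by congr dom; apply/funext => n; rewrite mulrA.
have [l1 u1 c1] := usum_box d1; have [l2' u2' _] := usum_box d2.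
have u2 : usum T2 (cexp (t 0 k) * l2').
  by apply: usum_ext (usumZ (cexp (t 0 k)) u2') => n; rewrite /T2 !mulrA.
have T10 n : (n k < 1)%N -> T1 n = 0.
  rewrite ltnS leqn0 => /eqP nk; rewrite /T1 /expo nk mulr0n add0r.
  by case: (J k); rewrite ?mul0r// mul1r -addrA subrKA addrC subrr mulr0 mul0r.
have e12 : (fun n => T1 (up k 1 n)) =1 T2.
  move=> n; rewrite /T1 /T2 /term /expterm expo_up expfun_up /= eqxx.
  rewrite mulrA coef_rec; ring.
have -> : 0 = l1 - cexp (t 0 k) * l2'.
  apply/esym/eqP; rewrite subr_eq0; apply/eqP.
  exact: usum_uniq (usum_ext e12 (usum_shift T10 u1)) u2.
by apply: climB c1 (usum_clim u2).
Qed.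

Definition turn J : V := \row_k (cplx 0 (2 * pi) * (J k)%:R).
Lemma cexp_2pin (n : nat) : cexp (cplx 0 (2 * pi) * n%:R) = 1 :> C.
Proof. by rewrite mulrC cexp_nat cexp_2pi expr1n. Qed.

Lemma expfun_turn J c n S t : expfun (expo c J n) (t + turn S) =
  (\prod_k (if S k && J k then (gammak c k)^-1 else 1)) * expfun (expo c J n) t.
Proof.
rewrite /expfun !cexp_sum -big_split/=; apply: eq_bigr => k _.
rewrite mxE mulrDl cexpD mulrC; congr (_ * _); rewrite mxE.
case: (S k); last by rewrite mulr0 mul0r cexp0.
rewrite mulr1 /expo mulrDr cexpD cexp_2pin mul1r.
case: (J k); last by rewrite mul0r mulr0 cexp0.
by rewrite mul1r mulrBr mulr1 cexpB cexp_2pi mul1r.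
Qed.

Lemma good_turn t S : good t -> good (t + turn S).
Proof.
move=> h k; rewrite mxE ReCD mxE; have e (d : bool) : ReC (cplx 0 (2 * pi) * d%:R : C) = 0 by case: d; rewrite ?mulr1 ?mulr0.
by rewrite e addr0.
Qed.

(** The exponents n_k + J_k (1 - c_k) are congruent modulo 1 for all n, so all
    the terms acquire the same factor. *)
Lemma G_turn J c S t : good t -> Gser J c (t + turn S) =
  (\prod_k (if S k && J k then (gammak c k)^-1 else 1)) * Gser J c t.
Proof.
move=> tg; have [h1 _] := G_usum J c (good_turn S tg); have [h2 _] := G_usum J c tg.
apply: usum_uniq h1 _; apply: usum_ext (usumZ _ h2) => n.
by rewrite /term /expterm expfun_turn mulrCA.
Qed.

Definition flip k J : cube m := [ffun j => if j == k then ~~ J j else J j].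

(** When c_k is an integer, the exponents n_k and n_k + 1 - c_k run over
    translates of N by the integer 1 - c_k; the exponents which occur in only
    one of the two series have coefficient 0, because one of the factors rG(1 +
    s_k), rG(c_k + s_k) vanishes. *)
Lemma G_flip_int J c k t : good t -> is_integer (c 0 k) -> ~~ J k ->
  Gser (flip k J) c t = Gser J c t.
Proof.
move=> tg [p cp] Jk.
have [h1 _] := G_usum J c tg; have [h2 _] := G_usum (flip k J) c tg.
have hfl j : flip k J j = if j == k then true else J j.
  by rewrite ffunE; case: eqVneq => [->|//]; rewrite Jk.
have [p1|p1] := leP p 1.
  (* c_k <= 1: the exponents with J_k = 1 are those with J_k = 0, translated by
     1 - c_k *)
  pose q := `|1 - p|%N.
  have qp : q%:R = 1 - c 0 k :> C.
    by rewrite cp /q natr_absz ger0_norm ?subr_ge0// intrB.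
  have hsv n : expo c J (up k q n) = expo c (flip k J) n.
    rewrite expo_up; apply/funext => j; rewrite /expo hfl; case: eqVneq => [->|_].
      by rewrite (negbTE Jk) mul0r addr0 mul1r qp.
    by rewrite mulr0n addr0.
  have z n : (n k < q)%N -> term_ab J c t n = 0.
    move=> nq; rewrite /term /expterm /coef (bigD1 k)//= /expo (negbTE Jk) mul0r addr0.
    have -> : rG (c 0 k + (n k)%:R) = 0.
      apply/rG_eq0; exists (q - (n k).+1)%N.
      by rewrite natrB// qp -[(n k).+1%:R]natr1; ring.
    by rewrite mulr0 !mul0r.
  apply: usum_uniq h2 _; apply: usum_ext (usum_shift z h1) => n.
  by rewrite /term hsv.
(* c_k > 1: the roles of the two series are exchanged *)
pose q := `|p - 1|%N.
have qp : q%:R = c 0 k - 1 :> C.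
  by rewrite cp /q natr_absz ger0_norm ?subr_ge0 ?(ltW p1)// intrB.
have hsv n : expo c (flip k J) (up k q n) = expo c J n.
  rewrite expo_up; apply/funext => j; rewrite /expo hfl; case: eqVneq => [->|_].
    by rewrite (negbTE Jk) mul0r addr0 mul1r qp; ring.
  by rewrite mulr0n addr0.
have z n : (n k < q)%N -> term_ab (flip k J) c t n = 0.
  move=> nq; rewrite /term /expterm /coef (bigD1 k)//= /expo hfl eqxx mul1r.
  have -> : rG (1 + ((n k)%:R + (1 - c 0 k))) = 0.
    apply/rG_eq0; exists (q - (n k).+1)%N.
    by rewrite natrB// qp -[(n k).+1%:R]natr1; ring.
  by rewrite mul0r !mul0r.
apply/esym; apply: usum_uniq h1 _; apply: usum_ext (usum_shift z h2) => n.
by rewrite /term hsv.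
Qed.
End SeriesProperties.

(** * Leading terms of the G_J, and their relation to the F_I *)

Opaque av edge pd cmod vn cexp clog rG.
Section LeadingTerm.
Variables (R : realType) (m : nat).
Local Notation C := (Cpx R).
Local Notation V := 'rV[C]_m.
Local Notation "x %:C" := (real_complex R x : C).
Local Notation I := {ffun 'I_m -> nat}.
Variables (a b : C) (T : R).
Hypothesis hT : m%:R ^+ 2 * expR T < 1.
Implicit Types (c t : V) (J : cube m) (n : I) (k : 'I_m) (s : 'I_m -> C).
Local Notation term_ab := (term a b).
Local Notation Gser := (Gser a b).

Lemma intD (z w : C) : is_integer z -> is_integer w -> is_integer (z + w).
Proof. by move=> [p ->] [q ->]; exists (p + q); rewrite intrD. Qed.

Lemma intN (z : C) : is_integer z -> is_integer (- z).
Proof. by move=> [p ->]; exists (- p); rewrite intrN. Qed.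

Lemma int_nat (n : nat) : is_integer (n%:R : C). Proof. by exists n. Qed.

Lemma int_sum (F : 'I_m -> C) : (forall k, is_integer (F k)) -> is_integer (\sum_k F k).
Proof.
move=> h; elim/big_ind : _ => //; first by exists 0.
by move=> x y; exact: intD.
Qed.

Lemma shift_sumE c J : shift_sum c J = \sum_k (J k)%:R - \sum_k (J k)%:R * c 0 k.
Proof. by rewrite -sumrB; apply: eq_bigr => k _; rewrite mulrBr mulr1. Qed.

Lemma shift_sum_nonint (z : C) c J : ~ is_integer (z - \sum_k (J k)%:R * c 0 k) -> ~ is_integer (z + shift_sum c J).
Proof.
move=> h h'; apply: h; rewrite shift_sumE addrCA in h'.
have hJ : is_integer (\sum_k (J k)%:R : C) by apply: int_sum => k; exact: int_nat.
by have := intD (intN hJ) h'; rewrite addKr.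
Qed.

Lemma rG_nonint (z : C) : ~ is_integer z -> rG z != 0.
Proof.
move=> h; apply/eqP => /rG_eq0[j hj]; apply: h; exists (- j%:Z).
by rewrite intrN; apply/eqP; rewrite -addr_eq0 hj.
Qed.

Lemma rG_eventually (z : C) : exists i : nat, forall i', (i <= i')%N -> rG (z + i'%:R) != 0.
Proof.
have [[j0 h0]|h] := pselect (exists j : nat, z + j%:R = 0).
  exists j0.+1 => i' hi; apply/eqP => /rG_eq0[j]; rewrite -addrA -natrD => hj.
  have /eqP : j0%:R = (i' + j)%:R :> C by apply: (addrI z); rewrite h0 hj.
  rewrite eqr_nat => /eqP e; move: hi; rewrite e ltnNge leq_addr.
  by [].
exists 0%N => i' _; apply/eqP => /rG_eq0[j]; rewrite -addrA -natrD => hj.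
by apply: h; exists (i' + j)%N.
Qed.

(** The two factors of the coefficient which depend on the k-th exponent. *)
Definition coef_nz c J k (i : nat) : bool :=
  rG (1 + (i%:R + (J k)%:R * (1 - c 0 k))) * rG (c 0 k + (i%:R + (J k)%:R * (1 - c 0 k))) != 0.
Lemma coef_nz_ex c J k : exists i, coef_nz c J k i.
Proof.
(* 1/Gamma has no zeros far to the right *)
have [i1 h1] := rG_eventually (1 + (J k)%:R * (1 - c 0 k)).
have [i2 h2] := rG_eventually (c 0 k + (J k)%:R * (1 - c 0 k)).
exists (maxn i1 i2); rewrite /coef_nz !(addrC (maxn i1 i2)%:R) !addrA mulf_neq0//.
  by rewrite h1// leq_maxl.
by rewrite h2// leq_maxr.
Qed.

(** The smallest exponents with nonzero coefficient. At integral c_k the first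
    coefficients may vanish, so this need not be n = 0. *)
Definition lead c J : I := [ffun k => ex_minn (coef_nz_ex c J k)].

Lemma expfun_shift s t (tau : R) : expfun s (t - const_mx tau%:C) = cexp (- tau%:C * \sum_k s k) * expfun s t.
Proof.
rewrite /expfun -cexpD; congr cexp; rewrite mulr_sumr -big_split/=; apply: eq_bigr => k _.
by rewrite !mxE mulrBl mulNr addrC.
Qed.

Section Vanishing.
Variables (c : V) (J : cube m) (t0 : V).
Hypothesis ha : ~ is_integer (a - \sum_k (J k)%:R * c 0 k).
Hypothesis hb : ~ is_integer (b - \sum_k (J k)%:R * c 0 k).
Let n0 := lead c J.

Lemma rG_dir (z : C) n : ~ is_integer (z - \sum_k (J k)%:R * c 0 k) ->
  rG (1 - z - \sum_k expo c J n k) != 0.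
Proof.
move=> /shift_sum_nonint h; apply: rG_nonint => h'; apply: h; rewrite expo_sum in h'.
have h2 := intD (intN h') (intD (int_nat 1) (intN (int_nat (mdeg n)))).
move: h2; congr is_integer; rewrite mulr1n; ring.
Qed.

Lemma term_lead : term_ab J c t0 n0 != 0.
Proof.
rewrite !mulf_neq0 ?rG_dir ?cexp_neq0//; apply/prodf_neq0 => k _.
by rewrite /expo /n0 ffunE; case: ex_minnP.
Qed.

(** The coefficient is a product of factors depending on the single exponents
    and of factors depending on their sum; a nonzero coefficient forces every
    n_k to be at least its minimum. *)
Lemma lead_min n : term_ab J c t0 n != 0 -> n != n0 -> (mdeg n0 < mdeg n)%N.
Proof.
move=> tn nn0; have hk k : (n0 k <= n k)%N.
  rewrite ffunE; case: ex_minnP => i hi; apply; apply/negP => /eqP z.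
  move: tn; rewrite /term /expterm /coef (bigD1 k)//= /expo z.
  by rewrite !mul0r eqxx.
have /existsP[k nk] : [exists k, n k != n0 k].
  rewrite -negb_forall; apply: contra nn0 => /forallP h.
  by apply/eqP/ffunP => k; exact/eqP.
rewrite /mdeg (bigD1 k)//= [X in (_ < X)%N](bigD1 k)//= -addSn.
apply: leq_add; last by apply: leq_sum => j _.
by rewrite ltn_neqAle eq_sym nk hk.
Qed.

(** Along t0 - tau (1, ..., 1) the leading term dominates: all other terms with
    nonzero coefficient have larger degree, hence decay faster by e^(-tau). *)
Lemma G_lead : good T t0 -> (forall tau : R, 0 <= tau -> Gser J c (t0 - const_mx tau%:C) = 0) -> False.
Proof.
move=> tg hz; have [A [r [A0 r0 r1 hd]]] := term_dom a b hT J c tg.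
pose K := A * (1 - r)^-1 ^+ m.
have K0 : 0 <= K by rewrite mulr_ge0// exprn_ge0// invr_ge0 subr_ge0 ltW.
have L0 : 0 < cmod (term_ab J c t0 n0) by rewrite cmod_gt0 term_lead.
(* the bound e^tau |leading term| <= K, weakened by e^tau >= 1 + tau, fails for
   large tau *)
suff H (tau : R) : 0 <= tau -> (1 + tau) * cmod (term_ab J c t0 n0) <= K.
  have := H (K / cmod (term_ab J c t0 n0)) (divr_ge0 K0 (ltW L0)).
  by rewrite mulrDl mul1r divfK ?gt_eqF// gerDr leNgt L0.
move=> tau0; have e0 := expR_gt0 tau.
have tg' : good T (t0 - const_mx tau%:C).
  move=> k; rewrite !mxE ReCB; apply: le_trans (tg k).
  by rewrite /ReC /= gerBl.
have [u1 _] := G_usum a b hT J c tg'; rewrite hz// in u1.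
(* the series, normalized so that its leading term does not depend on tau *)
pose f n := cexp (tau%:C * ((mdeg n0)%:R - (mdeg n)%:R)) * term_ab J c t0 n.
have u2 : usum f 0.
  have := usumZ (cexp (tau%:C * ((mdeg n0)%:R + shift_sum c J))) u1; rewrite mulr0.
  apply: usum_ext => n; rewrite /f /term /expterm expfun_shift mulrCA (mulrA (cexp _)) -cexpD.
  rewrite /expfun -!cexpD [in RHS]mulrAC -cexpD [in RHS]mulrC; congr (_ * cexp _).
  rewrite expo_sum; ring.
have fn0 : f n0 = term_ab J c t0 n0 by rewrite /f subrr mulr0 cexp0 mul1r.
pose g n := if n == n0 then 0 else f n.
have hg : dombd g (A / expR tau) r.
  move=> n; rewrite /g; case: eqVneq => [_|nn0].
    by rewrite cmod0 mulr_ge0 ?exprn_ge0// divr_ge0// ltW.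
  rewrite /f cmodM; have [->|tn] := eqVneq (term_ab J c t0 n) 0.
    by rewrite cmod0 mulr0 mulr_ge0 ?exprn_ge0// divr_ge0// ltW.
  rewrite mulrAC mulrC; apply: ler_pM; rewrite ?cmod_ge0//.
  rewrite cmod_cexp -expRN ler_expR ReCZ ReCB !natrC /ReC /=.
  rewrite -[leRHS]mulrN1; apply: ler_wpM2l => //.
  have : (mdeg n0).+1%:R <= (mdeg n)%:R :> R by rewrite ler_nat; exact: lead_min.
  by rewrite lerBlDr (addrC (-1)) lerBrDr natr1.
have Kg : K / expR tau = A / expR tau * (1 - r)^-1 ^+ m by rewrite /K mulrAC.
have bound : cmod (term_ab J c t0 n0) <= K / expR tau.
  have [N hN] := sub_box [:: n0].
  have n0N M : (N <= M)%N -> n0 \in box m M by move=> NM; apply: (box_sub NM); apply: hN; rewrite inE.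
  have cl : clim (fun M => f n0 - bsum M f) (f n0 - 0) by apply: climB (clim_cst _) (usum_clim u2).
  rewrite -fn0 -(subr0 (f n0)); apply: (clim_le (N := N)) cl => M NM.
  have -> : f n0 - bsum M f = - \sum_(n <- box m M) g n.
    rewrite /bsum (bigD1_seq n0) ?box_uniq ?n0N//= [in RHS](bigD1_seq n0) ?box_uniq ?n0N//=.
    rewrite /g eqxx add0r opprD addrA subrr add0r; congr (- _).
    by apply: eq_bigr => n /negbTE ->.
  rewrite cmodN Kg; apply: dom_sum_le => //; last exact: box_uniq.
  by rewrite divr_ge0// ltW.
rewrite ler_pdivlMr// in bound; apply: le_trans bound; rewrite mulrC ler_wpM2l ?cmod_ge0//.
exact: expR_ge1Dx.
Qed.
End Vanishing.

Transparent rG.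
Lemma GammaE (z : C) : Gamma z = (rG z)^-1. Proof. by rewrite /rG invrK. Qed.

Opaque rG.

(** The reflection formula, up to the factor rG(1 - A): Gamma quotients at A +
    N are traded for 1/Gamma at 1 - A - N, which has no poles. *)
Lemma poch_reflect (A : C) N : ~ is_integer A ->
  poch A N * rG (1 - A) = (-1) ^+ N * rG (1 - A - N%:R).
Proof.
move=> hA; have nz i : rG (A + i%:R) != 0.
  by apply: rG_nonint => h; apply: hA; have := intD h (intN (int_nat i)); rewrite addrK.
rewrite /poch !GammaE invrK; elim: N => [|N ih].
  by rewrite addr0 subr0 expr0 mul1r mulVf ?mul1r//; have := nz 0%N; rewrite addr0.
have e1 : (rG (A + N.+1%:R))^-1 = (A + N%:R) * (rG (A + N%:R))^-1.
  rewrite (rG_rec (A + N%:R)) -addrA natr1; have := nz N; rewrite (rG_rec (A + N%:R)) mulf_eq0.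
  rewrite negb_or => /andP[h1 _]; have h2 := nz N.+1.
  by rewrite invfM mulrA mulfV ?mul1r.
have e2 : rG (1 - A - N.+1%:R) = - (A + N%:R) * rG (1 - A - N%:R).
  by rewrite rG_rec -natr1; congr (_ * rG _); ring.
rewrite e1 e2 -mulrA -mulrA (mulrA _^-1) ih exprS; ring.
Qed.

Definition tmap t : V := \row_k cexp (t 0 k).

(** By the reflection formula this is sin(pi z)/pi. Only its functional
    equation and its simple zeros at the integers are used. *)
Definition reflG (z : C) : C := rG (1 - z) * rG z.
Definition sgn J : C := \prod_k (-1) ^+ J k.

Lemma rG_nat (n' : nat) : rG (1 + n'%:R : C) = (n'`!%:R)^-1.
Proof.
have nzf i : (i`!%:R : C) != 0 by rewrite pnatr_eq0 -lt0n fact_gt0.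
elim: n' => [|n ih]; first by rewrite addr0 rG1 fact0 invr1.
have nS : (1 + n%:R : C) != 0 by rewrite addrC natr1 pnatr_eq0.
have := rG_rec (1 + n%:R : C); rewrite ih -addrA natr1 => /(congr1 (fun z => (1 + n%:R)^-1 * z)).
by rewrite mulKf// => <-; rewrite factS natrM invfM addrC natr1.
Qed.

Lemma factor_alg1 (z A B D f : C) : A != 0 -> B != 0 -> D != 0 -> f != 0 -> z - 1 != 0 -> 1 - z != 0 ->
  ((z - 1) * A)^-1 / (B^-1 / D^-1 * f) = -1 / ((1 - z) * D * A) * (B / f).
Proof. by move=> nA nB nD nf z1 z2; field; rewrite nA nB nD nf z1 z2. Qed.

Lemma factor_alg0 (A B D f : C) : A != 0 -> B != 0 -> D != 0 -> f != 0 ->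
  D^-1 / (B^-1 / A^-1 * f) = (D * A)^-1 * (f^-1 * B).
Proof. by move=> nA nB nD nf; field; rewrite nA nB nD nf. Qed.

(** The contribution of one index k to F_J, where d = J_k. *)
Lemma factor_k (z : C) (d : bool) (n' : nat) : ~ is_integer z ->
  Gamma ((-1) ^+ d * (1 - z)) / (poch (z + 2 * d%:R * (1 - z)) n' * n'`!%:R) =
  (-1) ^+ d / reflG z * (rG (1 + (n'%:R + d%:R * (1 - z))) * rG (z + (n'%:R + d%:R * (1 - z)))).
Proof.
move=> hz; have nz1 : rG z != 0 by exact: rG_nonint.
have nz2 : rG (1 - z) != 0.
  by apply: rG_nonint => h; apply: hz; have := intD (int_nat 1) (intN h); rewrite subKr.
have nzn (w : C) : ~ is_integer w -> rG (w + n'%:R) != 0.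
  by move=> hw; apply: rG_nonint => h; apply: hw; have := intD h (intN (int_nat n')); rewrite addrK.
have nzf : (n'`!%:R : C) != 0 by rewrite pnatr_eq0 -lt0n fact_gt0.
rewrite /poch /reflG !GammaE; case: d.
  rewrite expr1 mulr1 mul1r.
  have -> : z + 2 * (1 - z) = 2 - z by ring.
  have -> : z + (n'%:R + (1 - z)) = 1 + n'%:R by ring.
  have -> : 1 + (n'%:R + (1 - z)) = 2 - z + n'%:R by rewrite -(natr1 1); ring.
  have -> : -1 * (1 - z) = z - 1 by ring.
  have e1 : rG (z - 1) = (z - 1) * rG z by rewrite rG_rec subrK.
  have e2 : rG (1 - z) = (1 - z) * rG (2 - z) by rewrite rG_rec; congr (_ * rG _); ring.
  have z1 : z - 1 != 0.
    by rewrite subr_eq0; apply/eqP => h; apply: hz; rewrite h; exact: (int_nat 1).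
  have z2 : ~ is_integer (2 - z).
    by move=> h; apply: hz; have := intD (int_nat 2) (intN h); rewrite subKr.
  have nz4 := nzn _ z2; have nz3 := rG_nonint z2.
  rewrite rG_nat e1 e2.
  have z1' : 1 - z != 0 by rewrite -opprB oppr_eq0.
  exact: factor_alg1.
have nz4 := nzn _ hz.
rewrite expr0 mulr0 !mul0r !addr0 !mul1r rG_nat.
exact: factor_alg0.
Qed.

Lemma FI_alg (G1 r1 r2 E p1 p2 D X K Q x1 x2 s : C) : p1 * r1 = s * x1 -> p2 * r2 = s * x2 ->
  s * s = 1 -> G1 * D = K * Q ->
  G1 * (r1 * r2) * E * (p1 * p2 * D * X) = K * (Q * (x1 * x2) * (X * E)).
Proof.
move=> e1 e2 e3 e4.
transitivity ((G1 * D) * (p1 * r1) * (p2 * r2) * (E * X)); first by ring.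
rewrite e1 e2 e4; transitivity ((s * s) * (K * (Q * (x1 * x2) * (X * E)))); first by ring.
by rewrite e3 mul1r.
Qed.

(** Termwise comparison: the prefactor of F_J is reflected into the
    coefficients, which leaves a factor independent of n. *)
Lemma FI_formula J c t : non_integral c ->
  ~ is_integer (a - \sum_k (J k)%:R * c 0 k) -> ~ is_integer (b - \sum_k (J k)%:R * c 0 k) ->
  good T t -> (forall k, `|ImC (t 0 k)| < pi) ->
  FI a b c J (tmap t) = sgn J / (\prod_k reflG (c 0 k)) * Gser J c t.
Proof.
move=> hc hA hB tg ht; have [u _] := G_usum a b hT J c tg.
set K := sgn J / _.
have sI (z : C) : shiftI z c J = z + shift_sum c J by [].
have nA := shift_sum_nonint hA; have nB := shift_sum_nonint hB.
pose Pref := (\prod_k Gamma ((-1) ^+ J k * (1 - c 0 k)))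
  / (Gamma (1 - shiftI a c J) * Gamma (1 - shiftI b c J))
  * (\prod_k cpow (tmap t 0 k) ((J k)%:R * (1 - c 0 k))).
have n1B (z : C) : ~ is_integer z -> rG (1 - z) != 0.
  move=> hz; apply: rG_nonint => h; apply: hz.
  by have := intD (int_nat 1) (intN h); rewrite subKr.
have Pref0 : Pref != 0.
  rewrite /Pref !GammaE !sI -invfM invrK !mulf_neq0 ?n1B//; apply/prodf_neq0 => k _; last exact: cexp_neq0.
  rewrite GammaE invr_neq0//; apply: rG_nonint => h; apply: (hc k).
  case: (J k) h => [|]; rewrite ?expr1 ?expr0 ?mul1r ?mulN1r.
    by move=> h; have := intD (int_nat 1) h; rewrite addrC opprB subrK.
  by move=> h; have := intD (int_nat 1) (intN h); rewrite subKr.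
pose N0 (n : I) := (\sum_k n k)%N.
pose ft (n : I) := poch (shiftI a c J) (\sum_k n k)%N * poch (shiftI b c J) (\sum_k n k)%N
      / ((\prod_k poch (reflI c J 0 k) (n k)) * \prod_k (n k)`!%:R)
      * \prod_k tmap t 0 k ^+ n k.
have key n : Pref * ft n = K * term_ab J c t n.
  rewrite /Pref /ft /K /term /expterm /coef expo_sum expfun_expo.
  have -> : \prod_k cpow (tmap t 0 k) ((J k)%:R * (1 - c 0 k)) =
     cexp (\sum_k t 0 k * ((J k)%:R * (1 - c 0 k))).
    rewrite cexp_sum; apply: eq_bigr => k _; rewrite /cpow mxE cexpK// mulrC//.
  have -> : \prod_k tmap t 0 k ^+ n k = \prod_k cexp (t 0 k) ^+ n k.
    by apply: eq_bigr => k _; rewrite mxE.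
  have pA := poch_reflect (mdeg n) nA; have pB := poch_reflect (mdeg n) nB.
  rewrite /mdeg in pA pB *.
  have ee (z : C) (N : nat) : 1 - z - (N%:R + shift_sum c J) = 1 - (z + shift_sum c J) - N%:R by ring.
  rewrite !ee !sI !GammaE.
  have sg : (-1) ^+ (\sum_k n k)%N * (-1) ^+ (\sum_k n k)%N = 1 :> C by rewrite -expr2 sqrr_sign.
  have hprod : (\prod_k Gamma ((-1) ^+ J k * (1 - c 0 k))) /
      ((\prod_k poch (reflI c J 0 k) (n k)) * \prod_k (n k)`!%:R) =
    sgn J / (\prod_k reflG (c 0 k)) * \prod_k (rG (1 + expo c J n k) * rG (c 0 k + expo c J n k)).
    rewrite /sgn -!prodfV -!big_split/= -prodfV -!big_split/=; apply: eq_bigr => k _.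
    by rewrite mxE; exact: factor_k.
  rewrite !invfM !invrK -invfM.
  exact: FI_alg pA pB sg hprod.
have uf : usum ft (Pref^-1 * (K * Gser J c t)).
  apply: usum_ext (usumZ Pref^-1 (usumZ K u)) => n.
  by rewrite -key mulKf.
have -> : FI a b c J (tmap t) = Pref * FC (shiftI a c J) (shiftI b c J) (reflI c J) (tmap t) by [].
by rewrite /FC (usum_sum uf) mulrA mulfV// mul1r.
Qed.
End LeadingTerm.

(** * The change of coordinates x = e^t *)

Opaque av edge pd cmod vn cexp clog rG.
Section Transport.
Variables (R : realType) (m : nat).
Local Notation C := (Cpx R).
Local Notation V := 'rV[C]_m.
Local Notation "x %:C" := (real_complex R x : C).
Variables (a b : C) (c : V).
Implicit Types (f g : V -> C) (t x : V) (k : 'I_m) (s : C).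
Local Notation tmap := (@tmap R m).

Lemma near_map (phi : V -> V) x (P : V -> Prop) : (forall k, vcont (fun y => phi y 0 k) x) ->
  (\forall y \near phi x, P y) -> \forall y \near x, P (phi y).
Proof.
move=> hc /nbhs_vnP[r r0 hr].
have r1 : 0 < r / m.+1%:R by rewrite divr_gt0.
have hk k : \forall y \near x, cmod (phi y 0 k - phi x 0 k) < r / m.+1%:R.
  by have [d d0 hd] := (vcontP _ _).1 (hc k) _ r1; apply/nbhs_vnP; exists d.
have := filter_forall (nbhs_filter x) hk; apply: filterS => y hy; apply: hr.
Transparent vn.
rewrite /vn; apply: le_lt_trans (_ : \sum_(k < m) r / m.+1%:R < _).
  by apply: ler_sum => k _; rewrite rowBE ltW.
rewrite sumr_const card_ord -(mulr_natr (r / _) m) -mulrA gtr_pMr// mulrC ltr_pdivrMr// mul1r ltr_nat.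
by [].
Opaque vn.
Qed.

Definition lmap x : V := \row_k clog (x 0 k).
Lemma tmapE t k : tmap t 0 k = cexp (t 0 k). Proof. by rewrite mxE. Qed.

Lemma lmapE x k : lmap x 0 k = clog (x 0 k). Proof. by rewrite mxE. Qed.

Lemma lmapK x : (forall k, x 0 k != 0) -> tmap (lmap x) = x.
Proof. by move=> h; apply/rowP => k; rewrite !mxE clogK. Qed.

Lemma tmapK t : (forall k, `|ImC (t 0 k)| < pi) -> lmap (tmap t) = t.
Proof. by move=> h; apply/rowP => k; rewrite !mxE cexpK. Qed.

Lemma tmap_hdiff t k : hdiff (fun y => tmap y 0 k) t (cexp (t 0 k) *: delta_mx 0 k).
Proof.
have := hdiff_cderiv (hdiff_coord k t) (cderiv_cexp _).
by apply: (hdiff_ext ltr01) => y _; rewrite tmapE.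
Qed.

Lemma lmap_hdiff x k : 0 < ReC (x 0 k) ->
  hdiff (fun y => lmap y 0 k) x ((x 0 k)^-1 *: delta_mx 0 k).
Proof.
move=> h; have := hdiff_cderiv (hdiff_coord k x) (cderiv_clog h).
by apply: (hdiff_ext ltr01) => y _; rewrite lmapE.
Qed.

Lemma tmap_near t (P : V -> Prop) : (\forall y \near tmap t, P y) -> \forall y \near t, P (tmap y).
Proof. by apply: near_map => k; exact: hdiff_cont (tmap_hdiff t k). Qed.

Lemma lmap_near x (P : V -> Prop) : (forall k, 0 < ReC (x 0 k)) ->
  (\forall y \near lmap x, P y) -> \forall y \near x, P (lmap y).
Proof. by move=> h; apply: near_map => k; exact: hdiff_cont (lmap_hdiff (h k)). Qed.

Lemma comp_tmap f t : hol f (tmap t) ->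
  hol (f \o tmap) t /\ forall k, pd k (f \o tmap) t = cexp (t 0 k) * pd k f (tmap t).
Proof.
move=> hf; have h := hdiff_comp (fun k => tmap_hdiff t k) hf; split; first exact: hdiff_hol h.
move=> k; apply: etrans (hdiff_pd k h) _; rewrite summxE (bigD1 k)//= big1; last first.
  by move=> j jk; rewrite !mxE eqxx eq_sym (negbTE jk) !mulr0.
have e (u v : C) : (u *: (v *: (delta_mx 0 k : V))) 0 k = v * u.
  by rewrite !mxE !eqxx mulr1 mulrC.
by rewrite addr0 e gradE.
Qed.

(** The principal logarithm is holomorphic on the right half plane, so near the
    base point the change of coordinates is biholomorphic. *)
Lemma comp_lmap g x : (forall k, 0 < ReC (x 0 k)) -> hol g (lmap x) -> hol (g \o lmap) x.
Proof. by move=> hx hg; exact: hdiff_hol (hdiff_comp (fun k => lmap_hdiff (hx k)) hg). Qed.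

Transparent pd.
Lemma theta1E f k s x : theta1 k s f x = x 0 k * pd k f x + s * f x.
Proof. by []. Qed.

Opaque pd.
Lemma theta1_tth1 f k s t : hol f (tmap t) -> theta1 k s f (tmap t) = tth1 k s (f \o tmap) t.
Proof. by move=> /comp_tmap[_ h]; rewrite theta1E /tth1 h tmapE. Qed.

Lemma theta_tth f s t : hol f (tmap t) -> theta s f (tmap t) = tth s (f \o tmap) t.
Proof.
move=> h; rewrite /theta /tth; congr (_ + _); apply: eq_bigr => k _.
by rewrite theta1_tth1// /tth1 mul0r addr0.
Qed.

Lemma hol_near_coord k x : hol_near (fun y : V => y 0 k) x.
Proof. by apply/hol_nearP; near=> y; exact: hol_coord. Unshelve. all: by end_near. Qed.

Lemma hol_near_theta1 f k s x : hol_near f x -> hol_near (theta1 k s f) x.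
Proof.
move=> h; have -> : theta1 k s f = fun y => y 0 k * pd k f y + s * f y by apply/funext => y; exact: theta1E.
apply: hol_nearD; first exact: hol_nearM (hol_near_coord _ _) (hol_near_pd _ h).
exact: hol_nearM (hol_near_cst _ _) h.
Qed.

Lemma hol_near_theta f s x : hol_near f x -> hol_near (theta s f) x.
Proof.
move=> h; apply: hol_nearD; last exact: hol_nearM (hol_near_cst _ _) h.
by apply: hol_near_sum => k _; exact: hol_near_theta1.
Qed.

Lemma tth1_near f g k s t : hol f t -> (\forall y \near t, f y = g y) -> tth1 k s f t = tth1 k s g t.
Proof. by move=> hf e; rewrite /tth1 (pd_near k e hf) (nbhs_singleton e). Qed.

Lemma tth_near f g s t : hol f t -> (\forall y \near t, f y = g y) -> tth s f t = tth s g t.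
Proof.
move=> hf e; have E1 : \sum_k pd k f t = \sum_k pd k g t.
  by apply: eq_bigr => k _; exact: pd_near e hf.
exact: (congr2 +%R E1 (congr1 (fun z => s * z) (nbhs_singleton e))).
Qed.

(** By the chain rule x_k d/dx_k becomes d/dt_k, applied twice. *)
Lemma EC_ECt f k t : hol_near f (tmap t) -> EC a b c k f (tmap t) = ECt a b c k (f \o tmap) t.
Proof.
move=> h; have hn : \forall y \near t, hol f (tmap y).
  by apply: (@tmap_near t (fun z => hol f z)); exact: (hol_nearP _ _).1.
rewrite /EC /ECt tmapE; congr (_ - _ * _).
  have hh := hol_near_hol (hol_near_theta1 k (c 0 k - 1) h).
  rewrite (theta1_tth1 k 0 hh); apply: tth1_near; first by have [] := comp_tmap hh.
  by apply: filterS hn => y hy; exact: theta1_tth1.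
have hh := hol_near_hol (hol_near_theta b h).
rewrite (theta_tth a hh); apply: tth_near; first by have [] := comp_tmap hh.
by apply: filterS hn => y hy; exact: theta_tth.
Qed.

Definition Solt t0 f := \forall t \near t0, hol f t /\ forall k, ECt a b c k f t = 0.

Section RealBasePoint.
Variable t0 : V.
Hypothesis t0Im : forall k, ImC (t0 0 k) = 0.
Let x0 := tmap t0.
Lemma t0pi k : `|ImC (t0 0 k)| < pi. Proof. by rewrite t0Im normr0 pi_gt0. Qed.

Lemma lx0 : lmap x0 = t0. Proof. by apply: tmapK => k; exact: t0pi. Qed.

Lemma x0Re k : 0 < ReC (x0 0 k).
Proof. Transparent cexp.
by rewrite /x0 tmapE /cexp t0Im cos0 mulr1 expR_gt0.
Opaque cexp. Qed.

Lemma near_x0Re : \forall x \near x0, forall k : 'I_m, 0 < ReC ((x : V) 0 k).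
Proof.
apply: (filter_forall (nbhs_filter x0)) => k; apply/nbhs_vnP; exists (ReC (x0 0 k)); first exact: x0Re.
move=> y yx; have := le_lt_trans (cmod_le_vn (y - x0) k) yx; rewrite rowBE => h.
have := le_lt_trans (Re_le_cmod _) h; rewrite ReCB ltr_norml => /andP[h1 _].
by move: h1; rewrite ltrBrDl subrr.
Qed.

Lemma near_t0pi : \forall t \near t0, forall k : 'I_m, `|ImC ((t : V) 0 k)| < pi.
Proof.
apply/nbhs_vnP; exists pi; first exact: pi_gt0.
move=> y yx k; have := le_lt_trans (cmod_le_vn (y - t0) k) yx; rewrite rowBE => h.
by have := le_lt_trans (Im_le_cmod _) h; rewrite ImCB t0Im subr0.
Qed.

Lemma near_x0_t0 (P : V -> Prop) : (\forall x \near x0, P x) <-> \forall t \near t0, P (tmap t).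
Proof.
split; first exact: tmap_near.
move=> h; have h2 : \forall x \near x0, P (tmap (lmap x)).
  by apply: (@lmap_near x0 (fun t => P (tmap t))); [exact: x0Re|rewrite lx0].
apply: filterS2 near_x0Re h2 => x hx; rewrite lmapK// => k.
by apply/eqP => e; have := hx k; rewrite e /ReC /= ltxx.
Qed.

Definition SolX f := \forall x \near x0, differentiable f x /\ forall k, EC a b c k f x = 0.

(** Near a real point t0 the map t -> e^t is inverted by the principal
    logarithm, so both the holomorphy and the equations can be transported. *)
Lemma Sol_Solt f : SolX f <-> Solt t0 (f \o tmap).
Proof.
have key : hol_near f x0 -> \forall t \near t0, forall k, EC a b c k f (tmap t) = ECt a b c k (f \o tmap) t.
  move=> /hol_near_near /tmap_near; apply: filterS => t ht k; exact: EC_ECt.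
split=> [h|h].
  have hf : hol_near f x0.
    by apply/hol_nearP; apply: filterS h => x [/holP].
  have /tmap_near h' := h; apply: filterS2 h' (key hf) => t [/holP h1 h2] h3.
  by split=> [|k]; [have [] := comp_tmap h1|rewrite -h3].
have hg : \forall t \near t0, hol (f \o tmap) t by apply: filterS h => t [].
have hf : hol_near f x0.
  apply/hol_nearP; have h2 : \forall x \near x0, hol (f \o tmap) (lmap x).
    by apply: (@lmap_near x0 (fun t => hol (f \o tmap) t)); [exact: x0Re|rewrite lx0].
  apply: filterS2 (near_nearW near_x0Re) h2 => x hx hh.
  have := comp_lmap (nbhs_singleton hx) hh.
  move/nbhs_vnP: hx => [r r0 hx]; apply: (hol_ext r0) => y yr /=.
  rewrite lmapK// => k; by apply/eqP => e; have := hx y yr k; rewrite e /ReC /= ltxx.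
apply/near_x0_t0; have h1 := (tmap_near ((hol_nearP _ _).1 hf)).
near=> t; split; first by apply/holP; near: t.
move=> k; have -> : EC a b c k f (tmap t) = ECt a b c k (f \o tmap) t.
  by move: k; near: t; exact: key.
by have [_] : hol (f \o tmap) t /\ forall k, ECt a b c k (f \o tmap) t = 0 by near: t.
Unshelve. all: by end_near.
Qed.
End RealBasePoint.
End Transport.

(** * Zeros and poles of the factors of tilde F_I *)

Opaque av edge pd cmod vn cexp clog rG.
Section Factors.
Variable R : realType.
Local Notation C := (Cpx R).
Local Notation "x %:C" := (real_complex R x : C).
Implicit Types (z w : C).
Local Notation tpi := (cplx 0 (2 * pi) : C).

(** Parameters near c can only be integral where c is; nonresonance is an open
    condition. *)
Lemma integers_isolated z : exists2 r : R, 0 < r & forall w, is_integer w -> cmod (w - z) < r -> w = z.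
Proof.
have int1 (p q : int) : cmod (p%:~R - q%:~R : C) < 1 -> p = q.
  rewrite -intrB -(rmorph_int (real_complex R)) cmod_real -intr_norm ltrz1 => h.
  by apply/eqP; rewrite -subr_eq0 -normr_le0 -ltzD1 add0r.
have [[p [pz pn]]|h] := pselect (exists p : int, cmod (p%:~R - z) < 2^-1 /\ p%:~R != z).
  exists (cmod (p%:~R - z)); first by rewrite cmod_gt0 subr_eq0.
  move=> w [q ->] qz; have e : q = p.
    apply: int1; apply: le_lt_trans (cmod_tri _ z _) _; rewrite (cmodBC z).
    by move: qz pz; clear; lra.
  by move: qz; rewrite e ltxx.
exists 2^-1 => //.
move=> w [q ->] qz; apply/eqP; apply/negPn/negP => n; apply: h; exists q; split => //.
Qed.

Lemma tpi_neq0 : tpi != 0.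
Proof.
apply/eqP => /(congr1 (@ImC R)); rewrite /ImC /= => /eqP.
by rewrite mulf_eq0 pnatr_eq0/= gt_eqF// pi_gt0.
Qed.

Lemma cexp_int z : is_integer z -> cexp (tpi * z) = 1.
Proof.
move=> [[n|n] ->]; first by rewrite mulrC cexp_nat cexp_2pi expr1n.
by rewrite NegzE intrN mulrN cexpN mulrC cexp_nat cexp_2pi expr1n invr1.
Qed.

Lemma reflG_rec w : reflG (w + 1) = - reflG w.
Proof.
rewrite /reflG (rG_rec w); have -> : 1 - (w + 1) = - w by ring.
rewrite (rG_rec (- w)) (addrC (- w)); ring.
Qed.

Lemma reflG_add w n : reflG (w + n%:R) = (-1) ^+ n * reflG w.
Proof.
elim: n => [|n ih]; first by rewrite addr0 mul1r.
by rewrite -natr1 addrA reflG_rec ih exprS; ring.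
Qed.

Lemma reflG_alg (s A z B : C) : s * (A * (z * B)) = z * (s * (A * B)).
Proof. ring. Qed.

Lemma quarter (v r : R) : 0 < r -> v < r / 4 -> 4 * v <= r /\ v < r.
Proof. by move=> r0 h; split; lra. Qed.

Lemma half_lt (v q e r : R) : v * q < e * r -> v * q / 2 <= e / 2 * r.
Proof. by move=> h; lra. Qed.

(** By the functional equation it is enough to treat z = 0, where reflG w = w
    rG(1 - w) rG(1 + w). *)
Lemma reflG_int_fact z : is_integer z ->
  exists h, [/\ cont_at h z, h z != 0 & forall w, reflG w = (w - z) * h w].
Proof.
move=> [p zp].
have [s s0 hs] : exists2 s : C, s != 0 & forall w, reflG w = s * reflG (w - z).
  rewrite zp; case: p {zp} => n.
    exists ((-1) ^+ n); first by rewrite signr_eq0.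
    by move=> w; rewrite -reflG_add subrK.
  exists ((-1) ^+ n.+1); first by rewrite signr_eq0.
  move=> w; rewrite NegzE intrN opprK -pmulrn.
  by rewrite reflG_add mulrA -expr2 sqrr_sign mul1r.
have [d hd] := rG_cderiv (1 : C).
pose h w := s * (rG (1 - (w - z)) * rG (1 + (w - z))).
have cz : cont_at (fun w => w - z) z by apply: contB (cont_id _) (cont_cst _ _).
exists h; split.
- apply: contM (cont_cst _ _) (contM _ _).
    have := @cont_comp _ (fun w => 1 - (w - z)) (@rG R) z.
    rewrite subrr subr0; apply; first exact: contB (cont_cst _ _) cz.
    exact: cderiv_cont hd.
  have := @cont_comp _ (fun w => 1 + (w - z)) (@rG R) z.
  rewrite subrr addr0; apply; first exact: contD (cont_cst _ _) cz.
  exact: cderiv_cont hd.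
- by rewrite /h subrr subr0 addr0 rG1 mulr1 mulr1.
- move=> w; rewrite hs /reflG (rG_rec (w - z)) /h (addrC 1 (w - z)).
  exact: reflG_alg.
Qed.

(** The contribution of one index k to the factor of the alternating sum in
    tilde F_I, where i = I_k and w = c_k. *)
Definition pole_factor (i : bool) w : C := (1 - cexp (tpi * w)) ^+ (1 - i)%N / reflG w.
Lemma reflG_neq0 z : ~ is_integer z -> reflG z != 0.
Proof.
move=> h; rewrite mulf_neq0 ?rG_nonint// => h'; apply: h.
by have := intD (int_nat R 1) (intN h'); rewrite subKr.
Qed.

Lemma cderiv_tpi z : cderiv (fun w => cexp (tpi * w)) z (cexp (tpi * z) * (tpi * 1)).
Proof. exact: cderiv_comp (cderivZ tpi (cderiv_id z)) (cderiv_cexp _). Qed.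

(** If i = 0, the zeros of 1 - exp(2 pi i w) cancel those of reflG w; if i = 1,
    a simple pole at the integers remains, and is removed by the factor w -
    z. *)
Lemma pole_factor_regular (i : bool) z : exists E, [/\ cont_at E z, E z != 0 &
  forall w, ~ is_integer w -> pole_factor i w * (if i && `[< is_integer z >] then w - z else 1) = E w].
Proof.
have cg : cont_at (fun w => cexp (tpi * w)) z := cderiv_cont (cderiv_tpi z).
have [zi|zn] := pselect (is_integer z); last first.
  exists (pole_factor i); split.
  - have crA : cont_at (@reflG R) z.
      have [d hd] := rG_cderiv z; have [d' hd'] := rG_cderiv (1 - z).
      apply: contM (cderiv_cont hd).
      apply: (@cont_comp _ (fun w => 1 - w) (@rG R)); last exact: cderiv_cont hd'.
      exact: contB (cont_cst _ _) (cont_id _).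
    apply: contM; last by apply: contV crA; exact: reflG_neq0.
    exact: contX (contB (cont_cst _ _) cg).
  - rewrite mulf_neq0 ?invr_neq0 ?reflG_neq0//; apply: expf_neq0; rewrite subr_eq0 eq_sym.
    by apply/eqP => /cexp_eq1.
  - by move=> w _; rewrite asboolF// andbF mulr1.
have [h [h1 h2 h3]] := reflG_int_fact zi.
have wz w : ~ is_integer w -> w - z != 0.
  by move=> hw; rewrite subr_eq0; apply/eqP => e; apply: hw; rewrite e.
rewrite asboolT// andbT; case: i.
  exists (fun w => (h w)^-1); split; [exact: contV|exact: invr_neq0|].
  move=> w hw; rewrite /pole_factor subnn expr0 h3 invfM mul1r mulrC mulrA mulfV ?mul1r//.
  exact: wz.
have [phi [p1 p2 p3]] := cderiv_tpi z.
exists (fun w => - phi w / h w); split.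
- by apply: contM; [exact: contN|exact: contV].
- rewrite mulf_neq0 ?invr_neq0// p2 oppr_eq0 mulr1 mulf_neq0 ?cexp_neq0//; exact: tpi_neq0.
- move=> w hw; rewrite /pole_factor subn0 expr1 p3 cexp_int// h3 mulr1.
  have nz := wz w hw; rewrite opprD addrA subrr add0r invfM.
  by rewrite -mulNr mulrA mulfK.
Qed.
End Factors.

(** * Limits of the tilde F_I at integral parameters *)

Section Limit.
Variables (R : realType) (m : nat).
Local Notation C := (Cpx R).
Local Notation V := 'rV[C]_m.
Local Notation "x %:C" := (real_complex R x : C).
Variables (a b : C) (T : R).
Hypothesis hT : m%:R ^+ 2 * expR T < 1.
Implicit Types (c t : V) (I J S : cube m) (k : 'I_m).
Local Notation Gser := (Gser a b).

Definition below J I := [forall k, (J k <= I k)%N].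

(** tilde F_I is this sum, times a factor which only depends on c. *)
Definition alt_sum I c t : C := \sum_(J : cube m | below J I) sgn R J * Gser J c t.
Definition prefactor c I : C := \prod_k pole_factor (I k) (c 0 k).

(** tilde F_I in the coordinates t, for generic c. *)
Definition Ftil I c t : C := prefactor c I * alt_sum I c t.

Lemma Ftilde_gen_Ftil I c t : non_integral c ->
  (forall J : cube m, ~ is_integer (a - \sum_k (J k)%:R * c 0 k)) ->
  (forall J : cube m, ~ is_integer (b - \sum_k (J k)%:R * c 0 k)) ->
  good T t -> (forall k, `|ImC (t 0 k)| < pi) ->
  Ftilde_gen a b c I (tmap t) = Ftil I c t.
Proof.
move=> hc hA hB tg ht; rewrite /Ftilde_gen /Ftil /prefactor /pole_factor big_split/= prodfV -mulrA; congr (_ * _).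
rewrite /alt_sum mulr_sumr; apply: eq_bigr => J _; rewrite (FI_formula hT hc _ _ tg ht)//.
by rewrite mulrA (mulrC _ (sgn _ _)).
Qed.

Lemma flipK k : involutive (@flip m k).
Proof.
move=> J; apply/ffunP => j; rewrite !ffunE; case: eqP => [_|//].
by rewrite negbK.
Qed.

Lemma sgn_flip k J : sgn R (flip k J) = - sgn R J.
Proof.
rewrite /sgn (bigD1 k)//= [in RHS](bigD1 k)//= ffunE eqxx -mulNr; congr (_ * _).
  by case: (J k); rewrite ?expr0 ?expr1 ?opprK.
by apply: eq_bigr => j jk; rewrite ffunE (negbTE jk).
Qed.

Lemma below_flip k I J : I k -> below (flip k J) I = below J I.
Proof.
move=> Ik; apply: eq_forallb => j; rewrite ffunE; case: eqP => // ->.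
by rewrite Ik !leq_b1.
Qed.

(** If c_k is an integer and I_k = 1, the involution J -> flip k J of the set
    of the J <= I preserves G_J and changes the sign. *)
Lemma alt_sum_vanish I c t k : good T t -> I k -> is_integer (c 0 k) -> alt_sum I c t = 0.
Proof.
move=> tg Ik ck; rewrite /alt_sum (bigID (fun J : cube m => J k))/=.
have -> : \sum_(J : cube m | below J I && J k) sgn R J * Gser J c t =
  \sum_(J : cube m | below J I && ~~ J k) - (sgn R J * Gser J c t).
  rewrite (reindex_inj (inv_inj (@flipK k)))/=; apply: eq_big => J.
    by rewrite below_flip// ffunE eqxx.
  rewrite below_flip// ffunE eqxx => /andP[_ Jk]; rewrite sgn_flip mulNr; congr (- (_ * _)).
  exact: (@G_flip_int R m a b T hT J c k t tg ck Jk).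
by rewrite sumrN addNr.
Qed.

Lemma near_nonres (z : C) c : (forall I : cube m, ~ is_integer (z - \sum_k (I k)%:R * c 0 k)) ->
  \forall c' \near c, forall I : cube m, ~ is_integer (z - \sum_k (I k)%:R * (c' : V) 0 k).
Proof.
move=> h; apply: (filter_forall (nbhs_filter c)) => I; have [r r0 hr] := integers_isolated (z - \sum_k (I k)%:R * c 0 k).
apply/nbhs_vnP; exists r => // y yr hy; apply: (h I); rewrite -(hr _ hy)//.
apply: le_lt_trans yr.
have -> : z - \sum_k (I k)%:R * y 0 k - (z - \sum_k (I k)%:R * c 0 k) = - \sum_k (I k)%:R * (y - c) 0 k.
  rewrite opprB addrC addrA subrK -opprB; congr (- _); rewrite -sumrB; apply: eq_bigr => k _.
  by rewrite rowBE mulrBr.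
rewrite cmodN; apply: le_trans (cmod_sum _ _ _) _.
Transparent vn.
by apply: ler_sum => k _; exact: cmod_bool.
Opaque vn.
Qed.

Section AtParameter.
Variable c : V.

(** The points c + x_n (1, ..., 1) with small positive x_n have no integral
    component, because integers are isolated. *)
Lemma nonint_seq (d : R) : 0 < d -> exists u : nat -> V,
  [/\ forall n, non_integral (u n), forall n, vn (u n - c) < d & vlim u c].
Proof.
move=> d0.
have : \forall c' \near c, vn ((c' : V) - c) < d /\ forall k : 'I_m, is_integer ((c' : V) 0 k) -> (c' : V) 0 k = c 0 k.
  have h1 : \forall c' \near c, vn ((c' : V) - c) < d by apply/nbhs_vnP; exists d.
  have h2 : \forall c' \near c, forall k : 'I_m, is_integer ((c' : V) 0 k) -> (c' : V) 0 k = c 0 k.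
    apply: (filter_forall (nbhs_filter c)) => k; have [r r0 hr] := integers_isolated (c 0 k).
    apply/nbhs_vnP; exists r => // y yr hy; apply: hr => //; apply: le_lt_trans yr.
    by rewrite -rowBE; exact: cmod_le_vn.
  by apply: filterS2 h1 h2 => y.
move=> /nbhs_vnP[r r0 hr].
pose x n : R := r / m.+1%:R / n.+1%:R.
have x0 n : 0 < x n by rewrite !divr_gt0.
pose u n : V := c + const_mx (x n)%:C.
have uc n k : u n 0 k = c 0 k + (x n)%:C by rewrite !mxE.
have ur n : vn (u n - c) < r.
Transparent vn.
  rewrite /vn; apply: le_lt_trans (_ : \sum_(k < m) r / m.+1%:R < _).
    apply: ler_sum => k _; rewrite rowBE uc addrC addKr cmod_real gtr0_norm//.
    by rewrite ler_pdivrMr// ler_peMr ?divr_ge0 ?(ltW r0)// ler1n.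
  by rewrite sumr_const card_ord -(mulr_natr (r / _) m) -mulrA gtr_pMr// mulrC ltr_pdivrMr// mul1r ltr_nat.
Opaque vn.
exists u; split.
- move=> n k hk; have [_ h] := hr _ (ur n); have := h k hk; rewrite uc => /eqP.
  rewrite -subr_eq0 addrC addKr => /eqP e; have := x0 n.
  by have := congr1 (@ReC R) e; rewrite /ReC /= => ->; rewrite ltxx.
- by move=> n; have [] := hr _ (ur n).
- move=> k; have h := climZ (r / m.+1%:R)%:C (@clim_0inv R).
  have := climD (clim_cst (c 0 k)) h; rewrite mulr0 addr0.
  apply: (clim_ext (N := 0%N)) => n _; rewrite uc /x (natrC R n.+1) -fmorphV -rmorphM.
  by [].
Qed.

Lemma to_param_proper : ProperFilter (to_param c).
Proof.
apply: Build_ProperFilter_ex => P; rewrite /to_param /within /= => /nbhs_vnP[r r0 hr].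
have [u [u1 u2 _]] := nonint_seq r0; exists (u 0%N).
by apply: hr; [exact: u2|exact: u1].
Qed.

Lemma to_paramP (P : V -> Prop) : (\forall c' \near to_param c, P c') <->
  exists2 d : R, 0 < d & forall c', non_integral c' -> vn (c' - c) < d -> P c'.
Proof.
split=> [/nbhs_vnP[r r0 h]|[r r0 h]]; first by exists r => // c' h1 h2; exact: h.
by apply/nbhs_vnP; exists r => // y yr hy; exact: h.
Qed.

(** The limit of tilde F_I, in the coordinates t, for arbitrary c. For
    nonintegral c it agrees with tilde F_I itself. *)
Definition Flim I t : C := lim ((fun c' => Ftil I c' t) @ to_param c).

Lemma lim_param (F : V -> C) (l : C) : (forall e : R, 0 < e -> exists2 d : R, 0 < d &
   forall c', non_integral c' -> vn (c' - c) < d -> cmod (F c' - l) < e) ->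
  lim (F @ to_param c) = l.
Proof.
move=> h; have PF := to_param_proper; apply/cvg_lim => //.
apply/(@cvgrPdist_lt _ _ _ (to_param c) _ F) => e e0; have [r er r0] := pos_real e0.
have [d d0 hd] := h r r0; apply/to_paramP; exists d => // c' h1 h2.
by rewrite er cmodE ltcR cmodBC; exact: hd.
Qed.

(** The indices k at which the factor of the alternating sum has a pole at
    c. *)
Definition integral_slots I : seq 'I_m := [seq k <- enum 'I_m | I k && `[< is_integer (c 0 k) >]].

Lemma prefactor_regular I : exists K : V -> C, [/\ vcont K c, K c != 0 &
  forall c', non_integral c' -> prefactor c' I * \prod_(k <- integral_slots I) (c' 0 k - c 0 k) = K c'].
Proof.
have [E hE] : exists E : 'I_m -> C -> C, forall k, [/\ cont_at (E k) (c 0 k), E k (c 0 k) != 0 &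
  forall w, ~ is_integer w -> pole_factor (I k) w * (if I k && `[< is_integer (c 0 k) >] then w - c 0 k else 1) = E k w].
  have h k := cid (pole_factor_regular (I k) (c 0 k)).
  by exists (fun k => sval (h k)) => k; exact: svalP (h k).
exists (fun c' => \prod_k E k (c' 0 k)); split.
- move=> u hu; apply: clim_prod => k _; have [h _ _] := hE k.
  exact: (cont_seqP _ _).1 h _ (hu k).
- by apply/prodf_neq0 => k _; have [_] := hE k.
- move=> c' hc; rewrite /integral_slots big_filter big_enum_cond/= big_mkcond/= /prefactor -big_split/=.
  by apply: eq_bigr => k _; have [_ _ <-] := hE k.
Qed.

Lemma alt_sum_hol (B : R) : 0 <= B -> exists M, forall I t, good T t -> vn t <= B ->
  hol_on (fun c' => alt_sum I c' t) c 1 M.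
Proof.
move=> B0; have B1 : 0 <= vn c + 1 + B by rewrite !addr_ge0 ?vn_ge0.
have [M hM] := G_hol_c a b hT B1.
exists (\sum_(J : cube m) `|M|) => I t tg tB.
have hJ J : hol_on (fun c' => Gser J c' t) c 1 M.
  by apply: hM => //; [rewrite lerDl|apply: le_trans tB _; rewrite lerDr addr_ge0 ?vn_ge0].
move=> y yr; split.
  by apply: hol_sum => J _; apply: holM (hol_cst _ _) _; have [] := hJ J y yr.
apply: le_trans (cmod_sum _ _ _) _; rewrite [leRHS](bigID (below^~ I))/=.
apply: ler_wpDr; first by rewrite sumr_ge0.
apply: ler_sum => J _; rewrite cmodM.
have -> : cmod (sgn R J) = 1.
  by rewrite cmod_prod big1// => k _; rewrite cmodX cmodN cmod1 expr1n.
by rewrite mul1r; have [_ h] := hJ J y yr; apply: le_trans h (ler_norm _).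
Qed.

(** Cauchy's estimate for the first derivatives. *)
Lemma lipschitz (g : V -> C) x r M : 0 < r -> hol_on g x r M ->
  forall h, 4 * vn h <= r -> cmod (g (x + h) - g x) <= 20 * M * (vn h / r).
Proof.
move=> r0 hg h hr; have [h1 h2] := taylor1 r0 hg hr; have M0 := hol_onM0 r0 hg.
have q0 : 0 <= vn h / r by rewrite divr_ge0 ?vn_ge0 ?ltW.
have q1 : vn h / r <= 1.
  by rewrite ler_pdivrMr// mul1r; apply: le_trans hr; rewrite ler_peMl ?vn_ge0// ler1n.
have e : (vn h / r) ^+ 2 <= vn h / r by rewrite expr2 ler_piMr.
have := cmod_tri (g (x + h) - g x) (\sum_k pd k g x * h 0 k) 0; rewrite !subr0 => h3.
apply: le_trans h3 _; apply: le_trans (lerD h1 h2) _.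
have -> : 20 * M * (vn h / r) = 16 * M * (vn h / r) + 4 * M * (vn h / r) by ring.
by rewrite lerD2r ler_wpM2l// mulr_ge0.
Qed.

(** The alternating sum is divisible by the product over integral_slots I; the
    quotient g is holomorphic in c with bounds independent of t, and the
    remaining factor K is continuous at c. The limit is K(c) g(c), and the rate
    of convergence depends only on K and on the bounds of g. *)
Lemma Ftil_cvg_uniform I (B : R) : 0 <= B -> exists M, forall e : R, 0 < e -> exists2 d : R, 0 < d &
  forall c', non_integral c' -> vn (c' - c) < d -> forall t, good T t -> vn t <= B ->
    cmod (Ftil I c' t - Flim I t) < e /\ cmod (Ftil I c' t) <= M.
Proof.
move=> B0; have [M0 hM0] := alt_sum_hol B0; have [K [K1 K2 K3]] := prefactor_regular I.
have ubad : uniq (integral_slots I) by rewrite filter_uniq ?enum_uniq.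
have [r [D [r0 hD]]] := divide ubad M0 (@ltr01 R).
have hg t : good T t -> vn t <= B -> exists2 g, hol_on g c r D &
    forall y, non_integral y -> vn (y - c) < r -> Ftil I y t = K y * g y.
  move=> tg tB; have [|g g1 g2] := hD _ c (hM0 I t tg tB).
    move=> k y; rewrite mem_filter => /andP[/andP[Ik /asboolP hk] _] _ e.
    by apply: (alt_sum_vanish tg Ik); rewrite e.
  exists g => // y hy yr; rewrite /Ftil g2// mulrA K3//.
have est t : good T t -> vn t <= B -> exists2 l, cmod l <= cmod (K c) * D &
    forall (e d : R), 0 < e -> (forall y, vn (y - c) < d -> cmod (K y - K c) < e) ->
    forall y, non_integral y -> vn (y - c) < d -> vn (y - c) < r -> 4 * vn (y - c) <= r ->
      cmod (Ftil I y t - l) <= e * D + cmod (K c) * (20 * D * (vn (y - c) / r)) /\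
      cmod (Ftil I y t) <= (cmod (K c) + e) * D.
  move=> tg tB; have [g g1 g2] := hg t tg tB; exists (K c * g c).
    rewrite cmodM ler_wpM2l ?cmod_ge0//; have [] := g1 c; rewrite ?subrr ?vn0//.
  move=> e d e0 hK y hy yd yr y4; rewrite (g2 y hy yr).
  have [_ gy] := g1 y yr; have Ky := hK y yd.
  have lg := lipschitz r0 g1 y4; rewrite subrKC in lg.
  split; last first.
    rewrite cmodM; apply: ler_pM; rewrite ?cmod_ge0//.
    by have := cmodB_ge (K y) (K c); move: Ky; clear; lra.
  have -> : K y * g y - K c * g c = (K y - K c) * g y + K c * (g y - g c) by ring.
  apply: le_trans (cmodD _ _) _; rewrite !cmodM; apply: lerD.
    by apply: ler_pM; rewrite ?cmod_ge0 ?(ltW Ky).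
  by rewrite ler_wpM2l ?cmod_ge0.
(* D bounds a modulus, so it can only be negative when no admissible t
   exists *)
have [D0|D0] := ltP D 0.
  exists 0 => e e0; exists 1 => // c' hc' _ t tg tB; exfalso.
  have [g g1 _] := hg t tg tB; have := hol_onM0 r0 g1; rewrite leNgt D0.
  by [].
have kc := cmod_ge0 (K c).
pose good_l t l := forall (e d : R), 0 < e -> (forall y, vn (y - c) < d -> cmod (K y - K c) < e) ->
    forall y, non_integral y -> vn (y - c) < d -> vn (y - c) < r -> 4 * vn (y - c) <= r ->
      cmod (Ftil I y t - l) <= e * D + cmod (K c) * (20 * D * (vn (y - c) / r)) /\
      cmod (Ftil I y t) <= (cmod (K c) + e) * D.
have unif (e : R) : 0 < e -> exists2 d : R, 0 < d & forall t l, good_l t l ->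
   forall y, non_integral y -> vn (y - c) < d ->
     cmod (Ftil I y t - l) < e /\ cmod (Ftil I y t) <= (cmod (K c) + 1) * D.
  move=> e0; pose e1 := Num.min 1 (e / (2 * (D + 1))).
  have D1 : 0 < D + 1 by lra.
  have e10 : 0 < e1 by rewrite lt_min ltr01 divr_gt0// mulr_gt0.
  have [d d0 hd] := (vcontP _ _).1 K1 e1 e10.
  (* half of q bounds the Lipschitz constant 20 D |K c| of K(c) g *)
  pose q := 40 * (cmod (K c) + 1) * (D + 1).
  have q0 : 0 < q by rewrite !mulr_gt0//; lra.
  exists (Num.min d (Num.min (r / 4) (e * r / q))).
    by rewrite !lt_min d0 (divr_gt0 (mulr_gt0 e0 r0) q0) divr_gt0.
  move=> t l l2 y hy.
  rewrite !lt_min => /andP[y1 /andP[y2 y3]].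
  have [y4 yr] := quarter r0 y2.
  have [h1 h2] := l2 e1 d e10 hd y hy y1 yr y4; split; last first.
    by apply: le_trans h2 _; rewrite ler_wpM2r// lerD2l; by rewrite ge_min lexx.
  apply: le_lt_trans h1 _; rewrite (splitr e); apply: ltr_leD.
    apply: lt_le_trans (_ : e1 * (D + 1) <= _); first by rewrite ltr_pM2l// ltrDl.
    have h : e1 <= e / (2 * (D + 1)) by rewrite ge_min lexx orbT.
    apply: le_trans (ler_wpM2r (ltW D1) h) _; rewrite invfM mulrA divfK ?gt_eqF//.
  have v0 := vn_ge0 (y - c); rewrite ltr_pdivlMr// in y3.
  rewrite mulrA mulrA ler_pdivrMr//; apply: le_trans (_ : vn (y - c) * q / 2 <= _).
    have -> : cmod (K c) * (20 * D) * vn (y - c) = vn (y - c) * (cmod (K c) * (20 * D)) by ring.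
    rewrite -mulrA ler_wpM2l//; have -> : q / 2 = 20 * ((cmod (K c) + 1) * (D + 1)).
      by rewrite /q; field.
    have -> : cmod (K c) * (20 * D) = 20 * (cmod (K c) * D) by ring.
    rewrite ler_wpM2l//; apply: ler_pM => //; rewrite lerDl//.
  exact: half_lt.
exists ((cmod (K c) + 1) * D) => e e0; have [d d0 hd] := unif e e0; exists d => // c' hc' cd t tg tB.
have [l l1 l2] := est t tg tB; have [h1 h2] := hd t l l2 c' hc' cd; split=> //.
suff -> : Flim I t = l by [].
apply: lim_param => e' e'0; have [d' d'0 hd'] := unif e' e'0.
by exists d' => // y h3 h4; have [] := hd' t l l2 y h3 h4.
Qed.
End AtParameter.
End Limit.

(** * Linearity of the differential operators *)

Opaque av edge pd cmod vn cexp clog rG.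
Section Linear.
Variables (R : realType) (m : nat).
Local Notation C := (Cpx R).
Local Notation V := 'rV[C]_m.
Variables (a b : C) (c : V).
Implicit Types (f g : V -> C) (t : V) (k : 'I_m) (z : C).
Lemma ECt_lin_alg z A p1 p2 p3 w B l1 l2 l3 l1' l2' l3' E F :
  (z * p1 + l1) + w * (z * p2 + l2) - A * ((z * p3 + l3) + E * (z * l1' + l2') + F * (z * B + l3')) =
  z * (p1 + w * p2 - A * (p3 + E * l1' + F * B)) + (l1 + w * l2 - A * (l3 + E * l2' + F * l3')) :> C.
Proof. ring. Qed.

Lemma ECt_lin k z f g t : hol_near f t -> hol_near g t ->
  ECt a b c k (fun y => z * f y + g y) t = z * ECt a b c k f t + ECt a b c k g t.
Proof.
move=> hf hg; have hzf : hol_near (fun y => z * f y) t by exact: hol_nearM (hol_near_cst _ _) hf.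
have hfg : hol_near (fun y => z * f y + g y) t by exact: hol_nearD.
rewrite !ECtE//.
have d1 : \forall y \near t, forall j, pd j (fun y => z * f y + g y) y = z * pd j f y + pd j g y.
  have h1 := (hol_nearP _ _).1 hf; have h2 := (hol_nearP _ _).1 hg.
  apply: filterS2 h1 h2 => y h1 h2 j.
  have hz1 : hol (fun y => z * f y) y by exact: holM (hol_cst _ _) h1.
  exact: etrans (pdD j hz1 h2) (congr1 (fun w => w + pd j g y) (pdZ z j h1)).
have d2 i j : pd i (pd j (fun y => z * f y + g y)) t = z * pd i (pd j f) t + pd i (pd j g) t.
  have h1 := hol_near_hol (hol_near_pd j hf); have h2 := hol_near_hol (hol_near_pd j hg).
  have hz1 : hol (fun y => z * pd j f y) t by exact: holM (hol_cst _ _) h1.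
  apply: etrans (etrans (pdD i hz1 h2) (congr1 (fun w => w + pd i (pd j g) t) (pdZ z i h1))).
  apply: pd_near; last exact: hol_near_hol (hol_near_pd j hfg).
  by apply: filterS d1 => y.
have e1 j := nbhs_singleton d1 j.
have E2 : hess_sum (fun y => z * f y + g y) t = z * hess_sum f t + hess_sum g t.
  rewrite /hess_sum mulr_sumr -big_split; apply: eq_bigr => i _ /=.
  by rewrite mulr_sumr -big_split; apply: eq_bigr => j _ /=; exact: d2.
have E1 : \sum_j pd j (fun y => z * f y + g y) t = z * \sum_j pd j f t + \sum_j pd j g t.
  by rewrite mulr_sumr -big_split; apply: eq_bigr => j _ /=; exact: e1.
apply: etrans (ECt_lin_alg _ _ _ _ _ _ _ _ _ _ _ _ _ _ _).
exact: (ECt_val_ext _ _ _ _ (d2 k k) (e1 k) E2 E1 erefl).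
Qed.

Lemma ECt_sum0 (X : Type) (r : seq X) (P : pred X) (al : X -> C) (F : X -> V -> C) k t :
  (forall i, P i -> hol_near (F i) t /\ ECt a b c k (F i) t = 0) ->
  ECt a b c k (fun y => \sum_(i <- r | P i) al i * F i y) t = 0.
Proof.
move=> h; suff [] : hol_near (fun y => \sum_(i <- r | P i) al i * F i y) t /\
  ECt a b c k (fun y => \sum_(i <- r | P i) al i * F i y) t = 0 by [].
elim: r => [|i r [ih1 ih2]].
  have -> : (fun y => \sum_(i <- [::] | P i) al i * F i y) = fun=> 0 by apply/funext => y; rewrite big_nil.
  have h0 := hol_near_cst (0 : C) t; split=> //.
  have := ECt_lin k (-1) h0 h0; rewrite mulN1r addNr => e.
  by rewrite mulN1r addNr in e.
case Pi : (P i); last first.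
  have -> // : (fun y => \sum_(j <- i :: r | P j) al j * F j y) =
    (fun y => \sum_(j <- r | P j) al j * F j y) by apply/funext => y; rewrite big_cons Pi.
have -> : (fun y => \sum_(j <- i :: r | P j) al j * F j y) =
  (fun y => al i * F i y + \sum_(j <- r | P j) al j * F j y) by apply/funext => y; rewrite big_cons Pi.
have [h1 h2] := h i Pi; split; last by rewrite ECt_lin// h2 ih2 mulr0 addr0.
by apply: hol_nearD ih1; exact: hol_nearM (hol_near_cst _ _) h1.
Qed.
End Linear.

(** * Linear independence by monodromy *)

Section BasePoint.
Variables (R : realType) (m : nat).
Local Notation C := (Cpx R).
Local Notation V := 'rV[C]_m.
Local Notation "x %:C" := (real_complex R x : C).
Hypothesis m1 : (1 <= m)%N.
Variables (a b : C).
Implicit Types (t : V) (I J S : cube m) (k : 'I_m).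
Local Notation Gser := (Gser a b).
Local Notation Ftil_ab := (Ftil a b).
Local Notation Flim := (Flim a b).

Definition log_xdot : R := ln ((2 * m%:R ^+ 2)^-1).

(** log (3/(4 m^2)), which lies between the logarithms of 1/(2 m^2), a
    coordinate of the base point, and of 1/m^2, the limit of convergence on the
    diagonal. *)
Definition Re_max : R := ln (3 / (4 * m%:R ^+ 2)).
Definition t0 : V := const_mx log_xdot%:C.

(** The distance from the base point to the boundary of the half space Re t_k
    <= Re_max. *)
Definition r1 : R := Re_max - log_xdot.
Lemma msq : 0 < m%:R ^+ 2 :> R. Proof. by rewrite exprn_gt0// ltr0n. Qed.

Lemma msq2 : 0 < 2 * m%:R ^+ 2 :> R. Proof. exact: mulr_gt0 (ltr0n _ 2) msq. Qed.

Lemma msq34 : 0 < 3 / (4 * m%:R ^+ 2) :> R.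
Proof. exact: divr_gt0 (ltr0n _ 3) (mulr_gt0 (ltr0n _ 4) msq). Qed.

Lemma Re_max_small : m%:R ^+ 2 * expR Re_max < 1 :> R.
Proof.
rewrite lnK ?posrE ?msq34//; have := msq; move: (m%:R ^+ 2) => y y0.
have -> : y * (3 / (4 * y)) = 3 / 4 by field; rewrite gt_eqF.
by lra.
Qed.

Lemma r1_gt0 : 0 < r1.
Proof.
rewrite subr_gt0 ltr_ln ?posrE ?msq34 ?invr_gt0 ?msq2//; have := msq; move: (m%:R ^+ 2) => y y0.
have -> : 3 / (4 * y) = 3 / 4 * y^-1 by field; rewrite gt_eqF.
by rewrite invfM ltr_pM2r ?invr_gt0//; lra.
Qed.

Lemma tmap_t0 : tmap t0 = xdot R m.
Proof.
apply/rowP => k; rewrite !mxE cexp_real lnK ?posrE ?invr_gt0 ?msq2//.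
by rewrite fmorphV rmorphM rmorphXn /= !rmorph_nat.
Qed.

Lemma t0Im k : ImC (t0 0 k) = 0. Proof. by rewrite mxE. Qed.

(** Every ball of radius r1 centred in this half space lies in the domain of
    convergence. It contains t0, its translates by 2 pi i, and the points t0 -
    tau (1, ..., 1) with tau >= 0. *)
Definition low (p : V) := forall k, ReC (p 0 k) <= log_xdot.
Lemma good_ball p : low p -> forall y, vn (y - p) < r1 -> good Re_max y.
Proof.
move=> hp y yr k; have := le_lt_trans (cmod_le_vn (y - p) k) yr; rewrite rowBE => h.
have := le_lt_trans (Re_le_cmod _) h; rewrite ReCB ltr_norml => /andP[_ h2].
by have := hp k; move: h2; rewrite /r1; lra.
Qed.

Lemma low_t0 : low t0. Proof. by move=> k; rewrite mxE. Qed.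

Section AtParameter.
Variable c : V.

(** A single sequence of generic parameters along which all tilde F_I converge,
    with uniform bounds. *)
Lemma Flim_seq (B : R) : 0 <= B -> exists u : nat -> V, [/\ forall n, non_integral (u n), vlim u c &
  forall I, exists M, forall t, good Re_max t -> vn t <= B ->
    (forall n, cmod (Ftil_ab I (u n) t) <= M) /\ clim (fun n => Ftil_ab I (u n) t) (Flim c I t)].
Proof.
move=> B0.
have [M hM] := choice (fun I => Ftil_cvg_uniform a b Re_max_small c I B0).
have /nbhs_vnP[d d0 hd] : \forall c' \near c, forall I, non_integral (c' : V) ->
    forall t, good Re_max t -> vn t <= B -> cmod (Ftil_ab I c' t) <= M I.
  apply: (filter_forall (nbhs_filter c)) => I; have [d d0 hd] := hM I 1 ltr01.
  by apply/nbhs_vnP; exists d => // c' h1 h2 t tg tB; have [] := hd c' h2 h1 t tg tB.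
have [u [u1 u2 u3]] := nonint_seq c d0; exists u; split=> // I; exists (M I) => t tg tB.
split=> [n|e e0]; first exact: hd (u2 n) _ (u1 n) _ tg tB.
have [d' d'0 hd'] := hM I e e0; have [N hN] := (vlimP _ _).1 u3 d' d'0.
by exists N => n Nn; have [] := hd' _ (u1 n) (hN n Nn) t tg tB.
Qed.

Lemma Ftil_hol I c' t : (\forall y \near t, good Re_max y) -> hol_near (Ftil_ab I c') t.
Proof.
move=> /nbhs_vnP[r r0 hg]; have B0 : 0 <= vn c' + (vn t + r) by rewrite !addr_ge0 ?vn_ge0 ?(ltW r0).
have [M hM] := G_hol_t a b Re_max_small B0.
apply: hol_nearM (hol_near_cst _ _) _; apply: hol_near_sum => J _.
apply: hol_nearM (hol_near_cst _ _) _; exists r, M; split=> //.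
have [] // := hM J c' t r r0 _ _ hg; first by rewrite lerDl addr_ge0 ?vn_ge0 ?(ltW r0).
by rewrite lerDr vn_ge0.
Qed.

Lemma G_near J c' t : (\forall y \near t, good Re_max y) -> hol_near (Gser J c') t.
Proof.
move=> /nbhs_vnP[r r0 hg]; have B0 : 0 <= vn c' + (vn t + r) by rewrite !addr_ge0 ?vn_ge0 ?(ltW r0).
have [M hM] := G_hol_t a b Re_max_small B0; exists r, M; split=> //.
have [] // := hM J c' t r r0 _ _ hg; first by rewrite lerDl addr_ge0 ?vn_ge0 ?(ltW r0).
by rewrite lerDr vn_ge0.
Qed.

Lemma Ftil_ECt I c' k t : (\forall y \near t, good Re_max y) -> ECt a b c' k (Ftil_ab I c') t = 0.
Proof.
move=> hg; have -> : Ftil_ab I c' = fun y => \sum_(J : cube m | below J I) (prefactor c' I * sgn R J) * Gser J c' y.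
  by apply/funext => y; rewrite /Ftil mulr_sumr; apply: eq_bigr => J _; rewrite mulrA.
apply: ECt_sum0 => J _; split; first exact: G_near.
exact: (@G_ECt R m a b Re_max Re_max_small J c' k t hg).
Qed.

(** A bounded limit of holomorphic solutions is a holomorphic solution. *)
Lemma Flim_hol (B : R) : 0 <= B -> exists M, forall I t r, 0 < r -> vn t + r <= B ->
  (forall y, vn (y - t) < r -> good Re_max y) ->
  hol_on (Flim c I) t r M /\ forall k, ECt a b c k (Flim c I) t = 0.
Proof.
move=> B0; have [u [u1 u2 u3]] := Flim_seq B0; have [M hM] := choice u3.
exists (\sum_I `|M I|) => I t r r0 tB hg.
have M1 : M I <= \sum_I `|M I|.
  by rewrite (bigD1 I)//=; apply: le_trans (ler_norm _) _; rewrite lerDl sumr_ge0.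
have nh y : vn (y - t) < r -> \forall z \near y, good Re_max z.
  move=> yr; apply/nbhs_vnP; exists (r - vn (y - t)); first by rewrite subr_gt0.
  move=> z; rewrite ltrBrDr => h; apply: hg; exact: le_lt_trans (vn_tri _ y _) h.
have hu n : hol_on (Ftil_ab I (u n)) t r (\sum_I `|M I|).
  move=> y yr; split; first exact: hol_near_hol (Ftil_hol I (u n) (nh y yr)).
  have [h _] := hM I y (hg y yr) (vn_near_le yr tB).
  exact: le_trans (h n) M1.
have hl y : vn (y - t) < r -> clim (fun n => Ftil_ab I (u n) y) (Flim c I y).
  by move=> yr; have [] := hM I y (hg y yr) (vn_near_le yr tB).
split; first by have [] := hol_lim r0 hu hl.
move=> k; have vtt : vn (t - t) < r by rewrite subrr vn0.
have h := @ECt_lim R m a b u c k (fun n => Ftil_ab I (u n)) (Flim c I) t r _ r0 hu hl (u2 k); apply: (clim_uniq h).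
by apply: (clim_ext (N := 0%N)) (clim_cst _) => n _; rewrite (Ftil_ECt _ _ _ (nh t vtt)).
Qed.

(** The identity theorem along the segment from t0 to q, which stays in the
    convex half space low. *)
Lemma zero_continuation (W : V -> C) q : low q ->
  (forall B : R, 0 <= B -> exists M, forall p, low p -> vn p + r1 <= B -> hol_on W p r1 M) ->
  (\forall t \near t0, W t = 0) -> \forall t \near q, W t = 0.
Proof.
move=> hq hW /nbhs_vnP[e e0 he].
have B0 : 0 <= vn t0 + vn (q - t0) + r1 by exact: addr_ge0 (addr_ge0 (vn_ge0 _) (vn_ge0 _)) (ltW r1_gt0).
have [M hM] := hW _ B0.
apply/nbhs_vnP; exists (r1 / 4); first by rewrite divr_gt0 ?r1_gt0.
move=> z zq; apply: (identity_segment r1_gt0 e0 _ he (M := M) (y := q)); last exact: ltW.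
move=> s s0 s1; apply: hM.
  move=> k; have ek : (t0 + s%:C *: (q - t0)) 0 k = log_xdot%:C + s%:C * (q 0 k - log_xdot%:C) by rewrite !mxE.
  rewrite ek ReCD ReCZ ReCB; have -> : ReC (log_xdot%:C : C) = log_xdot by [].
  by rewrite gerDl mulr_ge0_le0// subr_le0.
rewrite lerD2r; apply: le_trans (vnD _ _) _; rewrite lerD2l vnZ cmod_real ger0_norm//.
by rewrite ler_piMl ?vn_ge0.
Qed.

Definition monod_wgt (i s : bool) : C := if i then (if s then 1 else -1) else (if s then 0 else 1).

(** The operator prod (M_k - 1) over the k with I0_k = 1, where (M_k f)(t) =
    f(t + 2 pi i e_k), expanded over the subsets S of indices that are turned.
    The weights are the coefficients of the expansion: for I0_k = 1 they are 1
    (turned) and -1 (not turned), and for I0_k = 0 only the term without turn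
    occurs. *)
Definition monod (I0 : cube m) (f : V -> C) t : C := \sum_(S : cube m) (\prod_k monod_wgt (I0 k) (S k)) * f (t + turn R S).
Lemma low_turn t S : low t -> low (t + turn R S).
Proof.
move=> h k; rewrite addrowE ReCD mxE.
have e (d : bool) : ReC (cplx 0 (2 * pi) * d%:R : C) = 0 by case: d; rewrite ?mulr1 ?mulr0.
by rewrite e addr0.
Qed.

(** Each G_J is an eigenfunction of the commuting operators M_k, so the sum
    over S factors into a product over k. *)
Lemma monod_G I0 J c' t : good Re_max t -> monod I0 (Gser J c') t =
  (\prod_k (if I0 k then (if J k then (gammak c' k)^-1 else 1) - 1 else 1)) * Gser J c' t.
Proof.
move=> tg; rewrite /monod.
have E S : (\prod_k monod_wgt (I0 k) (S k)) * Gser J c' (t + turn R S) =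
  (\prod_k (monod_wgt (I0 k) (S k) * (if S k && J k then (gammak c' k)^-1 else 1))) * Gser J c' t.
  by rewrite (@G_turn R m a b Re_max Re_max_small J c' S t tg) mulrA -big_split.
rewrite (eq_bigr _ (fun S _ => E S)) -mulr_suml; congr (_ * _).
rewrite -(bigA_distr_bigA (fun k (s : bool) => monod_wgt (I0 k) s * (if s && J k then (gammak c' k)^-1 else 1))).
apply: eq_bigr => k _; rewrite big_bool /monod_wgt /=; case: (I0 k); last by rewrite mul0r add0r mulr1.
by rewrite mul1r mulr1.
Qed.

Lemma monod_Ftil I0 I c' t : good Re_max t -> monod I0 (Ftil_ab I c') t =
  prefactor c' I * \sum_(J : cube m | below J I) sgn R J *
   ((\prod_k (if I0 k then (if J k then (gammak c' k)^-1 else 1) - 1 else 1)) * Gser J c' t).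
Proof.
move=> tg; have -> : monod I0 (Ftil_ab I c') t =
    prefactor c' I * \sum_(J : cube m | below J I) sgn R J * monod I0 (Gser J c') t.
  rewrite /monod [in RHS]mulr_sumr.
  rewrite [RHS](eq_bigr (fun J : cube m => \sum_(S : cube m) (\prod_k monod_wgt (I0 k) (S k)) *
     (prefactor c' I * (sgn R J * Gser J c' (t + turn R S))))); last first.
    move=> J _; rewrite 2!mulr_sumr; apply: eq_bigr => S _.
    by rewrite (mulrCA (sgn R J)) (mulrCA (prefactor c' I)).
  rewrite exchange_big/=; apply: eq_bigr => S _.
  by rewrite /Ftil /alt_sum 2!mulr_sumr.
by congr (_ * _); apply: eq_bigr => J _; rewrite monod_G.
Qed.

Lemma monod_prod0 I0 J c' k : I0 k -> ~~ J k ->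
  \prod_k (if I0 k then (if J k then (gammak c' k)^-1 else 1) - 1 else 1) = 0 :> C.
Proof. by move=> h1 h2; rewrite (bigD1 k)//= h1 (negbTE h2) subrr mul0r. Qed.

(** If I_k = 0, only series with J_k = 0 occur in tilde F_I, and M_k - 1 kills
    them. *)
Lemma monod_Ftil0 I0 I c' t k : good Re_max t -> I0 k -> ~~ I k -> monod I0 (Ftil_ab I c') t = 0.
Proof.
move=> tg h1 h2; rewrite monod_Ftil// big1 ?mulr0// => J /forallP JI.
rewrite (monod_prod0 _ h1) ?mul0r ?mulr0//; have := JI k; rewrite (negbTE h2) leqn0.
by case: (J k).
Qed.

(** The eigenvalue gamma_k^-1 - 1 = gamma_k^-1 (1 - gamma_k) supplies the
    factor 1 - gamma_k which tilde F_I0 lacks at the indices of I0, so all the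
    factors are those of the regular case I_k = 0. *)
Definition monod_coef (I0 : cube m) (c' : V) : C :=
  \prod_k ((if I0 k then (gammak c' k)^-1 else 1) * pole_factor false (c' 0 k)).

(** Among the J <= I0 only J = I0 survives. *)
Lemma monod_Ftil1 I0 c' t : good Re_max t -> monod I0 (Ftil_ab I0 c') t = sgn R I0 * monod_coef I0 c' * Gser I0 c' t.
Proof.
move=> tg; rewrite monod_Ftil// (bigD1 I0)/=; last by apply/forallP.
rewrite [X in _ * (_ + X)]big1 ?addr0; last first.
  move=> J /andP[/forallP JI JI0].
  have [k h1 h2] : exists2 k, I0 k & ~~ J k.
    have /existsP[k hk] : [exists k, J k != I0 k].
      rewrite -negb_forall; apply: contra JI0 => /forallP h.
      by apply/eqP/ffunP => k; exact/eqP.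
    by exists k; move: hk (JI k); case: (J k); case: (I0 k).
  by rewrite (monod_prod0 _ h1 h2) mul0r mulr0.
rewrite mulrCA -[in RHS]mulrA; congr (_ * _); rewrite mulrA; congr (_ * _).
rewrite /prefactor /monod_coef -big_split/=; apply: eq_bigr => k _; rewrite /pole_factor; case: (I0 k).
  rewrite subnn subn0 expr0 expr1 mul1r /gammak [in RHS]mulrA mulrBr [in RHS]mulrBr !mulr1.
  by rewrite mulVf ?cexp_neq0// mulrBl mul1r (mulrC (reflG _)^-1).
by rewrite mul1r mulr1.
Qed.

(** The factors 1 - gamma_k cancel the zeros of reflG, so the limit at integral
    parameters is finite and nonzero. *)
Lemma monod_coef_regular I0 : exists2 K : V -> C, vcont K c /\ K c != 0 &
  forall c', non_integral c' -> monod_coef I0 c' = K c'.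
Proof.
have [E hE] := choice (fun k => pole_factor_regular false (c 0 k)).
exists (fun c' => \prod_k ((if I0 k then (gammak c' k)^-1 else 1) * E k (c' 0 k))).
  split; last first.
    apply/prodf_neq0 => k _; have [_ h _] := hE k; rewrite mulf_neq0//; case: (I0 k).
      by rewrite invr_neq0// cexp_neq0.
    exact: oner_neq0.
  move=> u hu; apply: clim_prod => k _; have [h _ _] := hE k.
  apply: climM; last exact: (cont_seqP _ _).1 h _ (hu k).
  case: (I0 k); last exact: clim_cst.
  apply: climV; first exact: cexp_neq0.
  exact: (cont_seqP _ _).1 (cderiv_cont (cderiv_tpi (c 0 k))) _ (hu k).
move=> c' hc; apply: eq_bigr => k _; have [_ _ h] := hE k.
by rewrite -(h _ (hc k)) mulr1.
Qed.

Lemma monod_lim I0 I t : good Re_max t -> exists u : nat -> V, [/\ forall n, non_integral (u n), vlim u c &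
  clim (fun n => monod I0 (Ftil_ab I (u n)) t) (monod I0 (Flim c I) t)].
Proof.
move=> tg; pose B : R := \sum_(S : cube m) vn (t + turn R S).
have B0 : 0 <= B by rewrite sumr_ge0// => S _; exact: vn_ge0.
have [u [u1 u2 u3]] := Flim_seq B0; exists u; split=> //.
have [M hM] := u3 I; apply: clim_sum => S _; apply: climZ.
have [] // := hM (t + turn R S).
  exact: good_turn.
by rewrite /B (bigD1 S)//= lerDl sumr_ge0// => S' _; exact: vn_ge0.
Qed.

Lemma monod_Flim0 I0 I t k : good Re_max t -> I0 k -> ~~ I k -> monod I0 (Flim c I) t = 0.
Proof.
move=> tg h1 h2; have [u [u1 u2 u3]] := monod_lim I0 I tg; apply: (clim_uniq u3).
by apply: (clim_ext (N := 0%N)) (clim_cst 0) => n _; rewrite (@monod_Ftil0 I0 I (u n) t k).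
Qed.

(** The relation for generic parameters passes to the limit, since both the
    factor and G_I0 are continuous in c. *)
Lemma monod_Flim1 I0 : exists2 lam : C, lam != 0 &
  forall t, good Re_max t -> monod I0 (Flim c I0) t = lam * Gser I0 c t.
Proof.
have [K [K1 K2] K3] := monod_coef_regular I0; exists (sgn R I0 * K c).
  by rewrite mulf_neq0//; apply/prodf_neq0 => k _; rewrite signr_eq0.
move=> t tg; have [u [u1 u2 u3]] := monod_lim I0 I0 tg; apply: (clim_uniq u3).
have B0 : 0 <= vn c + 1 + vn t by rewrite !addr_ge0 ?vn_ge0.
have [M hM] := G_hol_c a b Re_max_small B0.
have hG : hol_on (fun c' => Gser I0 c' t) c 1 M.
  by apply: hM => //; [rewrite lerDl vn_ge0|rewrite lerDr addr_ge0 ?vn_ge0].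
have cG : vcont (fun c' => Gser I0 c' t) c.
  have vcc : vn (c - c) < 1 by rewrite subrr vn0.
  by have [h _] := hG c vcc; exact: hdiff_cont h.
have h := climM (climZ (sgn R I0) (K1 u u2)) (cG u u2).
by apply: (clim_ext (N := 0%N)) h => n _; rewrite (monod_Ftil1 I0 (u n) tg) K3.
Qed.

Section Indep.
Hypothesis ha : forall J : cube m, ~ is_integer (a - \sum_k (J k)%:R * c 0 k).
Hypothesis hb : forall J : cube m, ~ is_integer (b - \sum_k (J k)%:R * c 0 k).

(** Among the indices with nonzero coefficient choose I0 with the largest
    number of ones. For every other such index I there is k with I0_k = 1 and
    I_k = 0, so the operator attached to I0 leaves only the term of I0. *)
Lemma Flim_indep (l : cube m -> C) :
  (\forall t \near t0, \sum_I l I * Flim c I t = 0) -> forall I, l I = 0.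
Proof.
move=> hz I; apply/eqP/negPn/negP => lI.
(* an index with nonzero coefficient and the largest number of ones *)
pose wt (J : cube m) : nat := \sum_k (J k : nat).
have [I0 lI0 hmax] := @arg_maxnP _ I (fun J => l J != 0) wt lI.
pose W t := \sum_I l I * Flim c I t.
have hW (B : R) : 0 <= B -> exists M, forall p, low p -> vn p + r1 <= B -> hol_on W p r1 M.
  move=> B0; have [M hM] := Flim_hol B0; exists (\sum_J cmod (l J) * M) => p pl pB.
  have hJ J := (hM J p r1 r1_gt0 pB (good_ball pl)).1.
  move=> y yr; split.
    by apply: hol_sum => J _; apply: holM (hol_cst _ _) _; have [] := hJ J y yr.
  apply: le_trans (cmod_sum _ _ _) _; apply: ler_sum => J _; rewrite cmodM.
  by rewrite ler_wpM2l ?cmod_ge0//; have [] := hJ J y yr.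
(* the relation is continued along the segment from t0 to t0 + 2 pi i S *)
have hWS S : \forall t \near t0, W (t + turn R S) = 0.
  have /nbhs_vnP[r r0 hr] := zero_continuation (low_turn S low_t0) hW hz.
  apply/nbhs_vnP; exists r => // y yr; apply: hr; by rewrite opprD addrACA subrr addr0.
have [lam lam0 hlam] := monod_Flim1 I0.
have MW t : good Re_max t -> monod I0 W t = l I0 * (lam * Gser I0 c t).
  move=> tg; have -> : monod I0 W t = \sum_J l J * monod I0 (Flim c J) t.
    rewrite /monod /W; under [RHS]eq_bigr do rewrite mulr_sumr.
    rewrite exchange_big/=; apply: eq_bigr => S _; rewrite mulr_sumr; apply: eq_bigr => J _.
    by rewrite mulrCA.
  rewrite (bigD1 I0)//= hlam// big1 ?addr0// => J JI0.
  have [->|lJ] := eqVneq (l J) 0; first by rewrite mul0r.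
  suff [k h1 h2] : exists2 k, I0 k & ~~ J k by rewrite (monod_Flim0 tg h1 h2) mulr0.
  have : (wt J <= wt I0)%N := hmax J lJ; rewrite leqNgt => /negP hn.
  have /existsP[k /andP[h1 h2]] : [exists k, I0 k && ~~ J k]; last by exists k.
  apply: contraT => hall; exfalso; apply: hn.
  have sub k : (I0 k <= J k)%N.
    move: hall; rewrite negb_exists => /forallP/(_ k).
    by case: (I0 k); case: (J k).
  have /existsP[k hk] : [exists k, J k != I0 k].
    rewrite -negb_forall; apply: contra JI0 => /forallP h.
    by apply/eqP/ffunP => k; exact/eqP.
  rewrite /wt (bigD1 k)//= [X in (_ < X)%N](bigD1 k)//= -addSn; apply: leq_add.
    by move: hk (sub k); case: (J k); case: (I0 k).
  by apply: leq_sum => j _.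
have G0 : \forall t \near t0, Gser I0 c t = 0.
  have h1 : \forall t \near t0, good Re_max t by apply/nbhs_vnP; exists r1; [exact: r1_gt0|exact: good_ball low_t0].
  have h2 := filter_forall (nbhs_filter t0) hWS.
  apply: filterS2 h1 h2 => t tg h; have := MW t tg.
  rewrite {1}/monod big1 => [/esym/eqP|S _]; last by rewrite h mulr0.
  by rewrite !mulf_eq0 (negbTE lI0) (negbTE lam0) => /eqP.
have hG (B : R) : 0 <= B -> exists M, forall p, low p -> vn p + r1 <= B -> hol_on (Gser I0 c) p r1 M.
  move=> B0; have B1 : 0 <= vn c + B by rewrite addr_ge0 ?vn_ge0.
  have [M hM] := G_hol_t a b Re_max_small B1; exists M => p pl pB.
  have [] // := hM I0 c p r1 r1_gt0 _ _ (good_ball pl); first by rewrite lerDl.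
  by apply: le_trans pB _; rewrite lerDr vn_ge0.
have tg0 : good Re_max t0 by apply: (good_ball low_t0); rewrite subrr vn0 r1_gt0.
suff H : forall tau : R, 0 <= tau -> Gser I0 c (t0 - const_mx tau%:C) = 0.
  exact: (@G_lead R m a b Re_max Re_max_small c I0 t0 (@ha I0) (@hb I0) tg0 H).
move=> tau tau0.
have lq : low (t0 - const_mx tau%:C).
  move=> k; rewrite !mxE ReCB; have -> : ReC (log_xdot%:C : C) = log_xdot by [].
  by have -> : ReC (tau%:C : C) = tau by []; rewrite gerBl.
exact: nbhs_singleton (zero_continuation lq hG G0).
Qed.
End Indep.
End AtParameter.
End BasePoint.

(** * Calculus of iterated partial derivatives *)

Opaque av edge pd cmod vn cexp clog rG.
Section MixedJets.
Variables (R : realType) (m : nat).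
Local Notation C := (Cpx R).
Local Notation V := 'rV[C]_m.
Local Notation "x %:C" := (real_complex R x : C).
Implicit Types (f g h : V -> C) (t : V) (k : 'I_m) (w : seq 'I_m).

Lemma nearT t (P : V -> Prop) : (forall y, P y) -> \forall y \near t, P y.
Proof. by move=> h; apply/nbhs_vnP; exists 1 => // y _; exact: h. Qed.

Lemma near_hn f t : hol_near f t -> \forall y \near t, hol f y.
Proof. exact: (hol_nearP _ _).1. Qed.

Lemma pd_near_near k f g t : (\forall y \near t, f y = g y) -> hol_near f t ->
  \forall y \near t, pd k f y = pd k g y.
Proof.
move=> e /near_hn hf; apply: filterS2 (near_nearW e) hf => y e' hy; exact: pd_near e' hy.
Qed.

Lemma pds_near w f g t : (\forall y \near t, f y = g y) -> hol_near f t ->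
  \forall y \near t, pds w f y = pds w g y.
Proof.
move=> e hf; elim: w => [//|k w ih] /=.
exact: (pd_near_near k ih (hol_near_pds w hf)).
Qed.

Lemma pds_near0 w f g t : (\forall y \near t, f y = g y) -> hol_near f t -> pds w f t = pds w g t.
Proof. by move=> e hf; exact: nbhs_singleton (pds_near w e hf). Qed.

Lemma pds_cat w w' f : pds (w ++ w') f = pds w (pds w' f).
Proof. by rewrite /pds foldr_cat. Qed.

Lemma pds_rcons w k f : pds (rcons w k) f = pds w (pd k f).
Proof. by rewrite -cats1 pds_cat. Qed.

Lemma pds_lin w z f g t : hol_near f t -> hol_near g t ->
  \forall y \near t, pds w (fun y => z * f y + g y) y = z * pds w f y + pds w g y.
Proof.
move=> hf hg; elim: w => [|k w ih] /=; first exact: nearT.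
have h1 := hol_near_pds w hf; have h2 := hol_near_pds w hg.
have hz : hol_near (fun y => z * pds w f y) t by exact: hol_nearM (hol_near_cst _ _) h1.
have hsum := hol_nearD hz h2.
have e2 : \forall y \near t, z * pds w f y + pds w g y = pds w (fun y => z * f y + g y) y.
  by apply: filterS ih => y ->.
have e3 := pd_near_near k e2 hsum.
have e4 : \forall y \near t, pd k (fun y => z * pds w f y + pds w g y) y = z * pd k (pds w f) y + pd k (pds w g) y.
  apply: filterS2 (near_hn h1) (near_hn h2) => y h3 h4.
  have hz1 : hol (fun y => z * pds w f y) y by exact: holM (hol_cst _ _) h3.
  exact: etrans (pdD k hz1 h4) (congr1 (fun u => u + pd k (pds w g) y) (pdZ z k h3)).
by apply: filterS2 e3 e4 => y <- ->.
Qed.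

Lemma pds_lin0 w z f g t : hol_near f t -> hol_near g t ->
  pds w (fun y => z * f y + g y) t = z * pds w f t + pds w g t.
Proof. by move=> h1 h2; exact: nbhs_singleton (pds_lin w z h1 h2). Qed.

Lemma pds_add0 w f g t : hol_near f t -> hol_near g t ->
  pds w (fun y => f y + g y) t = pds w f t + pds w g t.
Proof.
move=> h1 h2; have := pds_lin0 w 1 h1 h2; rewrite mul1r => <-; apply: pds_near0; last exact: hol_nearD.
by apply: nearT => y; rewrite mul1r.
Qed.

Lemma pds_zero w t : pds w (fun=> 0 : C) t = 0.
Proof.
have h0 := hol_near_cst (0 : C) t.
have e := pds_lin0 w (-1) h0 h0; rewrite mulN1r addNr in e.
by rewrite mulN1r addNr in e.
Qed.

Lemma pds_sum w (X : Type) (r : seq X) (al : X -> C) (F : X -> V -> C) t :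
  (forall i, hol_near (F i) t) ->
  pds w (fun y => \sum_(i <- r) al i * F i y) t = \sum_(i <- r) al i * pds w (F i) t.
Proof.
move=> h; have hs r' : hol_near (fun y => \sum_(i <- r') al i * F i y) t.
  by apply: hol_near_sum => i _; exact: hol_nearM (hol_near_cst _ _) (h i).
elim: r => [|i r ih].
  rewrite big_nil -[RHS](pds_zero w t); apply: pds_near0 => //.
  by apply: nearT => y; rewrite big_nil.
rewrite big_cons -ih -pds_lin0//; apply: pds_near0 => //.
by apply: nearT => y; rewrite big_cons.
Qed.

Lemma pds_sum1 w (X : Type) (r : seq X) (F : X -> V -> C) t :
  (forall i, hol_near (F i) t) ->
  pds w (fun y => \sum_(i <- r) F i y) t = \sum_(i <- r) pds w (F i) t.
Proof.
move=> h; have := pds_sum w r (fun=> 1) h.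
under [RHS]eq_bigr do rewrite mul1r.
move=> <-; apply: pds_near0; first by apply: nearT => y; apply: eq_bigr => i _; rewrite mul1r.
by apply: hol_near_sum => i _.
Qed.

Lemma pds_swap f t j k : hol_near f t -> \forall y \near t, pd j (pd k f) y = pd k (pd j f) y.
Proof.
move=> [r [M [r0 hf]]]; apply/nbhs_vnP; exists (r / 2); first by rewrite divr_gt0.
by have [] := hol_pd r0 hf k => _ h y; exact: h.
Qed.

Lemma pds_rot w k f t : hol_near f t ->
  \forall y \near t, pds w (pd k f) y = pd k (pds w f) y.
Proof.
move=> hf; elim: w => [|j w ih] /=; first exact: nearT.
have e1 := pd_near_near j ih (hol_near_pds w (hol_near_pd k hf)).
by apply: filterS2 e1 (pds_swap j k (hol_near_pds w hf)) => y -> ->.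
Qed.

(** Partial derivatives commute, so only the multiset of the word matters. *)
Lemma pds_perm w w' f t : hol_near f t -> perm_eq w w' -> \forall y \near t, pds w f y = pds w' f y.
Proof.
move=> hf; elim: w w' => [|k w ih] w' pw.
  by move: pw; rewrite perm_sym => /perm_nilP ->; exact: nearT.
have kw : k \in w' by rewrite -(perm_mem pw) mem_head.
have [p1 [p2 e]] : exists p1 p2, w' = p1 ++ k :: p2.
  by case/splitPr: kw => p1 p2; exists p1, p2.
subst w'; have pw' : perm_eq w (p1 ++ p2).
  by move: pw; rewrite perm_sym perm_catC /= perm_cons perm_catC perm_sym.
have e1 := pd_near_near k (ih _ pw') (hol_near_pds w hf).
have e2 := pds_rot p1 k (hol_near_pds p2 hf).
rewrite pds_cat /=; apply: filterS2 e1 e2 => y -> ->.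
by rewrite pds_cat.
Qed.

(** All terms of the product rule except one contain a lower derivative of
    g. *)
Lemma leibniz w n g h t : hol_near g t -> hol_near h t ->
  (forall v, (size v < n)%N -> pds v g t = 0) -> (size w <= n)%N ->
  pds w (fun y => h y * g y) t = h t * pds w g t.
Proof.
elim/last_ind: w n g h => [//|w k ih] n g h hg hh hv; rewrite size_rcons => wn.
have e : \forall y \near t, pd k (fun y => h y * g y) y = pd k h y * g y + h y * pd k g y.
  by apply: filterS2 (near_hn hh) (near_hn hg) => y h1 h2; exact: pdM.
have hhk := hol_near_pd k hh; have hgk := hol_near_pd k hg.
have hp := hol_nearM hh hg.
have E2 : pds w (fun y => h y * pd k g y) t = h t * pds w (pd k g) t.
  case: n hv wn => // n hv wn; apply: (ih n) => // v vn'.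
  by have := hv (rcons v k); rewrite pds_rcons size_rcons; exact.
apply: etrans (congr1 (@^~ t) (pds_rcons w k _)) _.
apply: etrans (pds_near0 w e (hol_near_pd k hp)) _.
apply: etrans (pds_add0 w (hol_nearM hhk hg) (hol_nearM hh hgk)) _.
apply: etrans (congr2 +%R (ih n g (pd k h) hg hhk hv (ltnW wn)) E2) _.
by rewrite (hv w wn) mulr0 add0r pds_rcons.
Qed.
End MixedJets.

(** * Solutions are determined by their square-free jets *)

Section Spanning.
Variables (R : realType) (m : nat).
Local Notation C := (Cpx R).
Local Notation V := 'rV[C]_m.
Local Notation "x %:C" := (real_complex R x : C).
Hypothesis m1 : (1 <= m)%N.
Variables (a b : C) (c : V).
Local Notation t0 := (t0 R m).
Implicit Types (f g h : V -> C) (t : V) (k : 'I_m) (w : seq 'I_m).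

(** Differentiate the k-th equation along w: all terms of order lower than |w|
    + 2 vanish by hypothesis, also those created by differentiating e^(t_k). *)
Lemma pds_ECt f w k n : Solt a b c t0 f -> (forall v, (size v < n)%N -> pds v f t0 = 0) ->
  (size w + 2 = n)%N ->
  pds (w ++ [:: k; k]) f t0 = cexp (t0 0 k) * \sum_i \sum_j pds (w ++ [:: i; j]) f t0.
Proof.
move=> hS hv wn.
have hf : hol_near f t0 by apply/hol_nearP; apply: filterS hS => t [].
(* the equation, solved for d_k^2 f, with the lower order terms collected in
   low *)
pose low := fun y => (a + b) * (\sum_j pd j f y) + a * b * f y.
have hs : hol_near (fun y => \sum_j pd j f y) t0 by apply: hol_near_sum => j _; exact: hol_near_pd.
have hab : hol_near (fun y => a * b * f y) t0 by exact: hol_nearM (hol_near_cst _ _) hf.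
have hlow : hol_near low t0 by apply: hol_nearD hab; exact: hol_nearM (hol_near_cst _ _) hs.
have hpp i j : hol_near (pd i (pd j f)) t0 by exact: hol_near_pd (hol_near_pd _ hf).
have hlap : hol_near (hess_sum f) t0 by apply: hol_near_sum => i _; apply: hol_near_sum => j _.
have hs2 i : hol_near (fun y => \sum_j pd i (pd j f) y) t0.
  by apply: hol_near_sum => j _; exact: hpp.
pose g := fun y => hess_sum f y + low y.
have hg : hol_near g t0 by exact: hol_nearD.
have he : hol_near (fun y : V => cexp (y 0 k)) t0.
  by apply/hol_nearP; apply: nearT => y; apply: hol_cexp; exact: hol_coord.
have heg := hol_nearM he hg; have hk := hol_near_pd k hf.
have e : \forall y \near t0, (1 - c 0 k) * pd k f y + cexp (y 0 k) * g y = pd k (pd k f) y.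
  apply: filterS2 hS (hol_near_near hf) => y [_ hy] hn; have := hy k; rewrite ECtE// => /eqP.
  rewrite subr_eq0 => /eqP h; rewrite /g /low addrA -h.
  by rewrite addrCA -mulrDl addrA subrK subrr mul0r addr0.
rewrite pds_cat /= -(pds_near0 w e); last first.
  by apply: hol_nearD heg; exact: hol_nearM (hol_near_cst _ _) hk.
rewrite pds_lin0//.
have sz (v : seq 'I_m) : (size v <= 1)%N -> forall u, (size u <= size w)%N -> pds (u ++ v) f t0 = 0.
  move=> v1 u uw; apply: hv; rewrite size_cat -wn addnS ltnS.
  by apply: leq_add.
have -> : pds w (pd k f) t0 = 0 by have := sz [:: k] isT w (leqnn _); rewrite pds_cat.
rewrite mulr0 add0r.
have glow u : (size u <= size w)%N -> pds u low t0 = 0.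
  move=> uw; rewrite pds_lin0//.
  have -> : pds u (fun y => a * b * f y) t0 = 0.
    have e1 : \forall y \near t0, a * b * f y = a * b * f y + 0 by apply: nearT => y; rewrite addr0.
    rewrite (pds_near0 u e1 hab) (pds_lin0 u (a * b) hf (hol_near_cst 0 t0)) pds_zero addr0.
    by have := sz [::] isT u uw; rewrite cats0 => ->; rewrite mulr0.
  rewrite addr0 pds_sum1; last by move=> j; exact: hol_near_pd.
  by rewrite big1 ?mulr0// => j _; have := sz [:: j] isT u uw; rewrite pds_cat.
have gu u : (size u <= size w)%N -> pds u g t0 = \sum_i \sum_j pds (u ++ [:: i; j]) f t0.
  move=> uw; rewrite pds_add0// glow// addr0 pds_sum1; last first.
    exact: hs2.
  apply: eq_bigr => i _; apply: etrans (pds_sum1 u _ (F := fun j => pd i (pd j f)) (hpp i)) _.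
  by apply: eq_bigr => j _; rewrite pds_cat.
rewrite (leibniz (n := size w) (g := g) (h := fun y : V => cexp (y 0 k)))//; last first.
  move=> v vw; rewrite gu ?(ltnW vw)// big1// => i _; rewrite big1// => j _.
  by apply: hv; rewrite size_cat -wn ltn_add2r.
by rewrite gu.
Qed.

(** A word with a repeated letter k can be rewritten with k, k at the end; the
    equation bounds this derivative by m^2/(2 m^2) = 1/2 times the largest
    derivative of the same order. So the maximum is at most half of itself. *)
Lemma jets_zero f : Solt a b c t0 f -> (forall w, uniq w -> pds w f t0 = 0) ->
  forall w, pds w f t0 = 0.
Proof.
move=> hS hu; have hf : hol_near f t0 by apply/hol_nearP; apply: filterS hS => t [].
suff H n : forall w, size w = n -> pds w f t0 = 0 by move=> w; exact: (H (size w)).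
elim/ltn_ind: n => n ih.
have hv v : (size v < n)%N -> pds v f t0 = 0 by move=> vn'; exact: (ih _ vn').
(* the largest derivative of order n *)
pose Mx : R := \big[Num.max/0]_(w : n.-tuple 'I_m) cmod (pds w f t0).
have leM w : size w = n -> cmod (pds w f t0) <= Mx.
  move=> wn; have wn' : size w == n by rewrite wn.
  exact: (le_bigmax _ (fun w : n.-tuple 'I_m => cmod (pds w f t0)) (Tuple wn')).
have half : Mx <= Mx / 2.
  have M0 : 0 <= Mx by exact: bigmax_ge_id.
  apply: bigmax_le; first by rewrite divr_ge0.
  move=> w _; have wn : size w = n by rewrite size_tuple.
  have [uw|nuw] := boolP (uniq w); first by rewrite hu// cmod0 divr_ge0.
  have [k [w' pw]] : exists k w', perm_eq w (w' ++ [:: k; k]).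
    have /existsP[k hk] : [exists k, (1 < count_mem k w)%N].
      apply: contraT; rewrite negb_exists => /forallP h; move/negP: nuw => nuw; exfalso; apply: nuw.
      apply: count_mem_uniq => k; rewrite -has_pred1 has_count.
      by have := h k; rewrite -leqNgt; case: (count_mem k w) => [|[|]].
    have k1 : k \in w by rewrite -has_pred1 has_count (ltnW hk).
    have k2 : k \in seq.rem k w by rewrite -has_pred1 has_count count_rem k1 /= eqxx subn_gt0.
    exists k, (seq.rem k (seq.rem k w)); rewrite perm_sym perm_catC perm_sym.
    by apply: perm_trans (perm_to_rem k1) _; rewrite perm_cons; exact: perm_to_rem.
  rewrite (nbhs_singleton (pds_perm hf pw)).
  have sw' : (size w' + 2 = n)%N by rewrite -wn (perm_size pw) size_cat.
  rewrite (pds_ECt k hS hv sw') cmodM.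
  have -> : cmod (cexp (t0 0 k)) = (2 * m%:R ^+ 2)^-1.
    by rewrite mxE cexp_real cmod_real gtr0_norm ?lnK ?posrE ?invr_gt0 ?msq2// expR_gt0.
  rewrite mulrC ler_pdivrMr ?msq2//.
  apply: le_trans (cmod_sum _ _ _) _; apply: le_trans (_ : \sum_(i < m) \sum_(j < m) Mx <= _).
    apply: ler_sum => i _; apply: le_trans (cmod_sum _ _ _) _; apply: ler_sum => j _.
    by apply: leM; rewrite size_cat.
  rewrite !sumr_const card_ord -mulrnA -(mulr_natr Mx) natrM -expr2.
  by rewrite [leRHS]mulrA divfK ?pnatr_eq0.
have M0 : Mx <= 0 by move: half; lra.
by move=> w wn; apply/eqP; rewrite -cmod_eq0 eq_le cmod_ge0 andbT (le_trans (leM w wn)).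
Qed.
End Spanning.

(** * The basis of the solution space *)

Opaque av edge pd cmod vn cexp clog rG.
Section Final.
Variables (R : realType) (m : nat).
Local Notation C := (Cpx R).
Local Notation V := 'rV[C]_m.
Local Notation "x %:C" := (real_complex R x : C).
Hypothesis m1 : (1 <= m)%N.
Variables (a b : C) (c : V).
Hypothesis ha : forall J : cube m, ~ is_integer (a - \sum_k (J k)%:R * c 0 k).
Hypothesis hb : forall J : cube m, ~ is_integer (b - \sum_k (J k)%:R * c 0 k).
Local Notation t0 := (t0 R m).
Local Notation r1 := (r1 R m).
Local Notation Re_max := (Re_max R m).
Local Notation Re_max_small := (Re_max_small R m1).
Local Notation Flim := (Flim a b).
Implicit Types (f g h : V -> C) (t : V) (k : 'I_m) (w : seq 'I_m) (I J : cube m).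

Lemma Solt_Flim I : Solt a b c t0 (Flim c I).
Proof.
have r0 : 0 < r1 / 2 by rewrite divr_gt0// r1_gt0.
have B0 : 0 <= vn t0 + r1 / 2 + r1 / 2 by exact: addr_ge0 (addr_ge0 (vn_ge0 _) (ltW r0)) (ltW r0).
have [M hM] := Flim_hol m1 a b c B0.
apply/nbhs_vnP; exists (r1 / 2) => // t tr.
have [] := hM I t (r1 / 2) r0.
- rewrite lerD2r; have := vn_tri t t0 0; rewrite !subr0 => h; apply: le_trans h _.
  by rewrite addrC lerD2l ltW.
- move=> y yt; apply: (good_ball (@low_t0 R m)); apply: le_lt_trans (vn_tri y t _) _.
  by rewrite (splitr r1); exact: ltrD.
- move=> h1 h2; split=> //; have [] := h1 t => //.
  by rewrite subrr vn0.
Qed.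

Lemma Solt_comb (l : cube m -> C) : Solt a b c t0 (fun t => \sum_I l I * Flim c I t).
Proof.
have h := filter_forall (nbhs_filter t0) Solt_Flim.
apply: filterS (near_nearW h) => t ht; split.
  apply: hol_sum => I _; apply: holM (hol_cst _ _) _.
  by have [] := nbhs_singleton ht I.
move=> k; apply: ECt_sum0 => I _; split.
  by apply/hol_nearP; apply: filterS ht => y hy; have [] := hy I.
by have [_] := nbhs_singleton ht I; exact.
Qed.

Lemma Solt_lin z f g : Solt a b c t0 f -> Solt a b c t0 g -> Solt a b c t0 (fun t => z * f t + g t).
Proof.
move=> hf hg; apply: filterS2 (near_nearW hf) (near_nearW hg) => t ft gt.
have hft : hol_near f t by apply/hol_nearP; apply: filterS ft => y [].
have hgt : hol_near g t by apply/hol_nearP; apply: filterS gt => y [].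
have [_ e1] := nbhs_singleton ft; have [_ e2] := nbhs_singleton gt.
split; first by apply: holD; [apply: holM (hol_cst _ _) _|]; exact: hol_near_hol.
by move=> k; rewrite ECt_lin// e1 e2 mulr0 addr0.
Qed.

Lemma Solt_near f : Solt a b c t0 f -> hol_near f t0.
Proof. by move=> h; apply/hol_nearP; apply: filterS h => y []. Qed.

(** Up to permutation these are the words without repeated letters. *)
Definition slots J : seq 'I_m := [seq k <- enum 'I_m | J k].

(** The solution space has dimension at most 2^m. *)
Lemma slots_jets f : Solt a b c t0 f -> (forall J, pds (slots J) f t0 = 0) ->
  \forall t \near t0, f t = 0.
Proof.
move=> hS hJ; have hf := Solt_near hS.
have /(jets_vanish hf)[r r0 hr] : forall w, pds w f t0 = 0.
  apply: (jets_zero m1 hS) => w uw; rewrite -[RHS](hJ [ffun k => k \in w]).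
  apply: (nbhs_singleton (pds_perm hf _)); apply: uniq_perm => //.
    by rewrite filter_uniq ?enum_uniq.
  by move=> k; rewrite mem_filter mem_enum ffunE andbT.
by apply/nbhs_vnP; exists r.
Qed.

Local Notation nI := #|{: cube m}|.
Definition jetmx : 'M[C]_nI := \matrix_(i, j) pds (slots (enum_val j)) (Flim c (enum_val i)) t0.
Lemma sum_enum (F : cube m -> C) : \sum_I F I = \sum_(i < nI) F (enum_val i).
Proof. by rewrite (reindex_onto (@enum_val _ {: cube m}) enum_rank)//=; [apply: eq_bigl => i; rewrite enum_valK eqxx|move=> i _; rewrite enum_rankK]. Qed.

Lemma jet_comb (l : cube m -> C) J :
  pds (slots J) (fun t => \sum_I l I * Flim c I t) t0 = \sum_I l I * pds (slots J) (Flim c I) t0.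
Proof. by apply: pds_sum => I; exact: Solt_near (Solt_Flim I). Qed.

(** A linear relation between the rows is a combination of the limits whose
    jets vanish, hence which is zero, hence trivial. *)
Lemma jetmx_unit : jetmx \in unitmx.
Proof.
rewrite -row_free_unit; apply/inj_row_free => v hv.
pose l (I : cube m) := v 0 (enum_rank I).
have hz : \forall t \near t0, \sum_I l I * Flim c I t = 0.
  apply: slots_jets; first exact: Solt_comb.
  move=> J; rewrite jet_comb sum_enum.
  have := congr1 (fun A : 'rV[C]_nI => A 0 (enum_rank J)) hv; rewrite !mxE => h.
  by apply: etrans h; apply: eq_bigr => i _; rewrite mxE /l enum_valK enum_rankK.
apply/rowP => i; rewrite mxE -(enum_valK i).
exact: (Flim_indep m1 (@ha) (@hb) hz).
Qed.

(** Solve for the combination with the same jets; the difference has vanishing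
    jets. *)
Lemma Flim_span f : Solt a b c t0 f -> exists l : cube m -> C,
  \forall t \near t0, f t = \sum_I l I * Flim c I t.
Proof.
move=> hS; pose r : 'rV[C]_nI := \row_j pds (slots (enum_val j)) f t0.
have [v vA] : exists v, v *m jetmx = r by exists (r *m invmx jetmx); rewrite mulmxKV// jetmx_unit.
pose l (I : cube m) := v 0 (enum_rank I); exists l.
pose F t := \sum_I l I * Flim c I t.
have hF : Solt a b c t0 F := Solt_comb l.
have : \forall t \near t0, -1 * F t + f t = 0.
  apply: slots_jets; first exact: Solt_lin.
  move=> J; rewrite pds_lin0; [|exact: Solt_near|exact: Solt_near].
  rewrite mulN1r addrC; apply/eqP; rewrite subr_eq0; apply/eqP; rewrite jet_comb sum_enum.
  have := congr1 (fun A : 'rV[C]_nI => A 0 (enum_rank J)) vA; rewrite !mxE enum_rankK => <-.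
  by apply: eq_bigr => i _; rewrite mxE /l enum_valK enum_rankK.
apply: filterS => t /eqP; rewrite mulN1r addrC subr_eq0 => /eqP.
by [].
Qed.

Lemma near_params : exists2 d : R, 0 < d & forall c', vn (c' - c) < d ->
  (forall J : cube m, ~ is_integer (a - \sum_k (J k)%:R * c' 0 k)) /\
  (forall J : cube m, ~ is_integer (b - \sum_k (J k)%:R * c' 0 k)).
Proof.
have h := filterI (near_nonres (@ha)) (near_nonres (@hb)); move: {h}(h (nbhs_filter c)) => h.
by move/nbhs_vnP: h => [d d0 hd]; exists d.
Qed.

(** The domain of convergence, intersected with the strip on which the
    principal logarithm inverts t -> e^t. *)
Definition inside t := good Re_max t /\ forall k, `|ImC (t 0 k)| < pi.
Lemma near_inside : \forall t \near t0, inside t /\ vn t <= vn t0 + r1.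
Proof.
have h1 : \forall t \near t0, good Re_max t /\ vn t <= vn t0 + r1.
  apply/nbhs_vnP; exists r1; first exact: r1_gt0.
  move=> y yr; split; first exact: (good_ball (@low_t0 R m)).
  have := vn_tri y t0 0; rewrite !subr0 => h; apply: le_trans h _.
  by rewrite addrC lerD2l ltW.
by apply: filterS2 h1 (near_t0pi (@t0Im R m)) => t [h2 h3] h4.
Qed.

Lemma Ftilde_limit I (B : R) : 0 <= B -> forall e : R, 0 < e -> exists2 d : R, 0 < d &
  forall c', non_integral c' -> vn (c' - c) < d -> forall t, inside t -> vn t <= B ->
    cmod (Ftilde_gen a b c' I (tmap t) - Flim c I t) < e.
Proof.
move=> B0 e e0; have [M hM] := Ftil_cvg_uniform a b Re_max_small c I B0; have [d d0 hd] := hM e e0.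
have [d' d'0 hd'] := near_params; exists (Num.min d d'); first by rewrite lt_min d0.
move=> c' hc; rewrite lt_min => /andP[h1 h2] t [tg ti] tB; have [hA hB] := hd' c' h2.
by rewrite (Ftilde_gen_Ftil Re_max_small I hc hA hB tg ti); have [] := hd c' hc h1 t tg tB.
Qed.

(** For nonintegral c, the constant family c' = c shows that tilde F_I equals
    the limit of itself. *)
Lemma Ftilde_Flim I t : inside t -> Ftilde a b c I (tmap t) = Flim c I t.
Proof.
move=> ti; rewrite /Ftilde; case: asboolP => hc.
  apply/eqP; rewrite -subr_eq0; apply/eqP; apply: cmod_small => e e0.
  have [d d0 hd] := Ftilde_limit I (vn_ge0 t) e0.
  by apply: ltW; apply: hd => //; rewrite subrr vn0.
apply: lim_param => e e0; have [d d0 hd] := Ftilde_limit I (vn_ge0 t) e0.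
by exists d => // c' h1 h2; exact: hd.
Qed.

Lemma near_Ftilde_Flim : \forall t \near t0, forall I, Ftilde a b c I (tmap t) = Flim c I t.
Proof. by apply: filterS near_inside => t [ti _] I; exact: Ftilde_Flim. Qed.

(** The estimate of Ftilde_limit is uniform in t over a bounded neighborhood of
    t0. *)
Lemma uniform_part I : exists2 U : set V, nbhs (xdot R m) U &
  {uniform U, (fun c' => Ftilde_gen a b c' I) @ to_param c --> Ftilde a b c I}.
Proof.
pose P t := inside t /\ vn t <= vn t0 + r1.
exists [set x | exists2 t, P t & x = tmap t].
  rewrite -(tmap_t0 R m1); apply/(near_x0_t0 (@t0Im R m)).
  by apply: filterS near_inside => t ht; exists t.
move=> W /uniform_nbhs[E [entE sub]].
move: entE; rewrite -entourage_ballE => -[e /= e0 he]; have [r er r0] := pos_real e0.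
have B0 : 0 <= vn t0 + r1 by exact: addr_ge0 (vn_ge0 _) (ltW (r1_gt0 R m1)).
have [d d0 hd] := Ftilde_limit I B0 r0.
apply/to_paramP; exists d => // c' h1 h2; apply: sub => x [t [ti tB] ->]; apply: he.
rewrite /ball /= er cmodE ltcR Ftilde_Flim// cmodBC; exact: hd.
Qed.

Lemma basis_part : is_germ_basis (xdot R m) (Sol a b c) (Ftilde a b c).
Proof.
have SolE f : Sol a b c f <-> Solt a b c t0 (f \o @tmap R m).
  by rewrite /Sol -(tmap_t0 R m1); exact: Sol_Solt (@t0Im R m) f.
have nearE (P : V -> Prop) : (\forall x \near xdot R m, P x) <-> \forall t \near t0, P (tmap t).
  by rewrite -(tmap_t0 R m1); exact: near_x0_t0 (@t0Im R m) P.
split.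
- move=> I; apply/SolE.
  have e : \forall t \near t0, Flim c I t = (Ftilde a b c I \o @tmap R m) t.
    by apply: filterS near_Ftilde_Flim => t h; rewrite /= h.
  apply: filterS2 (near_nearW e) (near_nearW (Solt_Flim I)) => t e1 h1.
  have h2 : hol_near (Flim c I) t by apply/hol_nearP; apply: filterS h1 => y [].
  split; first exact: hol_near_hol (hol_near_ext e1 h2).
  by move=> k; rewrite -(ECt_ext a b c k h2 e1); have [_] := nbhs_singleton h1; exact.
- move=> l /nearE hl; apply: (Flim_indep m1 (@ha) (@hb)).
  apply: filterS2 hl near_Ftilde_Flim => t h1 h; apply: etrans h1.
  by apply: eq_bigr => I _; rewrite h.
- move=> f /SolE/Flim_span[l hl]; exists l; apply/nearE.
  apply: filterS2 hl near_Ftilde_Flim => t /= -> h.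
  by apply: eq_bigr => I _; rewrite h.
Qed.
End Final.

Theorem theorem3p3 (R : realType) (m : nat) (a b : Cpx R) (c : 'rV[Cpx R]_m)
    (m_ge1 : (1 <= m)%N)
    (ha : forall I : cube m, ~ is_integer (a - \sum_k (I k)%:R * c 0 k))
    (hb : forall I : cube m, ~ is_integer (b - \sum_k (I k)%:R * c 0 k)) :
  ((exists k : 'I_m, is_integer (c 0 k)) ->
     forall I : cube m, exists2 U : set 'rV[Cpx R]_m,
       nbhs (xdot R m) U &
       {uniform U, (fun c' => Ftilde_gen a b c' I) @ to_param c
                     --> Ftilde a b c I})
  /\ is_germ_basis (xdot R m) (Sol a b c) (Ftilde a b c).
Proof.
split; first by move=> _ I; exact: uniform_part.
exact: basis_part.
Qed.
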